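(* Let $p$ be a prime and $F\in\{\mathbb{C},\mathbb{R},\mathbb{F}_q\}$ with $\operatorname{char}(\mathbb{F}_q)\neq p$. For every $k\ge0$ there is an isomorphism of $\mathcal{E}(1)_p^\vee$-comodules $$B_0(k)\cong L_p(\nu_p(k!))\oplus W_k,$$ where $W_k$ is a sum of suspensions of $\mathcal{E}(1)_p^\vee$.
   Context: $H=H\mathbb{F}_p$ is the motivic Eilenberg--MacLane spectrum over $F$, $\mathbb{M}_p=\pi_{*,*}H$, and $\mathcal{A}_p^\vee=\pi_{*,*}(H\wedge H)$ is the motivic dual Steenrod algebra (Voevodsky), a Hopf algebroid over $\mathbb{M}_p$ generated as an algebra by $\tau_i$ ($i\ge0$) and $\xi_i$ ($i\ge1$), with conjugates $\bar\tau_i,\bar\xi_i$ in degrees $|\bar\tau_i|=(2p^i-1,p^i-1)$, $|\bar\xi_i|=(2p^i-2,p^i-1)$, and coproduct $\psi(\bar\tau_k)=1\otimes\bar\tau_k+\sum_{i+j=k}\bar\tau_i\otimes\bar\xi_j^{p^i}$, $\psi(\bar\xi_k)=\sum_{i+j=k}\bar\xi_i\otimes\bar\xi_j^{p^i}$ ($\bar\xi_0=1$). $\mathcal{E}(n)_p^\vee=\mathcal{A}_p^\vee/(\bar\xi_i\ (i\ge1),\ \bar\tau_j\ (j>n))$, dual to the subalgebra $\mathcal{E}(n)_p$ of the Steenrod algebra generated by the Milnor primitives $Q_0,\dots,Q_n$. Left $\mathcal{E}(n)_p^\vee$-comodules are identified with right $\mathcal{E}(n)_p$-modules (with $\bar\tau_i$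 dual to $Q_i$). $(\mathcal{A}//\mathcal{E}(0))^\vee\subset\mathcal{A}_p^\vee$ is the $\mathbb{M}_p$-subalgebra generated by $\bar\xi_1,\bar\xi_2,\dots,\bar\tau_1,\bar\tau_2,\dots$. Set $\operatorname{wt}(\bar\xi_i)=\operatorname{wt}(\bar\tau_i)=p^i$, $\operatorname{wt}(xy)=\operatorname{wt}(x)+\operatorname{wt}(y)$. The Brown--Gitler comodule $B_0(k)$ is the $\mathbb{M}_p$-span in $(\mathcal{A}//\mathcal{E}(0))^\vee$ of monomials of weight at most $k$, with left $\mathcal{E}(1)_p^\vee$-coaction induced by $\psi$ and projection on the left factor. The motivic homological lightning flash module $L_p(k)$, $k\ge1$, is the right $\mathcal{E}(1)_p$-module generated by $x_1,\dots,x_k$ with $|x_i|=(2i(p-1)+1,\,i(p-1))$ and relations $x_{i+1}Q_1=x_iQ_0$ for $1\le i\le k-1$ and $x_iQ_0Q_1=0$ for all $i$; $L_p(0)=\mathbb{M}_p$. $\nu_p$ is the $p$-adic valuation. *)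

(* Defs.v *)
From HB Require Import structures.
From mathcomp Require Import all_boot all_order all_algebra ssrAC.
From mathcomp Require Import boolp classical_sets.

Set Implicit Arguments.
Unset Strict Implicit.
Unset Printing Implicit Defensive.

Import GRing.Theory.
Local Open Scope ring_scope.
Local Open Scope quotient_scope.

Inductive rexpr (I : Type) : Type :=
  | Var of I
  | Zero
  | One
  | Opp of rexpr I
  | Add of rexpr I & rexpr I
  | Mul of rexpr I & rexpr I.

Arguments Zero {I}.
Arguments One {I}.

HB.instance Definition _ (I : Type) := gen_eqMixin (rexpr I).
HB.instance Definition _ (I : Type) := gen_choiceMixin (rexpr I).

Fixpoint reval (I : Type) (R : pzRingType) (v : I -> R) (t : rexpr I) : R :=
  match t with
  | Var i => v i
  | Zero => 0
  | One => 1
  | Opp a => - reval v a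
  | Add a b => reval v a + reval v b
  | Mul a b => reval v a * reval v b
  end.

Section Presentation.

Context (I : Type) (E : rexpr I -> rexpr I -> Prop).

Inductive rcong : rexpr I -> rexpr I -> Prop :=
  | rc_rel a b : E a b -> rcong a b
  | rc_refl a : rcong a a
  | rc_sym a b : rcong a b -> rcong b a
  | rc_trans a b c : rcong a b -> rcong b c -> rcong a c
  | rc_opp a b : rcong a b -> rcong (Opp a) (Opp b)
  | rc_add a b c d : rcong a b -> rcong c d -> rcong (Add a c) (Add b d)
  | rc_mul a b c d : rcong a b -> rcong c d -> rcong (Mul a c) (Mul b d)
  | rc_addA a b c : rcong (Add a (Add b c)) (Add (Add a b) c)
  | rc_addC a b : rcong (Add a b) (Add b a)
  | rc_add0 a : rcong (Add Zero a) a
  | rc_addN a : rcong (Add (Opp a) a) Zero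
  | rc_mulA a b c : rcong (Mul a (Mul b c)) (Mul (Mul a b) c)
  | rc_mul1l a : rcong (Mul One a) a
  | rc_mul1r a : rcong (Mul a One) a
  | rc_mulDl a b c : rcong (Mul (Add a b) c) (Add (Mul a c) (Mul b c))
  | rc_mulDr a b c : rcong (Mul a (Add b c)) (Add (Mul a b) (Mul a c)).

Definition rcongb (a b : rexpr I) : bool := `[< rcong a b >].

Fact rcongb_equiv : equiv_class_of rcongb.
Proof.
split.
- by move=> a; apply/asboolP/rc_refl.
- by move=> a b; apply/asboolP/asboolP => /rc_sym.
- by move=> b a c /asboolP ab /asboolP bc; apply/asboolP; apply: rc_trans ab bc.
Qed.

Canonical rcong_equiv := EquivRelPack rcongb_equiv.

Definition pres := {eq_quot rcong_equiv}.

HB.instance Definition _ := Choice.on pres.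
HB.instance Definition _ := Quotient.on pres.

Definition rclass (a : rexpr I) : pres := \pi_pres a.

Lemma rclassP a b : rclass a = rclass b <-> rcong a b.
Proof.
by split=> [/eqmodP/asboolP | ab]; last apply/eqmodP/asboolP.
Qed.

Lemma rclassK (x : pres) : rclass (repr x) = x.
Proof. exact: reprK. Qed.

Lemma rclass_repr a : rcong (repr (rclass a)) a.
Proof. by apply/rclassP; rewrite rclassK. Qed.

Definition pres_add (x y : pres) := rclass (Add (repr x) (repr y)).
Definition pres_mul (x y : pres) := rclass (Mul (repr x) (repr y)).
Definition pres_opp (x : pres) := rclass (Opp (repr x)).

Lemma pres_addE a b : pres_add (rclass a) (rclass b) = rclass (Add a b).
Proof. by apply/rclassP; apply: rc_add; exact: rclass_repr. Qed.
Lemma pres_mulE a b : pres_mul (rclass a) (rclass b) = rclass (Mul a b).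
Proof. by apply/rclassP; apply: rc_mul; exact: rclass_repr. Qed.
Lemma pres_oppE a : pres_opp (rclass a) = rclass (Opp a).
Proof. by apply/rclassP; apply: rc_opp; exact: rclass_repr. Qed.

Lemma pres_ind (P : pres -> Prop) :
  (forall a, P (rclass a)) -> forall x, P x.
Proof. by move=> H x; rewrite -(rclassK x). Qed.

Fact pres_addA : associative pres_add.
Proof.
elim/pres_ind=> a; elim/pres_ind=> b; elim/pres_ind=> c.
by rewrite !pres_addE; apply/rclassP/rc_addA.
Qed.
Fact pres_addC : commutative pres_add.
Proof.
elim/pres_ind=> a; elim/pres_ind=> b.
by rewrite !pres_addE; apply/rclassP/rc_addC.
Qed.
Fact pres_add0 : left_id (rclass Zero) pres_add.
Proof. by elim/pres_ind=> a; rewrite !pres_addE; apply/rclassP/rc_add0. Qed.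
Fact pres_addN : left_inverse (rclass Zero) pres_opp pres_add.
Proof.
by elim/pres_ind=> a; rewrite pres_oppE !pres_addE; apply/rclassP/rc_addN.
Qed.
Fact pres_mulA : associative pres_mul.
Proof.
elim/pres_ind=> a; elim/pres_ind=> b; elim/pres_ind=> c.
by rewrite !pres_mulE; apply/rclassP/rc_mulA.
Qed.
Fact pres_mul1l : left_id (rclass One) pres_mul.
Proof. by elim/pres_ind=> a; rewrite !pres_mulE; apply/rclassP/rc_mul1l. Qed.
Fact pres_mul1r : right_id (rclass One) pres_mul.
Proof. by elim/pres_ind=> a; rewrite !pres_mulE; apply/rclassP/rc_mul1r. Qed.
Fact pres_mulDl : left_distributive pres_mul pres_add.
Proof.
elim/pres_ind=> a; elim/pres_ind=> b; elim/pres_ind=> c.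
by rewrite !(pres_addE, pres_mulE); apply/rclassP/rc_mulDl.
Qed.
Fact pres_mulDr : right_distributive pres_mul pres_add.
Proof.
elim/pres_ind=> a; elim/pres_ind=> b; elim/pres_ind=> c.
by rewrite !(pres_addE, pres_mulE); apply/rclassP/rc_mulDr.
Qed.

HB.instance Definition _ := GRing.isZmodule.Build pres
  pres_addA pres_addC pres_add0 pres_addN.
HB.instance Definition _ := GRing.Zmodule_isPzRing.Build pres
  pres_mulA pres_mul1l pres_mul1r pres_mulDl pres_mulDr.

Lemma rclass0 : rclass Zero = 0. Proof. by []. Qed.
Lemma rclass1 : rclass One = 1. Proof. by []. Qed.
Lemma rclassN a : rclass (Opp a) = - rclass a.
Proof. by rewrite -pres_oppE. Qed.
Lemma rclassD a b : rclass (Add a b) = rclass a + rclass b.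
Proof. by rewrite -pres_addE. Qed.
Lemma rclassM a b : rclass (Mul a b) = rclass a * rclass b.
Proof. by rewrite -pres_mulE. Qed.

Definition pgen (i : I) : pres := rclass (Var i).

Lemma rclassE a : rclass a = reval pgen a.
Proof.
elim: a => //= [a <-|a <- b <-|a <- b <-].
- by rewrite rclassN.
- by rewrite rclassD.
- by rewrite rclassM.
Qed.

Definition rmodel (R : pzRingType) (v : I -> R) : Prop :=
  forall a b, E a b -> reval v a = reval v b.

Lemma pgen_model : rmodel pgen.
Proof. by move=> a b ab; rewrite -!rclassE; apply/rclassP/rc_rel. Qed.

(** The ring morphism out of [pres] sending the generator [i] to [v i]; it is
    one as soon as [v] satisfies the relations. *)
Definition pmap_ring (R : pzRingType) (v : I -> R) (x : pres) : R :=
  reval v (repr x).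

Section Lift.
Variables (R : pzRingType) (v : I -> R).
Hypothesis vE : rmodel v.

Lemma reval_cong a b : rcong a b -> reval v a = reval v b.
Proof.
elim=> //=.
- by move=> ? ? ? _ -> _ ->.
- by move=> ? ? _ ->.
- by move=> ? ? ? ? _ -> _ ->.
- by move=> ? ? ? ? _ -> _ ->.
- by move=> *; rewrite addrA.
- by move=> *; rewrite addrC.
- by move=> *; rewrite add0r.
- by move=> *; rewrite addNr.
- by move=> *; rewrite mulrA.
- by move=> *; rewrite mul1r.
- by move=> *; rewrite mulr1.
- by move=> *; rewrite mulrDl.
- by move=> *; rewrite mulrDr.
Qed.

Lemma pmap_ringE a : pmap_ring v (rclass a) = reval v a.
Proof. by apply: reval_cong; exact: rclass_repr. Qed.

Lemma pmap_ring_gen i : pmap_ring v (pgen i) = v i.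
Proof. exact: pmap_ringE. Qed.

Lemma pmap_ring0 : pmap_ring v 0 = 0.
Proof. by rewrite -rclass0 pmap_ringE. Qed.
Lemma pmap_ring1 : pmap_ring v 1 = 1.
Proof. by rewrite -rclass1 pmap_ringE. Qed.
Lemma pmap_ringN x : pmap_ring v (- x) = - pmap_ring v x.
Proof. by elim/pres_ind: x => a; rewrite -rclassN !pmap_ringE. Qed.
Lemma pmap_ringD x y : pmap_ring v (x + y) = pmap_ring v x + pmap_ring v y.
Proof.
by elim/pres_ind: x => a; elim/pres_ind: y => b; rewrite -rclassD !pmap_ringE.
Qed.
Lemma pmap_ringM x y : pmap_ring v (x * y) = pmap_ring v x * pmap_ring v y.
Proof.
by elim/pres_ind: x => a; elim/pres_ind: y => b; rewrite -rclassM !pmap_ringE.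
Qed.

End Lift.

Inductive homog (deg : I -> int * int) : int * int -> pres -> Prop :=
  | homog0 d : homog deg d 0
  | homogN d x : homog deg d x -> homog deg d (- x)
  | homogD d x y : homog deg d x -> homog deg d y -> homog deg d (x + y)
  | homog1 : homog deg 0 1
  | homog_gen i : homog deg (deg i) (pgen i)
  | homogM d e x y :
      homog deg d x -> homog deg e y -> homog deg (d + e) (x * y).

End Presentation.

Section Tensor.

Context (R : pzRingType) (X : zmodType) (ract : X -> R -> X) (Y : lmodType R).

Record balanced (Z : zmodType) (f : X -> Y -> Z) : Prop := Balanced {
  balDl : forall x x' y, f (x + x') y = f x y + f x' y;
  balDr : forall x y y', f x (y + y') = f x y + f x y';
  balM : forall x r y, f (ract x r) y = f x (r *: y) }.

Definition fsum (Z : zmodType) (f : X -> Y -> Z) (s : seq (X * Y)) : Z :=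
  \sum_(u <- s) f u.1 u.2.

(** Formal sums of pure tensors, identified when all balanced biadditive maps
    agree on them. *)
Definition tcong (s t : seq (X * Y)) : bool :=
  `[< forall (Z : zmodType) (f : X -> Y -> Z),
        balanced f -> fsum f s = fsum f t >].

Fact tcong_equiv_class : equiv_class_of tcong.
Proof.
split.
- by move=> a; apply/asboolP.
- by move=> a b; apply/asboolP/asboolP => H Z f bf; rewrite H.
- move=> b a c /asboolP ab /asboolP bc; apply/asboolP => Z f bf.
  by rewrite ab // bc.
Qed.

Canonical tcong_equiv := EquivRelPack tcong_equiv_class.

Definition tens := {eq_quot tcong_equiv}.

HB.instance Definition _ := Choice.on tens.
HB.instance Definition _ := Quotient.on tens.

Definition tclass (s : seq (X * Y)) : tens := \pi_tens s.

Lemma tclassP s t : tclass s = tclass t <->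
  forall (Z : zmodType) (f : X -> Y -> Z), balanced f -> fsum f s = fsum f t.
Proof. by split=> [/eqmodP/asboolP | st]; last apply/eqmodP/asboolP. Qed.

Lemma tclassK (x : tens) : tclass (repr x) = x.
Proof. exact: reprK. Qed.

Lemma fsum_repr (Z : zmodType) (f : X -> Y -> Z) s :
  balanced f -> fsum f (repr (tclass s)) = fsum f s.
Proof. by apply/tclassP: Z f; rewrite tclassK. Qed.

Definition tneg (s : seq (X * Y)) := [seq (- u.1, u.2) | u <- s].

Lemma fsum_cat (Z : zmodType) (f : X -> Y -> Z) s t :
  fsum f (s ++ t) = fsum f s + fsum f t.
Proof. by rewrite /fsum big_cat. Qed.

Lemma bal0l (Z : zmodType) (f : X -> Y -> Z) y : balanced f -> f 0 y = 0.
Proof. by move=> bf; apply: (addrI (f 0 y)); rewrite -balDl // !addr0. Qed.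

Lemma balNl (Z : zmodType) (f : X -> Y -> Z) x y :
  balanced f -> f (- x) y = - f x y.
Proof.
by move=> bf; apply: (addrI (f x y)); rewrite -balDl // !subrr bal0l.
Qed.

Lemma fsum_neg (Z : zmodType) (f : X -> Y -> Z) s :
  balanced f -> fsum f (tneg s) = - fsum f s.
Proof.
move=> bf; rewrite /fsum big_map -sumrN; apply: eq_bigr => u _ /=.
exact: balNl.
Qed.

Definition tens_add (x y : tens) := tclass (repr x ++ repr y).
Definition tens_opp (x : tens) := tclass (tneg (repr x)).

Lemma tens_addE s t : tens_add (tclass s) (tclass t) = tclass (s ++ t).
Proof. by apply/tclassP => Z f bf; rewrite !fsum_cat !fsum_repr. Qed.
Lemma tens_oppE s : tens_opp (tclass s) = tclass (tneg s).
Proof. by apply/tclassP => Z f bf; rewrite !fsum_neg ?fsum_repr. Qed.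

Lemma tclass_ind (P : tens -> Prop) :
  (forall s, P (tclass s)) -> forall x, P x.
Proof. by move=> H x; rewrite -(tclassK x). Qed.

Fact tens_addA : associative tens_add.
Proof.
elim/tclass_ind=> a; elim/tclass_ind=> b; elim/tclass_ind=> c.
by rewrite !tens_addE catA.
Qed.
Fact tens_addC : commutative tens_add.
Proof.
elim/tclass_ind=> a; elim/tclass_ind=> b; rewrite !tens_addE.
by apply/tclassP => Z f bf; rewrite !fsum_cat addrC.
Qed.
Fact tens_add0 : left_id (tclass [::]) tens_add.
Proof. by elim/tclass_ind=> a; rewrite tens_addE. Qed.
Fact tens_addN : left_inverse (tclass [::]) tens_opp tens_add.
Proof.
elim/tclass_ind=> a; rewrite tens_oppE tens_addE.
apply/tclassP => Z f bf; rewrite fsum_cat fsum_neg // addNr.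
by rewrite /fsum big_nil.
Qed.

HB.instance Definition _ := GRing.isZmodule.Build tens
  tens_addA tens_addC tens_add0 tens_addN.

Definition pure (x : X) (y : Y) : tens := tclass [:: (x, y)].

Lemma tclassE s : tclass s = \sum_(u <- s) pure u.1 u.2.
Proof.
elim: s => [|[x y] s IH]; first by rewrite big_nil.
by rewrite big_cons -IH -[RHS]/(tens_add _ _) tens_addE.
Qed.

Lemma pure_balanced : balanced pure.
Proof.
split=> [x x' y|x y y'|x r y].
- rewrite -[RHS]/(tens_add _ _) tens_addE; apply/tclassP => Z f bf.
  by rewrite /fsum !big_cons !big_nil /= !addr0 balDl.
- rewrite -[RHS]/(tens_add _ _) tens_addE; apply/tclassP => Z f bf.
  by rewrite /fsum !big_cons !big_nil /= !addr0 balDr.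
- by apply/tclassP => Z f bf; rewrite /fsum !big_cons !big_nil /= balM.
Qed.

Lemma tens_ind (P : tens -> Prop) :
  P 0 -> (forall x y t, P t -> P (pure x y + t)) -> forall t, P t.
Proof.
move=> P0 PD; elim/tclass_ind=> s; rewrite tclassE.
by elim: s => [|u s IH]; rewrite ?big_nil ?big_cons //; apply: PD.
Qed.

(** Well defined for balanced [f] only. *)
Definition tlift (Z : zmodType) (f : X -> Y -> Z) (t : tens) : Z :=
  fsum f (repr t).

Section TLift.
Variables (Z : zmodType) (f : X -> Y -> Z).
Hypothesis bf : balanced f.

Lemma tlift_pure x y : tlift f (pure x y) = f x y.
Proof. by rewrite /tlift fsum_repr // /fsum big_seq1. Qed.

Lemma tliftD s t : tlift f (s + t) = tlift f s + tlift f t.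
Proof.
elim/tclass_ind: s => s; elim/tclass_ind: t => t.
by rewrite -[tclass s + _]/(tens_add _ _) tens_addE /tlift !fsum_repr ?fsum_cat.
Qed.

Lemma tlift0 : tlift f 0 = 0.
Proof. by apply: (addrI (tlift f 0)); rewrite -tliftD !addr0. Qed.

End TLift.

End Tensor.

Inductive base_field : Type :=
  | Complexes
  | Reals
  | FiniteField of finFieldType.

Definition char_neq (p : nat) (F : base_field) : Prop :=
  if F is FiniteField K then p \notin [pchar K] else True.

(** The known computation of [M_p]: it is generated by a class [theta] in degree
    [(0, -w)] and a class [gamma] in degree [(-1, -w)].  As [M_p] in degree [(-a, -b)] is
    [H^a(F; mu_p^{(x) b})] for [a <= b] and zero otherwise:
    - over the complex numbers it is [F_p[tau]];
    - over the real numbers it is [F_2[tau, rho]] if [p = 2] and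
      [F_p[tau^2]] if [p] is odd;
    - over a field with [q] elements it is [F_p[theta, gamma] / gamma^2] with
      [w] the order of [q] modulo [p] (so that [theta] is "[tau^w]").
    [coeff_nil] is the exponent of the nilpotent generator [gamma] ([Some 1]
    when there is no such generator, [None] when it is not nilpotent), and
    [coeff_bock] tells whether the Bockstein of [theta] is [gamma] or zero.
    Over a finite field the Bockstein vanishes if and only if Frobenius acts
    trivially on [mu_{p^2}^{(x) w}]; when it does not vanish, [gamma] is
    normalized to be its value.  For [p = 2] the Bockstein of [theta = tau] is
    [rho], the class of [-1]. *)
Record coeff_data := CoeffData {
  coeff_wt : nat;
  coeff_nil : option nat;
  coeff_bock : bool }.

Definition order_mod (p q : nat) : nat :=
  (find (fun i => q ^ i.+1 == 1 %[mod p])%N (iota 0 p)).+1.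

Definition coeffs (p : nat) (F : base_field) : coeff_data :=
  match F with
  | Complexes => CoeffData 1%N (Some 1%N) false
  | Reals => if p == 2%N then CoeffData 1%N None true
             else CoeffData 2%N (Some 1%N) false
  | FiniteField K =>
      let w := order_mod p #|K| in
      CoeffData w (Some 2%N) (#|K| ^ w != 1 %[mod p ^ 2])%N
  end.

Definition rpow (I : Type) (a : rexpr I) (n : nat) := iter n (Mul a) One.
Definition rnat (I : Type) (n : nat) : rexpr I := iter n (Add One) Zero.
Definition rsign (I : Type) (s : bool) (a : rexpr I) := if s then Opp a else a.

Lemma reval_pow (I : Type) (R : pzRingType) (v : I -> R) a n :
  reval v (rpow a n) = reval v a ^+ n.
Proof. by elim: n => //= n ->; rewrite exprS. Qed.
Lemma reval_nat (I : Type) (R : pzRingType) (v : I -> R) n :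
  reval v (rnat I n) = n%:R.
Proof. by elim: n => //= n ->; rewrite mulrS. Qed.
Lemma reval_sign (I : Type) (R : pzRingType) (v : I -> R) s a :
  reval v (rsign s a) = (-1) ^+ s * reval v a.
Proof. by case: s; rewrite /= ?mulN1r ?mul1r. Qed.

(** [x |-> (-1)^{|x|} x]: in all signs only the parity of the first degree
    matters. *)
Definition psigma (I : Type) (E : rexpr I -> rexpr I -> Prop) (par : I -> bool)
  : pres E -> pres E := pmap_ring (fun i => (-1) ^+ par i * pgen E i).

Inductive mgen : Type := Theta | Gamma.

Definition mpar (g : mgen) : bool := if g is Gamma then true else false.

(** [Xi i] and [Tau i] stand for the conjugates of Voevodsky's generators of the
    dual Steenrod algebra, and [Xi 0] for the unit. *)
Inductive agen : Type :=
  | Mg of mgen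
  | Xi of nat
  | Tau of nat.

Definition apar (g : agen) : bool :=
  match g with Mg h => mpar h | Xi _ => false | Tau _ => true end.

Section Motivic.

Context (p : nat) (b : coeff_data).

Definition mdeg (g : mgen) : int * int :=
  match g with
  | Theta => (0, - (coeff_wt b)%:Z)
  | Gamma => (-1, - (coeff_wt b)%:Z)
  end.

Definition adeg (g : agen) : int * int :=
  match g with
  | Mg h => mdeg h
  | Xi i => (2 * (p ^ i)%N%:Z - 2, (p ^ i)%N%:Z - 1)
  | Tau i => (2 * (p ^ i)%N%:Z - 1, (p ^ i)%N%:Z - 1)
  end.

Inductive mrel : rexpr mgen -> rexpr mgen -> Prop :=
  | mrel_char : mrel (rnat _ p) Zero
  | mrel_comm g h : mrel (Mul (Var g) (Var h))
                      (rsign (mpar g && mpar h) (Mul (Var h) (Var g)))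
  | mrel_nil n : coeff_nil b = Some n -> mrel (rpow (Var Gamma) n) Zero.

Definition MM := pres mrel.
HB.instance Definition _ := GRing.PzRing.on MM.

Definition mtheta : MM := pgen mrel Theta.
Definition mgamma : MM := pgen mrel Gamma.

Definition rho_expr : rexpr agen :=
  if coeff_bock b then Var (Mg Gamma) else Zero.

(** Voevodsky's presentation of [A_p^vee], which is free over [M_p] on the
    monomials in the generators that are square-free in the [Tau i].
    For [p = 2], conjugating Voevodsky's relation
    [tau_i^2 = tau xi_{i+1} + rho tau_{i+1} + rho tau_0 xi_{i+1}] (with
    [tau] replaced by [tau + rho tau_0]) gives the relation below.
    [K] is a set of generators to be killed: we need [A_p^vee] itself
    and its quotient [E(1)_p^vee]. *)
Inductive arel (K : agen -> Prop) : rexpr agen -> rexpr agen -> Prop :=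
  | arel_char : arel K (rnat _ p) Zero
  | arel_comm g h : arel K (Mul (Var g) (Var h))
                      (rsign (apar g && apar h) (Mul (Var h) (Var g)))
  | arel_nil n :
      coeff_nil b = Some n -> arel K (rpow (Var (Mg Gamma)) n) Zero
  | arel_xi0 : arel K (Var (Xi 0)) One
  | arel_tau i : arel K (rpow (Var (Tau i)) 2%N)
      (if p == 2%N then Add (Mul (Var (Mg Theta)) (Var (Xi i.+1)))
                          (Mul rho_expr (Var (Tau i.+1)))
       else Zero)
  | arel_kill g : K g -> arel K (Var g) Zero.

Definition steenrod (K : agen -> Prop) := pres (arel K).
HB.instance Definition _ (K : agen -> Prop) := GRing.PzRing.on (steenrod K).

Section Units.
Context (K : agen -> Prop).
Notation S := (steenrod K).

Definition ag (g : agen) : S := pgen (arel K) g.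
Definition xi (i : nat) : S := ag (Xi i).
Definition tau (i : nat) : S := ag (Tau i).
Definition rho : S := reval ag rho_expr.

Lemma ag_model : rmodel (arel K) ag. Proof. exact: pgen_model. Qed.

Lemma ag_comm g h : ag g * ag h = (-1) ^+ (apar g && apar h) * (ag h * ag g).
Proof. by have := ag_model (arel_comm K g h); rewrite reval_sign. Qed.

Definition etaL : MM -> S := pmap_ring (fun g => ag (Mg g)).

(** The right unit is dual to the Bockstein on coefficients.  For [p = 2] it is
    [tau |-> tau + rho tau_0]; for odd [p] the sign is absorbed in the choice of
    [gamma]. *)
Definition etaR : MM -> S :=
  pmap_ring (fun g => if g is Theta then ag (Mg Theta) - rho * tau 0
                      else ag (Mg Gamma)).

Definition sigma : S -> S := psigma apar.

Lemma rhoE : rho = if coeff_bock b then ag (Mg Gamma) else 0.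
Proof. by rewrite /rho /rho_expr; case: (coeff_bock b). Qed.

Lemma ag_char : p%:R = 0 :> S.
Proof. by have := ag_model (arel_char K); rewrite reval_nat. Qed.

Lemma etaL_model : rmodel mrel (fun g => ag (Mg g)).
Proof.
move=> _ _ [|g h|n Hn] /=.
- by rewrite reval_nat ag_char.
- by rewrite reval_sign /= (ag_comm (Mg g) (Mg h)).
- by rewrite reval_pow /=; have := ag_model (arel_nil K Hn); rewrite reval_pow.
Qed.

Fact scale_A (a c : MM) (x : S) : etaL a * (etaL c * x) = etaL (a * c) * x.
Proof. by rewrite mulrA /etaL (pmap_ringM etaL_model). Qed.
Fact scale_1 : left_id 1 (fun (m : MM) (x : S) => etaL m * x).
Proof. by move=> x; rewrite /etaL (pmap_ring1 etaL_model) mul1r. Qed.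
Fact scale_Dr : right_distributive (fun (m : MM) (x : S) => etaL m * x) +%R.
Proof. by move=> m x y; rewrite mulrDr. Qed.
Fact scale_Dl (x : S) : {morph (fun m => etaL m * x) : a c / a + c}.
Proof. by move=> a c; rewrite /etaL (pmap_ringD etaL_model) mulrDl. Qed.

End Units.

HB.instance Definition _ (K : agen -> Prop) :=
  GRing.Zmodule_isLmodule.Build MM (steenrod K)
    (@scale_A K) (@scale_1 K) (@scale_Dr K) (@scale_Dl K).

End Motivic.

Section Coproduct.

Context (p : nat) (b : coeff_data).
Implicit Types (K : agen -> Prop).
Notation M := (MM p b).
Notation S := (steenrod p b).

Lemma ag_nil K n : coeff_nil b = Some n -> ag p b K (Mg Gamma) ^+ n = 0.
Proof.
by move=> Hn; have := ag_model (arel_nil p K Hn); rewrite reval_pow.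
Qed.

Lemma gamma2 K : ag p b K (Mg Gamma) * ag p b K (Mg Gamma)
  = - (ag p b K (Mg Gamma) * ag p b K (Mg Gamma)).
Proof. by rewrite {1}ag_comm /= expr1 mulN1r. Qed.

Lemma etaR_model K : rmodel (mrel p b)
  (fun g => if g is Theta then ag p b K (Mg Theta) - rho p b K * tau p b K 0
            else ag p b K (Mg Gamma)).
Proof.
have tg : (ag p b K (Mg Theta) - rho p b K * tau p b K 0) * ag p b K (Mg Gamma)
  = ag p b K (Mg Gamma) * (ag p b K (Mg Theta) - rho p b K * tau p b K 0).
  rewrite mulrBl mulrBr (ag_comm _ _ _ (Mg Theta)) /= expr0 mul1r; congr (_ - _).
  rewrite rhoE; case: (coeff_bock b); last by rewrite !(mul0r, mulr0).
  rewrite -mulrA (ag_comm _ _ _ (Tau 0)) /= expr1 mulN1r mulrN !mulrA.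
  by rewrite -mulNr -gamma2.
move=> _ _ [|g h|n Hn] /=.
- by rewrite reval_nat ag_char.
- rewrite reval_sign /=; case: g; case: h; rewrite /= ?expr0 ?mul1r //.
  exact: (ag_comm p b K (Mg Gamma) (Mg Gamma)).
- by rewrite reval_pow /= ag_nil.
Qed.

Lemma sigma_model K :
  rmodel (arel p b K) (fun g => (-1) ^+ apar g * pgen (arel p b K) g).
Proof.
pose s g := (-1) ^+ apar g * pgen (arel p b K) g.
move=> a c; case=> [|g h|n Hn||i|g Hg] /=.
- by rewrite reval_nat ag_char.
- rewrite reval_sign /= -!/(ag p b K _).
  have := ag_comm p b K g h; rewrite !mulr_sign.
  by case: (apar g); case: (apar h) => /=; rewrite ?mulNr ?mulrN ?opprK => <-.
- rewrite reval_pow /= expr1 mulN1r exprNn -/(ag p b K _) ag_nil //.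
  by rewrite mulr0.
- by rewrite expr0 mul1r; have /= := ag_model (arel_xi0 p b K).
- have /= := ag_model (arel_tau p b K i).
  rewrite !expr1 !mulN1r !mulr1 mulrNN => ->.
  case: eqP => //= _; rewrite !expr0 !expr1 !mul1r mulN1r; congr (_ + _).
  by rewrite /rho_expr; case: (coeff_bock b);
    rewrite /= ?mul0r // expr1 mulN1r mulrNN.
- by have := ag_model (arel_kill p b Hg); rewrite /= /ag => ->; rewrite mulr0.
Qed.

Lemma sigmaD K (x y : S K) : sigma (x + y) = sigma x + sigma y.
Proof. exact: (pmap_ringD (@sigma_model K)). Qed.
Lemma sigmaM K (x y : S K) : sigma (x * y) = sigma x * sigma y.
Proof. exact: (pmap_ringM (@sigma_model K)). Qed.
Lemma sigmaN K (x : S K) : sigma (- x) = - sigma x.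
Proof. exact: (pmap_ringN (@sigma_model K)). Qed.
Lemma sigma0 K : sigma (0 : S K) = 0.
Proof. exact: (pmap_ring0 (@sigma_model K)). Qed.
Lemma sigma1 K : sigma (1 : S K) = 1.
Proof. exact: (pmap_ring1 (@sigma_model K)). Qed.
Lemma sigma_gen K g : sigma (ag p b K g) = (-1) ^+ apar g * ag p b K g.
Proof. exact: (pmap_ring_gen (@sigma_model K)). Qed.

Section Tens.
Context (K : agen -> Prop) (N : lmodType M).

(** [steenrod K (x)_M N], where [M] acts on the right of [steenrod K] through
    the right unit; it is a left [M]-module through the left unit. *)
Definition stens := tens (fun (x : S K) (m : M) => x * etaR K m) N.
HB.instance Definition _ := GRing.Zmodule.on stens.

Definition spure (x : S K) (n : N) : stens := pure _ x n.

Lemma spureDl x x' n : spure (x + x') n = spure x n + spure x' n.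
Proof. exact: (balDl (pure_balanced _ _)). Qed.
Lemma spureDr x n n' : spure x (n + n') = spure x n + spure x n'.
Proof. exact: (balDr (pure_balanced _ _)). Qed.
Lemma spureM x m n : spure (x * etaR K m) n = spure x (m *: n).
Proof. exact: (balM (pure_balanced _ _)). Qed.
Lemma spure0l n : spure 0 n = 0.
Proof. by apply: (addrI (spure 0 n)); rewrite -spureDl !addr0. Qed.
Lemma spure0r x : spure x 0 = 0.
Proof. by apply: (addrI (spure x 0)); rewrite -spureDr !addr0. Qed.
Lemma spureNl x n : spure (- x) n = - spure x n.
Proof. by apply: (addrI (spure x n)); rewrite -spureDl !subrr spure0l. Qed.
Lemma spureNr x n : spure x (- n) = - spure x n.
Proof. by apply: (addrI (spure x n)); rewrite -spureDr !subrr spure0r. Qed.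

Lemma stens_ind (P : stens -> Prop) :
  P 0 -> (forall x n t, P t -> P (spure x n + t)) -> forall t, P t.
Proof. exact: tens_ind. Qed.

Definition stens_scale (m : M) (t : stens) : stens :=
  tlift (fun x n => spure (m *: x) n) t.

Lemma stens_scale_bal (m : M) :
  balanced (fun (x : S K) (m : M) => x * etaR K m)
    (fun x (n : N) => spure (m *: x) n).
Proof.
split=> [x x' n|x n n'|x r n]; first by rewrite scalerDr spureDl.
- by rewrite spureDr.
- by rewrite -spureM; congr (spure _ _); apply: mulrA.
Qed.

Lemma stens_scale_pure m x n : stens_scale m (spure x n) = spure (m *: x) n.
Proof. exact: (tlift_pure (stens_scale_bal m)). Qed.

Fact stens_scaleDr : right_distributive stens_scale +%R.
Proof. by move=> m s t; exact: (tliftD (stens_scale_bal m)). Qed.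
Lemma stens_scale0 m : stens_scale m 0 = 0.
Proof. exact: (tlift0 (stens_scale_bal m)). Qed.
Fact stens_scaleA m r t :
  stens_scale m (stens_scale r t) = stens_scale (m * r) t.
Proof.
elim/stens_ind: t => [|x n t IH]; first by rewrite !stens_scale0.
by rewrite !stens_scaleDr IH !stens_scale_pure scalerA.
Qed.
Fact stens_scale1 : left_id 1 stens_scale.
Proof.
elim/stens_ind=> [|x n t IH]; first by rewrite !stens_scale0.
by rewrite !stens_scaleDr IH !stens_scale_pure scale1r.
Qed.
Fact stens_scaleDl t : {morph stens_scale^~ t : m r / m + r}.
Proof.
move=> m r; elim/stens_ind: t => [|x n t IH].
  by rewrite !stens_scale0 addr0.
by rewrite !stens_scaleDr IH !stens_scale_pure scalerDl spureDl addrACA.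
Qed.

HB.instance Definition _ := GRing.Zmodule_isLmodule.Build M stens
  stens_scaleA stens_scale1 stens_scaleDr stens_scaleDl.

End Tens.

Definition smap K (N N' : lmodType M) (f : N -> N') : stens K N -> stens K N' :=
  tlift (fun x n => spure x (f n)).

Definition par_iter K (s : bool) (x : S K) : S K := if s then sigma x else x.

(** Left multiplication by [x (x) y] in the graded tensor product, for [y] of
    parity [s]: [c (x) d |-> (-1)^{s |c|} x c (x) y d]. *)
Definition mulop K K' (x : S K) (s : bool) (y : S K')
  : stens K (S K') -> stens K (S K') :=
  tlift (fun c d => spure (x * par_iter s c) (y * d)).

(** Left multiplication by [psi g], with
    [psi (xi_k) = sum xi_i (x) xi_{k-i}^{p^i}] and
    [psi (tau_k) = 1 (x) tau_k + sum tau_i (x) xi_{k-i}^{p^i}] (conjugates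
    throughout).  Both factors may be [A_p^vee] or a quotient of it. *)
Definition psi_gen K K' (g : agen) (t : stens K (S K')) : stens K (S K') :=
  match g with
  | Mg h => mulop (ag p b K (Mg h)) false 1 t
  | Xi k => \sum_(i < k.+1)
      mulop (xi p b K i) false (xi p b K' (k - i) ^+ (p ^ i)%N) t
  | Tau k => mulop 1 true (tau p b K' k) t
      + \sum_(i < k.+1)
          mulop (tau p b K i) false (xi p b K' (k - i) ^+ (p ^ i)%N) t
  end.

Fixpoint psi_op K K' (a : rexpr agen) (t : stens K (S K'))
  : stens K (S K') :=
  match a with
  | Var g => psi_gen g t
  | Zero => 0
  | One => t
  | Opp a => - psi_op a t
  | Add a c => psi_op a t + psi_op c t
  | Mul a c => psi_op a (psi_op c t)
  end.

Definition sone K K' : stens K (S K') := spure (1 : S K) (1 : S K').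

(** The map [psi : S K' -> S K (x)_M S K'].  It does not depend on the
    representative, and is multiplicative, whenever [psi] kills [K'] (see
    [psi_op_cong], [psi_mul_gen]). *)
Definition psi K K' (x : S K') : stens K (S K') :=
  psi_op (repr x) (sone K K').

Definition gcentral K (s : bool) (x : S K) : Prop :=
  forall y, x * y = par_iter s y * x.

Lemma par_iterM K s (x y : S K) :
  par_iter s (x * y) = par_iter s x * par_iter s y.
Proof. by case: s => //=; rewrite sigmaM. Qed.
Lemma par_iterD K s (x y : S K) :
  par_iter s (x + y) = par_iter s x + par_iter s y.
Proof. by case: s => //=; rewrite sigmaD. Qed.
Lemma par_iterN K s (x : S K) : par_iter s (- x) = - par_iter s x.
Proof. by case: s => //=; rewrite sigmaN. Qed.
Lemma par_iter0 K s : par_iter s (0 : S K) = 0.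
Proof. by case: s => //=; rewrite sigma0. Qed.
Lemma par_iter1 K s : par_iter s (1 : S K) = 1.
Proof. by case: s => //=; rewrite sigma1. Qed.

Lemma gcentral_ag K g : gcentral (apar g) (ag p b K g).
Proof.
elim/pres_ind=> a; rewrite rclassE -/(ag p b K).
elim: a => [h|||a IH|a IHa c IHc|a IHa c IHc] /=.
- rewrite -/(ag p b K h) ag_comm; case: (apar g) => /=;
    rewrite ?expr0 ?mul1r // sigma_gen.
  by case: (apar h); rewrite ?expr0 ?mul1r // !expr1 !mulN1r mulNr.
- by rewrite par_iter0 mulr0 mul0r.
- by rewrite par_iter1 mulr1 mul1r.
- by rewrite par_iterN mulrN mulNr IH.
- by rewrite par_iterD mulrDr mulrDl IHa IHc.
- by rewrite par_iterM mulrA IHa -mulrA IHc mulrA.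
Qed.

Lemma sigmaK K (x : S K) : sigma (sigma x) = x.
Proof.
elim/pres_ind: x => a; rewrite rclassE -/(ag p b K).
elim: a => [h|||a IH|a IHa c IHc|a IHa c IHc] /=.
- rewrite -/(ag p b K h) !sigma_gen; rewrite !mulr_sign; case: (apar h) (sigma_gen K h).
    by rewrite mulr_sign sigmaN => ->; rewrite opprK.
  by rewrite mulr_sign.
- by rewrite !sigma0.
- by rewrite !sigma1.
- by rewrite !sigmaN IH.
- by rewrite !sigmaD IHa IHc.
- by rewrite !sigmaM IHa IHc.
Qed.

Lemma par_iter_comp K s t (x : S K) :
  par_iter s (par_iter t x) = par_iter (s (+) t) x.
Proof. by case: s; case: t => //=; rewrite sigmaK. Qed.

Lemma gcentralM K s t (x y : S K) :
  gcentral s x -> gcentral t y -> gcentral (s (+) t) (x * y).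
Proof.
by move=> cx cy z; rewrite -mulrA cy mulrA cx par_iter_comp mulrA.
Qed.
Lemma gcentral1 K : gcentral false (1 : S K).
Proof. by move=> y; rewrite mulr1 mul1r. Qed.
Lemma gcentral_xi K i n : gcentral false (xi p b K i ^+ n).
Proof.
elim: n => [|n IH]; first exact: gcentral1.
by rewrite exprS; apply: (@gcentralM _ false false) => //; exact: gcentral_ag.
Qed.

Definition msigma : M -> M := psigma mpar.

Lemma msigma_model :
  rmodel (mrel p b) (fun g => (-1) ^+ mpar g * pgen (mrel p b) g).
Proof.
have M_ := pgen_model (E := mrel p b).
move=> a c; case=> [|g h|n Hn] /=.
- by rewrite reval_nat; have := M_ _ _ (mrel_char p b); rewrite reval_nat.
- have := M_ _ _ (mrel_comm p b g h); rewrite /= !reval_sign /= !mulr_sign.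
  by case: (mpar g); case: (mpar h) => /=; rewrite ?mulNr ?mulrN ?opprK => <-.
- rewrite reval_pow /= expr1 mulN1r exprNn.
  by have := M_ _ _ (mrel_nil p Hn); rewrite reval_pow /= => ->; rewrite mulr0.
Qed.

Definition mpar_iter (s : bool) (m : M) := if s then msigma m else m.

Section Eta.
Context (K : agen -> Prop).

Lemma etaLD (m r : M) : etaL K (m + r) = etaL K m + etaL K r.
Proof. by rewrite /etaL (pmap_ringD (@etaL_model p b K)). Qed.
Lemma etaLM (m r : M) : etaL K (m * r) = etaL K m * etaL K r.
Proof. by rewrite /etaL (pmap_ringM (@etaL_model p b K)). Qed.
Lemma etaL1 : etaL K (1 : M) = 1.
Proof. by rewrite /etaL (pmap_ring1 (@etaL_model p b K)). Qed.
Lemma etaRD (m r : M) : etaR K (m + r) = etaR K m + etaR K r.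
Proof. by rewrite /etaR (pmap_ringD (@etaR_model K)). Qed.
Lemma etaRM (m r : M) : etaR K (m * r) = etaR K m * etaR K r.
Proof. by rewrite /etaR (pmap_ringM (@etaR_model K)). Qed.
Lemma etaR1 : etaR K (1 : M) = 1.
Proof. by rewrite /etaR (pmap_ring1 (@etaR_model K)). Qed.

Lemma sigma_etaL (m : M) : sigma (etaL K m) = etaL K (msigma m).
Proof.
have L := @etaL_model p b K; have s := msigma_model.
rewrite /etaL /msigma /psigma.
elim/pres_ind: m => a; rewrite (pmap_ringE L) (pmap_ringE s).
elim: a => [h|||a IH|a IHa c IHc|a IHa c IHc] /=.
- rewrite sigma_gen (pmap_ringM L) (pmap_ring_gen L) /=; congr (_ * _).
  case: (mpar h); last by rewrite !expr0 (pmap_ring1 L).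
  by rewrite !expr1 (pmap_ringN L) (pmap_ring1 L).
- by rewrite sigma0 (pmap_ring0 L).
- by rewrite sigma1 (pmap_ring1 L).
- by rewrite sigmaN IH (pmap_ringN L).
- by rewrite sigmaD IHa IHc (pmap_ringD L).
- by rewrite sigmaM IHa IHc (pmap_ringM L).
Qed.

Lemma sigma_rho : sigma (rho p b K) = - rho p b K.
Proof.
rewrite rhoE; case: (coeff_bock b); last by rewrite sigma0 oppr0.
by rewrite sigma_gen expr1 mulN1r.
Qed.

Lemma sigma_etaR (m : M) : sigma (etaR K m) = etaR K (msigma m).
Proof.
have L := @etaR_model K; have s := msigma_model.
rewrite /etaR /msigma /psigma.
elim/pres_ind: m => a; rewrite (pmap_ringE L) (pmap_ringE s).
elim: a => [h|||a IH|a IHa c IHc|a IHa c IHc] /=.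
- rewrite (pmap_ringM L) (pmap_ring_gen L) /=; case: h => /=.
    rewrite expr0 (pmap_ring1 L) mul1r sigmaD sigmaN sigmaM sigma_rho.
    by rewrite !sigma_gen /= expr0 mul1r expr1 mulN1r mulrNN.
  by rewrite sigma_gen /= !expr1 (pmap_ringN L) (pmap_ring1 L).
- by rewrite sigma0 (pmap_ring0 L).
- by rewrite sigma1 (pmap_ring1 L).
- by rewrite sigmaN IH (pmap_ringN L).
- by rewrite sigmaD IHa IHc (pmap_ringD L).
- by rewrite sigmaM IHa IHc (pmap_ringM L).
Qed.

Lemma par_iter_etaL s (m : M) : par_iter s (etaL K m) = etaL K (mpar_iter s m).
Proof. by case: s => //=; rewrite sigma_etaL. Qed.
Lemma par_iter_etaR s (m : M) : par_iter s (etaR K m) = etaR K (mpar_iter s m).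
Proof. by case: s => //=; rewrite sigma_etaR. Qed.
End Eta.

Section Ops.
Context (K K' : agen -> Prop).
Notation T := (stens K (S K')).
Implicit Types (x : S K) (y : S K') (t u : T).

Lemma mulop_bal x s (y : S K') : gcentral s y ->
  balanced (fun (x : S K) (m : M) => x * etaR K m)
    (fun c (d : S K') => spure (x * par_iter s c) (y * d) : T).
Proof.
move=> cy; split=> [c c' d|c d d'|c m d].
- by rewrite par_iterD mulrDr spureDl.
- by rewrite mulrDr spureDr.
- rewrite par_iterM par_iter_etaR mulrA spureM; congr (spure _ _).
  by rewrite /GRing.scale /= [RHS]mulrA [in RHS]cy par_iter_etaL mulrA.
Qed.

Section One.
Variables (x : S K) (s : bool) (y : S K').
Hypothesis cy : gcentral s y.

Lemma mulop_pure c d :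
  mulop x s y (spure c d) = spure (x * par_iter s c) (y * d).
Proof. exact: (tlift_pure (mulop_bal x cy)). Qed.
Lemma mulopD t u : mulop x s y (t + u) = mulop x s y t + mulop x s y u.
Proof. exact: (tliftD (mulop_bal x cy)). Qed.
Lemma mulop0 : mulop x s y (0 : T) = 0.
Proof. exact: (tlift0 (mulop_bal x cy)). Qed.
Lemma mulopN t : mulop x s y (- t) = - mulop x s y t.
Proof. by apply: (addrI (mulop x s y t)); rewrite -mulopD !subrr mulop0. Qed.
Lemma mulop_sum I (r : seq I) (P : pred I) (F : I -> T) :
  mulop x s y (\sum_(i <- r | P i) F i) = \sum_(i <- r | P i) mulop x s y (F i).
Proof. by apply: (big_morph _ mulopD mulop0). Qed.
End One.

Lemma T_ext (f g : T -> T) :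
  {morph f : t u / t + u} -> {morph g : t u / t + u} ->
  (forall c d, f (spure c d) = g (spure c d)) -> f =1 g.
Proof.
move=> fD gD fg.
have f0 : f 0 = 0 by apply: (addrI (f 0)); rewrite -fD !addr0.
have g0 : g 0 = 0 by apply: (addrI (g 0)); rewrite -gD !addr0.
by elim/stens_ind=> [|c d t IH]; rewrite ?f0 ?g0 // fD gD IH fg.
Qed.

Lemma mulopM x s y x' s' y' t : gcentral s y -> gcentral s' y' ->
  mulop x s y (mulop x' s' y' t)
  = mulop (x * par_iter s x') (s (+) s') (y * y') t.
Proof.
move=> cy cy'; have cyy' := gcentralM cy cy'.
move: t; apply: T_ext => [t u|t u|c d]; first by rewrite !mulopD.
- by rewrite !mulopD.
- by rewrite !mulop_pure // par_iterM par_iter_comp !mulrA.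
Qed.

Lemma mulop_Nl x s y t : gcentral s y ->
  mulop (- x) s y t = - mulop x s y t.
Proof.
move=> cy; move: t; apply: T_ext => [t u|t u|c d]; rewrite ?mulopD //.
- by rewrite opprD.
- by rewrite !mulop_pure // mulNr spureNl.
Qed.
Lemma mulop_Nr x s y t : gcentral s y ->
  mulop x s (- y) t = - mulop x s y t.
Proof.
move=> cy; have cyN : gcentral s (- y).
  by move=> z; rewrite mulNr cy mulrN.
move: t; apply: T_ext => [t u|t u|c d]; rewrite ?mulopD //.
- by rewrite opprD.
- by rewrite !mulop_pure // mulNr spureNr.
Qed.
Lemma mulop_Dl x x' s y t : gcentral s y ->
  mulop (x + x') s y t = mulop x s y t + mulop x' s y t.
Proof.
move=> cy; move: t; apply: T_ext => [t u|t u|c d]; rewrite ?mulopD //.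
- by rewrite addrACA.
- by rewrite !mulop_pure // mulrDl spureDl.
Qed.
Lemma mulop_0l s y t : gcentral s y -> mulop 0 s y t = 0.
Proof.
move=> cy; apply: (addrI (mulop 0 s y t)).
by rewrite -mulop_Dl // !addr0.
Qed.
Lemma mulop_0r x s t : mulop x s 0 t = 0.
Proof.
have c0 : gcentral s (0 : S K') by move=> z; rewrite mul0r mulr0.
move: t; apply: T_ext => [t u|t u|c d]; rewrite ?mulopD ?addr0 //.
by rewrite !mulop_pure // mul0r spure0r.
Qed.
Lemma mulop_11 t : mulop 1 false 1 t = t.
Proof.
have c1 := @gcentral1 K'.
by move: t; apply: T_ext => [t u|t u|c d]; rewrite ?mulopD // mulop_pure // !mul1r.
Qed.

(** Sums of left multiplications by homogeneous tensors of parity [s]. *)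
Definition hpar K0 (s : bool) (x : S K0) :=
  gcentral s x /\ sigma x = (-1) ^+ s * x.

Inductive oplike (s : bool) : (T -> T) -> Prop :=
  | oplike_mul x sx y sy : s = sx (+) sy -> hpar sx x -> hpar sy y ->
      oplike s (mulop x sy y)
  | oplike0 : oplike s (fun=> 0)
  | oplikeD f g : oplike s f -> oplike s g -> oplike s (fun t => f t + g t).

Lemma oplike_add s f : oplike s f -> {morph f : t u / t + u}.
Proof.
elim=> {f} [x sx y sy _ _ [cy _]|t u|f g _ fD _ gD t u].
- by move=> t u; rewrite mulopD.
- by rewrite addr0.
- by rewrite fD gD addrACA.
Qed.

Lemma oplike_comm s s' f g t : oplike s f -> oplike s' g ->
  f (g t) = if s && s' then - g (f t) else g (f t).
Proof.
move=> Hf Hg; elim: Hf => {f} [x sx y sy -> hx hy||f f' Hf IHf Hf' IHf'].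
- elim: Hg => {g} [x' sx' y' sy' -> hx' hy'||g g' _ IHg _ IHg'].
  + case: hx hy hx' hy' => [cx ex] [cy ey] [cx' ex'] [cy' ey'].
    have ca : mulop x sy y (mulop x' sy' y' t)
      = (if (sy && sx') (+) (sx && sx') (+) (sy && sy') then -%R else id)
          (mulop (x' * x) (sy' (+) sy) (y' * y) t).
      rewrite mulopM //.
      have -> : x * par_iter sy x' = (-1) ^+ ((sy && sx') (+) (sx && sx')) * (x' * x).
        have -> : par_iter sy x' = (-1) ^+ (sy && sx') * x'.
          by case: (sy); rewrite /= ?ex' // expr0 mul1r.
        rewrite cx par_iterM.
        have -> : par_iter sx x' = (-1) ^+ (sx && sx') * x'.
          by case: (sx); rewrite /= ?ex' // expr0 mul1r.
        have -> : par_iter sx ((-1) ^+ (sy && sx')) = (-1) ^+ (sy && sx') :> S K.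
          by case: (sy && sx'); rewrite ?expr1 ?expr0 ?par_iterN par_iter1.
        by rewrite signr_addb !mulrA.
      have -> : y * y' = (-1) ^+ (sy && sy') * (y' * y).
        rewrite cy; case: (sy); rewrite /= ?ey' ?mulrA //.
        by rewrite expr0 mul1r.
      have cyy : gcentral (sy (+) sy') (y' * y).
        by rewrite addbC; apply: gcentralM.
      rewrite [sy' (+) sy]addbC.
      case: (sy && sx'); case: (sx && sx'); case: (sy && sy');
        rewrite /= ?expr1 ?expr0 ?mul1r ?mulN1r ?(mulop_Nl,mulop_Nr) ?opprK //;
        try by move=> z; rewrite mulNr cyy mulrN.
      
    have cb : mulop x' sy' y' (mulop x sy y t)
      = (if sy' && sx then -%R else id)
          (mulop (x' * x) (sy' (+) sy) (y' * y) t).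
      rewrite mulopM //.
      have -> : par_iter sy' x = (-1) ^+ (sy' && sx) * x.
        by case: (sy'); rewrite /= ?ex // expr0 mul1r.
      have cyy : gcentral (sy' (+) sy) (y' * y) by apply: gcentralM.
      case: (sy' && sx); rewrite ?expr0 ?mul1r // expr1 mulN1r mulrN.
      by rewrite mulop_Nl.
    rewrite ca cb.
    by case: (sx); case: (sy); case: (sx'); case: (sy'); rewrite //= opprK.
  + have [cy _] := hy; rewrite mulop0 //; case: ifP; by rewrite ?oppr0.
  + have [cy _] := hy; rewrite mulopD // IHg IHg'; case: ifP => //.
    by rewrite opprD.
- have gD := oplike_add Hg.
  have -> : g 0 = 0 by apply: (addrI (g 0)); rewrite -gD !addr0.
  by rewrite oppr0 if_same.
- rewrite IHf IHf' (oplike_add Hg); case: ifP => //; by rewrite opprD.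
Qed.

Lemma hpar_ag K0 g : hpar (apar g) (ag p b K0 g).
Proof. by split; [exact: gcentral_ag | exact: sigma_gen]. Qed.
Lemma hpar1 K0 : hpar false (1 : S K0).
Proof. by split; [exact: gcentral1 | rewrite sigma1 expr0 mul1r]. Qed.
Lemma hpar_xi K0 i n : hpar false (xi p b K0 i ^+ n).
Proof.
split; first exact: gcentral_xi.
rewrite expr0 mul1r; elim: n => [|n IH]; first by rewrite sigma1.
by rewrite exprS sigmaM IH sigma_gen expr0 mul1r.
Qed.

Lemma oplike_sum s (I : Type) (r : seq I) (F : I -> T -> T) :
  (forall i, oplike s (F i)) -> oplike s (fun t => \sum_(i <- r) F i t).
Proof.
move=> H; elim: r => [|i r IH].
  have -> : (fun t => \sum_(i <- [::]) F i t) = (fun=> 0).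
    by apply/funext => t; rewrite big_nil.
  exact: oplike0.
have -> : (fun t => \sum_(i <- i :: r) F i t)
        = (fun t => F i t + \sum_(i <- r) F i t).
  by apply/funext => t; rewrite big_cons.
exact: oplikeD.
Qed.

Lemma oplike_psi_gen g : oplike (apar g) (psi_gen (K := K) (K' := K') g).
Proof.
case: g => [h|k|k] /=.
- by apply: (@oplike_mul _ _ (mpar h) _ false) => //;
    rewrite ?addbF //; [exact: (hpar_ag K (Mg h)) | exact: hpar1].
- apply: oplike_sum => i; apply: (@oplike_mul _ _ false _ false) => //.
    exact: (hpar_ag K (Xi i)).
  exact: hpar_xi.
- apply: oplikeD.
    apply: (@oplike_mul _ _ false _ true) => //; first exact: hpar1.
    exact: (hpar_ag K' (Tau k)).
  apply: oplike_sum => i; apply: (@oplike_mul _ _ true _ false) => //.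
    exact: (hpar_ag K (Tau i)).
  exact: hpar_xi.
Qed.

Lemma psi_genD g : {morph psi_gen (K := K) (K' := K') g : t u / t + u}.
Proof. exact: oplike_add (oplike_psi_gen g). Qed.

Lemma psi_opD a : {morph psi_op (K := K) (K' := K') a : t u / t + u}.
Proof.
elim: a => [g|||a IH|a IHa c IHc|a IHa c IHc] t u /=.
- exact: psi_genD.
- by rewrite addr0.
- by [].
- by rewrite IH opprD.
- by rewrite IHa IHc addrACA.
- by rewrite IHc IHa.
Qed.

End Ops.

Section PsiWellDefined.
Context (K K' : agen -> Prop).
Notation T := (stens K (S K')).
Implicit Types (x : S K) (y : S K') (t u : T).

Lemma oplike_sq_sum (I : Type) (r : seq I) (F : I -> T -> T) t :
  (forall i, oplike true (F i)) ->
  \sum_(i <- r) F i (\sum_(j <- r) F j t) = \sum_(i <- r) F i (F i t).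
Proof.
move=> HF; pose G (l : seq I) u := \sum_(i <- l) F i u.
rewrite -/(G r t) -/(G r (G r t)).
elim: r => [|i r IH]; first by rewrite /G !big_nil.
have HG : oplike true (G r) by exact: oplike_sum.
have GE u : G (i :: r) u = F i u + G r u by rewrite /G big_cons.
rewrite !GE !(oplike_add (HF i)) !(oplike_add HG) IH big_cons.
rewrite (oplike_comm t HG (HF i)) /= -addrA; congr (_ + _).
by rewrite addrA subrr add0r.
Qed.

Lemma tau_sq K0 k : tau p b K0 k * tau p b K0 k =
  if p == 2%N then ag p b K0 (Mg Theta) * xi p b K0 k.+1
                 + rho p b K0 * tau p b K0 k.+1 else 0.
Proof.
have /= := ag_model (arel_tau p b K0 k); rewrite mulr1 => ->.
by case: (p == 2%N).
Qed.

Lemma opp_char2 K0 (x : S K0) : p = 2%N -> - x = x.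
Proof.
move=> p2; apply/eqP; rewrite -subr_eq0 -opprD oppr_eq0 -mulr2n -mulr_natl.
have E n : p = n -> n%:R = 0 :> S K0 by move=> <-; exact: ag_char.
by rewrite (E 2%N p2) mul0r.
Qed.

Lemma sigma_char2 K0 (x : S K0) : p = 2%N -> sigma x = x.
Proof.
move=> p2; elim/pres_ind: x => a; rewrite rclassE -/(ag p b K0).
elim: a => [h|||a IH|a IHa c IHc|a IHa c IHc] /=.
- by rewrite sigma_gen mulr_sign opp_char2 // if_same.
- by rewrite sigma0.
- by rewrite sigma1.
- by rewrite sigmaN IH.
- by rewrite sigmaD IHa IHc.
- by rewrite sigmaM IHa IHc.
Qed.

Lemma par_iter_char2 K0 s (x : S K0) : p = 2%N -> par_iter s x = x.
Proof. by move=> p2; case: s => //=; rewrite sigma_char2. Qed.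

Lemma gcentral_char2 K0 s (x : S K0) : p = 2%N -> gcentral s x.
Proof.
move=> p2 y; rewrite par_iter_char2 //; elim/pres_ind: x => a.
rewrite rclassE -/(ag p b K0).
elim: a => [h|||a IH|a IHa c IHc|a IHa c IHc] /=.
- by rewrite gcentral_ag par_iter_char2.
- by rewrite mulr0 mul0r.
- by rewrite mulr1 mul1r.
- by rewrite mulrN mulNr IH.
- by rewrite mulrDr mulrDl IHa IHc.
- by rewrite -mulrA IHc !mulrA IHa.
Qed.

Lemma psi_op_nat n t : psi_op (rnat agen n) t = t *+ n.
Proof. by elim: n => //= n ->; rewrite mulrS. Qed.

Lemma stens_char t : t *+ p = 0.
Proof.
elim/stens_ind: t => [|x y t IH]; first by rewrite mul0rn.
rewrite mulrnDl IH addr0.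
have E n : spure x y *+ n = spure (n%:R * x) y.
  elim: n => [|n IHn]; first by rewrite mul0r spure0l.
  by rewrite !mulrS IHn mulrDl mul1r spureDl.
by rewrite E ag_char mul0r spure0l.
Qed.

Lemma psi_op_arel a c t :
  (forall g, K' g -> forall u : T, psi_gen g u = 0) ->
  arel p b K' a c -> psi_op a t = psi_op c t.
Proof.
move=> kill; case=> [|g h|n Hn||k|g Hg] /=.
- by rewrite psi_op_nat stens_char.
- rewrite (oplike_comm t (oplike_psi_gen K K' g) (oplike_psi_gen K K' h)).
  by case: (apar g && apar h).
- have c1 := @gcentral1 K'.
  have E i : psi_op (rpow (Var (Mg Gamma)) i) t
      = mulop (ag p b K (Mg Gamma) ^+ i) false 1 t.
    elim: i => [|i IH]; first by rewrite mulop_11.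
    by rewrite /= IH /= mulopM // mulr1 -exprS.
  by rewrite E ag_nil // mulop_0l.
- have x0 K0 : xi p b K0 0 = 1 by exact: (ag_model (arel_xi0 p b K0)).
  by rewrite big_ord1 /= subn0 !x0 expr1n mulop_11.
- have odd_tau i : oplike true (fun u : T =>
      mulop (tau p b K i) false (xi p b K' (k - i) ^+ (p ^ i)%N) u).
    apply: (@oplike_mul _ _ _ _ true _ false) => //.
      exact: (hpar_ag K (Tau i)).
    exact: hpar_xi.
  have odd1 : oplike true (mulop (1 : S K) true (tau p b K' k)).
    apply: (@oplike_mul _ _ _ _ false _ true) => //; first exact: hpar1.
    exact: (hpar_ag K' (Tau k)).
  pose B u := \sum_(i < k.+1)
     mulop (tau p b K i) false (xi p b K' (k - i) ^+ (p ^ i)%N) u.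
  have oddB : oplike true B by apply: oplike_sum => i; exact: odd_tau.
  rewrite -!/(B _) (oplike_add odd1) (oplike_add oddB).
  rewrite (oplike_comm t odd1 oddB) /= -addrA [- _ + (_ + _)]addrA addNr add0r.
  have -> : B (B t) = \sum_(i < k.+1) mulop (tau p b K i * tau p b K i) false
     (xi p b K' (k - i) ^+ (p ^ i * 2)%N) t.
    apply: etrans (@oplike_sq_sum _ (index_enum _) (fun (i : 'I_k.+1) u =>
      mulop (tau p b K i) false (xi p b K' (k - i) ^+ (p ^ i)%N) u) t _) _.
      by move=> i; exact: odd_tau.
    apply: eq_bigr => i _; have cx := @gcentral_xi K' (k - i) (p ^ i).
    by rewrite mulopM //= exprM expr2.
  have -> : mulop 1 true (tau p b K' k) (mulop 1 true (tau p b K' k) t)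
     = mulop 1 false (tau p b K' k * tau p b K' k) t.
    have ct := @gcentral_ag K' (Tau k).
    by rewrite mulopM //= sigma1 mul1r.
  rewrite tau_sq; case: eqP => [p2|np2] /=; last first.
    rewrite mulop_0r add0r big1 // => i _; rewrite tau_sq.
    case: eqP => // _; apply: mulop_0l; exact: gcentral_xi.
  have gc K0 s (x : S K0) : gcentral s x by exact: gcentral_char2.
  have mul_s x s y u : mulop x s y u = mulop x false y u.
    move: u; apply: T_ext => [u v|u v|c' d]; rewrite ?mulopD //.
    by rewrite !mulop_pure // par_iter_char2.
  have mulop_Dr x s y y' u :
      mulop x s (y + y') u = mulop x s y u + mulop x s y' u.
    move: u; apply: T_ext => [u v|u v|c' d]; rewrite ?mulopD //.
      by rewrite addrACA.
    by rewrite !mulop_pure // mulrDl spureDr.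
  have mulop_eta x s (m : M) y u :
      mulop x s (etaL K' m * y) u = mulop (x * etaR K m) s y u.
    move: u; apply: T_ext => [u v|u v|c' d]; rewrite ?mulopD //.
    rewrite !mulop_pure // -[x * _ * _]mulrA.
    have -> : etaR K m * par_iter s c' = par_iter s c' * etaR K m.
      by rewrite (gc K false (etaR K m)).
    by rewrite mulrA spureM; congr spure; rewrite -mulrA.
  have theta_L : ag p b K' (Mg Theta) = etaL K' (mtheta p b).
    by rewrite /etaL (pmap_ring_gen (@etaL_model p b K')).
  have theta_R : etaR K (mtheta p b)
      = ag p b K (Mg Theta) + rho p b K * tau p b K 0.
    rewrite /etaR (pmap_ring_gen (@etaR_model K)) /=.
    by rewrite [- (_ * _)]opp_char2.
  pose mrho : M := if coeff_bock b then mgamma p b else 0.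
  have rho_L : rho p b K' = etaL K' mrho.
    rewrite rhoE /mrho /etaL; case: (coeff_bock b).
      by rewrite (pmap_ring_gen (@etaL_model p b K')).
    by rewrite (pmap_ring0 (@etaL_model p b K')).
  have rho_R : etaR K mrho = rho p b K.
    rewrite rhoE /mrho /etaR; case: (coeff_bock b).
      by rewrite (pmap_ring_gen (@etaR_model K)).
    by rewrite (pmap_ring0 (@etaR_model K)).
  have psi_rho u : psi_op (rho_expr b) u = mulop (rho p b K) false 1 u.
    rewrite rhoE /rho_expr; case: (coeff_bock b) => //=.
    by rewrite mulop_0l.
  have xi00 : xi p b K 0 = 1 by exact: (ag_model (arel_xi0 p b K)).
  have mul1op x x' u s y :
      mulop x false 1 (mulop x' s y u) = mulop (x * x') s y u.
    by rewrite mulopM //= mul1r.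
  pose X i := mulop (ag p b K (Mg Theta) * xi p b K i) false
                (xi p b K' (k.+1 - i) ^+ (p ^ i)%N) t.
  pose Y i := mulop (rho p b K * tau p b K i) false
                (xi p b K' (k.+1 - i) ^+ (p ^ i)%N) t.
  have -> : \sum_(i < k.+1) mulop (tau p b K i * tau p b K i) false
       (xi p b K' (k - i) ^+ (p ^ i * 2)) t
    = \sum_(i < k.+1) X i.+1 + \sum_(i < k.+1) Y i.+1.
    rewrite -big_split /=; apply: eq_bigr => i _.
    rewrite tau_sq; case: eqP => // _; rewrite mulop_Dl //.
    have -> : (p ^ i * 2 = p ^ i.+1)%N by rewrite expnSr p2.
    by rewrite /X /Y subSS.
  have -> : mulop (ag p b K (Mg Theta)) false 1
       (\sum_(i < k.+2) mulop (xi p b K i) false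
          (xi p b K' (k.+1 - i) ^+ (p ^ i)) t) = X 0%N + \sum_(i < k.+1) X i.+1.
    rewrite mulop_sum // big_ord_recl /=; congr (_ + _); first exact: mul1op.
    by apply: eq_bigr => i _; exact: mul1op.
  have -> : psi_op (rho_expr b) (mulop 1 true (tau p b K' k.+1) t
      + \sum_(i < k.+2) mulop (tau p b K i) false
          (xi p b K' (k.+1 - i) ^+ (p ^ i)) t)
    = mulop (rho p b K) false (tau p b K' k.+1) t
      + (Y 0%N + \sum_(i < k.+1) Y i.+1).
    rewrite psi_rho mulopD // mul1op mulr1 mul_s; congr (_ + _).
    rewrite mulop_sum // big_ord_recl /=; congr (_ + _); first exact: mul1op.
    by apply: eq_bigr => i _; exact: mul1op.
  have -> : mulop 1 false (ag p b K' (Mg Theta) * xi p b K' k.+1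
                           + rho p b K' * tau p b K' k.+1) t
    = (X 0%N + Y 0%N) + mulop (rho p b K) false (tau p b K' k.+1) t.
    rewrite mulop_Dr theta_L rho_L !mulop_eta !mul1r theta_R rho_R mulop_Dl //.
    by rewrite /X /Y xi00 mulr1 subn0 expn0 expr1.
  set a1 := X 0%N; set a2 := Y 0%N; set r := mulop (rho p b K) _ _ _.
  by rewrite (AC (3 * 2)%AC ((1 * 4) * (3 * (2 * 5)))%AC).
- by rewrite kill.
Qed.

Lemma psi_op_cong a c t :
  (forall g, K' g -> forall u : T, psi_gen g u = 0) ->
  rcong (arel p b K') a c -> psi_op a t = psi_op c t.
Proof.
move=> kill ac; elim: ac t => {a c} /=.
- by move=> a c ac t; exact: psi_op_arel.
- by [].
- by move=> a c _ IH t; rewrite IH.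
- by move=> a c d _ IH1 _ IH2 t; rewrite IH1.
- by move=> a c _ IH t; rewrite IH.
- by move=> a c d e _ IH1 _ IH2 t; rewrite IH1 IH2.
- by move=> a c d e _ IH1 _ IH2 t; rewrite IH2 IH1.
- by move=> a c d t; rewrite addrA.
- by move=> a c t; rewrite addrC.
- by move=> a t; rewrite add0r.
- by move=> a t; rewrite addNr.
- by [].
- by [].
- by [].
- by [].
- by move=> a c d t; rewrite psi_opD.
Qed.

End PsiWellDefined.

Section Psi.
Context (K K' : agen -> Prop).
Hypothesis kill : forall g, K' g ->
  forall u : stens K (S K'), psi_gen g u = 0.

Lemma psiE a : psi K (rclass (arel p b K') a) = psi_op a (sone K K').
Proof. by apply: psi_op_cong kill _; exact: rclass_repr. Qed.

Lemma psi1 : psi K (1 : S K') = sone K K'.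
Proof. by rewrite -[1]rclass1 psiE. Qed.
Lemma psi0 : psi K (0 : S K') = 0.
Proof. by rewrite -[0]rclass0 psiE. Qed.
Lemma psiD (x y : S K') : psi K (x + y) = psi K x + psi K y.
Proof. by elim/pres_ind: x => a; elim/pres_ind: y => c; rewrite -rclassD !psiE. Qed.
Lemma psi_mul_gen g (x : S K') : psi K (ag p b K' g * x) = psi_gen g (psi K x).
Proof.
by elim/pres_ind: x => a; rewrite /ag /pgen -rclassM !psiE.
Qed.

Lemma psiZ (m : M) (x : S K') : psi K (m *: x) = m *: psi K x.
Proof.
have L := @etaL_model p b K'; have LK := @etaL_model p b K.
have E (t : stens K (S K')) (g : mgen) :
    mulop (ag p b K (Mg g)) false 1 t = pgen (mrel p b) g *: t.
  move: t; apply: T_ext => [t u|t u|c d].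
  - by rewrite mulopD //; exact: gcentral1.
  - exact: scalerDr.
  rewrite mulop_pure ?mul1r; last exact: gcentral1.
  rewrite [RHS]stens_scale_pure /=; congr (spure (_ * _) _).
  by rewrite /etaL (pmap_ring_gen LK).
elim/pres_ind: m x => a; rewrite (rclassE (mrel p b)).
elim: a => [g|||a IH|a IHa c IHc|a IHa c IHc] x /=.
- rewrite -[RHS]E -[RHS]/(psi_gen (Mg g) _) -psi_mul_gen; congr psi; congr (_ * _).
  by rewrite /etaL (pmap_ring_gen L).
- by rewrite !scale0r psi0.
- by rewrite !scale1r.
- rewrite !scaleNr -IH; apply: (addrI (psi K (reval (pgen (mrel p b)) a *: x))).
  by rewrite -psiD !subrr psi0.
- by rewrite !scalerDl psiD IHa IHc.
- by rewrite -!scalerA IHa IHc.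
Qed.

End Psi.

Definition kill_none (g : agen) : Prop := False.
Definition kill_E (n : nat) (g : agen) : Prop :=
  match g with Mg _ => False | Xi i => (0 < i)%N | Tau j => (n < j)%N end.

(** [A_p^vee] and [E(1)_p^vee]. *)
Notation A := (steenrod p b kill_none).
Notation E1 := (steenrod p b (kill_E 1)).

Lemma kill_A K g : kill_none g ->
  forall u : stens K A, psi_gen g u = 0.
Proof. by []. Qed.

Lemma ag_kill K g : K g -> ag p b K g = 0.
Proof. by move=> Kg; have /= := ag_model (arel_kill p b Kg). Qed.

Lemma kill_E_ok n g : (0 < p)%N -> kill_E n g ->
  forall u : stens (kill_E n) (steenrod p b (kill_E n)), psi_gen g u = 0.
Proof.
move=> p0; have xi0 i : (0 < i)%N -> xi p b (kill_E n) i = 0.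
  by move=> i0; exact: (@ag_kill _ (Xi i)).
have tau0 i : (n < i)%N -> tau p b (kill_E n) i = 0.
  by move=> i0; exact: (@ag_kill _ (Tau i)).
have xiX i j : (0 < i)%N -> xi p b (kill_E n) i ^+ (p ^ j)%N = 0.
  by move=> i0; rewrite xi0 // expr0n -leqn0 leqNgt expn_gt0 p0.
case: g => [h|k|k] //= Hk u.
- apply: big1 => -[i /= Hi] _; have [i0|i0] := posnP i.
    by rewrite i0 subn0 xiX // mulop_0r.
  by rewrite xi0 // mulop_0l //; exact: gcentral_xi.
- rewrite tau0 // mulop_0r add0r; apply: big1 => -[i /= Hi] _.
  have [ni|ni] := ltnP n i.
    by rewrite tau0 // mulop_0l //; exact: gcentral_xi.
  by rewrite xiX ?mulop_0r // subn_gt0; exact: leq_ltn_trans ni Hk.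
Qed.

Definition sproj K : A -> S K := pmap_ring (ag p b K).

Definition sproj_tens K (N : lmodType M) : stens kill_none N -> stens K N :=
  tlift (fun x n => spure (sproj K x) n).

Section Sproj.
Context (K : agen -> Prop).

Lemma sproj_model : rmodel (arel p b kill_none) (ag p b K).
Proof.
move=> a c; case=> [|g h|n Hn||i|g []]; apply: ag_model.
- exact: arel_char.
- exact: arel_comm.
- exact: arel_nil.
- exact: arel_xi0.
- exact: arel_tau.
Qed.

Lemma sproj_ag g : sproj K (ag p b kill_none g) = ag p b K g.
Proof. by rewrite /sproj /ag (pmap_ring_gen sproj_model). Qed.
Lemma sprojD (x y : A) : sproj K (x + y) = sproj K x + sproj K y.
Proof. by rewrite /sproj (pmap_ringD sproj_model). Qed.
Lemma sprojN (x : A) : sproj K (- x) = - sproj K x.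
Proof. by rewrite /sproj (pmap_ringN sproj_model). Qed.
Lemma sprojM (x y : A) : sproj K (x * y) = sproj K x * sproj K y.
Proof. by rewrite /sproj (pmap_ringM sproj_model). Qed.
Lemma sproj0 : sproj K 0 = 0.
Proof. by rewrite /sproj (pmap_ring0 sproj_model). Qed.
Lemma sproj1 : sproj K 1 = 1.
Proof. by rewrite /sproj (pmap_ring1 sproj_model). Qed.

Lemma sproj_sigma (x : A) : sproj K (sigma x) = sigma (sproj K x).
Proof.
elim/pres_ind: x => a; rewrite rclassE -/(ag p b kill_none).
elim: a => [h|||a IH|a IHa c IHc|a IHa c IHc] /=.
- by rewrite sproj_ag !sigma_gen !mulr_sign; case: (apar h);
    rewrite ?sprojN sproj_ag.
- by rewrite sigma0 sproj0 sigma0.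
- by rewrite sigma1 sproj1 sigma1.
- by rewrite sigmaN !sprojN sigmaN IH.
- by rewrite sigmaD !sprojD sigmaD IHa IHc.
- by rewrite sigmaM !sprojM sigmaM IHa IHc.
Qed.

Lemma sproj_etaR (m : M) : sproj K (etaR kill_none m) = etaR K m.
Proof.
rewrite /etaR; elim/pres_ind: m => a.
rewrite (pmap_ringE (@etaR_model kill_none)) (pmap_ringE (@etaR_model K)).
elim: a => [h|||a IH|a IHa c IHc|a IHa c IHc] /=.
- case: h; rewrite ?sproj_ag // sprojD sprojN sprojM !sproj_ag !rhoE.
  by case: (coeff_bock b); rewrite ?sproj_ag ?sproj0.
- exact: sproj0.
- exact: sproj1.
- by rewrite sprojN IH.
- by rewrite sprojD IHa IHc.
- by rewrite sprojM IHa IHc.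
Qed.

Lemma sproj_bal (N : lmodType M) :
  balanced (fun (x : A) (m : M) => x * etaR kill_none m)
    (fun x (n : N) => spure (sproj K x) n).
Proof.
split=> [x x' n|x n n'|x m n]; first by rewrite sprojD spureDl.
- by rewrite spureDr.
- by rewrite sprojM sproj_etaR spureM.
Qed.

Lemma sproj_tens_pure (N : lmodType M) (x : A) (n : N) :
  sproj_tens K (spure x n) = spure (sproj K x) n.
Proof. exact: (tlift_pure (sproj_bal N)). Qed.
Lemma sproj_tensD (N : lmodType M) (t u : stens kill_none N) :
  sproj_tens K (t + u) = sproj_tens K t + sproj_tens K u.
Proof. exact: (tliftD (sproj_bal N)). Qed.
Lemma sproj_tens0 (N : lmodType M) :
  sproj_tens K (0 : stens kill_none N) = 0.
Proof. exact: (tlift0 (sproj_bal N)). Qed.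

Lemma sproj_mulop (x : A) s (y : A) (t : stens kill_none A) : gcentral s y ->
  sproj_tens K (mulop x s y t) = mulop (sproj K x) s y (sproj_tens K t).
Proof.
move=> cy; elim/stens_ind: t => [|c d t IH].
  by rewrite !(mulop0, sproj_tens0).
rewrite mulopD // !sproj_tensD mulopD // IH; congr (_ + _).
rewrite mulop_pure // !sproj_tens_pure mulop_pure // sprojM.
by case: s {cy IH} => //=; rewrite sproj_sigma.
Qed.

Lemma sproj_psi_gen g (t : stens kill_none A) :
  sproj_tens K (psi_gen g t) = psi_gen g (sproj_tens K t).
Proof.
have S_ (n : nat) (F : 'I_n -> stens kill_none A) :
    sproj_tens K (\sum_(i < n) F i) = \sum_(i < n) sproj_tens K (F i).
  by apply: (big_morph _ (@sproj_tensD A) (@sproj_tens0 A)).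
case: g => [h|k|k] /=.
- by rewrite sproj_mulop ?sproj_ag //; exact: gcentral1.
- rewrite S_; apply: eq_bigr => i _.
  by rewrite sproj_mulop ?sproj_ag //; exact: gcentral_xi.
- rewrite sproj_tensD sproj_mulop ?sproj1; last exact: (@gcentral_ag _ (Tau k)).
  congr (_ + _); rewrite S_; apply: eq_bigr => i _.
  by rewrite sproj_mulop ?sproj_ag //; exact: gcentral_xi.
Qed.

Lemma sproj_psi (x : A) : sproj_tens K (psi kill_none x) = psi K x.
Proof.
have E a (t : stens kill_none A) :
    sproj_tens K (psi_op a t) = psi_op a (sproj_tens K t).
  elim: a t => [g|||a IH|a IHa c IHc|a IHa c IHc] t //=.
  - exact: sproj_psi_gen.
  - exact: sproj_tens0.
  - rewrite -IH; apply: (addrI (sproj_tens K (psi_op a t))).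
    by rewrite -sproj_tensD !subrr sproj_tens0.
  - by rewrite sproj_tensD IHa IHc.
  - by rewrite IHa IHc.
elim/pres_ind: x => a; rewrite !psiE //; first by rewrite E sproj_tens_pure sproj1.
Qed.

End Sproj.

Lemma smap_bal K (N N' : lmodType M) (f : {linear N -> N'}) :
  balanced (fun (x : S K) (m : M) => x * etaR K m) (fun x n => spure x (f n)).
Proof.
split=> [x x' n|x n n'|x m n]; first by rewrite spureDl.
- by rewrite raddfD spureDr.
- by rewrite spureM linearZ.
Qed.

Lemma smap_pure K (N N' : lmodType M) (f : {linear N -> N'}) (x : S K) n :
  smap f (spure x n) = spure x (f n).
Proof. exact: (tlift_pure (smap_bal K f)). Qed.
Lemma smapD K (N N' : lmodType M) (f : {linear N -> N'}) (t u : stens K N) :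
  smap f (t + u) = smap f t + smap f u.
Proof. exact: (tliftD (smap_bal K f)). Qed.
Lemma smap0 K (N N' : lmodType M) (f : {linear N -> N'}) :
  smap f (0 : stens K N) = 0.
Proof. exact: (tlift0 (smap_bal K f)). Qed.

Inductive stens_gr K (N : lmodType M) (gr : int * int -> N -> Prop) :
    int * int -> stens K N -> Prop :=
  | stens_gr0 d : stens_gr gr d 0
  | stens_grD d t u : stens_gr gr d t -> stens_gr gr d u -> stens_gr gr d (t + u)
  | stens_gr_pure d e x n : homog (adeg p b) d x -> gr e n ->
      stens_gr gr (d + e) (spure x n).

(** The data of a bigraded left [E(1)_p^vee]-comodule; the axioms are in
    [is_comodule]. *)
Record comod := Comod {
  cm_mod :> lmodType M;
  cm_gr : int * int -> cm_mod -> Prop;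
  cm_coact : cm_mod -> stens (kill_E 1) cm_mod }.

Definition counit : E1 -> M :=
  pmap_ring (fun g => match g with
                      | Mg h => pgen (mrel p b) h
                      | Xi i => (i == 0%N)%:R
                      | Tau _ => 0
                      end).

(** [psi (x) 1], followed by the associativity isomorphism. *)
Definition psi_tens (N : lmodType M) :
    stens (kill_E 1) N -> stens (kill_E 1) (stens (kill_E 1) N) :=
  tlift (fun x n => smap (fun y : E1 => spure y n) (psi (kill_E 1) x)).

Record is_comodule (N : comod) : Prop := IsComodule {
  cm_gr0 : forall d, cm_gr d (0 : N);
  cm_grB : forall d (x y : N), cm_gr d x -> cm_gr d y -> cm_gr d (x - y);
  cm_grZ : forall d e (m : M) (x : N),
    homog (mdeg b) d m -> cm_gr e x -> cm_gr (d + e) (m *: x);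
  cm_gr_span : forall x : N, exists (D : seq (int * int)) (c : int * int -> N),
    (forall d, cm_gr d (c d)) /\ x = \sum_(d <- D) c d;
  cm_gr_indep : forall (D : seq (int * int)) (c : int * int -> N),
    uniq D -> (forall d, cm_gr d (c d)) -> \sum_(d <- D) c d = 0 ->
    forall d, d \in D -> c d = 0;
  cm_coactP : forall (m : M) (x y : N),
    cm_coact (m *: x + y) = m *: cm_coact x + cm_coact y;
  cm_coact_gr : forall d (x : N),
    cm_gr d x -> stens_gr (@cm_gr N) d (cm_coact x);
  cm_coassoc : forall x : N,
    psi_tens (cm_coact x) = smap (@cm_coact N) (cm_coact x);
  cm_counit : forall x : N,
    tlift (fun (y : E1) (n : N) => counit y *: n) (cm_coact x) = x }.

Definition is_comod_hom (N N' : comod) (f : N -> N') : Prop :=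
  [/\ forall (m : M) (x y : N), f (m *: x + y) = m *: f x + f y,
      forall d x, cm_gr d x -> cm_gr d (f x)
    & forall x, cm_coact (f x) = smap f (cm_coact x)].

Definition comod_iso (N N' : comod) : Prop :=
  exists (f : N -> N') (g : N' -> N),
    [/\ is_comod_hom f, is_comod_hom g, cancel f g & cancel g f].

Definition coeff_comod : comod :=
  @Comod (MM p b)^o (homog (mdeg b))
    (fun m => spure (etaL (kill_E 1) m) (1 : (MM p b)^o)).

Definition comod_sum (N N' : comod) : comod :=
  @Comod (N * N')%type (fun d x => cm_gr d x.1 /\ cm_gr d x.2)
    (fun x => smap (fun n : N => (n, 0 : N')) (cm_coact x.1)
              + smap (fun n' : N' => (0 : N, n')) (cm_coact x.2)).

(** The direct sum of the suspensions of [E(1)_p^vee] by [s 0], ..., [s n.-1].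
    Suspending only shifts degrees: the signs sometimes put in the coaction give
    an isomorphic comodule. *)
Definition susp_sum (n : nat) (s : 'I_n -> int * int) : comod :=
  @Comod {ffun 'I_n -> E1} (fun d x => forall i, homog (adeg p b) (d - s i) (x i))
    (fun x => \sum_(i < n)
       smap (fun y : E1 => [ffun j => if j == i then y else 0])
            (psi (kill_E 1) (x i))).

(** [E(1)_p] consists of the right [M]-linear functionals on [E(1)_p^vee]; it
    acts on the right of a left comodule by [x . f = (f (x) 1) (psi x)].
    [Q_i] is dual to [tau_i-bar] in the basis of products of
    [tau_0-bar, tau_1-bar]; see [milnorP]. *)
Definition is_milnor (i : nat) (f : E1 -> M) : Prop :=
  [/\ forall x y, f (x + y) = f x + f y,
      forall x m, f (x * etaR (kill_E 1) m) = f x * m,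
      f 1 = 0,
      forall j, (j <= 1)%N -> f (tau p b (kill_E 1) j) = (i == j)%:R
    & f (tau p b (kill_E 1) 0 * tau p b (kill_E 1) 1) = 0].

Definition milnor (i : nat) : E1 -> M :=
  xget (fun=> 0) [set f | is_milnor i f]%classic.

Definition ract (N : comod) (x : N) (f : E1 -> M) : N :=
  tlift (fun (y : E1) (n : N) => f y *: n) (cm_coact x).

Definition flash_family (k : nat) (N : comod) (x : nat -> N) : Prop :=
  [/\ forall i, (0 < i <= k)%N ->
        cm_gr (2 * i%:Z * (p%:Z - 1) + 1, i%:Z * (p%:Z - 1)) (x i),
      forall i, (0 < i < k)%N ->
        ract (x i.+1) (milnor 1) = ract (x i) (milnor 0)
    & forall i, (0 < i <= k)%N ->
        ract (ract (x i) (milnor 0)) (milnor 1) = 0].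

(** [L] is the lightning flash module [L_p(k)]: for [k > 0] it is generated by
    [x 1], ..., [x k] subject to these relations, as a bigraded right
    [E(1)_p]-module, that is, as a bigraded left [E(1)_p^vee]-comodule. *)
Definition lightning_flash (k : nat) (L : comod) : Prop :=
  if k == 0%N then comod_iso L coeff_comod else
  is_comodule L /\
  exists x : nat -> L, flash_family k x /\
    forall (N : comod) (y : nat -> N), is_comodule N -> flash_family k y ->
      exists f : L -> N,
        [/\ is_comod_hom f, forall i, (0 < i <= k)%N -> f (x i) = y i
          & forall g : L -> N, is_comod_hom g ->
              (forall i, (0 < i <= k)%N -> g (x i) = y i) -> g =1 f].

(** Monomials of weight [w] in [xi_i-bar], [tau_i-bar], [i >= 1], the generators
    of [(A // E(0))^vee]. *)
Inductive bg_monomial : nat -> A -> Prop :=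
  | bg_one : bg_monomial 0%N 1
  | bg_xi w i x : (0 < i)%N -> bg_monomial w x ->
      bg_monomial (p ^ i + w)%N (xi p b kill_none i * x)
  | bg_tau w i x : (0 < i)%N -> bg_monomial w x ->
      bg_monomial (p ^ i + w)%N (tau p b kill_none i * x).

Inductive bg_span (k : nat) : A -> Prop :=
  | bg_span_mon w x : (w <= k)%N -> bg_monomial w x -> bg_span k x
  | bg_span0 : bg_span k 0
  | bg_spanD x y : bg_span k x -> bg_span k y -> bg_span k (x + y)
  | bg_spanZ (m : M) x : bg_span k x -> bg_span k (m *: x).

Definition bg_pred (k : nat) : {pred A} := fun x => `[< bg_span k x >].

Fact bg_pred_closed k : submod_closed (bg_pred k).
Proof.
split=> [|m x y /asboolP Bx /asboolP By]; first exact/asboolP/bg_span0.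
by apply/asboolP/bg_spanD => //; exact: bg_spanZ.
Qed.

HB.instance Definition _ (k : nat) :=
  GRing.isSubmodClosed.Build M A (bg_pred k) (bg_pred_closed k).

Definition bg (k : nat) := {x : A | x \in bg_pred k}.

HB.instance Definition _ (k : nat) := [isSub of bg k for @sval _ _].
HB.instance Definition _ (k : nat) := [Choice of bg k by <:].
HB.instance Definition _ (k : nat) := [SubChoice_isSubLmodule of bg k by <:].

(** The left coaction of [E(1)_p^vee] on [A_p^vee] induced by [psi] and the
    projection on the left factor; by [sproj_psi] it is [psi (kill_E 1)]. *)
Definition coactA (x : A) : stens (kill_E 1) A :=
  sproj_tens (kill_E 1) (psi kill_none x).

Lemma coactAE x : coactA x = psi (kill_E 1) x.
Proof. exact: sproj_psi. Qed.

(** The restriction of the coaction to [B_0(k)]: the only element of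
    [E(1)_p^vee (x)_M B_0(k)] with image [coactA (val x)], [E(1)_p^vee] being
    free as a right [M]-module.  Such an element exists by [bg_coactP]. *)
Definition bg_coact (k : nat) (x : bg k) : stens (kill_E 1) (bg k) :=
  xget 0 [set t | smap val t = coactA (val x)]%classic.

Lemma bg_span_mon_le w k x : (w <= k)%N -> bg_span w x -> bg_span k x.
Proof.
move=> wk; elim=> {x} [v x vw Hx||x y _ Hx _ Hy|m x _ Hx].
- by apply: bg_span_mon Hx; exact: leq_trans wk.
- exact: bg_span0.
- exact: bg_spanD.
- exact: bg_spanZ.
Qed.

Lemma gscale_comm s (x y : A) (m : M) :
  gcentral s x -> x * (m *: y) = mpar_iter s m *: (x * y).
Proof.
by move=> cx; rewrite /GRing.scale /= mulrA cx par_iter_etaL mulrA.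
Qed.

Lemma bg_span_xi k i x : (0 < i)%N ->
  bg_span k x -> bg_span (p ^ i + k) (xi p b kill_none i * x).
Proof.
move=> i0; elim=> {x} [v x vw Hx||x y _ Hx _ Hy|m x _ Hx].
- by apply: (@bg_span_mon _ (p ^ i + v)); rewrite ?leq_add2l //; exact: bg_xi.
- by rewrite mulr0; exact: bg_span0.
- by rewrite mulrDr; exact: bg_spanD.
- rewrite (@gscale_comm false); first exact: bg_spanZ.
  exact: (@gcentral_ag _ (Xi i)).
Qed.

Lemma bg_span_tau k i x : (0 < i)%N ->
  bg_span k x -> bg_span (p ^ i + k) (tau p b kill_none i * x).
Proof.
move=> i0; elim=> {x} [v x vw Hx||x y _ Hx _ Hy|m x _ Hx].
- by apply: (@bg_span_mon _ (p ^ i + v)); rewrite ?leq_add2l //; exact: bg_tau.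
- by rewrite mulr0; exact: bg_span0.
- by rewrite mulrDr; exact: bg_spanD.
- rewrite (@gscale_comm true); first exact: bg_spanZ.
  exact: (@gcentral_ag _ (Tau i)).
Qed.

Lemma bg_span_xiX k i j x : (j <= i)%N -> bg_span k x ->
  bg_span (p ^ i + k) (xi p b kill_none (i - j) ^+ (p ^ j)%N * x).
Proof.
rewrite leq_eqVlt => /predU1P[->|ji] Bx.
  rewrite subnn.
  have -> : xi p b kill_none 0 = 1 by exact: (ag_model (arel_xi0 p b kill_none)).
  by rewrite expr1n mul1r; apply: bg_span_mon_le Bx; exact: leq_addl.
have -> : (p ^ i = p ^ (i - j) * p ^ j)%N by rewrite -expnD subnK // ltnW.
elim: (p ^ j)%N => [|n IH]; first by rewrite expr0 mul1r muln0.
rewrite exprS -mulrA mulnS -addnA; apply: bg_span_xi => //.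
by rewrite subn_gt0.
Qed.

Inductive bg_tens K (k : nat) : stens K A -> Prop :=
  | bg_tens0 : bg_tens k 0
  | bg_tensD t u : bg_tens k t -> bg_tens k u -> bg_tens k (t + u)
  | bg_tens_pure c d : bg_span k d -> bg_tens k (spure c d).

Lemma bg_tens_sum K k (I : Type) (r : seq I) (P : pred I) (F : I -> stens K A) :
  (forall i, P i -> bg_tens k (F i)) -> bg_tens k (\sum_(i <- r | P i) F i).
Proof.
move=> H; elim/big_rec: _ => [|i t Pi Ht]; first exact: bg_tens0.
by apply: bg_tensD => //; exact: H.
Qed.

Lemma bg_tens_mulop K k l c s (y : A) (t : stens K A) : gcentral s y ->
  (forall x, bg_span k x -> bg_span l (y * x)) ->
  bg_tens k t -> bg_tens l (mulop c s y t).
Proof.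
move=> cy H; elim=> {t} [|t u _ Ht _ Hu|c' d Hd].
- by rewrite mulop0 //; exact: bg_tens0.
- by rewrite mulopD //; exact: bg_tensD.
- by rewrite mulop_pure //; apply: bg_tens_pure; exact: H.
Qed.

Lemma psi_bg_span K k (x : A) : bg_span k x -> bg_tens k (psi K x).
Proof.
have kA := @kill_A K.
elim=> {x} [w x wk Hx||x y _ Hx _ Hy|m x _ Hx].
- have : bg_tens w (psi K x); last first.
    elim=> [|t u _ Ht _ Hu|c d Hd]; first exact: bg_tens0.
    - exact: bg_tensD.
    - by apply: bg_tens_pure; exact: bg_span_mon_le Hd.
  elim: Hx => {w x wk} [|w i x i0 _ IH|w i x i0 _ IH].
  + by rewrite psi1 //; apply/bg_tens_pure/bg_span_mon; last exact: bg_one.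
  + rewrite psi_mul_gen //=; apply: bg_tens_sum => -[j /= ji] _.
    apply: bg_tens_mulop IH; first exact: gcentral_xi.
    by move=> z; exact: bg_span_xiX.
  + rewrite psi_mul_gen //=; apply: bg_tensD.
      apply: bg_tens_mulop IH; first exact: (@gcentral_ag _ (Tau i)).
      by move=> z; exact: bg_span_tau.
    apply: bg_tens_sum => -[j /= ji] _.
    apply: bg_tens_mulop IH; first exact: gcentral_xi.
    by move=> z; exact: bg_span_xiX.
- by rewrite psi0 //; exact: bg_tens0.
- by rewrite psiD //; exact: bg_tensD.
- rewrite psiZ //; elim: Hx => [|t u _ Ht _ Hu|c d Hd].
  + by rewrite scaler0; exact: bg_tens0.
  + by rewrite scalerDr; exact: bg_tensD.
  + by rewrite [_ *: _]stens_scale_pure; exact: bg_tens_pure.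
Qed.

Lemma bg_coactP k (x : bg k) : smap val (bg_coact x) = coactA (val x).
Proof.
rewrite /bg_coact; apply: (@xgetPex _ 0
  [set t : stens (kill_E 1) (bg k) | smap val t = coactA (val x)]%classic).
rewrite /=; have : bg_tens k (coactA (val x)).
  by rewrite coactAE; apply: psi_bg_span; apply/asboolP; exact: (valP x).
elim=> [|t u _ [t' <-] _ [u' <-]|c d Hd].
- by exists 0; exact: (@smap0 (kill_E 1) _ _ (val : {linear bg k -> A})).
- exists (t' + u').
  exact: (@smapD (kill_E 1) _ _ (val : {linear bg k -> A})).
- have Hd' : d \in bg_pred k by exact/asboolP.
  exists (spure c (Sub d Hd' : bg k)).
  rewrite -[d in RHS](SubK (bg k) Hd').
  exact: (@smap_pure (kill_E 1) _ _ (val : {linear bg k -> A})).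
Qed.

Definition brown_gitler (k : nat) : comod :=
  @Comod (bg k) (fun d x => homog (adeg p b) d (val x)) (@bg_coact k).

End Coproduct.

(** [E(1)_p^vee] maps to the ring [B2] of right combinations of [1], [T1], [T0],
    [T0 T1], a twofold extension of [M_p]; the coordinates there give [Q_0] and
    [Q_1]. *)
Module MilnorModel.

Record qdata (B : pzRingType) (s : B -> B) (c : B) : Prop := QData {
  qsD : forall x y, s (x + y) = s x + s y;
  qsM : forall x y, s (x * y) = s x * s y;
  qs1 : s 1 = 1;
  qsc : s c = c;
  qcc : forall x, x * c = c * s (s x) }.

Section Q.
Context (B : pzRingType) (s : B -> B) (c : B) (H : qdata s c).
Definition qext := let _ := H in (B * B)%type.
HB.instance Definition _ := GRing.Zmodule.copy qext (B * B)%type.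
Definition qmul (u v : qext) : qext :=
  (u.1 * v.1 + c * s u.2 * v.2, s u.1 * v.2 + u.2 * v.1).
Lemma qs0 : s 0 = 0.
Proof. by apply: (addrI (s 0)); rewrite -(qsD H) !addr0. Qed.
Fact qmulA : associative qmul.
Proof.
move=> [x y] [x' y'] [x'' y'']; rewrite /qmul /=; congr (_, _).
- rewrite !(mulrDl, mulrDr) !(qsD H, qsM H) !(mulrDl, mulrDr) !mulrA.
  by rewrite (qcc H) (AC (2*2) (1*4*(2*3)))%AC; reflexivity.
- rewrite !(qsD H, qsM H) !(mulrDl, mulrDr) (qsc H) !mulrA (qcc H).
  by rewrite (AC (2*2) (1*4*(2*3)))%AC; reflexivity.
Qed.
Fact qmul1l : left_id (1, 0) qmul.
Proof.
move=> [x y]; rewrite /qmul /= (qs1 H) qs0 !(mul1r, mulr0, mul0r, addr0). by [].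
Qed.
Fact qmul1r : right_id (1, 0) qmul.
Proof. by move=> [x y]; rewrite /qmul /= !(mulr1, mulr0, addr0, add0r). Qed.
Fact qmulDl : left_distributive qmul +%R.
Proof.
move=> [x y] [x' y'] [x'' y'']; rewrite /qmul /=.
by congr (_, _); rewrite !(qsD H) !(mulrDl, mulrDr) addrACA.
Qed.
Fact qmulDr : right_distributive qmul +%R.
Proof.
move=> [x y] [x' y'] [x'' y'']; rewrite /qmul /=.
by congr (_, _); rewrite !(mulrDl, mulrDr) addrACA.
Qed.
HB.instance Definition _ := GRing.Zmodule_isPzRing.Build qext
  qmulA qmul1l qmul1r qmulDl qmulDr.
Definition qs (u : qext) : qext := (s u.1, - s u.2).
Lemma qME (u v : qext) : u * v =
 (u.1 * v.1 + c * s u.2 * v.2, s u.1 * v.2 + u.2 * v.1) :> qext.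
Proof. by []. Qed.
End Q.

Section Model.
Context (p : nat) (b : coeff_data).
Notation M := (MM p b).
Lemma ms_D (x y : M) : msigma (x + y) = msigma x + msigma y.
Proof. exact: (pmap_ringD (@msigma_model p b)). Qed.
Lemma ms_M (x y : M) : msigma (x * y) = msigma x * msigma y.
Proof. exact: (pmap_ringM (@msigma_model p b)). Qed.
Lemma ms_1 : msigma (1 : M) = 1.
Proof. exact: (pmap_ring1 (@msigma_model p b)). Qed.
Lemma ms_0 : msigma (0 : M) = 0.
Proof. exact: (pmap_ring0 (@msigma_model p b)). Qed.
Lemma ms_N (x : M) : msigma (- x) = - msigma x.
Proof. exact: (pmap_ringN (@msigma_model p b)). Qed.
Definition mg (g : mgen) : M := pgen (mrel p b) g.
Lemma ms_g g : msigma (mg g) = (-1) ^+ mpar g * mg g.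
Proof. exact: (pmap_ring_gen (@msigma_model p b)). Qed.
Lemma mchar : p%:R = 0 :> M.
Proof. by have := pgen_model (mrel_char p b); rewrite reval_nat. Qed.
Lemma mcomm g h : mg g * mg h = (-1) ^+ (mpar g && mpar h) * (mg h * mg g).
Proof. by have := pgen_model (mrel_comm p b g h); rewrite reval_sign. Qed.

Lemma Mind (P : M -> Prop) : P 0 -> P 1 -> (forall x, P x -> P (- x)) ->
  (forall x y, P x -> P y -> P (x + y)) -> (forall x y, P x -> P y -> P (x * y)) ->
  (forall g, P (mg g)) -> forall x, P x.
Proof.
move=> P0 P1 PN PD PM Pg; elim/pres_ind=> a; rewrite rclassE.
by elim: a => /=; auto.
Qed.
Lemma ms_K (x : M) : msigma (msigma x) = x.
Proof.
elim/Mind: x => [||x IH|x y IH IH'|x y IH IH'|g].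
- by rewrite !ms_0.
- by rewrite !ms_1.
- by rewrite !ms_N IH.
- by rewrite !ms_D IH IH'.
- by rewrite !ms_M IH IH'.
- by rewrite ms_g mulr_sign; case: g => /=; rewrite ?ms_N ms_g /= ?expr0 ?expr1 ?mul1r ?mulN1r ?opprK.
Qed.

Lemma q1 : qdata (@msigma p b) 0.
Proof.
by split; [exact: ms_D|exact: ms_M|exact: ms_1|exact: ms_0| move=> x; rewrite mulr0 mul0r].
Qed.
Definition B1 := qext q1.
Definition mrho : M := if coeff_bock b then mg Gamma else 0.
Definition i1 (x : M) : B1 := (x, 0).
Definition t1 : B1 := (0, 1).
Definition s1 : B1 -> B1 := @qs _ _ _ q1.
Definition c0 : B1 := if p == 2%N then (0, mrho) else 0.

Lemma mopp2 (x : M) : p = 2%N -> - x = x.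
Proof.
move=> p2; apply/eqP; rewrite -subr_eq0 -opprD oppr_eq0 -mulr2n -mulr_natl.
have E n : p = n -> n%:R = 0 :> M by move=> <-; exact: mchar.
by rewrite (E 2%N p2) mul0r.
Qed.
Lemma ms2 (x : M) : p = 2%N -> msigma x = x.
Proof.
move=> p2; elim/Mind: x => [||x IH|x y IH IH'|x y IH IH'|g].
- by rewrite !ms_0.
- by rewrite !ms_1.
- by rewrite !ms_N IH.
- by rewrite !ms_D IH IH'.
- by rewrite !ms_M IH IH'.
- by rewrite ms_g mulr_sign; case: g => //=; rewrite mopp2.
Qed.
Lemma mgc g (x : M) : mg g * x = (if mpar g then msigma x else x) * mg g.
Proof.
elim/Mind: x => [||x IH|x y IH IH'|x y IH IH'|h].
- by rewrite ms_0 if_same mulr0 mul0r.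
- by rewrite ms_1 if_same mulr1 mul1r.
- rewrite ms_N mulrN IH; case: (mpar g); by rewrite mulNr.
- rewrite ms_D mulrDr IH IH'; case: (mpar g); by rewrite mulrDl.
- rewrite ms_M mulrA IH -mulrA IH' mulrA; by case: (mpar g).
- rewrite mcomm ms_g; case: g => //=; rewrite ?expr0 ?mul1r //.
  by rewrite mulrA.
Qed.
Lemma mcommg (x y : M) : p = 2%N -> x * y = y * x.
Proof.
move=> p2; elim/Mind: x => [||x IH|x z IH IH'|x z IH IH'|g].
- by rewrite mulr0 mul0r.
- by rewrite mulr1 mul1r.
- by rewrite mulrN mulNr IH.
- by rewrite mulrDl mulrDr IH IH'.
- by rewrite -mulrA IH' mulrA IH mulrA.
- by rewrite mgc ms2 // if_same.
Qed.

Lemma q2 : qdata s1 c0.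
Proof.
split.
- move=> [x y] [x' y']; rewrite /s1 /qs /= ms_D ms_D opprD. by [].
- move=> [x y] [x' y']; rewrite /s1 /qs !qME /= !mul0r !addr0 ms_M; congr (_, _).
  by rewrite ms_D !ms_M opprD mulrN mulNr.
- by rewrite /s1 /qs /= ms_1 ms_0 oppr0.
- rewrite /c0 /s1 /qs; case: eqP => [p2|_] /=; rewrite ?ms_0 ?oppr0 // ms2 //.
  by rewrite mopp2.
- move=> [x y]; rewrite /c0; case: eqP => [p2|_]; last by rewrite mulr0 mul0r.
  rewrite !qME /s1 /qs /=.  rewrite !(mul0r, mulr0, addr0, add0r, oppr0, ms_0, ms_K, opprK, ms2) // mcommg //.
Qed.
Definition B2 := qext q2.
Definition i2 (x : M) : B2 := ((x, 0), 0).
Definition T1 : B2 := ((0, 1), 0).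
Definition T0 : B2 := (0, (1, 0)).
Lemma i2M x y : i2 (x * y) = i2 x * i2 y.
Proof. by rewrite /i2 ?qME /= ?qME /= ?qME /= /s1 /qs /= ?qME /= ms_0 oppr0 !(mul0r, mulr0, addr0, add0r). Qed.
Lemma i2D x y : i2 (x + y) = i2 x + i2 y.
Proof. by congr (_, _); [congr (_, _)|] => //=; rewrite ?addr0. Qed.
Lemma i2N x : i2 (- x) = - i2 x.
Proof. by congr (_, _); [congr (_, _)|] => //=; rewrite ?oppr0. Qed.
Lemma i21 : i2 1 = 1. Proof. by []. Qed.
Lemma i20 : i2 0 = 0. Proof. by []. Qed.
Lemma i2T0 x : i2 x * T0 = T0 * i2 (msigma x).
Proof. by rewrite /i2 /T0 ?qME /= ?qME /= ?qME /= /s1 /qs /= ?qME /= ?ms_0 ?ms_1 ?oppr0 !(mul0r, mulr0, addr0, add0r, mul1r, mulr1, oppr0). Qed.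
Lemma i2T1 x : i2 x * T1 = T1 * i2 (msigma x).
Proof. by rewrite /i2 /T1 ?qME /= ?qME /= ?qME /= /s1 /qs /= ?qME /= ?ms_0 ?ms_1 ?oppr0 !(mul0r, mulr0, addr0, add0r, mul1r, mulr1, oppr0). Qed.
Lemma T11 : T1 * T1 = 0.
Proof. by rewrite /T1 ?qME /= ?qME /= ?qME /= /s1 /qs /= ?qME /= ?ms_0 ?ms_1 ?oppr0 !(mul0r, mulr0, addr0, add0r, mul1r, mulr1, oppr0). Qed.
Lemma T10 : T1 * T0 = - (T0 * T1).
Proof.
rewrite /T1 /T0 ?qME /= ?qME /= ?qME /= /s1 /qs /= ?qME /= ?ms_0 ?ms_1 ?oppr0 !(mul0r, mulr0, addr0, add0r, mul1r, mulr1, oppr0).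
by congr (_, _); rewrite ?oppr0 //; congr (_, _); rewrite ?oppr0.
Qed.

Lemma T00E : T0 * T0 = ((c0, 0) : B2).
Proof.
rewrite /T0 qME /= /s1 /qs /= ms_1 ms_0 oppr0.
rewrite -[(1, 0)]/(1 : B1) -[(0,0)]/(0 : B1). 
by rewrite !(mul0r, mulr0, addr0, add0r, mul1r, mulr1).
Qed.
Lemma T00_2 : p = 2%N -> T0 * T0 = i2 mrho * T1.
Proof.
move=> p2; rewrite T00E i2T1.
have E : c0 = (0, mrho) by rewrite /c0; case: eqP.
apply: etrans (congr1 (fun c => (c, 0) : B2) E) _.
rewrite /T1 /i2 ?qME /= ?qME /= ?qME /= ms2 //.
rewrite /s1 /qs /= ms_0 oppr0.
by rewrite ?ms_0 ?ms_1 ?oppr0 !(mul0r, mulr0, addr0, add0r, mul1r, mulr1, oppr0).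
Qed.
Lemma T00_n : p <> 2%N -> T0 * T0 = 0.
Proof.
move=> p2; rewrite T00E.
have E : c0 = 0 by rewrite /c0; case: eqP.
exact: etrans (congr1 (fun c => (c, 0) : B2) E) _.
Qed.
Lemma Vchar : p%:R = 0 :> B2.
Proof.
have E n : n%:R = i2 n%:R :> B2.
  by elim: n => [|n IH]; rewrite // !mulrS i2D IH.
by rewrite E mchar.
Qed.
Lemma opp2 (x : B2) : p = 2%N -> - x = x.
Proof.
move=> p2; apply/eqP; rewrite -subr_eq0 -opprD oppr_eq0 -mulr2n -mulr_natl.
have E n : p = n -> n%:R = 0 :> B2 by move=> <-; exact: Vchar.
by rewrite (E 2%N p2) mul0r.
Qed.
Lemma ms_rho : msigma mrho = - mrho.
Proof. by rewrite /mrho; case: ifP; rewrite ?ms_0 ?oppr0 // ms_g expr1 mulN1r. Qed.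
Lemma oddrr : i2 mrho * T0 * T0 = - (i2 mrho * T0 * T0).
Proof.
case: (eqVneq p 2%N) => [p2|/eqP np2]; first by rewrite opp2.
by rewrite -!mulrA T00_n // mulr0 oppr0.
Qed.
Definition vth := i2 (mg Theta) + i2 mrho * T0.
Lemma vthT0 : vth * T0 = T0 * vth.
Proof.
rewrite /vth mulrDl mulrDr i2T0 ms_g expr0 mul1r; congr (_ + _).
by rewrite mulrA -[mrho in RHS]opprK -ms_rho i2N mulrN -i2T0 mulNr -oddrr.
Qed.
Lemma vthT1 : vth * T1 = T1 * vth.
Proof.
rewrite /vth mulrDl mulrDr i2T1 ms_g expr0 mul1r; congr (_ + _).
rewrite mulrA -[mrho in RHS]opprK -ms_rho i2N mulrN -i2T1 mulNr.
by rewrite -!mulrA T10 mulrN opprK.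
Qed.
Lemma gg : mg Gamma * mg Gamma = - (mg Gamma * mg Gamma).
Proof. by rewrite {1}mcomm expr1 mulN1r. Qed.
Lemma vthG : vth * i2 (mg Gamma) = i2 (mg Gamma) * vth.
Proof.
rewrite /vth mulrDl mulrDr -!i2M mcomm expr0 mul1r; congr (_ + _).
have GT : i2 (mg Gamma) * T0 = - (T0 * i2 (mg Gamma)).
  by rewrite i2T0 ms_g expr1 mulN1r i2N mulrN.
rewrite mulrA -i2M.
have -> : i2 mrho * T0 * i2 (mg Gamma) = - (i2 (mrho * mg Gamma) * T0).
  by rewrite -mulrA -[T0 * _]opprK -GT mulrN i2M mulrA.
rewrite /mrho; case: ifP => _; first by rewrite {1}gg i2N mulNr opprK.
by rewrite mul0r mulr0 mul0r oppr0.
Qed.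
Definition V (g : agen) : B2 := match g with
 | Mg Theta => vth
 | Mg Gamma => i2 (mg Gamma)
 | Xi i => (i == 0%N)%:R
 | Tau 0 => T0 | Tau 1 => T1 | Tau _ => 0 end.
Lemma V_comm g h : V g * V h = (-1) ^+ (apar g && apar h) * (V h * V g).
Proof.
have GT0 : i2 (mg Gamma) * T0 = - (T0 * i2 (mg Gamma)).
  by rewrite i2T0 ms_g expr1 mulN1r i2N mulrN.
have GT1 : i2 (mg Gamma) * T1 = - (T1 * i2 (mg Gamma)).
  by rewrite i2T1 ms_g expr1 mulN1r i2N mulrN.
have T00N : T0 * T0 = - (T0 * T0).
  case: (eqVneq p 2%N) => [p2|/eqP np2]; first by rewrite opp2.
  by rewrite T00_n // oppr0.
have xg i x : V (Xi i) * x = x * V (Xi i).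
  by rewrite /=; case: (i == 0%N); rewrite ?(mul1r, mulr1, mul0r, mulr0).
pose C (s : bool) (x y : B2) := x * y = if s then - (y * x) else y * x.
have C0l s (x : B2) : C s 0 x by rewrite /C mulr0 mul0r oppr0 if_same.
have C0r s (x : B2) : C s x 0 by rewrite /C mulr0 mul0r oppr0 if_same.
have Csym s (x y : B2) : C s x y -> C s y x.
  by rewrite /C => ->; case: s; rewrite ?opprK.
have Cx i (x : B2) : C false (V (Xi i)) x by rewrite /C xg.
rewrite mulr_sign -/(C _ _ _).
have CTG : C true (i2 (mg Gamma)) T0 by exact: GT0.
have CTG1 : C true (i2 (mg Gamma)) T1 by exact: GT1.
have Ct0 : C false vth T0 by exact: vthT0.
have Ct1 : C false vth T1 by exact: vthT1.
have CtG : C false vth (i2 (mg Gamma)) by exact: vthG.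
have CGG : C true (i2 (mg Gamma)) (i2 (mg Gamma)) by rewrite /C -i2M {1}gg i2N.
have C00 : C true T0 T0 by exact: T00N.
have C11 : C true T1 T1 by rewrite /C T11 oppr0.
have C10 : C true T1 T0 by exact: T10.
have Ctt : C false vth vth by rewrite /C.
move: C C0l C0r Csym Cx CTG CTG1 Ct0 Ct1 CtG CGG C00 C11 C10 Ctt => C C0l C0r Csym Cx CTG CTG1 Ct0 Ct1 CtG CGG C00 C11 C10 Ctt.
clear xg.
case: g => [[]|i|[|[|i]]]; case: h => [[]|j|[|[|j]]]; rewrite [apar _ && _]/=;
first [exact: Cx | apply: Csym; exact: Cx | exact: C0l | exact: C0r | assumption | apply: Csym; assumption].
Qed.
Lemma V_model : rmodel (arel p b (kill_E 1)) V.
Proof.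
move=> a c; case=> [|g h|n Hn||i|g Hg] /=.
- by rewrite reval_nat Vchar.
- by rewrite reval_sign /= V_comm.
- rewrite reval_pow /=.
  have E k : i2 (mg Gamma) ^+ k = i2 (mg Gamma ^+ k).
    by elim: k => [|k IH] //; rewrite !exprS IH i2M.
  rewrite E; have := pgen_model (mrel_nil p Hn); rewrite reval_pow /= => ->.
  by [].
- by [].
- rewrite mulr1; have R : reval V (rho_expr b) = i2 mrho.
    by rewrite /rho_expr /mrho; case: (coeff_bock b).
  case: eqP => [p2|np2] /=; rewrite ?R ?mulr0 ?add0r; case: i => [|[|i]];
    rewrite ?mulr0 ?mul0r ?T11 //.
  + exact: T00_2.
  + exact: T00_n.
- by case: g Hg => [h|[|i]|[|[|i]]].
Qed.

Notation E1 := (steenrod p b (kill_E 1)).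
Definition phi : E1 -> B2 := pmap_ring V.
Lemma phi_ag g : phi (ag p b _ g) = V g.
Proof. exact: (pmap_ring_gen V_model). Qed.
Lemma phiD x y : phi (x + y) = phi x + phi y.
Proof. exact: (pmap_ringD V_model). Qed.
Lemma phiM x y : phi (x * y) = phi x * phi y.
Proof. exact: (pmap_ringM V_model). Qed.
Lemma phiN x : phi (- x) = - phi x.
Proof. exact: (pmap_ringN V_model). Qed.
Lemma phi1 : phi 1 = 1.
Proof. exact: (pmap_ring1 V_model). Qed.
Lemma phi0 : phi 0 = 0.
Proof. exact: (pmap_ring0 V_model). Qed.
Lemma phi_rho : phi (rho p b _) = i2 mrho.
Proof. by rewrite rhoE /mrho; case: (coeff_bock b); rewrite ?phi_ag ?phi0. Qed.
Lemma phi_etaR m : phi (etaR (kill_E 1) m) = i2 m.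
Proof.
rewrite /etaR; elim/pres_ind: m => a; rewrite (pmap_ringE (@etaR_model p b (kill_E 1))).
rewrite rclassE; elim: a => [h|||a IH|a IHa c IHc|a IHa c IHc] /=.
- case: h; last by rewrite phi_ag.
  by rewrite phiD phiN phiM phi_rho !phi_ag /= /vth addrK.
- exact: phi0.
- exact: phi1.
- by rewrite phiN IH i2N.
- by rewrite phiD IHa IHc i2D.
- by rewrite phiM IHa IHc i2M.
Qed.
Lemma B2r (x : B2) m : x * i2 m = ((x.1.1 * m, x.1.2 * m), (x.2.1 * m, x.2.2 * m)).
Proof.
case: x => [[x y] [z w]]; rewrite /i2 ?qME /= ?qME /= ?qME /= /s1 /qs /= ?qME /=.
by rewrite ?ms_0 ?ms_1 ?oppr0 !(mul0r, mulr0, addr0, add0r, mul1r, mulr1, oppr0).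
Qed.
Lemma milnor0 : is_milnor 0 (fun x : E1 => (phi x).2.1).
Proof.
split.
- by move=> x y; rewrite phiD.
- by move=> x m; rewrite phiM phi_etaR B2r.
- by rewrite phi1.
- by case=> [|[|//]] _; rewrite phi_ag.
- rewrite phiM !phi_ag /= ?qME /= ?qME /= ?qME /= /s1 /qs /= ?qME /=.
  by rewrite ?ms_0 ?ms_1 ?oppr0 !(mul0r, mulr0, addr0, add0r, mul1r, mulr1, oppr0).
Qed.
Lemma milnor1 : is_milnor 1 (fun x : E1 => (phi x).1.2).
Proof.
split.
- by move=> x y; rewrite phiD.
- by move=> x m; rewrite phiM phi_etaR B2r.
- by rewrite phi1.
- by case=> [|[|//]] _; rewrite phi_ag.
- rewrite phiM !phi_ag /= ?qME /= ?qME /= ?qME /= /s1 /qs /= ?qME /=.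
  by rewrite ?ms_0 ?ms_1 ?oppr0 !(mul0r, mulr0, addr0, add0r, mul1r, mulr1, oppr0).
Qed.
End Model.

End MilnorModel.

Lemma milnorP (p : nat) (b : coeff_data) (i : nat) :
  (i <= 1)%N -> is_milnor i (@milnor p b i).
Proof.
case: i => [|[|//]] _; apply: xgetPex.
- by exists (fun x => (MilnorModel.phi x).2.1); exact: MilnorModel.milnor0.
- by exists (fun x => (MilnorModel.phi x).1.2); exact: MilnorModel.milnor1.
Qed.

(* Main.v *)
Require Import Defs.
From HB Require Import structures.
From mathcomp Require Import all_boot all_order all_algebra finfield ssrAC zify ring.
From mathcomp Require Import boolp classical_sets functions.

(** Inserting powers of a ghost variable [xi_0], which is [1] in the dual Steenrod
    algebra, [B_0(k)] gets the [M]-basis of monomials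
    [xi_0^a tau_1^{e_1} xi_1^{m_1} tau_2^{e_2} ...] of weight exactly [k].  Up to terms
    with fewer [tau]'s, which only occur for [p = 2] and come from [rho], the primitives
    [Q_0] and [Q_1] act on it as the odd derivations [tau_i |-> xi_i] and
    [tau_i |-> xi_{i-1}^p], that is, as Koszul differentials.  Each of them has an explicit
    contracting homotopy away from one monomial, and these two monomials are the ends of a
    zigzag [z_0, x_1, z_1, ..., x_N, z_N] of monomials with [Q_0 x_i = z_i],
    [Q_1 x_i = z_{i-1}] and [N = nu_p(k!)], whose span [L] is the lightning flash.
    Acyclicity of [Q_0] and [Q_1] relative to [L] shows that [Q_0 Q_1 v \in L] implies
    [v \in L + im Q_0 + im Q_1].  Hence any set [Y] of monomials that spans a complement
    of [L + im Q_0 + im Q_1] over [F_p] generates freely, over the exterior algebra on [Q_0]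
    and [Q_1], a complement of [L].  The comodule map from the sum of the flash and of one
    copy of [E(1)^vee] for each element of [Y] is this decomposition up to terms with fewer
    [tau]'s, so it is bijective by induction on the number of [tau]'s.  Linear independence
    of monomials over [M] is seen on an explicit module over the presented algebra. *)

(** The obstacle behind this design is that the coefficient ring [MM p b] is not a field, so no
    complement of the flash can be chosen by linear algebra over it. The combinatorics is therefore
    done on families of coefficients in an arbitrary abelian group and is natural in that group: the
    differentials, the homotopies and the zigzag involve only the coefficients 0, 1 and -1, and
    nothing is ever divided, so characteristic p does no harm. The choice of [Y] is the only step
    that needs a field. The ghost variable turns [Q_1 tau_1 = 1] into [Q_1 tau_1 = xi_0^p]. Both
    differentials then preserve the weight, and one formula covers all indices, which makes
    recursion on the list of exponents possible. The comparison map goes out of the copies of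
    [E(1)^vee], although cofreeness only describes maps into them. This works because [E(1)^vee] is
    also free of rank one over [E(1)], on [tau_0 tau_1]: prescribing the image of that class, with
    compatible images under [Q_0], [Q_1] and their product, determines a comodule map. *)

Set Implicit Arguments.
Unset Strict Implicit.
Unset Printing Implicit Defensive.

Import GRing.Theory Num.Theory.
Local Open Scope ring_scope.

(** * Koszul differentials on families of coefficients *)

(** [f a [:: (e_1, m_1); ...; (e_n, m_n)]] is the coefficient of the monomial
    [xi_0^a tau_1^{e_1} xi_1^{m_1} ... tau_n^{e_n} xi_n^{m_n}].  The recursions below peel
    off [xi_0^a tau_1^{e_1}] and treat [xi_1] as the new ghost variable. *)
Definition fam (C : Type) := nat -> seq (bool * nat) -> C.

Section Koszul.
Context (p : nat) (C : zmodType).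
Implicit Types (f g : fam C) (a m : nat) (t : seq (bool * nat)).

(** The derivations [tau_i |-> xi_i] and [tau_i |-> xi_{i-1}^p], expressed on coefficients. *)
Fixpoint Q0 f a t : C :=
  match t with
  | [::] => 0
  | (e, m) :: t' =>
      let r := Q0 (fun m t => f a ((e, m) :: t)) m t' in
      if e then - r
      else r + (if m is m'.+1 then f a ((true, m') :: t') else 0)
  end.

Fixpoint Q1 f a t : C :=
  match t with
  | [::] => 0
  | (e, m) :: t' =>
      let r := Q1 (fun m t => f a ((e, m) :: t)) m t' in
      if e then - r
      else r + (if (p <= a)%N then f (a - p)%N ((true, m) :: t') else 0)
  end.

(** Contracting homotopies for [Q0] and [Q1]: the first variable that is not in its lowest
    position is moved by [xi_i |-> tau_i], resp. [xi_{i-1}^p |-> tau_i]. *)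
Fixpoint h0 f a t : C :=
  match t with
  | [::] => 0
  | (e, m) :: t' =>
      if e then f a ((false, m.+1) :: t')
      else if m is 0%N then h0 (fun m t => f a ((e, m) :: t)) m t' else 0
  end.

Fixpoint h1 f a t : C :=
  match t with
  | [::] => 0
  | (e, m) :: t' =>
      if e then f (a + p)%N ((false, m) :: t')
      else if (a < p)%N then h1 (fun m t => f a ((e, m) :: t)) m t' else 0
  end.

Definition low0 t := all (pred1 (false, 0%N)) t.

Fixpoint low1 a t : bool :=
  if t is (e, m) :: t' then [&& ~~ e, (a < p)%N & low1 m t'] else true.

Lemma Q0D f g a t : Q0 (f + g) a t = Q0 f a t + Q0 g a t.
Proof.
elim: t f g a => [|[e m] t IH] f g a /=; first by rewrite addr0.
have -> : (fun m t => (f + g) a ((e, m) :: t))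
  = (fun m t => f a ((e, m) :: t)) + (fun m t => g a ((e, m) :: t)) by [].
rewrite IH; case: e; first by rewrite opprD.
by case: m => [|m]; rewrite ?addr0 // addrACA.
Qed.

Lemma Q1D f g a t : Q1 (f + g) a t = Q1 f a t + Q1 g a t.
Proof.
elim: t f g a => [|[e m] t IH] f g a /=; first by rewrite addr0.
have -> : (fun m t => (f + g) a ((e, m) :: t))
  = (fun m t => f a ((e, m) :: t)) + (fun m t => g a ((e, m) :: t)) by [].
rewrite IH; case: e; first by rewrite opprD.
by case: leqP => _; rewrite ?addr0 // addrACA.
Qed.

Lemma Q00 a t : Q0 0 a t = 0.
Proof. by apply: (addrI (Q0 0 a t)); rewrite -Q0D !addr0. Qed.
Lemma Q10 a t : Q1 0 a t = 0.
Proof. by apply: (addrI (Q1 0 a t)); rewrite -Q1D !addr0. Qed.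

Lemma Q0_ext f g a t : (forall t', size t' = size t -> f a t' = g a t') ->
  Q0 f a t = Q0 g a t.
Proof.
elim: t f g a => [|[e m] t IH] f g a H //=.
rewrite (IH _ (fun m t => g a ((e, m) :: t))) => [|t' st']; last by rewrite H //= st'.
by case: (e) => //; congr (_ + _); move: H; case: m => // m H; rewrite H.
Qed.

Lemma Q1_ext f g a t : (forall a' t', size t' = size t -> f a' t' = g a' t') ->
  Q1 f a t = Q1 g a t.
Proof.
elim: t f g a => [|[e m] t IH] f g a H //=.
rewrite (IH _ (fun m t => g a ((e, m) :: t))) => [|m' t' st']; last by rewrite H //= st'.
by case: (e) => //; case: leqP => // _; rewrite H.
Qed.

Lemma h0_ext f g a t : (forall t', size t' = size t -> f a t' = g a t') ->
  h0 f a t = h0 g a t.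
Proof.
elim: t f g a => [|[e m] t IH] f g a H //=.
rewrite (IH _ (fun m t => g a ((e, m) :: t))) => [|t' st']; last by rewrite H //= st'.
by rewrite H.
Qed.

Lemma h1_ext f g a t : (forall a' t', size t' = size t -> f a' t' = g a' t') ->
  h1 f a t = h1 g a t.
Proof.
elim: t f g a => [|[e m] t IH] f g a H //=.
rewrite (IH _ (fun m t => g a ((e, m) :: t))) => [|m' t' st']; last by rewrite H //= st'.
by rewrite H.
Qed.

Lemma h00 a t : h0 0 a t = 0.
Proof. by elim: t a => [|[[] m] t IH] a //=; case: m => // ; rewrite -[RHS](IH 0%N). Qed.
Lemma h10 a t : h1 0 a t = 0.
Proof. by elim: t a => [|[[] m] t IH] a //=; case: leqP => // _; rewrite -[RHS](IH m). Qed.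

(** [Q0] never moves the ghost exponent, so reindexing it is harmless. The homotopy identity needs
    this for the exponent of [xi_1], the ghost variable of the tail, which [h0] raises by one. *)
Lemma Q0_arg (u : nat -> nat) f a t : Q0 (fun a => f (u a)) a t = Q0 f (u a) t.
Proof. by case: t. Qed.

(** On the first nontrivial pair, [tau_i |-> xi_i] is undone by [xi_i^(m+1) |-> tau_i xi_i^m], with
    no factor to invert; the differentials of the tail cancel by the sign of passing [tau_i]. Only
    the monomials with all pairs trivial, the powers of [xi_0], are left over. *)
Lemma homotopy0 f a t :
  Q0 (h0 f) a t + h0 (Q0 f) a t = if low0 t then 0 else f a t.
Proof.
elim: t f a => [|[e m] t IH] f a; first by rewrite addr0.
case: e => [|].
  rewrite /= (Q0_arg S (fun m t => f a ((false, m) :: t))).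
  by rewrite addKr.
case: m => [|m] /=.
  rewrite addr0 (@Q0_ext _ (h0 (fun m t => f a ((false, m) :: t)))) //.
  rewrite (@h0_ext _ (Q0 (fun m t => f a ((false, m) :: t)))) ?IH //.
  by move=> t' _ /=; rewrite addr0.
by rewrite addr0 (@Q0_ext _ 0) // Q00 add0r.
Qed.

(** The shift is multiplication by the [d]-th power of the ghost variable, which is a cycle. *)
Lemma Q1_shift d f a t :
  Q1 (fun a t => if (d <= a)%N then f (a - d)%N t else 0) a t
  = if (d <= a)%N then Q1 f (a - d)%N t else 0.
Proof.
case: t => [|[e m] t] /=; first by rewrite if_same.
case: (leqP d a) => da; last first.
  rewrite Q10; case: e; rewrite ?oppr0 // add0r; case: leqP => // pa.
  by rewrite leqNgt (leq_ltn_trans (leq_subr _ _) da).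
case: e => //; congr (_ + _); case: (leqP p a) => pa.
  have -> : (p <= a - d)%N = (d <= a - p)%N by lia.
  by have -> : (a - d - p = a - p - d)%N by lia.
by have -> : (p <= a - d)%N = false by lia.
Qed.

(** As for [Q0], with [xi_{i-1}^p |-> tau_i]. A pair cannot be moved exactly when [tau_i] is absent
    and the exponent of [xi_{i-1}] is below [p]; the leftover monomials thus have base-[p] digits as
    exponents, except for the last one. *)
Lemma homotopy1 f a t :
  Q1 (h1 f) a t + h1 (Q1 f) a t = if low1 a t then 0 else f a t.
Proof.
elim: t f a => [|[e m] t IH] f a; first by rewrite addr0.
case: e => [|] /=.
  by rewrite leq_addl addnK addKr.
have [pa|ap] := leqP p a.
  rewrite subnK // addr0 (@Q1_ext _ 0) ?Q10 ?add0r //.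
rewrite addr0 (@h1_ext _ (Q1 (fun m t => f a ((false, m) :: t)))) ?IH //.
by move=> m' t' _ /=; rewrite addr0.
Qed.

Lemma Q0N f a t : Q0 (- f) a t = - Q0 f a t.
Proof. by apply: (addrI (Q0 f a t)); rewrite -Q0D !subrr Q00. Qed.
Lemma Q1N f a t : Q1 (- f) a t = - Q1 f a t.
Proof. by apply: (addrI (Q1 f a t)); rewrite -Q1D !subrr Q10. Qed.

Lemma Q0Q0 f a t : Q0 (Q0 f) a t = 0.
Proof.
elim: t f a => [|[e m] t IH] f a //=.
case: e => /=.
  have -> : (fun m t => - Q0 (fun m t => f a ((true, m) :: t)) m t)
    = - Q0 (fun m t => f a ((true, m) :: t)) by [].
  by rewrite Q0N IH oppr0 oppr0.
have -> : (fun m0 t0 => Q0 (fun m t => f a ((false, m) :: t)) m0 t0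
     + match m0 with 0%N => 0 | m'.+1 => f a ((true, m') :: t0) end)
   = Q0 (fun m t => f a ((false, m) :: t))
     + (fun m0 t0 => if m0 is m'.+1 then f a ((true, m') :: t0) else 0) by [].
rewrite Q0D IH add0r; case: m => [|m].
  by rewrite addr0 (@Q0_ext _ 0) // Q00.
rewrite (@Q0_ext _ (fun a' => (fun m t => f a ((true, m) :: t)) a'.-1)) //.
by rewrite (Q0_arg predn (fun m t => f a ((true, m) :: t))) subrr.
Qed.

Lemma Q1Q1 f a t : Q1 (Q1 f) a t = 0.
Proof.
elim: t f a => [|[e m] t IH] f a //=.
case: e => /=.
  have -> : (fun m t => - Q1 (fun m t => f a ((true, m) :: t)) m t)
    = - Q1 (fun m t => f a ((true, m) :: t)) by [].
  by rewrite Q1N IH oppr0 oppr0.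
have -> : (fun m0 t0 => Q1 (fun m t => f a ((false, m) :: t)) m0 t0
     + (if (p <= a)%N then f (a - p)%N ((true, m0) :: t0) else 0))
   = Q1 (fun m t => f a ((false, m) :: t))
     + (fun m0 t0 => if (p <= a)%N then f (a - p)%N ((true, m0) :: t0) else 0) by [].
rewrite Q1D IH add0r; case: leqP => _; last by rewrite addr0 Q10.
by rewrite subrr.
Qed.

(** Differentiating [tau_1] multiplies by [xi_1], resp. [xi_0^p]. Both multiplications commute with
    the differentials of the tail, so the cross terms cancel against the sign in front of
    [tau_1]. *)
Lemma Q0Q1 f a t : Q0 (Q1 f) a t = - Q1 (Q0 f) a t.
Proof.
elim: t f a => [|[e m] t IH] f a /=; first by rewrite oppr0.
case: e => /=.
  have -> : (fun m t => - Q1 (fun m t => f a ((true, m) :: t)) m t)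
    = - Q1 (fun m t => f a ((true, m) :: t)) by [].
  have -> : (fun m t => - Q0 (fun m t => f a ((true, m) :: t)) m t)
    = - Q0 (fun m t => f a ((true, m) :: t)) by [].
  by rewrite Q0N Q1N IH.
have -> : (fun m0 t0 => Q1 (fun m t => f a ((false, m) :: t)) m0 t0
     + (if (p <= a)%N then f (a - p)%N ((true, m0) :: t0) else 0))
   = Q1 (fun m t => f a ((false, m) :: t))
     + (fun m0 t0 => if (p <= a)%N then f (a - p)%N ((true, m0) :: t0) else 0) by [].
have -> : (fun m0 t0 => Q0 (fun m t => f a ((false, m) :: t)) m0 t0
     + match m0 with 0%N => 0 | m'.+1 => f a ((true, m') :: t0) end)
   = Q0 (fun m t => f a ((false, m) :: t))
     + (fun m0 t0 => if (1 <= m0)%N then (fun m t => f a ((true, m) :: t)) (m0 - 1)%N t0 else 0).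
  apply/funext => m0; apply/funext => t0; congr (_ + _); by case: m0 => [|m0] //; rewrite subn1.
rewrite Q0D Q1D IH (Q1_shift 1 (fun m t => f a ((true, m) :: t))) !opprD -!addrA; congr (_ + _).
have -> : Q0 (fun m0 t0 => if (p <= a)%N then f (a - p)%N ((true, m0) :: t0) else 0) m t
  = if (p <= a)%N then Q0 (fun m0 t0 => f (a - p)%N ((true, m0) :: t0)) m t else 0.
  by case: leqP => // _; exact: Q00.
rewrite [RHS]addrC; congr (_ + _); first by case: leqP; rewrite ?opprK ?oppr0.
by case: m => [|m]; rewrite ?subn1 ?oppr0.
Qed.

(** The additive statistic giving [xi_i] the value [al i] and [tau_i] the value [be i]; its
    instances [stat_rwt], [stat_xdg], [stat_cnt] are weight, number of [xi]'s (with [xi_0])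
    and number of [tau]'s. *)
Fixpoint stat (al be : nat -> int) i a t : int :=
  al i * a%:Z + (if t is (e, m) :: t' then be i.+1 * (e : nat)%:Z + stat al be i.+1 m t'
                 else 0).

(** Weight and the two counts are handled at once: replacing a [tau_j] by [xi_j] changes an additive
    statistic by [al j - be j], and the condition on [c] asks that this be independent of [j]. *)
Lemma Q0_from f a t : Q0 f a t <> 0 -> exists t',
  [/\ f a t' <> 0, size t' = size t
    & forall al be c i, (forall j, al j.+1 - be j.+1 = c) ->
        stat al be i a t = stat al be i a t' + c].
Proof.
elim: t f a => [|[e m] t IH] f a //=.
have IH' : Q0 (fun m t => f a ((e, m) :: t)) m t <> 0 -> exists t',
  [/\ f a t' <> 0, size t' = (size t).+1
    & forall al be c i, (forall j, al j.+1 - be j.+1 = c) ->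
        al i * a%:Z + (be i.+1 * (e : nat)%:Z + stat al be i.+1 m t)
        = stat al be i a t' + c].
  move=> /IH [t' [ft' st' H]]; exists ((e, m) :: t'); split; rewrite //= ?st' //.
  by move=> al be c i E; rewrite (H _ _ _ _ E) !addrA.
case: e IH' => IH' H; first by apply: IH' => E; apply: H; rewrite E oppr0.
case: m {IH} IH' H => [|m] IH' H; first by apply: IH'; rewrite addr0 in H.
have [E|/eqP E] := eqVneq (f a ((true, m) :: t)) 0.
  by apply: IH'; rewrite E addr0 in H.
exists ((true, m) :: t); split=> // al be c i /(_ i) Ec /=.
rewrite -Ec; case: (t) => [|[e' m'] t'] /=; rewrite -?natz; ring.
Qed.

Lemma Q1_from f a t : Q1 f a t <> 0 -> exists a' t',
  [/\ f a' t' <> 0, size t' = size t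
    & forall al be c i, (forall j, al j * p%:Z - be j.+1 = c) ->
        stat al be i a t = stat al be i a' t' + c].
Proof.
elim: t f a => [|[e m] t IH] f a //=.
have IH' : Q1 (fun m t => f a ((e, m) :: t)) m t <> 0 -> exists a' t',
  [/\ f a' t' <> 0, size t' = (size t).+1
    & forall al be c i, (forall j, al j * p%:Z - be j.+1 = c) ->
        al i * a%:Z + (be i.+1 * (e : nat)%:Z + stat al be i.+1 m t)
        = stat al be i a' t' + c].
  move=> /IH [m' [t' [ft' st' H]]]; exists a, ((e, m') :: t'); split; rewrite //= ?st' //.
  by move=> al be c i E; rewrite (H _ _ _ _ E) !addrA.
case: e IH' => IH' H; first by apply: IH' => E; apply: H; rewrite E oppr0.
case: leqP H => [pa|_] H; last by apply: IH'; rewrite addr0 in H.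
have [E|/eqP E] := eqVneq (f (a - p)%N ((true, m) :: t)) 0.
  by apply: IH'; rewrite E addr0 in H.
exists (a - p)%N, ((true, m) :: t); split=> // al be c i /(_ i) Ec /=.
have -> : (a - p)%N%:Z = a%:Z - p%:Z by lia.
rewrite -Ec; ring.
Qed.

Lemma h0_from f a t : h0 f a t <> 0 -> exists t',
  [/\ f a t' <> 0, size t' = size t
    & forall al be c i, (forall j, al j.+1 - be j.+1 = c) ->
        stat al be i a t' = stat al be i a t + c].
Proof.
elim: t f a => [|[e m] t IH] f a //=.
case: e => [H|].
  exists ((false, m.+1) :: t); split=> // al be c i /(_ i) Ec /=.
  rewrite -Ec; case: (t) => [|[e' m'] t'] /=; rewrite -?natz; ring.
case: m => // /IH [t' [ft' st' H]]; exists ((false, 0%N) :: t').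
split; rewrite //= ?st' // => al be c i E; by rewrite (H _ _ _ _ E) !addrA.
Qed.

Lemma h1_from f a t : h1 f a t <> 0 -> exists a' t',
  [/\ f a' t' <> 0, size t' = size t
    & forall al be c i, (forall j, al j * p%:Z - be j.+1 = c) ->
        stat al be i a' t' = stat al be i a t + c].
Proof.
elim: t f a => [|[e m] t IH] f a //=.
case: e => [H|].
  exists (a + p)%N, ((false, m) :: t); split=> // al be c i /(_ i) Ec /=.
  rewrite -Ec PoszD; ring.
case: ltnP => // _ /IH [m' [t' [ft' st' H]]]; exists a, ((false, m') :: t').
split; rewrite //= ?st' // => al be c i E; by rewrite (H _ _ _ _ E) !addrA.
Qed.

End Koszul.

(** * Naturality of the differentials in the coefficient group *)

Section Natural.
Context (p : nat) (C D : zmodType) (phi : C -> D).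
Hypothesis phiD : {morph phi : x y / x + y}.

Lemma morph0 : phi 0 = 0.
Proof. by apply: (addrI (phi 0)); rewrite -phiD !addr0. Qed.
Lemma morphN x : phi (- x) = - phi x.
Proof. by apply: (addrI (phi x)); rewrite -phiD !subrr morph0. Qed.

Lemma Q0_comp (f : fam C) a t : Q0 (fun a t => phi (f a t)) a t = phi (Q0 f a t).
Proof.
elim: t f a => [|[e m] t IH] f a /=; first by rewrite morph0.
rewrite (IH (fun m t => f a ((e, m) :: t))) -morphN; case: e => //.
by rewrite phiD; case: m => // ; rewrite morph0.
Qed.

Lemma Q1_comp (f : fam C) a t :
  Q1 p (fun a t => phi (f a t)) a t = phi (Q1 p f a t).
Proof.
elim: t f a => [|[e m] t IH] f a /=; first by rewrite morph0.
rewrite (IH (fun m t => f a ((e, m) :: t))) -morphN; case: e => //.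
by rewrite phiD; case: leqP; rewrite ?morph0.
Qed.
End Natural.

(** * Single monomials and the Leibniz rule *)

Section Delta.
Context (p : nat) (C : zmodType).
Implicit Types (f : fam C) (c : C).

Definition dlt c a0 t0 : fam C := fun a t => if (a == a0) && (t == t0) then c else 0.

Definition lft a0 e0 f : fam C := fun a t =>
  if t is (e, m) :: t' then if (a == a0) && (e == e0) then f m t' else 0 else 0.

Definition xish f : fam C := fun m t => if m is m'.+1 then f m' t else 0.

Lemma dlt_lft c a e m t : dlt c a ((e, m) :: t) = lft a e (dlt c m t).
Proof.
apply/funext => a'; apply/funext => -[|[e' m'] t']; rewrite /dlt /lft.
  by rewrite andbF.
rewrite eqseq_cons xpair_eqE; case: (a' == a) => //=.
by case: (e' == e).
Qed.

Lemma xish_dlt c m t : xish (dlt c m t) = dlt c m.+1 t.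
Proof. by apply/funext => -[|m']; apply/funext. Qed.

Lemma lft0 a e : lft a e 0 = 0.
Proof. by apply/funext => a'; apply/funext => -[|[e' m'] t'] //=; rewrite if_same. Qed.

(** The Leibniz rule for the prefix [xi_0^a0 tau_1^e0]: the first summand differentiates [tau_1],
    where [xish] multiplies the tail by [xi_1], its ghost variable; the second differentiates the
    tail, with the sign of passing [tau_1]. *)
Lemma Q0_lft a0 e0 f :
  Q0 (lft a0 e0 f) = (if e0 then lft a0 false (xish f) else 0)
                     + (if e0 then - lft a0 e0 (Q0 f) else lft a0 e0 (Q0 f)).
Proof.
have E a e m t : Q0 (fun m t => if (a == a0) && (e == e0) then f m t else 0) m t
   = if (a == a0) && (e == e0) then Q0 f m t else 0.
  by case: ifP => // _; rewrite Q00.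
apply/funext => a; apply/funext => t; case: e0 E => E.
  rewrite -[RHS]/(lft a0 false (xish f) a t - lft a0 true (Q0 f) a t).
  case: t => [|[e m] t] /=; first by rewrite subr0.
  rewrite E; case: e => /=; first by rewrite andbF add0r.
  rewrite andbT andbF addrC subr0 addr0; case: m => [|m] /=; by rewrite ?andbT ?if_same.
rewrite add0r; case: t => [|[e m] t] //=; rewrite E.
case: e => /=; first by rewrite andbF oppr0.
by case: m => [|m]; rewrite ?andbF addr0.
Qed.

Lemma Q1_lft a0 e0 f :
  Q1 p (lft a0 e0 f) = (if e0 then lft (a0 + p) false f else 0)
                     + (if e0 then - lft a0 e0 (Q1 p f) else lft a0 e0 (Q1 p f)).
Proof.
have E a e m t : Q1 p (fun m t => if (a == a0) && (e == e0) then f m t else 0) m t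
   = if (a == a0) && (e == e0) then Q1 p f m t else 0.
  by case: ifP => // _; rewrite Q10.
apply/funext => a; apply/funext => t; case: e0 E => E.
  rewrite -[RHS]/(lft (a0 + p) false f a t - lft a0 true (Q1 p f) a t).
  case: t => [|[e m] t] /=; first by rewrite subr0.
  rewrite E; case: e => /=; first by rewrite andbF add0r.
  rewrite !andbT andbF addrC subr0 addr0.
  case: leqP => pa; last by case: eqP => // E'; move: pa; rewrite E' ltnNge leq_addl.
  by congr (if _ then _ else _); apply/eqP/eqP; lia.
rewrite add0r; case: t => [|[e m] t] //=; rewrite E.
case: e => /=; first by rewrite andbF oppr0.
by rewrite andbF if_same addr0.
Qed.

Definition tau_free t := all (fun em : bool * nat => ~~ em.1) t.

Lemma Q0_pure c a t : tau_free t -> Q0 (dlt c a t) = 0.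
Proof.
elim: t a => [|[e m] t IH] a /=.
  move=> _; apply/funext => a'; apply/funext => -[|x t'] //.
  rewrite (@Q0_ext _ _ 0) ?Q00 // => -[|y t''] //= _.
  by rewrite /dlt andbF.
by case/andP; case: e => // _ pt; rewrite dlt_lft Q0_lft IH // lft0 addr0.
Qed.

Lemma Q1_pure c a t : tau_free t -> Q1 p (dlt c a t) = 0.
Proof.
elim: t a => [|[e m] t IH] a /=.
  move=> _; apply/funext => a'; apply/funext => -[|x t'] //.
  rewrite (@Q1_ext _ _ _ 0) ?Q10 // => a'' -[|y t''] //= _.
  by rewrite /dlt andbF.
by case/andP; case: e => // _ pt; rewrite dlt_lft Q1_lft IH // lft0 addr0.
Qed.

(** Every term of an image under [Q0] contains some [xi_i] with [i >= 1]. Hence this end of the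
    zigzag is never hit by [Q0]; [low1_Q1] does the same for the other end. *)
Lemma low0_Q0 f a t : low0 t -> Q0 f a t = 0.
Proof.
elim: t f a => [|[e m] t IH] f a //= /andP[/eqP[-> ->]] lt.
by rewrite IH // addr0.
Qed.

Lemma low1_Q1 f a t : low1 p a t -> Q1 p f a t = 0.
Proof.
elim: t f a => [|[e m] t IH] f a //= /and3P[ne ap lt].
by rewrite IH // (negbTE ne) add0r leqNgt ap.
Qed.
End Delta.

(** * The zigzag of monomials and its length *)

Section Chain.
Local Open Scope nat_scope.
Context (p : nat) (p_gt1 : 1 < p).

Fixpoint rwt a (t : seq (bool * nat)) : nat :=
  (a + if t is (e, m) :: t' then p * (e + rwt m t') else 0)%N.

Fixpoint cnt (t : seq (bool * nat)) : nat :=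
  if t is (e, m) :: t' then (e + cnt t')%N else 0%N.

Fixpoint xdg a (t : seq (bool * nat)) : nat :=
  (a + if t is (e, m) :: t' then xdg m t' else 0)%N.

Definition zs n := nseq n (false, 0%N).

(** The zigzag [z_i], [x_i] among the monomials of weight [m]: [xi_0^p]'s are traded for
    [xi_1]'s one by one, then [xi_1^p]'s for [xi_2]'s, and so on; [x_i] is the monomial with
    one [tau] between [z_{i-1}] and [z_i]. *)
Fixpoint zch m n i : nat * seq (bool * nat) :=
  if n is n'.+1 then
    if (i <= m %/ p)%N then ((m - p * i)%N, (false, i) :: zs n')
    else let r := zch (m %/ p) n' (i - m %/ p) in ((m %% p)%N, (false, r.1) :: r.2)
  else (m, [::]).

Fixpoint xch m n i : nat * seq (bool * nat) :=
  if n is n'.+1 then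
    if (i <= m %/ p)%N then ((m - p * i)%N, (true, i.-1) :: zs n')
    else let r := xch (m %/ p) n' (i - m %/ p) in ((m %% p)%N, (false, r.1) :: r.2)
  else (m, [::]).

(** The sum in Legendre's formula cut after [n] terms, each of which counts the trades on one
    segment of the zigzag. *)
Fixpoint nu m n := if n is n'.+1 then (m %/ p + nu (m %/ p) n')%N else 0%N.

Lemma pure_zs n : tau_free (zs n).
Proof. by elim: n. Qed.

Lemma zch0 m n : zch m n 0 = (m, zs n).
Proof. by case: n => //= n; rewrite muln0 subn0. Qed.

(** At [i = m %/ p] both branches of [zch] give [xi_0^(m %% p) xi_1^(m %/ p)], so the second
    description is valid at this corner too; consecutive segments are glued there. *)
Lemma zch_step m n i : (m %/ p <= i)%N ->
  zch m n.+1 i = ((m %% p)%N, (false, (zch (m %/ p) n (i - m %/ p)).1)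
                               :: (zch (m %/ p) n (i - m %/ p)).2).
Proof.
rewrite /=; case: (leqP i (m %/ p)) => // h1 h2.
have -> : i = (m %/ p)%N by lia.
rewrite subnn zch0; congr (_, _).
by rewrite {1}(divn_eq m p) mulnC addKn.
Qed.

Lemma zch_pure m n i : tau_free (zch m n i).2.
Proof.
by elim: n m i => //= n IH m i; case: leqP => //= _; rewrite ?pure_zs ?IH.
Qed.

(** Exponents below [p], followed by an unrestricted last one, are the base-[p] expansion of the
    weight. So the weight determines the monomial, and no trade is possible after it. *)
Lemma low1_zch n a t : size t = n -> low1 p a t ->
  (a, t) = zch (rwt a t) n (nu (rwt a t) n).
Proof.
elim: t n a => [|[e m] t IH] [|n] a //=; first by rewrite addn0.
case=> st /and3P[ne ap lt]; rewrite -[RHS]/(zch (a + p * (e + rwt m t)) n.+1 (nu (a + p * (e +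
  rwt m t)) n.+1)).
rewrite (negbTE ne) add0n.
have D : ((a + p * rwt m t) %/ p = rwt m t)%N.
  by rewrite addnC mulnC divnMDl ?divn_small ?addn0 //; lia.
have E : ((a + p * rwt m t) %% p = a)%N by rewrite addnC mulnC modnMDl modn_small.
rewrite zch_step D ?E /= ?D ?leq_addr // addKn -(IH _ _ st lt) //=.
Qed.

Lemma low0_zch n a t : size t = n -> low0 t -> (a, t) = zch (rwt a t) n 0.
Proof.
rewrite zch0 => <- lt.
have -> : t = zs (size t).
  by elim: t lt => //= x t IH /andP[/eqP <- /IH <-].
have -> : rwt a (zs (size t)) = a.
  by elim: (size t) a => //= [|j IH] a; rewrite ?addn0 // IH add0n muln0 addn0.
by rewrite size_nseq.
Qed.

Lemma xdg_zs a n : xdg a (zs n) = a.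
Proof. by elim: n a => [|n IH] a /=; rewrite ?addn0 // IH addn0. Qed.
Lemma cnt_zs n : cnt (zs n) = 0%N.
Proof. by elim: n. Qed.
Lemma rwt_zs a n : rwt a (zs n) = a.
Proof. by elim: n a => [|n IH] a /=; rewrite ?addn0 // IH add0n muln0 addn0. Qed.

(** In the last clause each trade replaces [p] factors by one. This both separates the [z_i] from
    each other and gives their degrees. *)
Lemma zchP m n i : (i <= nu m n)%N ->
  [/\ size (zch m n i).2 = n, rwt (zch m n i).1 (zch m n i).2 = m,
      cnt (zch m n i).2 = 0%N
    & (xdg (zch m n i).1 (zch m n i).2 + i * p.-1 = m)%N].
Proof.
elim: n m i => [|n IH] m i /=.
  by rewrite leqn0 => /eqP ->; rewrite mul0n !addn0.
case: (leqP i (m %/ p)) => [im _|mi inu] /=.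
  have pim : (p * i <= m)%N by rewrite mulnC -leq_divRL //; lia.
  rewrite size_nseq rwt_zs xdg_zs cnt_zs add0n; split=> //; first by rewrite subnK.
  have -> : (p * i = i + i * p.-1)%N by case: (p) p_gt1 => // q _ /=; rewrite mulSn mulnC.
  move: pim; have -> : (p * i = i + i * p.-1)%N by case: (p) p_gt1 => // q _ /=;
    rewrite mulSn mulnC.
  lia.
have [|s1 s2 s3 s4] := IH (m %/ p)%N (i - m %/ p)%N; first by lia.
rewrite /= s1 s2 s3 add0n; split=> //; first by rewrite addnC mulnC -divn_eq.
have := divn_eq m p; move: (m %/ p)%N (m %% p)%N s4 mi => q r s4 mi ->.
have -> : (q * p = q + q * p.-1)%N by case: (p) p_gt1 => // p' _ /=; rewrite mulnS.
have -> : (i * p.-1 = q * p.-1 + (i - q) * p.-1)%N by rewrite -mulnDl subnKC // ltnW.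
lia.
Qed.

Lemma xchP m n i : (0 < i <= nu m n)%N ->
  [/\ size (xch m n i).2 = n, rwt (xch m n i).1 (xch m n i).2 = m,
      cnt (xch m n i).2 = 1%N
    & (xdg (xch m n i).1 (xch m n i).2 + p + i.-1 * p.-1 = m)%N].
Proof.
elim: n m i => [|n IH] m i /=; first by lia.
case: (leqP i (m %/ p)) => [im /andP[i0 _]|mi /andP[i0 inu]] /=.
  have pim : (p * i <= m)%N by rewrite mulnC -leq_divRL //; lia.
  rewrite size_nseq rwt_zs xdg_zs cnt_zs; split=> //; first by rewrite add1n prednK // subnK.
  case: i i0 im pim => // i _ _ /=.
  have -> : (p * i.+1 = p + i + i * p.-1)%N by case: (p) p_gt1 => // q _ /=;
    rewrite mulnS mulSn mulnC; lia.
  lia.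
have [|s1 s2 s3 s4] := IH (m %/ p)%N (i - m %/ p)%N; first by lia.
rewrite /= s1 s2 s3 add0n; split=> //; first by rewrite addnC mulnC -divn_eq.
have := divn_eq m p; move: (m %/ p)%N (m %% p)%N s4 mi => q r s4 mi ->.
have -> : (q * p = q + q * p.-1)%N by case: (p) p_gt1 => // p' _ /=; rewrite mulnS.
have -> : (i.-1 = q + (i - q).-1)%N by lia.
rewrite mulnDl; lia.
Qed.

Lemma Q0_xch (C : zmodType) (c : C) m n i : 0 < i <= nu m n ->
  Q0 (dlt c (xch m n i).1 (xch m n i).2) = dlt c (zch m n i).1 (zch m n i).2.
Proof.
elim: n m i => [|n IH] m i /=; first by lia.
case: (leqP i (m %/ p)) => [im /andP[i0 _]|mi /andP[i0 inu]] /=.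
  rewrite !dlt_lft Q0_lft Q0_pure ?pure_zs // lft0 oppr0 addr0 xish_dlt.
  by case: i i0 im.
by rewrite !dlt_lft Q0_lft add0r IH //; lia.
Qed.

Lemma Q1_xch (C : zmodType) (c : C) m n i : 0 < i <= nu m n ->
  Q1 p (dlt c (xch m n i).1 (xch m n i).2)
  = dlt c (zch m n i.-1).1 (zch m n i.-1).2.
Proof.
elim: n m i => [|n IH] m i; first by rewrite /=; lia.
case: (leqP i (m %/ p)) => [im|mi] /andP[i0]; last first.
  (* [z_{i-1}] may be the corner that ends the previous segment; it has to be rewritten in the form
     of the next one. *)
  rewrite zch_step; last by lia.
  rewrite /= [(i <= m %/ p)%N]leqNgt mi /= => inu.
  rewrite !dlt_lft Q1_lft add0r IH; last by lia.
  by have -> : (i - m %/ p).-1 = i.-1 - m %/ p by lia.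
have im' : i.-1 <= m %/ p by lia.
rewrite /= im im' => _ /=.
rewrite !dlt_lft Q1_lft Q1_pure ?pure_zs // lft0 oppr0 addr0.
have pim : (p * i <= m)%N by rewrite mulnC -leq_divRL //; lia.
congr (lft _ _ _); case: i i0 im im' pim => // i _ _ _ /=.
by rewrite mulnS; lia.
Qed.

(** Legendre's formula. The terms of index [i > m] vanish since [m < i < p^i], so [n >= m] rounds
    see all of it. *)
Lemma nu_fact m n : prime p -> m <= n -> nu m n = logn p m`!.
Proof.
move=> pp; rewrite logn_fact // => mn.
have E j : nu (m %/ p ^ j) n = \sum_(1 <= i < n.+1) m %/ p ^ (j + i).
  elim: n {mn} j => [|n IH] j; first by rewrite big_nil.
  rewrite /= -divnMA -expnSr IH [in RHS]big_ltn // addn1 [in RHS]big_add1 /=; congr (_ + _).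
  by apply: eq_bigr => i _; rewrite addSnnS.
have := E 0; rewrite expn0 divn1 => ->.
rewrite (big_cat_nat (n := m.+1)) //= [X in _ + X]big1_seq ?addn0 // => i.
rewrite mem_index_iota => /andP[_ /andP[mi _]]; rewrite divn_small // add0n.
by apply: leq_trans mi (ltnW (ltn_expl _ p_gt1)).
Qed.
End Chain.

(** * Supports and truncations *)

Section Supp.
Context (p : nat) (C : zmodType).
Implicit Types (f g : fam C) (P : nat -> seq (bool * nat) -> Prop).

Definition supp P f := forall a t, f a t <> 0 -> P a t.

Lemma famD f g a t : (f + g) a t = f a t + g a t. Proof. by []. Qed.
Lemma famN f a t : (- f) a t = - f a t. Proof. by []. Qed.
Lemma fam_sum I (r : seq I) (F : I -> fam C) a t :
  (\sum_(i <- r) F i) a t = \sum_(i <- r) F i a t.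
Proof.
by elim: r => [|i r IH]; rewrite ?big_nil // !big_cons famD IH.
Qed.

Lemma supp0 P : supp P 0. Proof. by move=> a t; case. Qed.
Lemma suppD P f g : supp P f -> supp P g -> supp P (f + g).
Proof.
move=> Hf Hg a t; rewrite famD; have [E|/eqP /Hf //] := eqVneq (f a t) 0.
by rewrite E add0r => /Hg.
Qed.
Lemma suppN P f : supp P f -> supp P (- f).
Proof. by move=> Hf a t H; apply: Hf => E; apply: H; rewrite famN E oppr0. Qed.
Lemma suppB P f g : supp P f -> supp P g -> supp P (f - g).
Proof. by move=> Hf Hg; apply: suppD => //; exact: suppN. Qed.
Lemma supp_sum P I (r : seq I) (F : I -> fam C) :
  (forall i, supp P (F i)) -> supp P (\sum_(i <- r) F i).
Proof.
move=> H; elim: r => [|i r IH]; first by rewrite big_nil; exact: supp0.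
by rewrite big_cons; exact: suppD.
Qed.
Lemma supp_dlt P c a t : P a t -> supp P (dlt c a t).
Proof. by move=> Pat a' t'; rewrite /dlt; case: ifP => // /andP[/eqP -> /eqP ->]. Qed.
Lemma supp_sub P P' f : (forall a t, P a t -> P' a t) -> supp P f -> supp P' f.
Proof. by move=> H Hf a t /Hf /H. Qed.

Definition restr (S : nat -> seq (bool * nat) -> bool) f : fam C :=
  fun a t => if S a t then f a t else 0.

Lemma supp_restr S P f : supp P f -> supp P (restr S f).
Proof. by move=> Hf a t; rewrite /restr; case: ifP => // _ /Hf. Qed.
Lemma supp_restrS (S : nat -> seq (bool * nat) -> bool) f :
  supp (fun a t => S a t) (restr S f).
Proof. by move=> a t; rewrite /restr; case: ifP. Qed.
Lemma restr_id (S : nat -> seq (bool * nat) -> bool) f :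
  supp (fun a t => S a t) f -> restr S f = f.
Proof.
move=> H; apply/funext => a; apply/funext => t; rewrite /restr; case: ifP => // /negP nS.
by have [->//|/eqP/H] := eqVneq (f a t) 0.
Qed.

Lemma Q0_morph : {morph @Q0 C : f g / f + g}.
Proof. by move=> f g; apply/funext => a; apply/funext => t; exact: Q0D. Qed.
Lemma Q1_morph : {morph @Q1 p C : f g / f + g}.
Proof. by move=> f g; apply/funext => a; apply/funext => t; exact: Q1D. Qed.
Lemma Q0_0 : Q0 (0 : fam C) = 0.
Proof. by apply/funext => a; apply/funext => t; exact: Q00. Qed.
Lemma Q1_0 : Q1 p (0 : fam C) = 0.
Proof. by apply/funext => a; apply/funext => t; exact: Q10. Qed.
Lemma Q0_opp f : Q0 (- f) = - Q0 f.
Proof. by apply/funext => a; apply/funext => t; exact: Q0N. Qed.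
Lemma Q1_opp f : Q1 p (- f) = - Q1 p f.
Proof. by apply/funext => a; apply/funext => t; exact: Q1N. Qed.
Lemma Q0_sq f : Q0 (Q0 f) = 0.
Proof. by apply/funext => a; apply/funext => t; exact: Q0Q0. Qed.
Lemma Q1_sq f : Q1 p (Q1 p f) = 0.
Proof. by apply/funext => a; apply/funext => t; exact: Q1Q1. Qed.
Lemma Q01 f : Q0 (Q1 p f) = - Q1 p (Q0 f).
Proof. by apply/funext => a; apply/funext => t; exact: Q0Q1. Qed.
Lemma Q0_sum I (r : seq I) (F : I -> fam C) :
  Q0 (\sum_(i <- r) F i) = \sum_(i <- r) Q0 (F i).
Proof. exact: (big_morph _ Q0_morph Q0_0). Qed.
Lemma Q1_sum I (r : seq I) (F : I -> fam C) :
  Q1 p (\sum_(i <- r) F i) = \sum_(i <- r) Q1 p (F i).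
Proof. exact: (big_morph _ Q1_morph Q1_0). Qed.

Lemma stat_rwt i a t :
  stat (fun j => (p ^ j)%N%:Z) (fun j => (p ^ j)%N%:Z) i a t = (p ^ i * rwt p a t)%N%:Z.
Proof.
elim: t i a => [|[e m] t IH] i a /=; first by rewrite addn0 addr0.
rewrite IH expnS; lia.
Qed.
Lemma stat_xdg i a t : stat (fun=> 1) (fun=> 0) i a t = (xdg a t)%:Z.
Proof.
elim: t i a => [|[e m] t IH] i a /=; first by rewrite addn0 addr0 mul1r.
rewrite IH; lia.
Qed.
Lemma stat_cnt i a t : stat (fun=> 0) (fun=> 1) i a t = (cnt t)%:Z.
Proof.
elim: t i a => [|[e m] t IH] i a /=; first by rewrite addr0 mul0r.
rewrite IH; lia.
Qed.

(** One condition serves differentials and homotopies alike: each keeps the number of slots and the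
    weight, and shifts the number of [xi]'s by [dx] and that of [tau]'s by [dc]. *)
Definition moves (S T : nat -> seq (bool * nat) -> Prop) (dx dc : int) :=
  forall a t a' t', S a t -> size t' = size t -> rwt p a' t' = rwt p a t ->
    (xdg a' t')%:Z = (xdg a t)%:Z + dx -> (cnt t')%:Z = (cnt t)%:Z + dc -> T a' t'.

Lemma supp_Q0 S T f : moves S T 1 (-1) -> supp S f -> supp T (Q0 f).
Proof.
move=> H Hf a t /Q0_from [t' [/Hf St st E]]; apply: H St _ _ _ _ => //.
- have := E (fun j => (p ^ j)%N%:Z) (fun j => (p ^ j)%N%:Z) 0 0%N.
  by rewrite !stat_rwt expn0 !mul1n addr0 => E'; have [] := E' (fun j => subrr _).
- have := E (fun=> 1) (fun=> 0) 1 0%N; rewrite !stat_xdg => E'; have {}E' := E' ltac:(lia); lia.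
- have := E (fun=> 0) (fun=> 1) (-1) 0%N; rewrite !stat_cnt => E'; have {}E' := E' ltac:(lia); lia.
Qed.

Lemma supp_Q1 S T f : moves S T p%:Z (-1) -> supp S f -> supp T (Q1 p f).
Proof.
move=> H Hf a t /Q1_from [a' [t' [/Hf St st E]]]; apply: H St _ _ _ _ => //.
- have := E (fun j => (p ^ j)%N%:Z) (fun j => (p ^ j)%N%:Z) 0 0%N.
  rewrite !stat_rwt expn0 !mul1n addr0 => E'.
  have H0 j : (p ^ j)%N%:Z * p%:Z - (p ^ j.+1)%N%:Z = 0 by rewrite expnSr; lia.
  by have [] := E' H0.
- have := E (fun=> 1) (fun=> 0) p%:Z 0%N; rewrite !stat_xdg => E'; have {}E' := E' ltac:(lia); lia.
- have := E (fun=> 0) (fun=> 1) (-1) 0%N; rewrite !stat_cnt => E'; have {}E' := E' ltac:(lia); lia.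
Qed.

Lemma supp_h0 S T f : moves S T (-1) 1 -> supp S f -> supp T (h0 f).
Proof.
move=> H Hf a t /h0_from [t' [/Hf St st E]]; apply: H St _ _ _ _ => //.
- have := E (fun j => (p ^ j)%N%:Z) (fun j => (p ^ j)%N%:Z) 0 0%N.
  by rewrite !stat_rwt expn0 !mul1n addr0 => E'; have [] := E' (fun j => subrr _).
- have := E (fun=> 1) (fun=> 0) 1 0%N; rewrite !stat_xdg => E'; have {}E' := E' ltac:(lia); lia.
- have := E (fun=> 0) (fun=> 1) (-1) 0%N; rewrite !stat_cnt => E'; have {}E' := E' ltac:(lia); lia.
Qed.

Lemma supp_h1 S T f : moves S T (- p%:Z) 1 -> supp S f -> supp T (h1 p f).
Proof.
move=> H Hf a t /h1_from [a' [t' [/Hf St st E]]]; apply: H St _ _ _ _ => //.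
- have := E (fun j => (p ^ j)%N%:Z) (fun j => (p ^ j)%N%:Z) 0 0%N.
  rewrite !stat_rwt expn0 !mul1n addr0 => E'.
  have H0 j : (p ^ j)%N%:Z * p%:Z - (p ^ j.+1)%N%:Z = 0 by rewrite expnSr; lia.
  by have [] := E' H0.
- have := E (fun=> 1) (fun=> 0) p%:Z 0%N; rewrite !stat_xdg => E'; have {}E' := E' ltac:(lia); lia.
- have := E (fun=> 0) (fun=> 1) (-1) 0%N; rewrite !stat_cnt => E'; have {}E' := E' ltac:(lia); lia.
Qed.

Lemma restr_split (S : nat -> seq (bool * nat) -> bool) f :
  f = restr S f + restr (fun a t => ~~ S a t) f.
Proof.
apply/funext => a; apply/funext => t; rewrite famD /restr.
by case: (S a t); rewrite ?addr0 ?add0r.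
Qed.

Lemma restr_sum (S : nat -> seq (bool * nat) -> bool) f g :
  supp (fun a t => S a t) f -> supp (fun a t => ~~ S a t) g -> restr S (f + g) = f.
Proof.
move=> Hf Hg; apply/funext => a; apply/funext => t; rewrite /restr famD.
case: ifP => [St|/negP nS].
  have [->|/eqP/Hg] := eqVneq (g a t) 0; by rewrite ?addr0 ?St.
by have [->|/eqP/Hf //] := eqVneq (f a t) 0.
Qed.

(** With both the condition and its negation carried along, the images of the kept and of the
    discarded part have disjoint supports. *)
Lemma restr_Q0 (S T : nat -> seq (bool * nat) -> bool) f :
  moves (fun a t => S a t) (fun a t => T a t) 1 (-1) ->
  moves (fun a t => ~~ S a t) (fun a t => ~~ T a t) 1 (-1) ->
  Q0 (restr S f) = restr T (Q0 f).
Proof.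
move=> H1 H2; rewrite [in RHS](restr_split S f) Q0_morph restr_sum //.
- exact: supp_Q0 H1 (@supp_restrS _ _).
- exact: supp_Q0 H2 (@supp_restrS _ _).
Qed.

Lemma restr_Q1 (S T : nat -> seq (bool * nat) -> bool) f :
  moves (fun a t => S a t) (fun a t => T a t) p%:Z (-1) ->
  moves (fun a t => ~~ S a t) (fun a t => ~~ T a t) p%:Z (-1) ->
  Q1 p (restr S f) = restr T (Q1 p f).
Proof.
move=> H1 H2; rewrite [in RHS](restr_split S f) Q1_morph restr_sum //.
- exact: supp_Q1 H1 (@supp_restrS _ _).
- exact: supp_Q1 H2 (@supp_restrS _ _).
Qed.
End Supp.

(** * Acyclicity relative to the flash *)

Section Acyclic.
Context (p : nat) (p_gt1 : (1 < p)%N) (k n : nat).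
Notation N := (nu p k n).
Notation z := (zch p k n).
Notation x := (xch p k n).

Definition mon a t : Prop := size t = n /\ rwt p a t = k.
Definition inL a t : Prop :=
  (exists2 i, (i <= N)%N & (a, t) = z i) \/ (exists2 i, (0 < i <= N)%N & (a, t) = x i).

Lemma zch_low1 k' n' : low1 p (zch p k' n' (nu p k' n')).1 (zch p k' n' (nu p k' n')).2.
Proof.
elim: n' k' => //= n' IH k'.
rewrite -[if _ then _ else _]/(zch p k' n'.+1 (k' %/ p + nu p (k' %/ p) n')%N).
by rewrite zch_step ?leq_addr // addKn /= ltn_pmod ?IH //; lia.
Qed.

Lemma zch_inj i j : (i <= N)%N -> (j <= N)%N -> z i = z j -> i = j.
Proof.
move=> /(zchP p_gt1)[_ _ _ Hi] /(zchP p_gt1)[_ _ _ Hj] E.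
have : (i * p.-1 = j * p.-1)%N by move: Hi Hj; rewrite E; lia.
by move/eqP; rewrite eqn_pmul2r => [/eqP|]; lia.
Qed.

Lemma xch_inj i j : (0 < i <= N)%N -> (0 < j <= N)%N -> x i = x j -> i = j.
Proof.
move=> Ii Ij; have [_ _ _ Hi] := xchP p_gt1 Ii; have [_ _ _ Hj] := xchP p_gt1 Ij.
move=> E; have : (i.-1 * p.-1 = j.-1 * p.-1)%N by move: Hi Hj; rewrite E; lia.
by move/eqP; rewrite eqn_pmul2r => [/eqP|]; lia.
Qed.

Lemma xch_zch i j : (0 < i <= N)%N -> (j <= N)%N -> x i = z j -> False.
Proof.
move=> Ii Ij; have [_ _ + _] := xchP p_gt1 Ii; have [_ _ + _] := zchP p_gt1 Ij.
by move=> + + E; rewrite E => ->.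
Qed.

Lemma inL_mon a t : inL a t -> mon a t.
Proof.
by case=> -[i Hi E]; [have [s r _ _] := zchP p_gt1 Hi|have [s r _ _] := xchP p_gt1 Hi];
  move: s r; rewrite -E.
Qed.

Section Coeff.
Context (C : zmodType).
Implicit Types (f g v w : fam C).
Notation Q1 := (Q1 p).

Definition ev f (u : nat * seq (bool * nat)) := f u.1 u.2.
Definition dp (c : C) (u : nat * seq (bool * nat)) : fam C := dlt c u.1 u.2.

Lemma dpE c u u' : ev (dp c u) u' = if u' == u then c else 0.
Proof. by case: u u' => [a t] [a' t']. Qed.

Lemma inL_dec f : supp inL f ->
  f = \sum_(i < N.+1) dp (ev f (z i)) (z i) + \sum_(i < N) dp (ev f (x i.+1)) (x i.+1).
Proof.
move=> Lf; apply/funext => a; apply/funext => t; rewrite famD !fam_sum.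
under eq_bigr => i _ do rewrite -[dp _ _ a t]/(ev (dp _ _) (a, t)) dpE.
under [X in _ + X]eq_bigr => i _ do rewrite -[dp _ _ a t]/(ev (dp _ _) (a, t)) dpE.
rewrite -[LHS]/(ev f (a, t)).
have [E|/eqP/Lf] := eqVneq (ev f (a, t)) 0.
  by rewrite !big1 ?addr0 // => i _; case: eqP => // <-.
case=> -[i Hi E]; rewrite E.
  have Hi' : (i < N.+1)%N by [].
  rewrite (bigD1 (Ordinal Hi')) //= eqxx !big1 ?addr0 // => j.
    case: eqP => // E' _; have Hj := ltn_ord j; case: (@xch_zch j.+1 i) => //.
  move=> ne; case: eqP => // /zch_inj E'; case/eqP: ne; apply: val_inj => /=.
  by rewrite E' // -ltnS.
have Hi' : (i.-1 < N)%N by lia.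
have Ei : i = (Ordinal Hi').+1 by rewrite /=; lia.
rewrite [X in _ + X](bigD1 (Ordinal Hi')) //= -Ei eqxx !big1 ?addr0 ?add0r // => j.
  move=> ne; case: eqP => // /xch_inj E'; case/eqP: ne; apply: val_inj => /=.
  by rewrite E' //; have := ltn_ord j; lia.
by case: eqP => // E' _; case: (@xch_zch i j) => //; rewrite -ltnS.
Qed.

Lemma Q0_dpz c i : Q0 (dp c (z i)) = 0.
Proof. exact/Q0_pure/zch_pure. Qed.
Lemma Q1_dpz c i : Q1 (dp c (z i)) = 0.
Proof. exact/Q1_pure/zch_pure. Qed.

Lemma Q0_inL f : supp inL f -> Q0 f = \sum_(i < N) dp (ev f (x i.+1)) (z i.+1).
Proof.
move=> Lf; rewrite {1}(inL_dec Lf) Q0_morph !Q0_sum big1 ?add0r => [|i _]; last exact: Q0_dpz.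
by apply: eq_bigr => i _; rewrite /dp Q0_xch //=; exact: ltn_ord.
Qed.
Lemma Q1_inL f : supp inL f -> Q1 f = \sum_(i < N) dp (ev f (x i.+1)) (z i).
Proof.
move=> Lf; rewrite {1}(inL_dec Lf) Q1_morph !Q1_sum big1 ?add0r => [|i _]; last exact: Q1_dpz.
by apply: eq_bigr => i _; rewrite /dp Q1_xch //=; exact: ltn_ord.
Qed.

Lemma inL_dpz c i : (i <= N)%N -> supp inL (dp c (z i)).
Proof. by move=> Hi; apply: supp_dlt; left; exists i => //; rewrite -surjective_pairing. Qed.
Lemma inL_dpx c i : (0 < i <= N)%N -> supp inL (dp c (x i)).
Proof. by move=> Hi; apply: supp_dlt; right; exists i => //; rewrite -surjective_pairing. Qed.

Lemma inL_Q0 f : supp inL f -> supp inL (Q0 f).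
Proof. by move=> /Q0_inL ->; apply: supp_sum => i; apply: inL_dpz; exact: ltn_ord. Qed.
Lemma inL_Q1 f : supp inL f -> supp inL (Q1 f).
Proof. by move=> /Q1_inL ->; apply: supp_sum => i; apply: inL_dpz; exact: ltnW. Qed.

Lemma mon_Q0 f : supp mon f -> supp mon (Q0 f).
Proof. by apply: (@supp_Q0 p) => a t a' t' [s r] s' r' _ _; rewrite /mon s' r'. Qed.
Lemma mon_Q1 f : supp mon f -> supp mon (Q1 f).
Proof. by apply: (@supp_Q1 p) => a t a' t' [s r] s' r' _ _; rewrite /mon s' r'. Qed.
Lemma mon_h0 f : supp mon f -> supp mon (h0 f).
Proof. by apply: (@supp_h0 p) => a t a' t' [s r] s' r' _ _; rewrite /mon s' r'. Qed.
Lemma mon_h1 f : supp mon f -> supp mon (h1 p f).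
Proof. by apply: (@supp_h1 p) => a t a' t' [s r] s' r' _ _; rewrite /mon s' r'. Qed.

Lemma evD f g u : ev (f + g) u = ev f u + ev g u. Proof. by []. Qed.
Lemma ev_sum I (r : seq I) (F : I -> fam C) u : ev (\sum_(i <- r) F i) u = \sum_(i <- r) ev (F i) u.
Proof. exact: fam_sum. Qed.

(** [Q0 v] is a cycle in the flash, so it has no component on the [x_i], whose images [z_i] are
    distinct, nor on [z_0], which [Q0] never hits. Hence it is [Q0 l] for a combination [l] of the
    [x_i], and the homotopy makes the cycle [v - l] a boundary up to a multiple of [z_0]. For [Q1]
    the end [z_N] takes the place of [z_0]. *)
Lemma Q0_acyclic v : supp mon v -> supp inL (Q0 v) ->
  exists2 w, supp mon w & supp inL (v - Q0 w).
Proof.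
move=> Mv LQ; set u := Q0 v in LQ.
have ux i : (i < N)%N -> ev u (x i.+1) = 0.
  move=> iN; have := Q0_inL LQ; rewrite Q0_sq => /(congr1 (ev^~ (z i.+1))).
  rewrite ev_sum (bigD1 (Ordinal iN)) //= dpE eqxx big1 ?addr0 // => j ne.
  rewrite dpE; case: eqP => // /zch_inj E; case/eqP: ne; apply/val_inj => /=.
  by have := E iN (ltn_ord j); lia.
have uz : ev u (z 0) = 0 by rewrite zch0 // /ev /u low0_Q0 //=; elim: (n).
pose l := \sum_(i < N) dp (ev u (z i.+1)) (x i.+1).
have Ll : supp inL l by apply: supp_sum => i; apply: inL_dpx; rewrite /= ltn_ord.
have Eu : u = Q0 l.
  rewrite {1}(inL_dec LQ) [X in _ + X]big1 => [|i _]; last first.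
    by rewrite ux //; apply/funext => a; apply/funext => t; rewrite /dp /dlt; case: ifP.
  rewrite addr0 big_ord_recl uz.
  have -> : dp 0 (z 0) = 0 by apply/funext => a; apply/funext => t; rewrite /dp /dlt; case: ifP.
  rewrite add0r /l Q0_sum; apply: eq_bigr => i _.
  by rewrite /dp Q0_xch //=; exact: ltn_ord.
have E0 : Q0 (v - l) = 0 by rewrite Q0_morph Q0_opp -Eu subrr.
have Mvl : supp mon (v - l).
  by apply: suppB => //; apply: supp_sub Ll; exact: inL_mon.
exists (h0 (v - l)); first exact: mon_h0.
have -> : v - Q0 (h0 (v - l)) = l + restr (fun _ t => low0 t) (v - l).
  apply/funext => a; apply/funext => t.
  have := homotopy0 (v - l) a t; rewrite E0 h00 addr0 => H.
  rewrite famD famN H famD /restr famD famN; case: (low0 t) => //.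
    by rewrite subr0 addrC subrK.
  by rewrite addr0 opprB addrC subrK.
apply: suppD => // a t; rewrite /restr; case: ifP => // lt /Mvl [st rt].
by left; exists 0%N => //; rewrite -rt; exact: low0_zch.
Qed.

Lemma Q1_acyclic v : supp mon v -> supp inL (Q1 v) ->
  exists2 w, supp mon w & supp inL (v - Q1 w).
Proof.
move=> Mv LQ; set u := Q1 v in LQ.
have ux i : (i < N)%N -> ev u (x i.+1) = 0.
  move=> iN; have := Q1_inL LQ; rewrite Q1_sq => /(congr1 (ev^~ (z i))).
  rewrite ev_sum (bigD1 (Ordinal iN)) //= dpE eqxx big1 ?addr0 // => j ne.
  rewrite dpE; case: eqP => // /zch_inj E; case/eqP: ne; apply/val_inj => /=.
  by have := E (ltnW iN) (ltnW (ltn_ord j)); lia.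
have uz : ev u (z N) = 0 by rewrite /ev /u low1_Q1 // zch_low1.
pose l := \sum_(i < N) dp (ev u (z i)) (x i.+1).
have Ll : supp inL l by apply: supp_sum => i; apply: inL_dpx; rewrite /= ltn_ord.
have Eu : u = Q1 l.
  rewrite {1}(inL_dec LQ) [X in _ + X]big1 => [|i _]; last first.
    by rewrite ux //; apply/funext => a; apply/funext => t; rewrite /dp /dlt; case: ifP.
  rewrite addr0 big_ord_recr /= uz.
  have -> : dp 0 (z N) = 0 by apply/funext => a; apply/funext => t; rewrite /dp /dlt; case: ifP.
  rewrite addr0 /l Q1_sum; apply: eq_bigr => i _.
  by rewrite /dp Q1_xch //=; exact: ltn_ord.
have E0 : Q1 (v - l) = 0 by rewrite Q1_morph Q1_opp -Eu subrr.
have Mvl : supp mon (v - l).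
  by apply: suppB => //; apply: supp_sub Ll; exact: inL_mon.
exists (h1 p (v - l)); first exact: mon_h1.
have -> : v - Q1 (h1 p (v - l)) = l + restr (low1 p) (v - l).
  apply/funext => a; apply/funext => t.
  have := homotopy1 p (v - l) a t; rewrite E0 h10 addr0 => H.
  rewrite famD famN H famD /restr famD famN; case: (low1 p a t) => //.
    by rewrite subr0 addrC subrK.
  by rewrite addr0 opprB addrC subrK.
apply: suppD => // a t; rewrite /restr; case: ifP => // lt /Mvl [st rt].
by left; exists N => //; rewrite -rt; exact: low1_zch.
Qed.

Lemma xdg_le_rwt a t : (xdg a t <= rwt p a t)%N.
Proof.
elim: t a => [|[e m] t IH] a //=; rewrite leq_add2l.
apply: leq_trans (IH m) _; apply: leq_trans (leq_addl e _) _.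
by rewrite leq_pmull //; lia.
Qed.

(** If [Q0 (Q1 u)] is in the flash, then [Q1 u = Q0 w] modulo the flash, and [w] satisfies the same
    hypothesis. As [Q1] adds [p] factors [xi] and [Q0] only one, [w] can be taken with at least
    [p - 1 >= 1] more of them than [u]. Their number is bounded by the weight, so the recursion
    stops; [d] is the room left. *)
Lemma acyclic v : supp mon v -> supp inL (Q0 (Q1 v)) ->
  exists w0 w1, [/\ supp mon w0, supp mon w1 & supp inL (v - Q0 w0 - Q1 w1)].
Proof.
suff H d u : supp mon u -> supp (fun a t => (k < xdg a t + d)%N) u ->
    supp inL (Q0 (Q1 u)) ->
    exists w0 w1, [/\ supp mon w0, supp mon w1 & supp inL (u - Q0 w0 - Q1 w1)].
  by move=> Mv; apply: (H k.+1) => // a t _; lia.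
elim: d u => [|d IH] u Mu Su LQ.
  have -> : u = 0.
    apply/funext => a; apply/funext => t.
    have [//|/eqP H] := eqVneq (u a t) 0.
    by have [_ R] := Mu _ _ H; have := Su _ _ H; rewrite -R addn0 ltnNge xdg_le_rwt.
  exists 0, 0; rewrite Q0_0 Q1_0 !subr0; split; exact: supp0.
have [w Mw Lw] := Q0_acyclic (mon_Q1 Mu) LQ.
(* [Q1 u] lives where [k.+1 < xdg a t + d]. Truncating [Q1 u - Q0 w] to this range keeps [Q1 u] and
   replaces [w] by [x1], which has enough [xi]'s for the induction. *)
pose x1 := restr (fun a t => (k < xdg a t + d)%N) w.
have L1 : supp inL (Q1 u - Q0 x1).
  have -> : Q1 u - Q0 x1 = restr (fun a t => (k.+1 < xdg a t + d)%N) (Q1 u - Q0 w).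
    rewrite (@restr_Q0 p _ _ (fun a t => (k.+1 < xdg a t + d)%N)) ; first last.
    - by move=> a t a' t'; lia.
    - by move=> a t a' t'; lia.
    rewrite -{1}(@restr_id _ (fun a t => (k.+1 < xdg a t + d)%N) (Q1 u)).
      apply/funext => a; apply/funext => t; rewrite /restr !(famD, famN).
      by case: ifP; rewrite ?subr0.
    by apply: supp_Q1 Su => a t a' t' ; lia.
  exact: supp_restr.
have [|||w0 [w1 [M0 M1 L2]]] := IH x1; first exact: supp_restr.
- exact: supp_restrS.
- have := inL_Q1 L1; rewrite Q1_morph Q1_sq add0r Q1_opp -Q01.
  by [].
(* Since [Q1 (Q0 w1) = - Q0 (Q1 w1)], adding [Q0 w1] to [u] removes the part [Q1 w1] of [x1] from
   [Q1 u], and what remains lies in the flash. *)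
have [||w2 M2 L3] := @Q1_acyclic (u + Q0 w1).
- by apply: suppD => //; exact: mon_Q0.
- have -> : Q1 (u + Q0 w1) = (Q1 u - Q0 x1) + Q0 (x1 - Q0 w0 - Q1 w1).
    rewrite Q1_morph !Q0_morph !Q0_opp Q0_sq Q01 oppr0 addr0 opprK.
    by rewrite -[RHS]addrA; congr (_ + _); rewrite addrA addNr add0r.
  by apply: suppD => //; exact: inL_Q0.
exists (- w1), w2; split=> //; first exact: suppN.
by rewrite Q0_opp opprK.
Qed.
End Coeff.
End Acyclic.

(** * The exterior decomposition *)

Local Notation mono := (nat * seq (bool * nat))%type.

Lemma dp0 (C : zmodType) u : dp (0 : C) u = 0.
Proof. by apply/funext => a; apply/funext => t; rewrite /dp /dlt; case: ifP. Qed.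
Lemma dpD (C : zmodType) (c d : C) u : dp (c + d) u = dp c u + dp d u.
Proof.
by apply/funext => a; apply/funext => t; rewrite famD /dp /dlt; case: ifP; rewrite ?addr0.
Qed.

Lemma dp_sum (C : zmodType) I (r : seq I) (G : I -> C) u :
  dp (\sum_(i <- r) G i) u = \sum_(i <- r) dp (G i) u.
Proof. by elim: r => [|i r IH]; rewrite ?big_nil ?dp0 // !big_cons dpD IH. Qed.

(** * Choosing monomials modulo a subspace *)

Section Greedy.
Context (F : fieldType) (U : fam F -> Prop).
Definition cz (c : F) (f : fam F) : fam F := fun a t => c * f a t.
Hypotheses (U0 : U 0)
  (UZ : forall c f, U f -> U (cz c f)).

Lemma cz_dp c d u : cz c (dp d u) = dp (c * d) u.
Proof.
by apply/funext => a; apply/funext => t; rewrite /cz /dp /dlt; case: ifP; rewrite ?mulr0.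
Qed.
Lemma czD c f g : cz c (f + g) = cz c f + cz c g.
Proof. by apply/funext => a; apply/funext => t; rewrite /cz !famD mulrDr. Qed.
Lemma cz_sum c I (r : seq I) (G : I -> fam F) :
  cz c (\sum_(i <- r) G i) = \sum_(i <- r) cz c (G i).
Proof.
apply: (big_morph _ (czD c)).
by apply/funext => a; apply/funext => t; rewrite /cz mulr0.
Qed.

(** A monomial is kept only if it is not a combination, modulo [U], of those kept before. Over a
    field a relation with nonzero coefficient at a new monomial could be solved for it, so the kept
    ones stay independent. *)
Lemma greedy (s : seq mono) : exists Y : seq mono,
  [/\ uniq Y, {subset Y <= s},
      forall u, u \in s -> exists c : mono -> F,
        U (dp 1 u - \sum_(y <- Y) dp (c y) y)
    & forall c : mono -> F, U (\sum_(y <- Y) dp (c y) y) ->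
        forall y, y \in Y -> c y = 0].
Proof.
elim: s => [|x s [Y [uY sY HY1 HY2]]].
  by exists [::]; split.
have [[c Hc]|nx] := pselect (exists c : mono -> F,
        U (dp 1 x - \sum_(y <- Y) dp (c y) y)).
  exists Y; split=> // [u /sY us|u]; first by rewrite inE us orbT.
  by rewrite inE => /predU1P[->|/HY1 //]; exists c.
have xY : x \notin Y.
  apply/negP => xY; apply: nx; exists (fun y => (y == x)%:R).
  rewrite (big_rem x) //= eqxx big_seq big1 ?addr0 ?subrr // => y.
  by rewrite mem_rem_uniq // !inE => /andP[/negbTE -> _]; rewrite dp0.
exists (x :: Y); split=> /=; first by rewrite xY.
- by move=> y; rewrite !inE => /predU1P[->|/sY ->]; rewrite ?eqxx ?orbT.
- move=> u; rewrite inE => /predU1P[->|/HY1 [c Hc]].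
    exists (fun y => (y == x)%:R); rewrite big_cons eqxx.
    rewrite big_seq big1 ?addr0 ?subrr // => y yY.
    by case: eqP yY xY => [-> -> //|_ _ _]; rewrite dp0.
  exists (fun y => if y == x then 0 else c y); rewrite big_cons eqxx dp0 add0r.
  rewrite (_ : \sum_(y <- Y) _ = \sum_(y <- Y) dp (c y) y) //.
  rewrite !big_seq; apply: eq_bigr => y yY.
  by case: eqP yY xY => [-> -> //|_ _ _].
- move=> c; rewrite big_cons => Hc.
  have cx : c x = 0.
    apply/eqP; apply: contra_notT nx => cx0.
    exists (fun y => - (c x)^-1 * c y).
    have := UZ (c x)^-1 Hc; rewrite czD cz_dp mulVf // cz_sum.
    congr (U (_ + _)); rewrite -sumrN; apply: eq_bigr => y _.
    apply/funext => a; apply/funext => t.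
    by rewrite famN cz_dp mulNr /dp /dlt; case: ifP; rewrite ?oppr0 ?opprK.
  rewrite cx dp0 add0r in Hc => y.
  by rewrite inE => /predU1P[->//|]; exact: HY2.
Qed.
End Greedy.

(** * A complement that serves all coefficient groups *)

Section Free.
Context (p : nat) (p_prime : prime p) (k n : nat).
Let p_gt1 : (1 < p)%N := prime_gt1 p_prime.
Notation Q1 := (Q1 p).
Notation mon := (mon p k n).
Notation inL := (inL p k n).

Definition entries := [seq (e, m) | e <- [:: true; false], m <- iota 0 k.+1].
Fixpoint lists (l : nat) : seq (seq (bool * nat)) :=
  if l is l'.+1 then
    [seq em :: t | em <- entries, t <- lists l']
  else [:: [::]].

(** The bound [k] on the exponents loses nothing, because each exponent is at most the number of
    [xi]'s and so at most the weight. *)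
Definition mons : seq mono :=
  undup [seq u <- [seq (a, t) | a <- iota 0 k.+1, t <- lists n]
        | (size u.2 == n) && (rwt p u.1 u.2 == k)].

Lemma mem_entries e m : (m <= k)%N -> (e, m) \in entries.
Proof.
move=> mk; apply/allpairsP; exists (e, m); split=> //; first by case: (e).
by have := mem_iota 0 k.+1 m; rewrite ltnS mk.
Qed.

Lemma mem_lists l t a : size t = l -> (xdg a t <= k)%N -> t \in lists l.
Proof.
elim: l t a => [|l IH] [|[e m] t] a //; move=> [st] H.
have mk : (m <= k)%N by move: H; case: (t) => [|[? ?] ?] /=; lia.
apply/(allpairsP (f := cons)); exists ((e, m), t); split=> //; first exact: mem_entries.
by apply: (IH _ m) => //; move: H => /=; lia.
Qed.

Lemma mem_mons a t : (a, t) \in mons <-> mon a t.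
Proof.
rewrite mem_undup mem_filter; split.
  by case/andP => /andP[/eqP s /eqP r] _.
case=> s r; apply/andP; split; first by rewrite /= s r !eqxx.
apply/(allpairsP (f := pair)); exists (a, t); split=> //.
  have := mem_iota 0 k.+1 a; rewrite ltnS /= => ->.
  by rewrite -r; case: (t) => [|[? ?] ?] /=; rewrite ?addn0 ?leq_addr.
by apply: (@mem_lists _ _ a) => //; rewrite -r; exact: xdg_le_rwt.
Qed.

Lemma uniq_mons : uniq mons. Proof. exact: undup_uniq. Qed.

Lemma supp_sum_dp (C : zmodType) (s : seq mono) (f : fam C) : uniq s ->
  supp (fun a t => (a, t) \in s) f -> f = \sum_(u <- s) dp (ev f u) u.
Proof.
move=> us Hf; apply/funext => a; apply/funext => t; rewrite fam_sum.
have E u : dp (ev f u) u a t = if (a, t) == u then ev f u else 0.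
  by rewrite -(dpE _ _ (a, t)).
under eq_bigr => u _ do rewrite E.
have [as_|nas] := boolP ((a, t) \in s).
  rewrite (big_rem (a, t)) //= eqxx big_seq big1 ?addr0 // => y.
  by rewrite mem_rem_uniq // !inE => /andP[/negbTE]; rewrite eq_sym => ->.
have [->|/eqP/Hf] := eqVneq (f a t) 0; last by rewrite (negbTE nas).
by rewrite big_seq big1 // => y; case: eqP => // <-; rewrite (negbTE nas).
Qed.

Definition imQL (C : zmodType) (f : fam C) := exists w0 w1 l,
  [/\ supp mon w0, supp mon w1, supp inL l & f = Q0 w0 + Q1 w1 + l].

Lemma imQL0 (C : zmodType) : imQL (0 : fam C).
Proof.
by exists 0, 0, 0; rewrite Q0_0 Q1_0 !addr0; split=> //; exact: supp0.
Qed.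
Lemma imQLD (C : zmodType) (f g : fam C) : imQL f -> imQL g -> imQL (f + g).
Proof.
move=> [w0 [w1 [l [M0 M1 L ->]]]] [w0' [w1' [l' [M0' M1' L' ->]]]].
exists (w0 + w0'), (w1 + w1'), (l + l'); split; try exact: suppD.
by rewrite Q0_morph Q1_morph addrACA [Q0 _ + _ + _]addrACA.
Qed.

Section Comp.
Context (C D : zmodType) (phi : C -> D) (phiD : {morph phi : x y / x + y}).
Definition fcomp (f : fam C) : fam D := fun a t => phi (f a t).
Lemma fcompD f g : fcomp (f + g) = fcomp f + fcomp g.
Proof. by apply/funext => a; apply/funext => t; rewrite /fcomp !famD phiD. Qed.
Lemma fcomp0 : fcomp 0 = 0.
Proof. by apply/funext => a; apply/funext => t; rewrite /fcomp (morph0 phiD). Qed.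
Lemma fcompN f : fcomp (- f) = - fcomp f.
Proof. by apply/funext => a; apply/funext => t; rewrite /fcomp !famN (morphN phiD). Qed.
Lemma fcomp_Q0 f : Q0 (fcomp f) = fcomp (Q0 f).
Proof. by apply/funext => a; apply/funext => t; exact: (Q0_comp phiD). Qed.
Lemma fcomp_Q1 f : Q1 (fcomp f) = fcomp (Q1 f).
Proof. by apply/funext => a; apply/funext => t; exact: (Q1_comp p phiD). Qed.
Lemma fcomp_dp c u : fcomp (dp c u) = dp (phi c) u.
Proof.
apply/funext => a; apply/funext => t; rewrite /fcomp /dp /dlt.
by case: ifP => //; rewrite (morph0 phiD).
Qed.
Lemma supp_fcomp P f : supp P f -> supp P (fcomp f).
Proof. by move=> H a t Hf; apply: H => E; apply: Hf; rewrite /fcomp E (morph0 phiD). Qed.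
Lemma imQL_fcomp f : imQL f -> imQL (fcomp f).
Proof.
move=> [w0 [w1 [l [M0 M1 L ->]]]]; exists (fcomp w0), (fcomp w1), (fcomp l).
by split; [exact: supp_fcomp..|rewrite !fcompD fcomp_Q0 fcomp_Q1].
Qed.
End Comp.

Section Scalar.
Context (C : zmodType) (Cp : forall m : C, m *+ p = 0).
(** A residue acts through its representative below [p]; this is additive in the residue because [p]
    kills [C]. *)
Definition scal (m : C) (c : 'F_p) : C := m *+ (c : nat).
Lemma scal_mod (m : C) a q : q = p -> m *+ (a %% q)%N = m *+ a.
Proof. by move=> ->; rewrite {2}(divn_eq a p) mulrnDr mulnC mulrnA Cp mul0rn add0r. Qed.
Lemma scalD (m : C) : {morph scal m : a b / a + b}.
Proof. by move=> a b; rewrite /scal -mulrnDr -(scal_mod m (a + b) (Fp_cast p_prime)). Qed.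
Lemma scalDl (m m' : C) c : scal (m + m') c = scal m c + scal m' c.
Proof. exact: mulrnDl. Qed.
Lemma scal1 (m : C) : scal m 1 = m.
Proof. by rewrite /scal /= -[RHS]mulr1n -(scal_mod m 1 (Fp_cast p_prime)). Qed.
End Scalar.

Lemma fct_choice (T : Type) (P : mono -> T -> Prop) (t0 : T) (s : seq mono) :
  (forall u, u \in s -> exists c, P u c) -> exists S, forall u, u \in s -> P u (S u).
Proof.
move=> H; have /choice[S HS] u : exists c, u \in s -> P u c.
  have [/H[c Hc]|us] := boolP (u \in s); first by exists c.
  by exists t0 => us'; case/negP: us.
by exists S.
Qed.

(** A complement found over [F_p] serves for any group [C] killed by [p], since coefficients
    can be moved along the maps [c |-> m *+ c] from [F_p] to [C]. *)
Lemma complement : exists Y : seq mono,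
  [/\ uniq Y, {subset Y <= mons}
    & forall C : zmodType, (forall m : C, m *+ p = 0) ->
      (forall v : fam C, supp mon v -> exists2 r,
          supp (fun a t => (a, t) \in Y) r & imQL (v - r)) /\
      (forall r : fam C, supp (fun a t => (a, t) \in Y) r -> imQL r -> r = 0)].
Proof.
have UZ (c : 'F_p) f : imQL f -> imQL (cz c f).
  by apply: (@imQL_fcomp 'F_p 'F_p (fun x => c * x)) => a b; exact: mulrDr.
have [Y [uY sY HY1 HY2]] := greedy (@imQL0 'F_p) UZ mons.
exists Y; split=> // C Cp.
(* [S u y] is the coefficient at [y] in a chosen reduction of the monomial [u] modulo [imQL]. By
   independence over ['F_p], members of [Y] reduce to themselves, which is [SY] below. *)
have [S HS] := fct_choice (fun=> 0) HY1.
have phiD := scalD Cp.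
split=> [v Mv|r Yr Ur].
  exists (\sum_(u <- mons) fcomp (scal (ev v u)) (\sum_(y <- Y) dp (S u y) y)).
    apply: supp_sum => u; apply: supp_fcomp => //; rewrite big_seq.
    elim/big_rec: _ => [|y f yY Hf]; first exact: supp0.
    by apply: suppD => //; apply: supp_dlt; rewrite -surjective_pairing.
  have Mv' : supp (fun a t => (a, t) \in mons) v by move=> a t /Mv /mem_mons.
  rewrite {1}(supp_sum_dp uniq_mons Mv') -sumrB big_seq.
  elim/big_rec: _ => [|u f us Hf]; first exact: imQL0.
  apply: imQLD => //; rewrite -[dp _ _](_ : fcomp (scal (ev v u)) (dp 1 u) = _).
    rewrite -(fcompN (phiD _)) -(fcompD (phiD _)).
    exact/(imQL_fcomp (phiD _))/HS.
  by rewrite fcomp_dp // scal1.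
have SY y y' : y \in Y -> y' \in Y -> S y y' = (y' == y)%:R.
  move=> yY y'Y; apply/eqP; rewrite eq_sym -subr_eq0; apply/eqP.
  apply: (HY2 (fun y' => (y' == y)%:R - S y y')) y'Y => //.
  suff -> : \sum_(u <- Y) dp ((u == y)%:R - S y u) u = dp 1 y - \sum_(u <- Y) dp (S y u) u.
    exact: HS _ (sY _ yY).
  have -> : \sum_(u <- Y) dp ((u == y)%:R - S y u) u
     = \sum_(u <- Y) dp (u == y)%:R u + \sum_(u <- Y) dp (- S y u) u.
    by rewrite -big_split; apply: eq_bigr => u _; exact: dpD.
  congr (_ + _).
    rewrite (big_rem y) //= eqxx big_seq big1 ?addr0 // => u.
    by rewrite mem_rem_uniq // !inE => /andP[/negbTE -> _]; rewrite dp0.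
  rewrite -sumrN; apply: eq_bigr => u _; apply/funext => a; apply/funext => t.
  by rewrite famN /dp /dlt; case: ifP; rewrite ?oppr0.
(* [pi f y] is the coefficient at [y] of the reduction of [f]. On families over [Y] it returns the
   coefficient itself, so freeness follows once it is seen to vanish on [imQL]. *)
pose pi (f : fam C) y := \sum_(u <- mons) scal (ev f u) (S u y).
have piD f g y : pi (f + g) y = pi f y + pi g y.
  by rewrite /pi -big_split; apply: eq_bigr => u _; exact: scalDl.
have pi0 y : pi 0 y = 0 by apply: (addrI (pi 0 y)); rewrite -piD !addr0.
have pi_sum (I : Type) (s : seq I) (G : I -> fam C) y :
    pi (\sum_(i <- s) G i) y = \sum_(i <- s) pi (G i) y.
  by apply: (big_morph (pi^~ y)) => // f g; exact: piD.
have piF m (f : fam 'F_p) y : y \in Y -> supp mon f -> imQL f ->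
    pi (fcomp (scal m) f) y = 0.
  move=> yY Mf Uf; have Mf' : supp (fun a t => (a, t) \in mons) f by move=> a t /Mf /mem_mons.
  have E : \sum_(u <- mons) ev f u * S u y = 0.
    apply: (HY2 (fun y => \sum_(u <- mons) ev f u * S u y)) yY => //.
    have -> : \sum_(y <- Y) dp (\sum_(u <- mons) ev f u * S u y) y =
       f + \sum_(u <- mons) cz (- ev f u) (dp 1 u - \sum_(y <- Y) dp (S u y) y).
      have -> : \sum_(y <- Y) dp (\sum_(u <- mons) ev f u * S u y) y
          = \sum_(y <- Y) \sum_(u <- mons) dp (ev f u * S u y) y.
        by apply: eq_bigr => z _; exact: dp_sum.
      rewrite exchange_big /= {2}(supp_sum_dp uniq_mons Mf') -big_split /=.
      apply: eq_bigr => u _; rewrite czD -sumrN cz_sum cz_dp mulr1 addrA.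
      rewrite -dpD subrr dp0 add0r; apply: eq_bigr => z _.
      apply/funext => a; apply/funext => t.
      by rewrite /cz famN mulrNN /dp /dlt; case: ifP; rewrite ?mulr0.
    apply: imQLD => //; rewrite big_seq; elim/big_rec: _ => [|u g us Hg]; first exact: imQL0.
    by apply: imQLD => //; apply: UZ; exact: HS.
  transitivity (scal m (\sum_(u <- mons) ev f u * S u y)); last by rewrite E (morph0 (phiD m)).
  rewrite (big_morph _ (phiD m) (morph0 (phiD m))); apply: eq_bigr => u _.
  by rewrite /scal -mulrnA -(scal_mod Cp m (_ * _)%N (Fp_cast p_prime)).
(* An operator natural in the coefficients is determined by its values on monomials over ['F_p],
   where [piF] applies. *)
have piK (Q : forall D : zmodType, fam D -> fam D) :
    (forall D, {morph @Q D : f g / f + g}) ->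
    (forall m (f : fam 'F_p), Q C (fcomp (scal m) f) = fcomp (scal m) (Q 'F_p f)) ->
    (forall f : fam 'F_p, supp mon f -> supp mon (Q 'F_p f) /\ imQL (Q 'F_p f)) ->
    forall w y, y \in Y -> supp mon w -> pi (Q C w) y = 0.
  move=> QD Qn QU w y yY Mw.
  have Mw' : supp (fun a t => (a, t) \in mons) w by move=> a t /Mw /mem_mons.
  have Q_0 : Q C 0 = 0 by apply: (addrI (Q C 0)); rewrite -QD !addr0.
  rewrite (supp_sum_dp uniq_mons Mw') (big_morph _ (QD C) Q_0) pi_sum big_seq big1 // => u us.
  rewrite -[dp _ _](_ : fcomp (scal (ev w u)) (dp 1 u) = _); last by rewrite fcomp_dp // scal1.
  rewrite Qn; have [] := QU (dp 1 u).
    by apply: supp_dlt; apply/mem_mons; rewrite -surjective_pairing.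
  by move=> M1 U1; exact: piF.
have [w0 [w1 [l [M0 M1 L E]]]] := Ur.
have pir y : y \in Y -> pi r y = 0.
  move=> yY.
  have E0 : pi (Q0 w0) y = 0.
    apply: (piK (fun D => @Q0 D)) => // [D|m f|f Mf]; first exact: Q0_morph.
      exact: fcomp_Q0.
    split; first exact: mon_Q0.
    by exists f, 0, 0; rewrite Q1_0 !addr0; split=> //; exact: supp0.
  have E1 : pi (Q1 w1) y = 0.
    apply: (piK (fun D (f : fam D) => Q1 f)) => // [D|m f|f Mf]; first exact: Q1_morph.
      exact: fcomp_Q1.
    split; first exact: mon_Q1.
    by exists 0, f, 0; rewrite Q0_0 addr0 add0r; split=> //; exact: supp0.
  rewrite E !piD E0 E1.
  rewrite !add0r.
  have Ml' : supp (fun a t => (a, t) \in mons) l by move=> a t /L /(inL_mon p_gt1) /mem_mons.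
  rewrite (supp_sum_dp uniq_mons Ml') pi_sum big_seq big1 // => u us.
  have [lu|/eqP/L Lu] := eqVneq (ev l u) 0; first by rewrite lu dp0 pi0.
  rewrite -[dp _ _](_ : fcomp (scal (ev l u)) (dp 1 u) = _); last by rewrite fcomp_dp // scal1.
  apply: piF => //; first by apply: supp_dlt; apply/mem_mons; rewrite -surjective_pairing.
  exists 0, 0, (dp 1 u); rewrite Q0_0 Q1_0 !add0r; split=> //; try exact: supp0.
  exact: supp_dlt.
apply/funext => a; apply/funext => t.
have [//|/eqP/Yr yY] := eqVneq (r a t) 0.
rewrite -[RHS](pir _ yY) /pi (big_rem (a, t)) ?sY //= SY // eqxx scal1 //.
rewrite big_seq big1 ?addr0 // => u.
rewrite mem_rem_uniq ?uniq_mons // !inE => /andP[ne us].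
have [E0|/eqP/Yr uY'] := eqVneq (ev r u) 0; first by rewrite E0 /scal mul0rn.
rewrite -surjective_pairing in uY'; rewrite SY // eq_sym (negbTE ne).
by rewrite /scal /= mulr0n.
Qed.
End Free.

Lemma shuffle (V : zmodType) (a x1 x2 x3 x4 x5 x6 x7 l : V) :
  a + (x4 + (x1 + x2 + x3) + x5) + (x6 - x1 + x7) + l
  = l + x5 + x7 + x3 + a + x4 + x6 + x2.
Proof.
transitivity ((x1 - x1) + (l + x5 + x7 + x3 + a + x4 + x6 + x2)).
  by rewrite [LHS](AC ((1*((1*3)*1))*3*1) ((3*8)*(10*6*9*5*1*2*7*4)))%AC.
by rewrite subrr add0r.
Qed.

Lemma split_sub2 (V : zmodType) (a b c : V) : a = b + c + (a - b - c).
Proof. by rewrite -[a - b - c]addrA -opprD [RHS]addrC subrK. Qed.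

(** * Decomposition into flash and exterior part *)

Section Decomposition.
Context (p : nat) (p_gt1 : (1 < p)%N) (k n : nat).
Notation Q1 := (Q1 p).
Notation mon := (mon p k n).
Notation inL := (inL p k n).
Notation imQL := (imQL p k n).
Context (C : zmodType) (Y : seq (nat * seq (bool * nat))).
Notation onY := (supp (fun a t => (a, t) \in Y)).
Hypothesis Y_mon : forall a t, (a, t) \in Y -> mon a t.
Hypothesis spanY : forall v : fam C, supp mon v -> exists2 r, onY r & imQL (v - r).
Hypothesis freeY : forall r : fam C, onY r -> imQL r -> r = 0.

Definition decomp (l a b c d : fam C) := l + a + Q0 b + Q1 c + Q0 (Q1 d).

Let onY_mon (r : fam C) : onY r -> supp mon r.
Proof. exact: supp_sub. Qed.

(** [w0] and [w1] in [Q0 w0 + Q1 w1] are reduced again. The differentials square to zero and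
    anticommute, so the second round leaves only terms of the form [Q0 (Q1 _)], and a third round
    ends there. The flash parts stay in the flash, which both differentials preserve. *)
Lemma decomp_span (v : fam C) : supp mon v -> exists l a b c d,
  [/\ supp inL l, onY a, onY b, onY c & onY d /\ v = decomp l a b c d].
Proof.
move=> Mv.
have split1 (w : fam C) : supp mon w -> exists r w0 w1 l,
    [/\ onY r, supp mon w0, supp mon w1, supp inL l & w = r + Q0 w0 + Q1 w1 + l].
  move=> /spanY[r Yr [w0 [w1 [l [M0 M1 L E]]]]]; exists r, w0, w1, l; split=> //.
  by rewrite -!addrA [Q0 _ + _]addrA -E addrC subrK.
have [a [w0 [w1 [l [Ya M0 M1 L ->]]]]] := split1 _ Mv.
have [b [w00 [w01 [l0 [Yb M00 M01 L0 E0]]]]] := split1 _ M0.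
have [c [w10 [w11 [l1 [Yc M10 M11 L1 E1]]]]] := split1 _ M1.
(* [Q1 (Q0 w10) = - Q0 (Q1 w10)], so the two leftover terms merge into [Q0 (Q1 (w01 - w10))]. *)
have [|d [w20 [w21 [l2 [Yd M20 M21 L2 E2]]]]] := split1 (w01 - w10).
  exact: suppB.
exists (l + Q0 l0 + Q1 l1 + Q0 (Q1 l2)), a, b, c, d; split=> //.
  do 2![apply: suppD; last by [exact: inL_Q1|apply: inL_Q0 => //; exact: inL_Q1]].
  by apply: suppD => //; exact: inL_Q0.
split=> //.
have F0 : Q0 w0 = Q0 b + Q0 (Q1 w01) + Q0 l0.
  by rewrite {1}E0 !Q0_morph Q0_sq addr0.
have F1 : Q1 w1 = Q1 c - Q0 (Q1 w10) + Q1 l1.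
  by rewrite {1}E1 !Q1_morph Q1_sq addr0 Q01 opprK.
have F2 : Q0 (Q1 w01) = Q0 (Q1 w10) + Q0 (Q1 d) + Q0 (Q1 l2).
  rewrite -[w01 in LHS](subrK w10) {1}E2 !Q1_morph Q1_sq addr0 !Q0_morph.
  by rewrite [Q0 (Q1 (Q0 _))]Q01 Q0_sq Q1_0 oppr0 addr0 addrC addrA.
rewrite /decomp F0 F1 F2.
exact: shuffle.
Qed.

Lemma Q10r (f : fam C) : Q1 (Q0 f) = - Q0 (Q1 f).
Proof. by rewrite Q01 opprK. Qed.

(** Relative acyclicity puts [a] into the sum of the two images and the flash, where [Y] has no
    nonzero combination. *)
Lemma Q0Q1_onY (a : fam C) : onY a -> supp inL (Q0 (Q1 a)) -> a = 0.
Proof.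
move=> Ya La; apply: freeY => //.
have [w0 [w1 [M0 M1 L]]] := acyclic p_gt1 (onY_mon Ya) La.
exists w0, w1, (a - Q0 w0 - Q1 w1); split=> //.
exact: split_sub2.
Qed.

(** Applying [Q0 Q1], then [Q1], then [Q0] leaves, besides flash terms, only [Q0 (Q1 _)] of [a], [b]
    and [c] in turn, so that [Q0Q1_onY] removes them one after the other; [d] is then alone with
    [l]. *)
Lemma decomp_free (l a b c d : fam C) : supp inL l -> onY a -> onY b -> onY c -> onY d ->
  decomp l a b c d = 0 -> [/\ l = 0, a = 0, b = 0, c = 0 & d = 0].
Proof.
move=> Ll Ya Yb Yc Yd E.
have a0 : a = 0.
  apply: Q0Q1_onY => //; have := congr1 (fun f => Q0 (Q1 f)) E.
  rewrite /decomp !Q1_morph !Q10r !Q1_sq Q0_0 !Q0_morph !Q0_opp Q0_sq Q0_0 oppr0.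
  rewrite !addr0 Q1_0 Q0_0 => /eqP.
  by rewrite addrC addr_eq0 => /eqP ->; apply: suppN; apply: inL_Q0 => //; exact: inL_Q1.
move: E; rewrite /decomp a0 addr0 => E.
have b0 : b = 0.
  apply: Q0Q1_onY => //; have := congr1 (fun f : fam C => Q1 f) E.
  rewrite !Q1_morph !Q10r !Q1_sq Q0_0 oppr0 !addr0 Q1_0 => /eqP.
  rewrite subr_eq0 => /eqP <-; exact: inL_Q1.
move: E; rewrite b0 Q0_0 addr0 => E.
have c0 : c = 0.
  apply: Q0Q1_onY => //; have := congr1 (fun f : fam C => Q0 f) E.
  rewrite !Q0_morph Q0_sq addr0 Q0_0 => /eqP; rewrite addrC addr_eq0 => /eqP ->.
  by apply: suppN; exact: inL_Q0.
move: E; rewrite c0 Q1_0 addr0 => E.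
have d0 : d = 0.
  apply: Q0Q1_onY => //; move/eqP: E; rewrite addrC addr_eq0 => /eqP ->.
  exact: suppN.
by move: E; rewrite d0 Q1_0 Q0_0 addr0.
Qed.

Definition low (h : nat) (f : fam C) := supp (fun _ t => (cnt t < h)%N) f.
(** [Q0] and [Q1] remove one exterior factor each. *)
Definition low_decomp h (l a b c d : fam C) :=
  [/\ low h l, low h a, low h.+1 b, low h.+1 c & low h.+2 d].

Definition cut (h : nat) : fam C -> fam C := restr (fun _ t => (cnt t < h)%N).

Lemma cut_Q0 h f : Q0 (cut h.+1 f) = cut h (Q0 f).
Proof. by apply: (@restr_Q0 p) => a t a' t'; lia. Qed.
Lemma cut_Q1 h f : Q1 (cut h.+1 f) = cut h (Q1 f).
Proof. by apply: (@restr_Q1 p) => a t a' t'; lia. Qed.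
Lemma cutD h f g : cut h (f + g) = cut h f + cut h g.
Proof.
apply/funext => a; apply/funext => t; rewrite famD /cut /restr !famD.
by case: ifP; rewrite ?addr0.
Qed.
Lemma cut_low h f : low h (cut h f).
Proof. exact: supp_restrS. Qed.
Lemma low_cut h f : low h f -> cut h f = f.
Proof. exact: restr_id. Qed.

(** With the bounds raised by the number of [tau]'s that each term loses, the decomposition is
    homogeneous in the number of [tau]'s. This permits induction on that number. *)
Lemma decomp_cut h l a b c d :
  decomp (cut h l) (cut h a) (cut h.+1 b) (cut h.+1 c) (cut h.+2 d)
  = cut h (decomp l a b c d).
Proof. by rewrite /decomp !cut_Q0 !cut_Q1 cut_Q0 !cutD. Qed.
End Decomposition.

(** * Homogeneous elements *)

Section Endo.
Context (N : zmodType).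

(** Additive endomorphisms form a ring, so operators satisfying the defining relations make [N] a
    module over the presented ring. Nonvanishing in a presentation is detected on such modules. *)
Record endo := Endo { efun :> N -> N; efunD : {morph efun : x y / x + y} }.

HB.instance Definition _ := gen_eqMixin endo.
HB.instance Definition _ := gen_choiceMixin endo.

Lemma endoP (f g : endo) : f =1 g -> f = g.
Proof.
case: f g => [f fD] [g gD] /= /funext E; rewrite E in fD *.
by congr Endo; exact: Prop_irrelevance.
Qed.

Lemma efun0 (f : endo) : f 0 = 0.
Proof. by apply: (addrI (f 0)); rewrite -efunD !addr0. Qed.
Lemma efunN (f : endo) x : f (- x) = - f x.
Proof. by apply: (addrI (f x)); rewrite -efunD !subrr efun0. Qed.

Program Definition endo_zero := @Endo (fun=> 0) _.
Next Obligation. by move=> x y /=; rewrite addr0. Qed.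
Program Definition endo_one := @Endo id _.
Next Obligation. by []. Qed.
Program Definition endo_add (f g : endo) := @Endo (fun x => f x + g x) _.
Next Obligation. by move=> x y /=; rewrite !efunD addrACA. Qed.
Program Definition endo_opp (f : endo) := @Endo (fun x => - f x) _.
Next Obligation. by move=> x y /=; rewrite efunD opprD. Qed.
Program Definition endo_mul (f g : endo) := @Endo (fun x => f (g x)) _.
Next Obligation. by move=> x y /=; rewrite !efunD. Qed.

Fact endo_addA : associative endo_add.
Proof. by move=> f g h; apply: endoP => x /=; rewrite addrA. Qed.
Fact endo_addC : commutative endo_add.
Proof. by move=> f g; apply: endoP => x /=; rewrite addrC. Qed.
Fact endo_add0 : left_id endo_zero endo_add.
Proof. by move=> f; apply: endoP => x /=; rewrite add0r. Qed.
Fact endo_addN : left_inverse endo_zero endo_opp endo_add.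
Proof. by move=> f; apply: endoP => x /=; rewrite addNr. Qed.
Fact endo_mulA : associative endo_mul.
Proof. by move=> f g h; apply: endoP. Qed.
Fact endo_mul1l : left_id endo_one endo_mul.
Proof. by move=> f; apply: endoP. Qed.
Fact endo_mul1r : right_id endo_one endo_mul.
Proof. by move=> f; apply: endoP. Qed.
Fact endo_mulDl : left_distributive endo_mul endo_add.
Proof. by move=> f g h; apply: endoP. Qed.
Fact endo_mulDr : right_distributive endo_mul endo_add.
Proof. by move=> f g h; apply: endoP => x /=; rewrite efunD. Qed.

HB.instance Definition _ := GRing.isZmodule.Build endo
  endo_addA endo_addC endo_add0 endo_addN.
HB.instance Definition _ := GRing.Zmodule_isPzRing.Build endo
  endo_mulA endo_mul1l endo_mul1r endo_mulDl endo_mulDr.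

Lemma endo_natE n x : (n%:R : endo) x = x *+ n.
Proof. by elim: n => // n IH; rewrite !mulrS -[LHS]/(x + (n%:R : endo) x) IH. Qed.
Lemma endo_signE (s : bool) (f : endo) x :
  ((-1) ^+ s * f) x = if s then - f x else f x.
Proof. by rewrite mulr_sign; case: s. Qed.
End Endo.

(** * Homogeneous components in a presented ring *)

Section Grading.
Context (I : Type) (E : rexpr I -> rexpr I -> Prop) (deg : I -> int * int).

Inductive hexpr : int * int -> rexpr I -> Prop :=
  | hVar i : hexpr (deg i) (Var i)
  | hZero d : hexpr d Zero
  | hOne : hexpr 0 One
  | hOpp d a : hexpr d a -> hexpr d (Opp a)
  | hAdd d a c : hexpr d a -> hexpr d c -> hexpr d (Add a c)
  | hMul d e a c : hexpr d a -> hexpr e c -> hexpr (d + e) (Mul a c).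

Hypothesis E_homog : forall a c, E a c -> exists d, hexpr d a /\ hexpr d c.

Notation P := (pres E).

(** Functions on the set of degrees stand for formal sums of translates of [P]; a generator
    multiplies and shifts by its degree. Homogeneous relations are respected, so the degree of a
    homogeneous element becomes visible as a shift. *)
Program Definition grop (i : I) : endo (int * int -> P) :=
  @Endo _ (fun f d => pgen E i * f (d - deg i)) _.
Next Obligation. by move=> f g; apply/funext => d; rewrite -mulrDr. Qed.

Lemma hexpr_grop d a : hexpr d a ->
  forall f e, (reval grop a : endo _) f e = rclass E a * f (e - d).
Proof.
elim=> {d a} [i|d||d a _ IH|d a c _ IHa _ IHc|d e a c _ IHa _ IHc] f e' /=.
- by [].
- by rewrite rclass0 mul0r.
- by rewrite rclass1 mul1r subr0.
- by rewrite rclassN mulNr -IH.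
- by rewrite rclassD mulrDl -IHa -IHc.
- by rewrite rclassM -mulrA IHa IHc opprD addrA.
Qed.

Lemma grop_model : rmodel E grop.
Proof.
move=> a c Eac; have [d [Ha Hc]] := E_homog Eac.
apply: endoP => f; apply/funext => e; rewrite (hexpr_grop Ha) (hexpr_grop Hc).
by congr (_ * _); apply/rclassP/rc_rel.
Qed.

Lemma homog_grop d x : homog deg d x ->
  forall f e, (pmap_ring grop x : endo _) f e = x * f (e - d).
Proof.
have G := grop_model.
elim=> {d x} [d|d x _ IH|d x y _ IHx _ IHy||i|d e x y _ IHx _ IHy] f e'.
- by rewrite (pmap_ring0 G) mul0r.
- by rewrite (pmap_ringN G) mulNr -IH.
- by rewrite (pmap_ringD G) mulrDl -IHx -IHy.
- by rewrite (pmap_ring1 G) mul1r subr0.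
- by rewrite (pmap_ring_gen G).
- by rewrite (pmap_ringM G) -mulrA -[LHS]/((pmap_ring grop x : endo _) _ _) IHx IHy opprD addrA.
Qed.

(** Applied to the unit placed in degree 0, the sum shows its summands at distinct places. *)
Lemma homog_indep (D : seq (int * int)) (c : int * int -> P) :
  uniq D -> (forall d, d \in D -> homog deg d (c d)) -> \sum_(d <- D) c d = 0 ->
  forall d, d \in D -> c d = 0.
Proof.
move=> uD Hc S d dD.
have G := grop_model.
pose f0 : int * int -> P := fun e => (e == 0)%:R.
have : (pmap_ring grop (\sum_(d <- D) c d) : endo _) f0 d = 0.
  by rewrite S (pmap_ring0 G).
rewrite (big_morph _ (pmap_ringD G) (pmap_ring0 G)).
have -> (r : seq (int * int)) (F : int * int -> endo (int * int -> P)) :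
    (\sum_(i <- r) F i) f0 d = \sum_(i <- r) F i f0 d.
  by elim: r => [|i r IH]; rewrite ?big_nil ?big_cons //= -IH.
rewrite (big_rem d) //= (homog_grop (Hc _ dD)) /f0 subrr eqxx mulr1.
rewrite big_seq big1 ?addr0 // => e; rewrite mem_rem_uniq // !inE => /andP[ne eD].
by rewrite (homog_grop (Hc _ eD)) subr_eq0 eq_sym (negbTE ne) mulr0.
Qed.

Inductive hsum : P -> Prop :=
  | hsum0 : hsum 0
  | hsumS d x y : homog deg d x -> hsum y -> hsum (x + y).

Lemma hsum1 d x : homog deg d x -> hsum x.
Proof. by move=> Hx; rewrite -[x]addr0; apply: hsumS Hx hsum0. Qed.
Lemma hsumD x y : hsum x -> hsum y -> hsum (x + y).
Proof.
move=> Hx Hy; elim: Hx => [|d x' z Hx' _ IH]; first by rewrite add0r.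
by rewrite -addrA; exact: hsumS Hx' IH.
Qed.
Lemma hsumN x : hsum x -> hsum (- x).
Proof.
elim=> [|d x' z Hx' _ IH]; first by rewrite oppr0; exact: hsum0.
by rewrite opprD; apply: hsumS IH; exact: homogN Hx'.
Qed.
Lemma hsumM x y : hsum x -> hsum y -> hsum (x * y).
Proof.
move=> Hx Hy; elim: Hx => [|d x' z Hx' _ IH]; first by rewrite mul0r; exact: hsum0.
rewrite mulrDl; apply: hsumD IH; elim: Hy => [|e y' w Hy' _ IH]; first by rewrite mulr0;
  exact: hsum0.
by rewrite mulrDr; apply: hsumS IH; exact: homogM Hx' Hy'.
Qed.

Lemma hsumP x : hsum x.
Proof.
elim/pres_ind: x => a; rewrite rclassE; elim: a => [i|||a|a IHa c|a IHa c] /=.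
- exact: hsum1 (homog_gen E deg i).
- exact: hsum0.
- exact: hsum1 (homog1 E deg).
- exact: hsumN.
- exact: hsumD IHa.
- exact: hsumM IHa.
Qed.

Lemma pres_homog_ind (Q : P -> Prop) :
  Q 0 -> (forall d x y, homog deg d x -> Q y -> Q (x + y)) -> forall x, Q x.
Proof.
move=> Q0 QD x; elim: (hsumP x) => // d y z Hy _; exact: QD Hy.
Qed.

(** [homog] is only an inductive predicate; this supplies the additive projections of the
    grading. *)
Definition gproj (d : int * int) (x : P) : P :=
  (pmap_ring grop x : endo _) (fun e => (e == 0)%:R) d.

Lemma gprojD d x y : gproj d (x + y) = gproj d x + gproj d y.
Proof. by rewrite /gproj (pmap_ringD grop_model). Qed.
Lemma gproj0 d : gproj d 0 = 0.
Proof. by rewrite /gproj (pmap_ring0 grop_model). Qed.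
Lemma gproj_homog d e x : homog deg e x -> gproj d x = if d == e then x else 0.
Proof.
move=> Hx; rewrite /gproj (homog_grop Hx) subr_eq0.
by case: eqP; rewrite ?mulr1 ?mulr0.
Qed.
Lemma homog_gproj d x : homog deg d (gproj d x).
Proof.
elim/pres_homog_ind: x => [|e x y Hx IH]; first by rewrite gproj0; exact: homog0.
rewrite gprojD; apply: homogD => //; rewrite (gproj_homog _ Hx).
by case: eqP => [->|_] //; exact: homog0.
Qed.
End Grading.

(** * The gradings of the coefficients and of the Steenrod algebra *)

Section GradedRing.
Context (p : nat) (b : coeff_data).

Lemma hexpr_eq (I : Type) (deg : I -> int * int) d e a : d = e -> hexpr deg d a -> hexpr deg e a.
Proof. by move=> ->. Qed.

Lemma hexpr_nat (I : Type) (deg : I -> int * int) n : hexpr deg 0 (rnat I n).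
Proof. by elim: n => [|n IH]; [exact: hZero|apply: hAdd IH; exact: hOne]. Qed.
Lemma hexpr_pow (I : Type) (deg : I -> int * int) d a n :
  hexpr deg d a -> hexpr deg (d *+ n) (rpow a n).
Proof.
by move=> Ha; elim: n => [|n IH]; [exact: hOne|rewrite mulrS; exact: hMul Ha IH].
Qed.
Lemma hexpr_sign (I : Type) (deg : I -> int * int) d s a :
  hexpr deg d a -> hexpr deg d (rsign s a).
Proof. by case: s => //=; exact: hOpp. Qed.

Lemma mrel_homog (a c : rexpr mgen) : mrel p b a c ->
  exists d, hexpr (mdeg b) d a /\ hexpr (mdeg b) d c.
Proof.
case=> [|g h|n Hn].
- by exists 0; split; [exact: hexpr_nat|exact: hZero].
- exists (mdeg b g + mdeg b h); split; first by apply: hMul; exact: hVar.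
  by apply: hexpr_sign; rewrite addrC; apply: hMul; exact: hVar.
- by eexists; split; [apply: hexpr_pow; exact: hVar|exact: hZero].
Qed.

Hypothesis wt1 : p = 2%N -> coeff_wt b = 1%N.

(** For [p = 2] the relation for [tau_i^2] is homogeneous because [theta] has weight -1, which is
    what [wt1] provides. *)
Lemma arel_homog K (a c : rexpr agen) : arel p b K a c ->
  exists d, hexpr (adeg p b) d a /\ hexpr (adeg p b) d c.
Proof.
case=> [|g h|n Hn||i|g Kg].
- by exists 0; split; [exact: hexpr_nat|exact: hZero].
- exists (adeg p b g + adeg p b h); split; first by apply: hMul; exact: hVar.
  by apply: hexpr_sign; rewrite addrC; apply: hMul; exact: hVar.
- by eexists; split; [apply: hexpr_pow; exact: hVar|exact: hZero].
- exists 0; split; last exact: hOne.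
  apply: (@hexpr_eq _ _ (adeg p b (Xi 0))); last exact: hVar.
  by apply: injective_projections; rewrite /= expn0; lia.
- exists (adeg p b (Tau i) *+ 2); split; first by apply: hexpr_pow; exact: hVar.
  case: eqP => [p2|_]; last exact: hZero.
  have w1 := wt1 p2; rewrite p2.
  apply: hAdd.
    apply: (@hexpr_eq _ _ (adeg 2 b (Mg Theta) + adeg 2 b (Xi i.+1))); last first.
      by apply: hMul; exact: hVar.
    by apply: injective_projections; rewrite mulr2n /= ?w1 expnS /=; lia.
  apply: (@hexpr_eq _ _ (adeg 2 b (Mg Gamma) + adeg 2 b (Tau i.+1))).
    by apply: injective_projections; rewrite mulr2n /= ?w1 expnS /=; lia.
  apply: hMul; last exact: hVar.
  by rewrite /rho_expr; case: (coeff_bock b); [exact: hVar|exact: hZero].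
- by eexists; split; [exact: hVar|exact: hZero].
Qed.

Lemma homog_etaL K d (m : MM p b) : homog (mdeg b) d m -> homog (adeg p b) d (etaL K m).
Proof.
have mL := @etaL_model p b K; rewrite /etaL.
elim=> {d m} [d|d x _ IH|d x y _ IHx _ IHy||g|d e x y _ IHx _ IHy].
- by rewrite (pmap_ring0 mL); exact: homog0.
- by rewrite (pmap_ringN mL); exact: homogN.
- by rewrite (pmap_ringD mL); exact: homogD.
- by rewrite (pmap_ring1 mL); exact: homog1.
- by rewrite (pmap_ring_gen mL); exact: (homog_gen (arel p b K) (adeg p b) (Mg g)).
- by rewrite (pmap_ringM mL); exact: homogM.
Qed.

Lemma homog_ag K g : homog (adeg p b) (adeg p b g) (ag p b K g).
Proof. exact: homog_gen. Qed.

Lemma homog_rho K : homog (adeg p b) (adeg p b (Mg Gamma)) (rho p b K).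
Proof. by rewrite rhoE; case: (coeff_bock b); [exact: homog_ag|exact: homog0]. Qed.

Lemma homog_etaR K d (m : MM p b) : homog (mdeg b) d m -> homog (adeg p b) d (etaR K m).
Proof.
have mR := @etaR_model p b K; rewrite /etaR.
elim=> {d m} [d|d x _ IH|d x y _ IHx _ IHy||g|d e x y _ IHx _ IHy].
- by rewrite (pmap_ring0 mR); exact: homog0.
- by rewrite (pmap_ringN mR); exact: homogN.
- by rewrite (pmap_ringD mR); exact: homogD.
- by rewrite (pmap_ring1 mR); exact: homog1.
- rewrite (pmap_ring_gen mR); case: g; last exact: (homog_ag K (Mg Gamma)).
  apply: homogD; first exact: (homog_ag K (Mg Theta)).
  apply: homogN; rewrite (_ : mdeg b Theta = adeg p b (Mg Gamma) + adeg p b (Tau 0)).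
    by apply: homogM; [exact: homog_rho|exact: homog_ag].
  by apply: injective_projections; rewrite /= ?expn0; lia.
- by rewrite (pmap_ringM mR); exact: homogM.
Qed.
End GradedRing.

(** * Independence of monomials *)

Section Tower.
Context (p : nat) (b : coeff_data).
Notation M := (MM p b).

(** A module with operators for the generators of the Steenrod algebra; adjoining the
    variables [xi_i], [tau_i] one after the other yields a module on which distinct monomials
    send a base vector to independent vectors. *)
Record stage := Stage { st_mod :> zmodType; st_op : agen -> endo st_mod }.

(** The prescribed value of [tau_j^2]. It involves [xi_{j+1}] and [tau_{j+1}], so higher indices
    must be adjoined before [tau_j]; the tower is therefore built downwards, and [square] is kept
    apart from [stage_ok]. *)
Definition carry (S : stage) (j : nat) : endo S :=
  if p == 2%N then st_op S (Mg Theta) * st_op S (Xi j.+1)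
    + (if coeff_bock b then st_op S (Mg Gamma) else 0) * st_op S (Tau j.+1)
  else 0.

Record stage_ok (S : stage) : Prop := StageOk {
  ok_char : p%:R = 0 :> endo S;
  ok_comm : forall g h, st_op S g * st_op S h
      = (-1) ^+ (apar g && apar h) * (st_op S h * st_op S g);
  ok_nil : forall n, coeff_nil b = Some n -> st_op S (Mg Gamma) ^+ n = 0;
  ok_xi0 : st_op S (Xi 0) = 1 }.

Definition square (S : stage) (j : nat) := st_op S (Tau j) * st_op S (Tau j) = carry S j.

Definition is_xi (j : nat) (g : agen) := if g is Xi i then i == j else false.
Definition is_tau (j : nat) (g : agen) := if g is Tau i then i == j else false.

Program Definition adj_xi_op (S : stage) (j : nat) (g : agen) : endo (nat -> S) :=
  @Endo _ (fun f n =>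
    if is_xi j g then (if n is n'.+1 then f n' else 0) else st_op S g (f n)) _.
Next Obligation.
move=> f h; apply/funext => n; rewrite -[RHS]/(_ n + _ n).
by case: ifP => _; [case: n => [|n]; rewrite ?addr0|rewrite -efunD].
Qed.
(** [f : nat -> S] stands for the formal series with [xi_j^n]-coefficient [f n]. *)
Definition adj_xi S j := Stage (adj_xi_op S j).

Program Definition adj_tau_op (S : stage) (j : nat) (g : agen) : endo (S * S)%type :=
  @Endo _ (fun w =>
    if is_tau j g then (carry S j w.2, w.1)
    else (st_op S g w.1, if apar g then - st_op S g w.2 else st_op S g w.2)) _.
Next Obligation.
move=> [u v] [u' v'] /=; case: ifP => _; first by rewrite efunD.
by rewrite !efunD; case: (apar g); rewrite ?opprD.
Qed.
(** The pair [(u, v)] stands for [u + tau_j v]. *)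
Definition adj_tau S j := Stage (adj_tau_op S j).

Lemma char0 (S : stage) (x : S) : stage_ok S -> x *+ p = 0.
Proof. by move=> ok; rewrite -endo_natE (ok_char ok). Qed.

Lemma char_opp (S : stage) (x : S) : stage_ok S -> p = 2%N -> - x = x.
Proof.
move=> ok p2; apply/eqP; rewrite -subr_eq0 -opprD oppr_eq0 -mulr2n.
by have := char0 x ok; rewrite p2 => ->.
Qed.

Lemma comm_op (S : stage) g h (x : S) : stage_ok S ->
  st_op S g (st_op S h x) = if apar g && apar h then - st_op S h (st_op S g x)
                            else st_op S h (st_op S g x).
Proof.
by move=> ok; rewrite -[LHS]/((st_op S g * st_op S h) x) (ok_comm ok) endo_signE.
Qed.

(** For [p = 2] signs are invisible and all operators commute; otherwise [carry] is zero. *)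
Lemma carry_comm (S : stage) j g (x : S) : stage_ok S ->
  carry S j (st_op S g x) = st_op S g (carry S j x).
Proof.
move=> ok; rewrite /carry; case: eqP => [p2|_]; last by rewrite [RHS]efun0.
have C g' h' y : st_op S g' (st_op S h' y) = st_op S h' (st_op S g' y).
  by rewrite comm_op // char_opp // if_same.
rewrite -[LHS]/(st_op S (Mg Theta) (st_op S (Xi j.+1) (st_op S g x))
  + (if coeff_bock b then st_op S (Mg Gamma) else 0) (st_op S (Tau j.+1) (st_op S g x))).
rewrite -[X in _ = st_op S g X]/(st_op S (Mg Theta) (st_op S (Xi j.+1) x)
  + (if coeff_bock b then st_op S (Mg Gamma) else 0) (st_op S (Tau j.+1) x)).
rewrite efunD (C _ g) (C (Mg Theta)); congr (_ + _); case: (coeff_bock b).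
  by rewrite (C _ g) (C (Mg Gamma)).
by rewrite [RHS]efun0.
Qed.

Lemma op_pow (S : stage) n : coeff_nil b = Some n -> stage_ok S ->
  forall x : S, iter n (st_op S (Mg Gamma)) x = 0.
Proof.
move=> Hn ok x; have E k : iter k (st_op S (Mg Gamma)) x = (st_op S (Mg Gamma) ^+ k) x.
  by elim: k => //= k ->; rewrite exprS.
by rewrite E (ok_nil ok).
Qed.

Lemma endo_exprE (N : zmodType) (f : endo N) k x : (f ^+ k) x = iter k f x.
Proof. by elim: k => //= k <-; rewrite exprS. Qed.

Lemma adj_xi_ok S j : (0 < j)%N -> stage_ok S -> stage_ok (adj_xi S j).
Proof.
move=> j0 ok; split.
- apply: endoP => f; rewrite endo_natE; apply/funext => n.
  have -> : (f *+ p) n = f n *+ p by elim: (p) => // q IH; rewrite !mulrS -IH.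
  exact: char0.
- move=> g h; apply: endoP => f; rewrite endo_signE; apply/funext => n.
  have -> (s : bool) (w : nat -> S) : (if s then - w else w) n = if s then - w n else w n.
    by case: s.
  rewrite /=; case gX : (is_xi j g); case hX : (is_xi j h) => //=.
  + by case: g gX => // i _; rewrite /=.
  + case: g gX => // i _ /=; by case: n => [|n]; rewrite ?efun0.
  + by case: h hX => // i _ /=; rewrite andbF; case: n => [|n]; rewrite ?efun0.
  + by rewrite comm_op.
- move=> n Hn; apply: endoP => f; rewrite endo_exprE; apply/funext => m.
  have -> : iter n (adj_xi_op S j (Mg Gamma)) f m = iter n (st_op S (Mg Gamma)) (f m).
    by elim: n {Hn} => //= n ->.
  by rewrite (op_pow Hn).
- apply: endoP => f; apply/funext => n /=.
  by rewrite (ok_xi0 ok) ltn_eqF.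
Qed.

Lemma adj_xi_square S j i : (i.+1 != j) -> square S i -> square (adj_xi S j) i.
Proof.
move=> ij sq; apply: endoP => f; apply/funext => n.
rewrite -[LHS]/((st_op S (Tau i) * st_op S (Tau i)) (f n)) sq /carry.
by case: (p == 2%N) => //=; rewrite (negbTE ij); case: (coeff_bock b).
Qed.

Lemma pairN (S : zmodType) (u v : S) : - (u, v) = (- u, - v).
Proof. by []. Qed.

Lemma adj_tau_ok S j : stage_ok S -> stage_ok (adj_tau S j).
Proof.
move=> ok; split.
- apply: endoP => -[u v]; rewrite endo_natE.
  have -> : (u, v) *+ p = (u *+ p, v *+ p) by elim: (p) => // q IH; rewrite !mulrS IH.
  by rewrite !char0.
- move=> g h; apply: endoP => -[u v]; rewrite endo_signE.
  rewrite /=; case gT : (is_tau j g); case hT : (is_tau j h) => //=.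
  + case: g h gT hT => // i [] // i' _ _ /=.
    have [p2|np2] := eqVneq p 2%N.
      by rewrite pairN !char_opp.
    have -> : carry S j = 0 by rewrite /carry (negbTE np2).
    by rewrite pairN !oppr0.
  + by case: g gT => // i _ /=; case: (apar h) => /=; rewrite ?efunN carry_comm ?pairN ?opprK.
  + by case: h hT => // i _ /=; case: (apar g) => /=; rewrite ?efunN carry_comm ?pairN ?opprK.
  + rewrite [st_op S g (st_op S h u)]comm_op //.
    have := comm_op g h v ok.
    by case: (apar g); case: (apar h) => /= E; rewrite ?pairN ?efunN ?E ?opprK.
- move=> n Hn; apply: endoP => -[u v]; rewrite endo_exprE.
  have E : exists s, iter n (adj_tau_op S j (Mg Gamma)) (u, v)
     = (iter n (st_op S (Mg Gamma)) u,
        if s then - iter n (st_op S (Mg Gamma)) v else iter n (st_op S (Mg Gamma)) v).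
    elim: n {Hn} => [|n [s IH]]; first by exists false.
    by exists (~~ s); rewrite !iterS IH /=; case: s {IH}; rewrite /= ?efunN ?opprK.
  by have [s ->] := E; rewrite !(op_pow Hn) // oppr0 if_same.
- by apply: endoP => -[u v] /=; rewrite (ok_xi0 ok).
Qed.

Lemma adj_tau_carry S i j u v : i.+1 != j ->
  carry (adj_tau S j) i (u, v) = (carry S i u, carry S i v).
Proof.
move=> ij; rewrite /carry; case: (p == 2%N) => //.
rewrite -[LHS]/(st_op (adj_tau S j) (Mg Theta) (st_op (adj_tau S j) (Xi i.+1) (u, v))
  + (if coeff_bock b then st_op (adj_tau S j) (Mg Gamma) else 0)
      (st_op (adj_tau S j) (Tau i.+1) (u, v))) /=.
rewrite (negbTE ij); case: (coeff_bock b) => //=.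
by rewrite efunN opprK.
Qed.

Lemma adj_tau_square S i j : i != j -> i.+1 != j -> square S i ->
  square (adj_tau S j) i.
Proof.
move=> ij i1j sq; apply: endoP => -[u v]; rewrite adj_tau_carry // -sq.
by rewrite /= (negbTE ij) /= efunN opprK.
Qed.

Lemma adj_tau_square_new S j : square (adj_tau S j) j.
Proof.
apply: endoP => -[u v]; rewrite adj_tau_carry ?gtn_eqF //.
by rewrite /= eqxx.
Qed.

Program Definition base_op (g : agen) : endo M :=
  @Endo _ (fun m => match g with
    | Mg h => pgen (mrel p b) h * m
    | Xi i => if i == 0%N then m else 0
    | Tau _ => 0 end) _.
Next Obligation.
move=> x y; case: g => [g|i|i] /=; rewrite ?mulrDr ?addr0 //.
by case: ifP; rewrite ?addr0.
Qed.
Definition base := Stage base_op.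

Lemma base_ok : stage_ok base.
Proof.
have M_ := pgen_model (E := mrel p b).
split.
- apply: endoP => m; rewrite endo_natE -mulr_natl.
  by have := M_ _ _ (mrel_char p b); rewrite reval_nat /= => ->; rewrite mul0r.
- move=> g h; apply: endoP => m; rewrite endo_signE.
  case: g => [g|i|i]; case: h => [h|i'|i'] /=; rewrite ?mulr0 ?oppr0 ?if_same ?andbF //=.
  + rewrite !mulrA; have := M_ _ _ (mrel_comm p b g h); rewrite reval_sign /= => ->.
    by rewrite mulr_sign; case: ifP => //; rewrite mulNr.
  + by case: ifP; rewrite ?mulr0.
  + by case: ifP; rewrite ?mulr0.
  + by do 2![case: ifP].
- move=> n Hn; apply: endoP => m; rewrite endo_exprE.
  have -> : iter n (base_op (Mg Gamma)) m = pgen (mrel p b) Gamma ^+ n * m.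
    by elim: n {Hn} => [|n IH]; rewrite ?mul1r // iterS IH /= exprS mulrA.
  by have := M_ _ _ (mrel_nil p Hn); rewrite reval_pow /= => ->; rewrite mul0r.
- exact: endoP.
Qed.

Lemma base_square i : square base i.
Proof.
apply: endoP => m; rewrite /carry; case: (p == 2%N) => //.
rewrite -[RHS]/(st_op base (Mg Theta) (st_op base (Xi i.+1) m)
  + (if coeff_bock b then st_op base (Mg Gamma) else 0) (st_op base (Tau i.+1) m)) /=.
by rewrite mulr0 efun0 addr0.
Qed.

Fixpoint tower d j : stage :=
  if d is d'.+1 then adj_tau (adj_xi (tower d' j.+1) j) j else base.

Lemma tower_ok d j : (0 < j)%N -> stage_ok (tower d j).
Proof.
elim: d j => [|d IH] j j0; first exact: base_ok.
by apply: adj_tau_ok; apply: adj_xi_ok => //; exact: IH.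
Qed.

(** The relation for [tau_i] involves only the indices [i] and [i + 1], so it survives the
    adjunction of smaller indices, and for the variable just adjoined it holds by construction. On
    [base] both sides are zero. *)
Lemma tower_square d j i : (0 < j)%N -> (j <= i)%N -> square (tower d j) i.
Proof.
elim: d j => [|d IH] j j0; first by move=> _; exact: base_square.
rewrite leq_eqVlt => /predU1P[->|ji]; first exact: adj_tau_square_new.
apply: adj_tau_square; rewrite ?gtn_eqF //; first exact: ltnW.
by apply: adj_xi_square; rewrite ?gtn_eqF //; [exact: ltnW|exact: IH].
Qed.
End Tower.

(** * Coordinates with respect to monomials *)

Section Coordinates.
Context (p : nat) (b : coeff_data).
Notation M := (MM p b).
Notation tower := (tower p b).

Lemma stage_model (S : stage) K : stage_ok p b S -> (forall i, square p b S i) ->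
  (forall g, K g -> st_op S g = 0) -> rmodel (arel p b K) (st_op S).
Proof.
move=> ok sq kill a c; case=> [|g h|n Hn||i|g Kg] /=.
- by rewrite reval_nat (ok_char ok).
- by rewrite reval_sign /= (ok_comm ok).
- by rewrite reval_pow (ok_nil ok).
- exact: ok_xi0 ok.
- have := sq i; rewrite /square /carry mulr1 => ->; case: (p == 2%N) => //=.
  by rewrite /rho_expr; case: (coeff_bock b).
- exact: kill.
Qed.

Definition mact (S : stage) (m : M) : endo S := pmap_ring (fun g => st_op S (Mg g)) m.

Definition emb (S : stage) (j : nat) (u : S) : adj_tau p b (adj_xi S j) j :=
  ((fun n => if n is 0%N then u else 0), 0).

Lemma op_emb (S : stage) j g (u : S) : ~~ is_xi j g -> ~~ is_tau j g ->
  st_op (adj_tau p b (adj_xi S j) j) g (emb j u) = emb j (st_op S g u).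
Proof.
move=> gx gt; have z := efun0 (adj_xi_op S j g).
apply: injective_projections => /=; rewrite (negbTE gt) /=.
  by apply/funext => n; rewrite (negbTE gx); case: n => //; rewrite efun0.
case: (apar g); last exact: z.
by rewrite -[RHS]oppr0; congr (- _); exact: z.
Qed.

Lemma reval_emb (S : stage) j a (u : S) :
  (reval (fun g => st_op (adj_tau p b (adj_xi S j) j) (Mg g)) a : endo _) (emb j u)
  = emb j ((reval (fun g => st_op S (Mg g)) a : endo S) u).
Proof.
have E u1 v1 : emb j (u1 + v1 : S) = emb j u1 + emb j v1.
  apply: injective_projections; last by rewrite /= addr0.
  by apply/funext => -[|n] //; apply/esym/addr0.
have E0 : emb j (0 : S) = 0.
  by apply: injective_projections => //; apply/funext => -[|n].
elim: a u => [g|||a IH|a IHa c IHc|a IHa c IHc] u.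
- exact: op_emb.
- exact/esym/E0.
- by [].
- rewrite -[LHS]/(- ((reval _ a : endo _) (emb j u))) IH.
  apply: (addrI (emb j ((reval (fun g => st_op S (Mg g)) a : endo S) u))).
  by rewrite subrr -E -[reval _ (Opp a)]/(- reval _ a) /= subrr E0.
- by rewrite -[LHS]/((reval _ a : endo _) (emb j u) + (reval _ c : endo _) (emb j u)) IHa IHc -E.
- by rewrite -[LHS]/((reval _ a : endo _) ((reval _ c : endo _) (emb j u))) IHc IHa.
Qed.

Fixpoint tone d j : tower d j :=
  match d with 0%N => 1 | d'.+1 => emb j (tone d' j.+1) end.

Fixpoint wact (S : stage) (one : S) j (t : seq (bool * nat)) (m : M) : S :=
  if t is (e, n) :: t' then
    iter e (st_op S (Tau j)) (iter n (st_op S (Xi j)) (wact one j.+1 t' m))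
  else mact S m one.

Lemma wact_emb (S : stage) (one : S) j i t m : (j < i)%N ->
  wact (emb j one) i t m = emb j (wact one i t m).
Proof.
elim: t i => [|[e n] t IH] i ji; first exact: reval_emb.
have Ex u : st_op (adj_tau p b (adj_xi S j) j) (Xi i) (emb j u) = emb j (st_op S (Xi i) u).
  by rewrite op_emb //= gtn_eqF.
have Et u : st_op (adj_tau p b (adj_xi S j) j) (Tau i) (emb j u) = emb j (st_op S (Tau i) u).
  by rewrite op_emb //= gtn_eqF.
have iter_emb k f g u : (forall u, f (emb j u) = emb j (g u)) ->
    iter k f (emb j u) = emb j (iter k g u).
  by move=> E; elim: k => //= k ->.
change (iter e (st_op (adj_tau p b (adj_xi S j) j) (Tau i))
  (iter n (st_op (adj_tau p b (adj_xi S j) j) (Xi i)) (wact (emb j one) i.+1 t m))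
  = emb j (wact one i ((e, n) :: t) m)).
rewrite IH; last exact: leq_trans ji _.
by rewrite (iter_emb S n _ _ _ Ex) (iter_emb S e _ _ _ Et).
Qed.

Fixpoint tev d j : tower d j -> seq (bool * nat) -> M :=
  match d return tower d j -> seq (bool * nat) -> M with
  | 0%N => fun m t => m
  | d'.+1 => fun w t =>
      if t is (e, n) :: t' then @tev d' j.+1 ((if e then w.2 else w.1) n) t' else 0
  end.

Lemma tevD d j (u v : tower d j) t : tev (u + v) t = tev u t + tev v t.
Proof.
elim: d j u v t => [|d IH] j u v t //=.
by case: t => [|[e n] t]; [rewrite addr0|rewrite -IH; case: e].
Qed.
Lemma tev0 d j t : tev (0 : tower d j) t = 0.
Proof. by apply: (addrI (tev (0 : tower d j) t)); rewrite -tevD !addr0. Qed.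

(** This is the independence of monomials, which the presentation alone does not show: each word
    moves the base vector to a place of its own. *)
Lemma tev_wact d j t t' m : size t = d -> size t' = d ->
  tev (wact (tone d j) j t m) t' = if t == t' then m else 0.
Proof.
elim: d j t t' => [|d IH] j [|[e n] t] [|[e' n'] t'] //.
  move=> _ _ /=; rewrite /mact /pmap_ring.
  have E a : (reval (fun g => st_op (base p b) (Mg g)) a : endo M) =1 *%R (rclass (mrel p b) a).
    elim: a => [g|||a IH|a IHa c IHc|a IHa c IHc] x.
    - by [].
    - by rewrite rclass0 mul0r.
    - by rewrite rclass1 mul1r.
    - by rewrite rclassN mulNr -IH.
    - by rewrite rclassD mulrDl -IHa -IHc.
    - by rewrite rclassM -mulrA -IHc -IHa.
  by rewrite [LHS]E mulr1 rclassK.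
move=> [st] [st'].
have Ew : wact (tone d.+1 j) j ((e, n) :: t) m =
  let f := (fun k => if k == n then wact (tone d j.+1) j.+1 t m else 0) in
  if e then (0, f) else (f, 0).
  rewrite [LHS]/= wact_emb //.
  have -> : iter n (st_op (tower d.+1 j) (Xi j)) (emb j (wact (tone d j.+1) j.+1 t m))
     = ((fun k => if k == n then wact (tone d j.+1) j.+1 t m else 0), 0).
    elim: n => [|n IHn]; first by congr pair; apply/funext => -[].
    rewrite iterS IHn /=; apply: injective_projections; rewrite /= ?efun0 //.
    by apply/funext => -[|k] /=; rewrite eqxx.
    by apply/funext => -[|k] /=; rewrite eqxx.
  case: e => //=; rewrite eqxx /=; congr pair; exact: efun0.
rewrite Ew /= eqseq_cons xpair_eqE.
have H k : tev (if k == n then wact (tone d j.+1) j.+1 t m else 0) t'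
    = if (n == k) && (t == t') then m else 0.
  by rewrite eq_sym; case: eqP => _ /=; rewrite ?IH // tev0.
by case: e {Ew}; case: e' => /=; rewrite ?tev0 // H.
Qed.

Fixpoint amon K j (t : seq (bool * nat)) : steenrod p b K :=
  if t is (e, n) :: t' then tau p b K j ^+ (e : nat) * (xi p b K j ^+ n * amon K j.+1 t')
  else 1.

Lemma pmap_etaL K (R : pzRingType) (V : agen -> R) (m : M) : rmodel (arel p b K) V ->
  pmap_ring V (etaL K m : steenrod p b K) = pmap_ring (fun g => V (Mg g)) m.
Proof.
move=> mV; rewrite [RHS]/pmap_ring.
rewrite (_ : etaL K m = reval (fun g => ag p b K (Mg g)) (repr m)) //.
elim: (repr m) => [g|||a IH|a IHa c IHc|a IHa c IHc] /=.
- exact: (pmap_ring_gen mV).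
- exact: (pmap_ring0 mV).
- exact: (pmap_ring1 mV).
- by rewrite (pmap_ringN mV) IH.
- by rewrite (pmap_ringD mV) IHa IHc.
- by rewrite (pmap_ringM mV) IHa IHc.
Qed.

Lemma pmap_pow (I : Type) (E : rexpr I -> rexpr I -> Prop) (R : pzRingType)
  (V : I -> R) (x : pres E) n : rmodel E V -> pmap_ring V (x ^+ n) = pmap_ring V x ^+ n.
Proof.
move=> mV; elim: n => [|n IH]; first by rewrite !expr0 (pmap_ring1 mV).
by rewrite !exprS (pmap_ringM mV) IH.
Qed.

Section TauAction.
Context (S : stage).
Lemma adj_tau_op0 j g (u : S) : ~~ is_tau j g ->
  st_op (adj_tau p b S j) g (u, 0) = (st_op S g u, 0).
Proof. by move=> gt; rewrite /= (negbTE gt) /= efun0 oppr0 if_same. Qed.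
Lemma adj_tau_mact0 j m (u : S) :
  mact (adj_tau p b S j) m (u, 0) = (mact S m u, 0).
Proof.
rewrite /mact /pmap_ring; elim: (repr m) u => [g|||a IH|a IHa c IHc|a IHa c IHc] u.
- exact: adj_tau_op0.
- by [].
- by [].
- by rewrite -[LHS]/(- ((reval _ a : endo _) (u, 0))) IH pairN oppr0.
- rewrite -[LHS]/((reval _ a : endo _) (u, 0) + (reval _ c : endo _) (u, 0)) IHa IHc.
  by apply: injective_projections => //=; rewrite addr0.
- by rewrite -[LHS]/((reval _ a : endo _) ((reval _ c : endo _) (u, 0))) IHc IHa.
Qed.
Lemma adj_tau_new0 j (u : S) : st_op (adj_tau p b S j) (Tau j) (u, 0) = (0, u).
Proof. by rewrite /= eqxx /= efun0. Qed.
End TauAction.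

Notation A := (steenrod p b kill_none).
(** [tau_0] does not occur in the words to be separated, but it is a generator of the algebra that
    has to act, so it is adjoined last. *)
Definition stageA n : stage := adj_tau p b (tower n 1) 0.

Lemma stageA_model n : rmodel (arel p b kill_none) (st_op (stageA n)).
Proof.
apply: stage_model => [|i|g []]; first by apply: adj_tau_ok; exact: tower_ok.
case: i => [|i]; first exact: adj_tau_square_new.
by apply: adj_tau_square => //; exact: tower_square.
Qed.

Definition coordA n t (x : A) : M :=
  tev ((pmap_ring (st_op (stageA n)) x : endo _) (tone n 1, 0)).1 t.

Lemma coordAD n t x y : coordA n t (x + y) = coordA n t x + coordA n t y.
Proof. by rewrite /coordA (pmap_ringD (@stageA_model n)) -tevD. Qed.

(** The scalar stands on the right because it acts on the base vector before the variables do;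
    [ccoord] later pays the sign for moving it to the left. *)
Lemma coordA_amon n t t' m : size t = n -> size t' = n ->
  coordA n t' (amon kill_none 1 t * etaL kill_none m) = if t == t' then m else 0.
Proof.
move=> st st'; rewrite -(tev_wact 1 m st st') /coordA.
have mV := @stageA_model n.
suff H j : (0 < j)%N ->
    (pmap_ring (st_op (stageA n)) (amon kill_none j t * etaL kill_none m) : endo _) (tone n 1, 0)
    = (wact (tone n 1) j t m, 0) by rewrite H.
elim: t {st} j => [|[e k] t IH] j j0.
  by rewrite mul1r (pmap_etaL _ mV) [LHS]adj_tau_mact0.
rewrite /= -!mulrA (pmap_ringM mV) (pmap_ringM mV) !(pmap_pow _ _ mV) !(pmap_ring_gen mV).
change ((st_op (stageA n) (Tau j) ^+ e) ((st_op (stageA n) (Xi j) ^+ k)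
  ((pmap_ring (st_op (stageA n)) (amon kill_none j.+1 t * etaL kill_none m) : endo _) (tone n 1,
    0)))
  = (iter e (st_op (tower n 1) (Tau j)) (iter k (st_op (tower n 1) (Xi j))
      (wact (tone n 1) j.+1 t m)), 0)).
rewrite IH // !endo_exprE.
have it q f (g : tower n 1 -> tower n 1) u : (forall u, f (u, 0) = (g u, 0)) ->
    iter q f (u, 0) = (iter q g u, 0) :> stageA n.
  by move=> E; elim: q => //= q ->.
rewrite (it k _ (st_op (tower n 1) (Xi j))); last by move=> u; exact: adj_tau_op0.
rewrite (it e _ (st_op (tower n 1) (Tau j))) // => u; apply: adj_tau_op0.
by rewrite /= gtn_eqF.
Qed.

Notation E1 := (steenrod p b (kill_E 1)).
(** [tau_1] comes first since for [p = 2] the square of [tau_0] is [rho tau_1]. *)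
Definition stageE : stage := adj_tau p b (adj_tau p b (base p b) 1) 0.

Lemma stageE_model : rmodel (arel p b (kill_E 1)) (st_op stageE).
Proof.
apply: stage_model => [|i|g].
- by do 2!apply: adj_tau_ok; exact: base_ok.
- case: i => [|[|i]]; first exact: adj_tau_square_new.
    by apply: adj_tau_square => //; exact: adj_tau_square_new.
  by do 2!apply: adj_tau_square => //; exact: base_square.
- have z (S : stage) j : ~~ is_tau j g -> st_op S g = 0 -> st_op (adj_tau p b S j) g = 0.
    move=> gt E; apply: endoP => -[u v]; rewrite /= (negbTE gt) E.
    by case: (apar g); rewrite /= ?oppr0.
  rewrite /stageE; case: g z => [g z []|i z Hi|i z Hi].
    apply: (z) => //; apply: (z) => //; apply: endoP => m /=; by rewrite gtn_eqF.
  apply: (z); first by rewrite /= gtn_eqF // ltnW.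
  by apply: (z); [rewrite /= gtn_eqF|apply: endoP].
Qed.

Definition coordE (x : E1) : (M * M) * (M * M) :=
  (pmap_ring (st_op stageE) x : endo _) ((1, 0), (0, 0)).

Lemma coordED x y : coordE (x + y) = coordE x + coordE y.
Proof. by rewrite /coordE (pmap_ringD stageE_model). Qed.

Lemma coordE_etaL m : coordE (etaL (kill_E 1) m) = ((m, 0), (0, 0)).
Proof.
rewrite /coordE (pmap_etaL _ stageE_model).
rewrite -[LHS]/(mact stageE m ((1, 0), 0)) adj_tau_mact0.
rewrite -[mact _ _ _]/(mact (adj_tau p b (base p b) 1) m (1, 0)) adj_tau_mact0.
by have := @tev_wact 0 1 [::] [::] m erefl erefl => /= ->.
Qed.

Lemma coordE_tau1 m :
  coordE (tau p b (kill_E 1) 1 * etaL (kill_E 1) m) = ((0, m), (0, 0)).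
Proof.
rewrite /coordE (pmap_ringM stageE_model) (pmap_ring_gen stageE_model).
rewrite -[LHS]/(st_op stageE (Tau 1) (coordE (etaL (kill_E 1) m))) coordE_etaL.
rewrite [LHS](@adj_tau_op0 _ 0 (Tau 1)) //.
by rewrite -[in RHS](adj_tau_new0 (S := base p b) 1 m).
Qed.

Lemma coordE_tau0 (x : E1) : (coordE x).2 = 0 ->
  coordE (tau p b (kill_E 1) 0 * x) = ((0, 0), (coordE x).1).
Proof.
move=> x0; rewrite /coordE (pmap_ringM stageE_model) (pmap_ring_gen stageE_model).
rewrite -[LHS]/(st_op stageE (Tau 0) (coordE x)).
have E : coordE x = ((coordE x).1, 0) by rewrite -x0 -surjective_pairing.
by rewrite {1}E; exact: (@adj_tau_new0 (adj_tau p b (base p b) 1) 0 (coordE x).1).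
Qed.
End Coordinates.

(** * Structure of the exterior coalgebra *)

Section E1.
Context (p : nat) (b : coeff_data).
Notation M := (MM p b).
Notation KE := (kill_E 1).
Notation E1 := (steenrod p b KE).
Notation t0 := (tau p b KE 0).
Notation t1 := (tau p b KE 1).
Notation etaR := (@Defs.etaR p b KE).
Notation etaL := (@Defs.etaL p b KE).

Definition mrho : M := if coeff_bock b then pgen (mrel p b) Gamma else 0.

Lemma etaL_mrho K : Defs.etaL K mrho = rho p b K.
Proof.
rewrite rhoE /mrho /Defs.etaL; case: (coeff_bock b).
  by rewrite (pmap_ring_gen (@etaL_model p b K)).
by rewrite (pmap_ring0 (@etaL_model p b K)).
Qed.
Lemma etaR_mrho K : Defs.etaR K mrho = rho p b K.
Proof.
rewrite rhoE /mrho /Defs.etaR; case: (coeff_bock b).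
  by rewrite (pmap_ring_gen (@etaR_model p b K)).
by rewrite (pmap_ring0 (@etaR_model p b K)).
Qed.
Lemma etaR0 K : Defs.etaR K (0 : M) = 0.
Proof. exact: (pmap_ring0 (@etaR_model p b K)). Qed.
Lemma etaRN K (m : M) : Defs.etaR K (- m) = - Defs.etaR K m.
Proof. exact: (pmap_ringN (@etaR_model p b K)). Qed.

Lemma scaleE K (m : M) (x : steenrod p b K) : m *: x = Defs.etaL K m * x.
Proof. by []. Qed.

Lemma xiE i : (0 < i)%N -> xi p b KE i = 0.
Proof. by move=> i0; exact: (@ag_kill _ _ _ (Xi i)). Qed.
Lemma xi_0 K : xi p b K 0 = 1.
Proof. exact: (ag_model (arel_xi0 p b K)). Qed.
Lemma tauE i : (1 < i)%N -> tau p b KE i = 0.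
Proof. by move=> i0; exact: (@ag_kill _ _ _ (Tau i)). Qed.

Lemma t00 : t0 * t0 = if p == 2%N then t1 * etaR mrho else 0.
Proof.
rewrite tau_sq; case: eqP => // p2; rewrite xiE // mulr0 add0r etaR_mrho.
exact: (@gcentral_char2 p b KE false (rho p b KE) p2).
Qed.
Lemma t11 : t1 * t1 = 0.
Proof. by rewrite tau_sq xiE // tauE // !mulr0 addr0 if_same. Qed.
Lemma t10 : t1 * t0 = - (t0 * t1).
Proof. by rewrite [LHS]ag_comm /= expr1 mulN1r. Qed.
Lemma t001 : t0 * (t0 * t1) = 0.
Proof.
rewrite mulrA t00; case: eqP => [p2|]; last by rewrite mul0r.
by rewrite -mulrA (@gcentral_char2 p b KE false (etaR mrho) p2) /= mulrA t11 mul0r.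
Qed.
Lemma t101 : t1 * (t0 * t1) = 0.
Proof. by rewrite mulrA t10 mulNr -mulrA t11 mulr0 oppr0. Qed.
Lemma sigma_t0 : sigma t0 = - t0. Proof. by rewrite sigma_gen /= expr1 mulN1r. Qed.
Lemma sigma_t1 : sigma t1 = - t1. Proof. by rewrite sigma_gen /= expr1 mulN1r. Qed.
Lemma sigma_t01 : sigma (t0 * t1) = t0 * t1.
Proof. by rewrite sigmaM sigma_t0 sigma_t1 mulrNN. Qed.

Definition tE (a : bool * bool) : E1 := t0 ^+ a.1 * t1 ^+ a.2.
Lemma tE00 : tE (false, false) = 1. Proof. by rewrite /tE mulr1. Qed.
Lemma tE10 : tE (true, false) = t0. Proof. by rewrite /tE mulr1 expr1. Qed.
Lemma tE01 : tE (false, true) = t1. Proof. by rewrite /tE mul1r expr1. Qed.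
Lemma tE11 : tE (true, true) = t0 * t1. Proof. by rewrite /tE !expr1. Qed.

Lemma sigma_tE a : sigma (tE a) = (-1) ^+ (a.1 (+) a.2) * tE a.
Proof.
case: a => -[] []; rewrite ?(tE00, tE10, tE01, tE11) ?(sigma1, sigma_t0, sigma_t1, sigma_t01);
by rewrite /= ?expr0 ?expr1 ?mul1r ?mulN1r.
Qed.

(** Spanning by [tE] is shown twice: with scalars through the right unit for tensor products, and
    with scalars on the left ([lspan]) for maps out of [E1]. When the Bockstein is nonzero the two
    units differ on [theta]. *)
Inductive rspan : E1 -> Prop :=
  | rspan0 : rspan 0
  | rspanD x y : rspan x -> rspan y -> rspan (x + y)
  | rspan_tE a m : rspan (tE a * etaR m).

Lemma rspanN x : rspan x -> rspan (- x).
Proof.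
elim=> {x} [|x y _ IHx _ IHy|a m]; first by rewrite oppr0; exact: rspan0.
- by rewrite opprD; exact: rspanD.
- by rewrite -mulrN -etaRN; exact: rspan_tE.
Qed.

Lemma rspan_mul z : (forall a m, rspan (z * (tE a * etaR m))) ->
  forall x, rspan x -> rspan (z * x).
Proof.
move=> H x; elim=> {x} [|x y _ IHx _ IHy|a m] //; first by rewrite mulr0; exact: rspan0.
by rewrite mulrDr; exact: rspanD.
Qed.

Lemma rspan_t0 x : rspan x -> rspan (t0 * x).
Proof.
apply: rspan_mul => -[[] []] m; rewrite mulrA ?(tE00, tE10, tE01, tE11).
- by rewrite t001 mul0r; exact: rspan0.
- rewrite t00; case: eqP => _; last by rewrite mul0r; exact: rspan0.
  by rewrite -mulrA -etaRM -tE01; exact: rspan_tE.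
- by rewrite -tE11; exact: rspan_tE.
- by rewrite mulr1 -tE10; exact: rspan_tE.
Qed.
Lemma rspan_t1 x : rspan x -> rspan (t1 * x).
Proof.
apply: rspan_mul => -[[] []] m; rewrite mulrA ?(tE00, tE10, tE01, tE11).
- by rewrite t101 mul0r; exact: rspan0.
- by rewrite t10 mulNr -tE11; apply: rspanN; exact: rspan_tE.
- by rewrite t11 mul0r; exact: rspan0.
- by rewrite mulr1 -tE01; exact: rspan_tE.
Qed.
Lemma rspan_gamma x : rspan x -> rspan (ag p b KE (Mg Gamma) * x).
Proof.
apply: rspan_mul => a m; rewrite mulrA (@gcentral_ag p b KE (Mg Gamma)) /= sigma_tE.
have E : ag p b KE (Mg Gamma) = etaR (pgen (mrel p b) Gamma).
  by rewrite /Defs.etaR (pmap_ring_gen (@etaR_model p b KE)).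
rewrite mulr_sign -mulrA {1}E -etaRM; case: (_ (+) _); last exact: rspan_tE.
by rewrite mulNr; apply: rspanN; exact: rspan_tE.
Qed.
(** [theta] is the sum of its right unit, which is central, and of [rho tau_0], which the previous
    lemmas handle. *)
Lemma rspan_theta x : rspan x -> rspan (ag p b KE (Mg Theta) * x).
Proof.
move=> Hx.
have E : ag p b KE (Mg Theta) = etaR (pgen (mrel p b) Theta) + rho p b KE * t0.
  by rewrite /Defs.etaR (pmap_ring_gen (@etaR_model p b KE)) subrK.
have Hrho y : rspan y -> rspan (rho p b KE * y).
  rewrite rhoE; case: (coeff_bock b) => Hy; first exact: rspan_gamma.
  by rewrite mul0r; exact: rspan0.
rewrite E mulrDl -mulrA; apply: rspanD; last by apply: Hrho; exact: rspan_t0.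
have C y : etaR (pgen (mrel p b) Theta) * y = y * etaR (pgen (mrel p b) Theta).
  rewrite /Defs.etaR (pmap_ring_gen (@etaR_model p b KE)) mulrBl mulrBr.
  rewrite (@gcentral_ag p b KE (Mg Theta)) /=; congr (_ - _).
  rewrite rhoE; case: (coeff_bock b); last by rewrite !mul0r mulr0.
  exact: (gcentralM (@gcentral_ag p b KE (Mg Gamma)) (@gcentral_ag p b KE (Tau 0))).
rewrite C; elim: Hx => [|y z _ IHy _ IHz|a m]; first by rewrite mul0r; exact: rspan0.
- by rewrite mulrDl; exact: rspanD.
- by rewrite -mulrA -etaRM; exact: rspan_tE.
Qed.

Lemma rspanP x : rspan x.
Proof.
suff H y : rspan y -> rspan (x * y).
  by rewrite -[x]mulr1; apply: H; rewrite -[1]mulr1 -{1}tE00 -(etaR1 p b KE); exact: rspan_tE.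
elim/pres_ind: x y => a; rewrite rclassE; elim: a => [g|||a IH|a IHa c IHc|a IHa c IHc] y Hy /=.
- case: g => [[]|i|[|[|i]]].
  + exact: rspan_theta.
  + exact: rspan_gamma.
  + case: i => [|i]; last by rewrite -/(ag p b KE _) -/(xi p b KE _) xiE // mul0r; exact: rspan0.
    by rewrite -/(ag p b KE _) -/(xi p b KE _) xi_0 mul1r.
  + exact: rspan_t0.
  + exact: rspan_t1.
  + by rewrite -/(ag p b KE _) -/(tau p b KE _) tauE // mul0r; exact: rspan0.
- by rewrite mul0r; exact: rspan0.
- by rewrite mul1r.
- by rewrite mulNr; apply: rspanN; exact: IH.
- by rewrite mulrDl; apply: rspanD; [exact: IHa|exact: IHc].
- by rewrite -mulrA; apply: IHa; exact: IHc.
Qed.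

Inductive lspan : E1 -> Prop :=
  | lspan0 : lspan 0
  | lspanD x y : lspan x -> lspan y -> lspan (x + y)
  | lspan_tE a m : lspan (m *: tE a).

Lemma lspanN x : lspan x -> lspan (- x).
Proof.
elim=> {x} [|x y _ IHx _ IHy|a m]; first by rewrite oppr0; exact: lspan0.
- by rewrite opprD; exact: lspanD.
- by rewrite -scaleNr; exact: lspan_tE.
Qed.
Lemma lspanZ m x : lspan x -> lspan (m *: x).
Proof.
elim=> {x} [|x y _ IHx _ IHy|a m']; first by rewrite scaler0; exact: lspan0.
- by rewrite scalerDr; exact: lspanD.
- by rewrite scalerA; exact: lspan_tE.
Qed.
Lemma lspan_tau j x : (forall a, lspan (tau p b KE j * tE a)) ->
  lspan x -> lspan (tau p b KE j * x).
Proof.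
move=> H; elim=> {x} [|x y _ IHx _ IHy|a m]; first by rewrite mulr0; exact: lspan0.
- by rewrite mulrDr; exact: lspanD.
- rewrite scaleE mulrA (@gcentral_ag p b KE (Tau j)) [par_iter _ _](@par_iter_etaL p b KE true).
  by rewrite -mulrA -scaleE; apply: lspanZ.
Qed.

Lemma lspanP x : lspan x.
Proof.
have l1 a : lspan (tE a) by rewrite -[tE a]scale1r; exact: lspan_tE.
suff H y : lspan y -> lspan (x * y).
  by rewrite -[x]mulr1; apply: H; rewrite -tE00.
elim/pres_ind: x y => a; rewrite rclassE; elim: a => [g|||a IH|a IHa c IHc|a IHa c IHc] y Hy /=.
- case: g => [g|i|[|[|i]]].
  + rewrite (_ : pgen _ _ = etaL (pgen (mrel p b) g)); first exact: lspanZ.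
    by rewrite /Defs.etaL (pmap_ring_gen (@etaL_model p b KE)).
  + case: i => [|i]; last by rewrite -/(ag p b KE _) -/(xi p b KE _) xiE // mul0r; exact: lspan0.
    by rewrite -/(ag p b KE _) -/(xi p b KE _) xi_0 mul1r.
  + apply: (@lspan_tau 0) Hy => -[[] []]; rewrite ?(tE00, tE10, tE01, tE11).
    * by rewrite t001; exact: lspan0.
    * rewrite t00; case: eqP => [p2|_]; last exact: lspan0.
      rewrite (@gcentral_char2 p b KE false t1 p2) /= etaR_mrho -etaL_mrho -tE01.
      exact: lspan_tE.
    * by rewrite -tE11.
    * by rewrite mulr1 -tE10.
  + apply: (@lspan_tau 1) Hy => -[[] []]; rewrite ?(tE00, tE10, tE01, tE11).
    * by rewrite t101; exact: lspan0.
    * by rewrite t10 -tE11; exact: lspanN.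
    * by rewrite t11; exact: lspan0.
    * by rewrite mulr1 -tE01.
  + by rewrite -/(ag p b KE _) -/(tau p b KE _) tauE // mul0r; exact: lspan0.
- by rewrite mul0r; exact: lspan0.
- by rewrite mul1r.
- by rewrite mulNr; apply: lspanN; exact: IH.
- by rewrite mulrDl; apply: lspanD; [exact: IHa|exact: IHc].
- by rewrite -mulrA; apply: IHa; exact: IHc.
Qed.

Record rlin (f : E1 -> M) : Prop := RLin {
  rlinD : forall x y, f (x + y) = f x + f y;
  rlinM : forall x m, f (x * etaR m) = f x * m }.

Definition rcoord (a : bool * bool) (x : E1) : M :=
  let u := MilnorModel.phi x in
  let v := if a.1 then u.2 else u.1 in if a.2 then v.2 else v.1.

Lemma rcoord_rlin a : rlin (rcoord a).
Proof.
split=> [x y|x m]; rewrite /rcoord.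
  by rewrite MilnorModel.phiD; case: a => -[] [].
by rewrite MilnorModel.phiM MilnorModel.phi_etaR MilnorModel.B2r; case: a => -[] [].
Qed.

Lemma rcoordE a c : rcoord a (tE c) = (a == c)%:R.
Proof.
rewrite /rcoord; case: c => -[] []; rewrite ?(tE00, tE10, tE01, tE11).
- rewrite MilnorModel.phiM !MilnorModel.phi_ag.
  rewrite /= ?MilnorModel.qME /= ?MilnorModel.qME /= ?MilnorModel.qME /= /MilnorModel.s1
    /MilnorModel.qs /=.
  rewrite ?MilnorModel.qME /= ?MilnorModel.ms_0 ?MilnorModel.ms_1 ?oppr0.
  by rewrite !(mul0r, mulr0, addr0, add0r, mul1r, mulr1, oppr0); case: a => -[] [].
- by rewrite MilnorModel.phi_ag; case: a => -[] [].
- by rewrite MilnorModel.phi_ag; case: a => -[] [].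
- by rewrite MilnorModel.phi1; case: a => -[] [].
Qed.

Definition counit_gen (g : agen) : M :=
  match g with Mg h => pgen (mrel p b) h | Xi i => (i == 0%N)%:R | Tau _ => 0 end.

Lemma counit_model : rmodel (arel p b KE) counit_gen.
Proof.
have M_ := pgen_model (E := mrel p b).
move=> a c; case=> [|g h|n Hn||i|g Kg] /=.
- by have := M_ _ _ (mrel_char p b); rewrite !reval_nat.
- rewrite reval_sign /=; case: g => [g|i|i]; case: h => [h|i'|i'] /=;
    rewrite ?(andbF, mul0r, mulr0, expr0, mul1r, oppr0) //.
  + by have := M_ _ _ (mrel_comm p b g h); rewrite !reval_sign.
  + by case: (i' == 0%N); rewrite ?mulr1 ?mul1r ?mulr0 ?mul0r.
  + by case: (i == 0%N); rewrite ?mulr1 ?mul1r ?mulr0 ?mul0r.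
  + by case: (i == 0%N); case: (i' == 0%N); rewrite ?mulr1 ?mul1r ?mulr0 ?mul0r.
- by have := M_ _ _ (mrel_nil p Hn); rewrite !reval_pow.
- by [].
- by rewrite mul0r; case: (p == 2%N); rewrite //= !mulr0 addr0.
- by case: g Kg => [g|i|i] //= i0; rewrite gtn_eqF.
Qed.

Lemma counit_rlin : rlin (@counit p b).
Proof.
have cm := counit_model.
split=> [x y|x m]; first exact: (pmap_ringD cm).
rewrite /counit (pmap_ringM cm); congr (_ * _).
rewrite /Defs.etaR {2}/pmap_ring -[RHS](rclassK m) rclassE.
elim: (repr m) => [g|||a IH|a IHa c IHc|a IHa c IHc] /=.
- case: g; last exact: (pmap_ring_gen cm).
  rewrite (pmap_ringD cm) (pmap_ringN cm) (pmap_ringM cm) !(pmap_ring_gen cm).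
  by rewrite mulr0 subr0.
- exact: (pmap_ring0 cm).
- exact: (pmap_ring1 cm).
- by rewrite (pmap_ringN cm) IH.
- by rewrite (pmap_ringD cm) IHa IHc.
- by rewrite (pmap_ringM cm) IHa IHc.
Qed.

Lemma rlin_ext f g : rlin f -> rlin g -> (forall a, f (tE a) = g (tE a)) -> f =1 g.
Proof.
move=> Hf Hg E x.
have f0 : f 0 = 0 by apply: (addrI (f 0)); rewrite -(rlinD Hf) !addr0.
have g0 : g 0 = 0 by apply: (addrI (g 0)); rewrite -(rlinD Hg) !addr0.
elim: (rspanP x) => [|y z _ IHy _ IHz|a m]; first by rewrite f0.
- by rewrite (rlinD Hf) (rlinD Hg) IHy IHz.
- by rewrite (rlinM Hf) (rlinM Hg) E.
Qed.

(** [milnor] is obtained by choice, but its defining conditions prescribe the values on the basis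
    [tE], and right linearity does the rest. *)
Lemma milnor_rcoord i : (i <= 1)%N ->
  @milnor p b i =1 rcoord (if i == 0%N then (true, false) else (false, true)).
Proof.
move=> i1; have [mD mM m1 mt m01] := milnorP p b i1.
apply: rlin_ext; [by split|exact: rcoord_rlin|].
case=> -[] []; rewrite rcoordE ?(tE00, tE10, tE01, tE11) ?m1 ?m01 ?mt //;
by clear mD mM m1 mt m01; case: i i1 => [|[|//]].
Qed.

Lemma counit_rcoord : @counit p b =1 rcoord (false, false).
Proof.
apply: rlin_ext; [exact: counit_rlin|exact: rcoord_rlin|].
have cm := counit_model; have ct j : counit (tau p b KE j) = 0 := pmap_ring_gen cm (Tau j).
case=> -[] []; rewrite rcoordE ?(tE00, tE10, tE01, tE11) ?ct //.
  by rewrite /counit (pmap_ringM cm) [X in X * _]ct mul0r.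
exact: (pmap_ring1 cm).
Qed.

Section Tens.
Context (N : lmodType M).
Notation T := (stens KE N).
Implicit Types (f : E1 -> M) (t u : T).

Definition slant f (t : T) : N := tlift (fun (y : E1) (n : N) => f y *: n) t.

Section Slant.
Variable f : E1 -> M.
Hypothesis Hf : rlin f.
Lemma slant_bal : balanced (fun (x : E1) (m : M) => x * etaR m) (fun y (n : N) => f y *: n).
Proof.
split=> [x x' n|x n n'|x m n]; first by rewrite (rlinD Hf) scalerDl.
- by rewrite scalerDr.
- by rewrite (rlinM Hf) scalerA.
Qed.
Lemma slant_pure x n : slant f (spure x n) = f x *: n.
Proof. exact: (tlift_pure slant_bal). Qed.
Lemma slantD t u : slant f (t + u) = slant f t + slant f u.
Proof. exact: (tliftD slant_bal). Qed.
End Slant.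

Lemma slant_ext f g : f =1 g -> slant f =1 slant g.
Proof. by move=> E; rewrite (_ : f = g) //; exact/funext. Qed.

Definition expand (n : bool * bool -> N) : T :=
  spure 1 (n (false, false)) + spure t0 (n (true, false))
  + spure t1 (n (false, true)) + spure (t0 * t1) (n (true, true)).

Lemma slant_expand a n : slant (rcoord a) (expand n) = n a.
Proof.
rewrite /expand -tE11 -tE10 -tE01 -tE00 !(slantD (rcoord_rlin a)).
rewrite !(slant_pure (rcoord_rlin a)) !rcoordE.
by case: a => -[] []; rewrite /= ?scale1r ?scale0r ?(addr0, add0r).
Qed.

Lemma expandD n n' : expand n + expand n' = expand (fun a => n a + n' a).
Proof.
rewrite /expand !spureDr.
by rewrite [LHS](AC (4*4) ((1*5)*(2*6)*(3*7)*(4*8)))%AC.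
Qed.

Lemma spure_tE a (n : N) :
  spure (tE a) n = expand (fun c => if c == a then n else 0).
Proof.
by rewrite /expand; case: a => -[] [];
  rewrite /= !spure0r ?(addr0, add0r) ?(tE00, tE10, tE01, tE11).
Qed.

Lemma stens_expand t : exists n, t = expand n.
Proof.
elim/stens_ind: t => [|x n t [n' ->]].
  by exists (fun=> 0); rewrite /expand !spure0r !addr0.
suff [n'' ->] : exists n'', spure x n = expand n'' by rewrite expandD; eexists.
elim: (rspanP x) => [|y z _ [ny Ey] _ [nz Ez]|a m].
- by exists (fun=> 0); rewrite /expand !spure0r spure0l !addr0.
- by rewrite spureDl Ey Ez expandD; eexists.
- by rewrite spureM spure_tE; eexists.
Qed.

(** [E1] is free on [tE] over the right unit, so a tensor amounts to four elements of [N]. All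
    coactions are computed below as such quadruples. *)
Lemma stens_expandE t : t = expand (fun a => slant (rcoord a) t).
Proof.
have [n ->] := stens_expand t; congr expand; apply/funext => a.
by rewrite slant_expand.
Qed.

Lemma stens_eq t u : (forall a, slant (rcoord a) t = slant (rcoord a) u) -> t = u.
Proof.
by move=> E; rewrite (stens_expandE t) (stens_expandE u); congr expand; apply/funext.
Qed.
End Tens.

Section Functorial.
Context (N N' : lmodType M) (f : N -> N').
Hypothesis flin : forall (m : M) x y, f (m *: x + y) = m *: f x + f y.

Lemma lin_add x y : f (x + y) = f x + f y.
Proof. by rewrite -[x]scale1r flin !scale1r. Qed.
Lemma lin_0 : f 0 = 0.
Proof. by apply: (addrI (f 0)); rewrite -lin_add !addr0. Qed.
Lemma lin_scale m x : f (m *: x) = m *: f x.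
Proof. by rewrite -[m *: x]addr0 flin lin_0 addr0. Qed.

Lemma lin_smap_bal : balanced (fun (x : E1) (m : M) => x * etaR m) (fun x n => spure x (f n)).
Proof.
split=> [x x' n|x n n'|x m n]; first by rewrite spureDl.
- by rewrite lin_add spureDr.
- by rewrite spureM lin_scale.
Qed.
Lemma lin_smap_pure (x : E1) n : smap f (spure x n) = spure x (f n).
Proof. exact: (tlift_pure lin_smap_bal). Qed.
Lemma lin_smapD (t u : stens KE N) : smap f (t + u) = smap f t + smap f u.
Proof. exact: (tliftD lin_smap_bal). Qed.
Lemma lin_smap0 : smap f (0 : stens KE N) = 0.
Proof. exact: (tlift0 lin_smap_bal). Qed.
Lemma lin_smapZ (m : M) (t : stens KE N) : smap f (m *: t) = m *: smap f t.
Proof.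
elim/stens_ind: t => [|x n t IH]; first by rewrite scaler0 lin_smap0 scaler0.
rewrite scalerDr !lin_smapD scalerDr IH; congr (_ + _).
by rewrite [m *: spure _ _]stens_scale_pure !lin_smap_pure [m *: spure x (f n)]stens_scale_pure.
Qed.
Lemma smap_expand n : smap f (expand n) = expand (fun a => f (n a)).
Proof. by rewrite /expand !lin_smapD !lin_smap_pure. Qed.
Lemma slant_smap g (t : stens KE N) : rlin g -> slant g (smap f t) = f (slant g t).
Proof.
move=> Hg; elim/stens_ind: t => [|x n t IH].
  rewrite lin_smap0; have S0 (L : lmodType M) : slant g (0 : stens KE L) = 0.
    exact: (tlift0 (slant_bal L Hg)).
  by rewrite !S0 lin_0.
rewrite lin_smapD !slantD // lin_add IH lin_smap_pure !slant_pure //.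
by rewrite lin_scale.
Qed.
(** Tensoring with [E1] is taking four copies. This is needed because the coaction on a Brown-Gitler
    comodule is known only after inclusion into the dual Steenrod algebra. *)
Lemma smap_inj : injective f -> injective (smap f : stens KE N -> stens KE N').
Proof.
move=> fI t u E; apply: stens_eq => a; apply: fI.
by rewrite -!slant_smap ?E //; exact: rcoord_rlin.
Qed.
End Functorial.

Lemma smap_comp (N N' N'' : lmodType M) (f : N -> N') (g : N' -> N'') (t : stens KE N) :
  (forall (m : M) x y, f (m *: x + y) = m *: f x + f y) ->
  (forall (m : M) x y, g (m *: x + y) = m *: g x + g y) ->
  smap g (smap f t) = smap (fun x => g (f x)) t.
Proof.
move=> flin glin.
have gflin (m : M) x y : g (f (m *: x + y)) = m *: g (f x) + g (f y) by rewrite flin glin.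
elim/stens_ind: t => [|x n t IH]; first by rewrite !lin_smap0.
by rewrite (lin_smapD flin) (lin_smapD glin) (lin_smapD gflin) IH (lin_smap_pure flin)
  (lin_smap_pure glin) (lin_smap_pure gflin).
Qed.

Lemma smap_id (N : lmodType M) (t : stens KE N) : smap id t = t.
Proof.
have idl (m : M) (x y : N) : id (m *: x + y) = m *: id x + id y by [].
elim/stens_ind: t => [|x n t IH]; first by rewrite lin_smap0.
by rewrite (lin_smapD idl) IH (lin_smap_pure idl).
Qed.
End E1.

(** * The coproduct of [E(1)^vee] and coassociativity *)

Section Psi.
Context (p : nat) (b : coeff_data).
Hypothesis p_gt0 : (0 < p)%N.
Notation M := (MM p b).
Notation KE := (kill_E 1).
Notation E1 := (steenrod p b KE).
Notation t0 := (tau p b KE 0).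
Notation t1 := (tau p b KE 1).
Notation etaR := (@Defs.etaR p b KE).
Notation etaL := (@Defs.etaL p b KE).

Let killE := fun g => @kill_E_ok p b 1 g p_gt0.

(** In the left factor only [xi_0 = 1], [tau_0] and [tau_1] survive. The default 0 at [k = 0] stands
    for the absent [tau_1] term. *)
Lemma psi_gen_tau (K' : agen -> Prop) k (t : stens KE (steenrod p b K')) :
  psi_gen (Tau k) t = mulop 1 true (tau p b K' k) t + mulop t0 false (xi p b K' k) t
    + mulop t1 false (if k is k'.+1 then xi p b K' k' ^+ p else 0) t.
Proof.
rewrite /= -addrA; congr (_ + _); rewrite big_ord_recl /= subn0 expn0 expr1; congr (_ + _).
case: k => [|k]; first by rewrite big_ord0 mulop_0r.
rewrite big_ord_recl big1 ?addr0 /=; first by rewrite subSS subn0 expn1.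
by move=> i _; rewrite tauE // mulop_0l //; exact: gcentral_xi.
Qed.

Section Expand.
Context (K' : agen -> Prop).
Notation S := (steenrod p b K').
Implicit Types (n : bool * bool -> S).

(** Multiplication by the coproduct of [tau_k] on quadruples. Minus signs come from passing an odd
    left factor, or from [tau_1 tau_0 = - tau_0 tau_1]; the term with [rho] comes from
    [tau_0^2 = rho tau_1]. *)
Definition tau_step k n : bool * bool -> S :=
  let a := xi p b K' k in let c := if k is k'.+1 then xi p b K' k' ^+ p else 0 in
  fun e => match e with
  | (false, false) => tau p b K' k * n (false, false)
  | (true, false) => a * n (false, false) - tau p b K' k * n (true, false)
  | (false, true) => c * n (false, false) - tau p b K' k * n (false, true)
       + (if p == 2%N then rho p b K' * (a * n (true, false)) else 0)
  | (true, true) => tau p b K' k * n (true, true) + a * n (false, true) - c * n (true, false)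
  end.

Lemma sum_shuffle (V : zmodType) (x1 x2 x3 x4 y1 y2 y3 z1 z2 : V) :
  x1 - x2 - x3 + x4 + (y1 + y2 + y3) + (z1 - z2)
  = x1 + (y1 - x2) + (z1 - x3 + y2) + (x4 + y3 - z2).
Proof. by rewrite [LHS](AC (4*3*2) (1*(5*2)*(8*3*6)*(4*7*9)))%AC. Qed.

Lemma psi_gen_tau_expand k n :
  psi_gen (Tau k) (expand n) = expand (tau_step k n).
Proof.
rewrite psi_gen_tau /expand.
set a := xi p b K' k; set c := if k is _.+1 then _ else _; set y := tau p b K' k.
have cy : gcentral true y by exact: (@gcentral_ag p b K' (Tau k)).
have ca : gcentral false a by exact: (@gcentral_ag p b K' (Xi k)).
have cc : gcentral false c.
  rewrite /c; case: (k) => [|k']; last exact: gcentral_xi.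
  by move=> z; rewrite mul0r mulr0.
rewrite !mulopD // !mulop_pure //= sigma1 sigma_t0 sigma_t1 sigma_t01 !mul1r.
rewrite !mulr1 t00 t10 t11 t001 t101 !spure0l !addr0 !spureNl.
have -> : spure (if p == 2%N then t1 * etaR (mrho p b) else 0) (a * n (true, false))
   = spure t1 (if p == 2%N then rho p b K' * (a * n (true, false)) else 0).
  case: eqP => _; last by rewrite spure0l spure0r.
  by rewrite spureM scaleE etaL_mrho.
rewrite sum_shuffle !spureDr !spureNr -/a -/c -/y.
by [].
Qed.
End Expand.

Lemma psi_tau k (x : E1) : psi KE (tau p b KE k * x) = psi_gen (Tau k) (psi KE x).
Proof. exact: psi_mul_gen. Qed.

Definition unitn (K : agen -> Prop) : bool * bool -> steenrod p b K :=
  fun e => if e == (false, false) then 1 else 0.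

Lemma sone_expand (K' : agen -> Prop) : @sone p b KE K' = expand (unitn K').
Proof. by rewrite /expand /unitn /= !spure0r !addr0. Qed.

Definition tabE (c a : bool * bool) : E1 :=
  match c, a with
  | (false, false), (false, false) => 1
  | (true, false), (false, false) => t0
  | (true, false), (true, false) => 1
  | (false, true), (false, false) => t1
  | (false, true), (false, true) => 1
  | (true, true), (false, false) => t0 * t1
  | (true, true), (true, false) => t1
  | (true, true), (false, true) => - t0
  | (true, true), (true, true) => 1
  | _, _ => 0
  end.

Lemma expand_ext (N : lmodType M) (n n' : bool * bool -> N) : n =1 n' -> expand n = expand n'.
Proof. by move=> E; rewrite /expand !E. Qed.

Lemma psi_tE c : psi KE (tE p b c) = expand (tabE c).
Proof.
have p1 : psi KE (1 : E1) = expand (tabE (false, false)).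
  by rewrite psi1 // sone_expand; apply: expand_ext => -[[] []].
have pt1 : psi KE t1 = expand (tabE (false, true)).
  rewrite -[t1]mulr1 psi_tau p1 psi_gen_tau_expand; apply: expand_ext => -[[] []] /=;
  by rewrite ?xi_0 ?xiE // ?expr1n ?(mulr0, mul0r, mulr1, mul1r, subr0, oppr0, addr0, add0r,
    if_same).
case: c => -[] []; rewrite ?(tE00, tE10, tE01, tE11) //.
- rewrite psi_tau pt1 psi_gen_tau_expand; apply: expand_ext => -[[] []] /=;
  by rewrite ?xi_0 ?(mulr0, mul0r, mulr1, mul1r, subr0, oppr0, addr0, add0r, if_same).
- rewrite -[t0]mulr1 psi_tau p1 psi_gen_tau_expand; apply: expand_ext => -[[] []] /=;
  by rewrite ?xi_0 ?(mulr0, mul0r, mulr1, mul1r, subr0, oppr0, addr0, add0r, if_same).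
Qed.

Definition rmul (m : M) (x : E1) : E1 := x * etaR m.
Lemma rmul_lin m (r : M) x y : rmul m (r *: x + y) = r *: rmul m x + rmul m y.
Proof. by rewrite /rmul mulrDl !scaleE mulrA. Qed.

Lemma mulop_rmul m (x : E1) s (y : E1) (t : stens KE E1) : gcentral s y ->
  mulop x s y (smap (rmul m) t) = smap (rmul m) (mulop x s y t).
Proof.
move=> cy; have rl := rmul_lin m.
elim/stens_ind: t => [|c d t IH]; first by rewrite (lin_smap0 rl) mulop0 // (lin_smap0 rl).
rewrite (lin_smapD rl) !mulopD // (lin_smapD rl) IH; congr (_ + _).
by rewrite (lin_smap_pure rl) !mulop_pure // (lin_smap_pure rl) /rmul mulrA.
Qed.

Lemma psi_gen_rmul m g (t : stens KE E1) :
  psi_gen g (smap (rmul m) t) = smap (rmul m) (psi_gen g t).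
Proof.
have rl := rmul_lin m.
have S_ (n : nat) (F : 'I_n -> stens KE E1) :
    smap (rmul m) (\sum_(i < n) F i) = \sum_(i < n) smap (rmul m) (F i).
  by apply: (big_morph _ (lin_smapD rl) (lin_smap0 rl)).
case: g => [h|k|k] /=.
- by apply: mulop_rmul; exact: gcentral1.
- by rewrite S_; apply: eq_bigr => i _; apply: mulop_rmul; exact: gcentral_xi.
- rewrite (lin_smapD rl) S_; congr (_ + _).
    by apply: mulop_rmul; exact: (@gcentral_ag _ _ _ (Tau k)).
  by apply: eq_bigr => i _; apply: mulop_rmul; exact: gcentral_xi.
Qed.

Lemma psiN (x : E1) : psi KE (- x) = - psi KE x.
Proof.
by apply: (addrI (psi KE x)); rewrite -psiD // !subrr psi0.
Qed.

(** Each [psi_gen] commutes with right multiplication in the right factor, so the identity spreads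
    from 1 to all elements. It is conditional on one [m] because the induction for [psi_etaR] uses
    it on a factor. *)
Lemma psi_rmul_of m : psi KE (etaR m) = spure 1 (etaR m) ->
  forall x, psi KE (x * etaR m) = smap (rmul m) (psi KE x).
Proof.
move=> H; have rl := rmul_lin m.
have H1 : psi KE (1 * etaR m) = smap (rmul m) (psi KE (1 : E1)).
  by rewrite mul1r H psi1 // (lin_smap_pure rl) /rmul mul1r.
suff Hx (a : rexpr agen) (y : E1) : psi KE (y * etaR m) = smap (rmul m) (psi KE y) ->
    psi KE (reval (ag p b KE) a * y * etaR m) = smap (rmul m) (psi KE (reval (ag p b KE) a * y)).
  elim/pres_ind=> a; rewrite rclassE -/(ag p b KE) -[reval _ a]mulr1; exact: Hx.
elim: a y => [g|||a IH|a IHa c IHc|a IHa c IHc] y Hy /=.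
- by rewrite -mulrA !psi_mul_gen // Hy psi_gen_rmul.
- by rewrite !mul0r psi0 // (lin_smap0 rl).
- by rewrite !mul1r.
- rewrite !mulNr !psiN IH //; apply: (addrI (smap (rmul m) (psi KE (reval (ag p b KE) a * y)))).
  by rewrite -(lin_smapD rl) !subrr (lin_smap0 rl).
- by rewrite !mulrDl !psiD // IHa // IHc // (lin_smapD rl).
- by rewrite -[_ * reval _ c * y]mulrA IHa ?IHc.
Qed.

Lemma psi_etaR m : psi KE (etaR m) = spure 1 (etaR m).
Proof.
have mV := @etaR_model p b KE; have mL := @etaL_model p b KE.
have g1 h : psi KE (ag p b KE (Mg h)) = spure (ag p b KE (Mg h)) (1 : E1).
  rewrite -[ag p b KE (Mg h)]mulr1 psi_mul_gen // psi1 //=.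
  by rewrite mulop_pure ?mulr1 ?mul1r //; exact: gcentral1.
have etaRg : etaR (pgen (mrel p b) Gamma) = ag p b KE (Mg Gamma).
  by rewrite /Defs.etaR (pmap_ring_gen mV).
have etaLg h : etaL (pgen (mrel p b) h) = ag p b KE (Mg h).
  by rewrite /Defs.etaL (pmap_ring_gen mL).
elim/pres_ind: m => a; rewrite rclassE.
elim: a => [g|||a IH|a IHa c IHc|a IHa c IHc] /=.
- case: g; last first.
    by rewrite etaRg g1 -{1}[ag _ _ _ _]mul1r -{1}etaRg spureM scaleE etaLg mulr1.
  rewrite {1}/Defs.etaR (pmap_ring_gen mV) psiD // g1.
  rewrite (_ : psi KE (- (rho p b KE * t0)) = - psi KE (rho p b KE * t0)); last exact: psiN.
  have -> : psi KE (rho p b KE * t0) = spure (rho p b KE * t0) (1 : E1) + spure (rho p b KE) t0.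
    rewrite rhoE; case: (coeff_bock b); last by rewrite mul0r psi0 // !spure0l addr0.
    rewrite psi_mul_gen // -tE10 psi_tE /expand /= !spure0r !addr0.
    have c1 := @gcentral1 p b KE.
    by rewrite mulopD // !mulop_pure //= !mulr1 !mul1r addrC tE10.
  (* The terms with right factor 1 add up to the right unit of [theta] on the left, which crosses
     the tensor sign as [theta]; with [rho] moved across too, this gives [theta - rho tau_0] on the
     right. *)
  rewrite opprD addrA -spureNl -spureDl.
  rewrite (_ : _ - _ = 1 * etaR (pgen (mrel p b) Theta)); last first.
    by rewrite mul1r /Defs.etaR (pmap_ring_gen mV).
  rewrite -[rho p b KE]mul1r -etaR_mrho !spureM !scaleE etaL_mrho etaLg mulr1.
  by rewrite -spureNr -spureDr /Defs.etaR (pmap_ring_gen mV).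
- by rewrite etaR0 psi0 // spure0r.
- by rewrite etaR1 psi1.
- by rewrite etaRN psiN // IH spureNr.
- by rewrite etaRD psiD // IHa IHc spureDr.
- by rewrite etaRM (psi_rmul_of IHc) IHa (lin_smap_pure (rmul_lin _)).
Qed.

Lemma psi_rmul m x : psi KE (x * etaR m) = smap (rmul m) (psi KE x).
Proof. exact: psi_rmul_of (psi_etaR m) x. Qed.

Section PsiTens.
Context (N : lmodType M).

Lemma spure_lin (n : N) (m : M) (x y : E1) :
  spure (m *: x + y) n = m *: (spure x n : stens KE N) + spure y n.
Proof. by rewrite spureDl [m *: spure _ _]stens_scale_pure. Qed.

Lemma psi_tens_bal : balanced (fun (x : E1) (m : M) => x * etaR m)
  (fun (x : E1) (n : N) => smap (fun y : E1 => spure y n) (psi KE x)).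
Proof.
split=> [x x' n|x n n'|x m n].
- by rewrite psiD // (lin_smapD (spure_lin n)).
- elim/stens_ind: (psi KE x) => [|c d t IH].
    by rewrite !(lin_smap0 (spure_lin _)) addr0.
  rewrite !(lin_smapD (spure_lin _)) IH addrACA; congr (_ + _).
  by rewrite !(lin_smap_pure (spure_lin _)) spureDr spureDr.
- rewrite psi_rmul smap_comp; [|exact: rmul_lin|exact: spure_lin].
  by congr (smap _ _); apply/funext => y; rewrite /rmul spureM.
Qed.

Lemma psi_tens_pure x (n : N) :
  psi_tens (spure x n) = smap (fun y : E1 => spure y n) (psi KE x).
Proof. exact: (tlift_pure psi_tens_bal). Qed.
Lemma psi_tensD (t u : stens KE N) : psi_tens (t + u) = psi_tens t + psi_tens u.
Proof. exact: (tliftD psi_tens_bal). Qed.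

Lemma slant_psi_tens a (n : bool * bool -> N) :
  slant (rcoord a) (psi_tens (expand n))
  = spure (tabE (false, false) a) (n (false, false)) + spure (tabE (true, false) a) (n (true,
    false))
    + spure (tabE (false, true) a) (n (false, true)) + spure (tabE (true, true) a) (n (true, true)).
Proof.
have Hr := rcoord_rlin p b a.
rewrite /expand -tE11 -tE10 -tE01 -tE00 !psi_tensD !(slantD Hr) !psi_tens_pure.
by rewrite !(slant_smap (spure_lin _)) // !psi_tE !slant_expand.
Qed.
End PsiTens.

Section Coassoc.
Context (N : comod p b) (co : is_comodule N).
Notation coact := (@cm_coact p b N).
Definition cocoef a (x : N) : N := slant (rcoord a) (coact x).

Lemma coact_expand x : coact x = expand (cocoef^~ x).
Proof. exact: stens_expandE. Qed.

(** Coassociativity read as a multiplication table: contracting the first of the two [E1] factors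
    with the functional dual to [tE a] leaves the entries of [tabE]. *)
Lemma coact_comp a x : coact (cocoef a x) =
  spure (tabE (false, false) a) x + spure (tabE (true, false) a) (cocoef (true, false) x)
    + spure (tabE (false, true) a) (cocoef (false, true) x)
    + spure (tabE (true, true) a) (cocoef (true, true) x).
Proof.
have c0 : cocoef (false, false) x = x.
  by rewrite -[RHS](cm_counit co) /cocoef -(slant_ext (@counit_rcoord p b)).
have := congr1 (slant (rcoord a)) (cm_coassoc co x).
rewrite (slant_smap (cm_coactP co)); last exact: (rcoord_rlin p b).
by rewrite {1}coact_expand slant_psi_tens c0 => <-.
Qed.
End Coassoc.
End Psi.

(** * Degrees of coordinates *)

Section Graded.
Context (p : nat) (b : coeff_data).
Hypothesis p_gt0 : (0 < p)%N.
Hypothesis wt1 : p = 2%N -> coeff_wt b = 1%N.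
Notation M := (MM p b).
Notation KE := (kill_E 1).
Notation E1 := (steenrod p b KE).
Notation t0 := (tau p b KE 0).
Notation t1 := (tau p b KE 1).
Notation etaR := (@Defs.etaR p b KE).
Notation etaL := (@Defs.etaL p b KE).
Notation tE := (tE p b).

Definition degE (a : bool * bool) : int * int :=
  adeg p b (Tau 0) *+ a.1 + adeg p b (Tau 1) *+ a.2.

Lemma homog_tE a : homog (adeg p b) (degE a) (tE a).
Proof.
rewrite /degE; case: a => -[] [];
  rewrite /= ?mulr1n ?mulr0n ?addr0 ?add0r ?(tE00, tE10, tE01, tE11).
- exact: (homogM (homog_ag p b KE (Tau 0)) (homog_ag p b KE (Tau 1))).
- exact: (homog_ag p b KE (Tau 0)).
- exact: (homog_ag p b KE (Tau 1)).
- exact: homog1.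
Qed.

(** Projecting [x] to its own degree changes nothing, yet it projects each coordinate in the
    homogeneous basis [tE]; uniqueness of coordinates finishes. *)
Lemma homog_rcoord d a (x : E1) : homog (adeg p b) d x -> homog (mdeg b) (d - degE a) (rcoord a x).
Proof.
move=> Hx; have Eh := arel_homog wt1 (K := KE); have Mh := @mrel_homog p b.
pose pr e (m : M) := gproj (mdeg b) e m.
have prP e c m : gproj (adeg p b) e (tE c * etaR m) = tE c * etaR (pr (e - degE c) m).
  elim/(pres_homog_ind (E := mrel p b) (deg := mdeg b)): m => [|e' m m' Hm IH].
    by rewrite /pr (gproj0 Mh) etaR0 mulr0 (gproj0 Eh).
  rewrite etaRD mulrDr (gprojD Eh) IH /pr (gprojD Mh) etaRD mulrDr; congr (_ + _).
  rewrite (gproj_homog Eh _ (homogM (homog_tE c) (homog_etaR wt1 KE Hm))).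
  rewrite (gproj_homog Mh _ Hm) subr_eq addrC.
  by case: eqP => // _; rewrite etaR0 mulr0.
have xE : x = \sum_c tE c * etaR (rcoord c x).
  elim: (rspanP x) => [|y z _ IHy _ IHz|c m].
  - rewrite big1 // => c _; have [D _] := rcoord_rlin p b c.
    have -> : rcoord c (0 : E1) = 0 by apply: (addrI (rcoord c (0 : E1))); rewrite -D !addr0.
    by rewrite etaR0 mulr0.
  - rewrite {1}IHy {1}IHz -big_split; apply: eq_bigr => c _.
    by rewrite (rlinD (rcoord_rlin p b c)) etaRD mulrDr.
  - rewrite (bigD1 c) //= big1 ?addr0 => [|c' ne].
      by rewrite (rlinM (rcoord_rlin p b c)) rcoordE eqxx mul1r.
    by rewrite (rlinM (rcoord_rlin p b c')) rcoordE (negbTE ne) mul0r etaR0 mulr0.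
have -> : rcoord a x = pr (d - degE a) (rcoord a x); last exact: homog_gproj.
have E2 : x = \sum_c tE c * etaR (pr (d - degE c) (rcoord c x)).
  have <- : gproj (adeg p b) d x = x by rewrite (gproj_homog Eh _ Hx) eqxx.
  rewrite {1}xE (big_morph _ (gprojD Eh d) (gproj0 Eh d)); apply: eq_bigr => c _.
  by rewrite prP (gproj_homog Eh _ Hx) eqxx.
rewrite {1}E2 (big_morph _ (rlinD (rcoord_rlin p b a)) (id1 := 0)); last first.
  by apply: (addrI (rcoord a (0 : E1))); rewrite -(rlinD (rcoord_rlin p b a)) !addr0.
rewrite (bigD1 a) //= big1 ?addr0 => [|c' ne].
  by rewrite (rlinM (rcoord_rlin p b a)) rcoordE eqxx mul1r.
by rewrite (rlinM (rcoord_rlin p b a)) rcoordE eq_sym (negbTE ne) mul0r.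
Qed.

Section Comodule.
Context (N : comod p b) (co : is_comodule N).

Lemma cm_grD d (x y : N) : cm_gr d x -> cm_gr d y -> cm_gr d (x + y).
Proof.
move=> Hx Hy; rewrite -[y]opprK; apply: (cm_grB co) => //; rewrite -sub0r.
by apply: (cm_grB co) => //; exact: cm_gr0.
Qed.

Lemma cm_gr_comp d a (x : N) : cm_gr d x -> cm_gr (d - degE a) (cocoef a x).
Proof.
move=> /(cm_coact_gr co); rewrite /cocoef; have Hr := rcoord_rlin p b a.
elim=> {x} [e|e t u _ IHt _ IHu|e e' x n Hx Hn].
- rewrite (_ : slant _ _ = 0); first exact: (cm_gr0 co).
  exact: (tlift0 (slant_bal N Hr)).
- by rewrite (slantD Hr); exact: cm_grD.
- rewrite (slant_pure Hr) addrAC; apply: (cm_grZ co) => //; exact: homog_rcoord.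
Qed.
End Comodule.
End Graded.

(** * The lightning flash comodule *)

Section Flash.
Context (p : nat) (b : coeff_data).
Hypothesis p_gt0 : (0 < p)%N.
Hypothesis wt1 : p = 2%N -> coeff_wt b = 1%N.
Context (nu : nat).
Notation M := (MM p b).
Notation KE := (kill_E 1).
Notation E1 := (steenrod p b KE).
Notation t0 := (tau p b KE 0).
Notation t1 := (tau p b KE 1).

(** Neighbouring generators share one image, so [nu] generators have [nu + 1] images. For [nu = 0]
    what remains is a single copy of [M], as it should. *)
Definition flash_mod : lmodType M := ({ffun 'I_nu -> M^o} * {ffun 'I_nu.+1 -> M^o})%type.
Notation L := flash_mod.

Definition comb (N : lmodType M) (X : 'I_nu -> N) (Z : 'I_nu.+1 -> N) (w : L) : N :=
  \sum_i (w.1 i : M) *: X i + \sum_j (w.2 j : M) *: Z j.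

(** [xb i] is the generator [x_{i+1}]; the elements [zb j] are the images of the generators
    under [Q_0] and [Q_1]. *)
Definition xb (i : 'I_nu) : L := ([ffun i' => (i' == i)%:R], 0).
Definition zb (j : 'I_nu.+1) : L := (0, [ffun j' => (j' == j)%:R]).

Section Comb.
Context (N : lmodType M) (X : 'I_nu -> N) (Z : 'I_nu.+1 -> N).
Lemma comb_lin (m : M) x y : comb X Z (m *: x + y) = m *: comb X Z x + comb X Z y.
Proof.
rewrite /comb scalerDr addrACA !scaler_sumr -!big_split /=; congr (_ + _).
  by apply: eq_bigr => i _; rewrite !ffunE scalerDl scalerA.
by apply: eq_bigr => i _; rewrite !ffunE scalerDl scalerA.
Qed.
Lemma comb_xb i : comb X Z (xb i) = X i.
Proof.
rewrite /comb /= [X in _ + X]big1 => [|j _]; last by rewrite ffunE scale0r.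
rewrite addr0 (bigD1 i) //= ffunE eqxx scale1r big1 ?addr0 // => i' ne.
by rewrite ffunE (negbTE ne) scale0r.
Qed.
Lemma comb_zb j : comb X Z (zb j) = Z j.
Proof.
rewrite /comb /= [X in X + _]big1 => [|i _]; last by rewrite ffunE scale0r.
rewrite add0r (bigD1 j) //= ffunE eqxx scale1r big1 ?addr0 // => j' ne.
by rewrite ffunE (negbTE ne) scale0r.
Qed.
End Comb.

Lemma comb_basis w : w = comb xb zb w.
Proof.
have sum_pair (J : finType) (F : J -> L) : \sum_j F j = (\sum_j (F j).1, \sum_j (F j).2).
  elim/big_rec3: _ => // j f g h _ ->.
  by [].
rewrite /comb !sum_pair; apply: injective_projections => /=; apply/ffunP => i.
  rewrite ffunE !sum_ffunE [X in _ + X]big1 ?addr0 => [|j _]; last by rewrite scaler0 ffunE.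
  rewrite (bigD1 i) //= !ffunE eqxx big1 ?addr0 => [|i' ne]; first by rewrite [RHS]mulr1.
  by rewrite !ffunE eq_sym (negbTE ne) [LHS]mulr0.
rewrite ffunE !sum_ffunE [X in X + _]big1 ?add0r => [|j _]; last by rewrite scaler0 ffunE.
rewrite (bigD1 i) //= !ffunE eqxx big1 ?addr0 => [|i' ne]; first by rewrite [RHS]mulr1.
by rewrite !ffunE eq_sym (negbTE ne) [LHS]mulr0.
Qed.

Lemma lin_comb (N N' : lmodType M) (X : 'I_nu -> N) (Z : 'I_nu.+1 -> N) (f : N -> N') w :
  (forall (m : M) x y, f (m *: x + y) = m *: f x + f y) ->
  f (comb X Z w) = comb (fun i => f (X i)) (fun j => f (Z j)) w.
Proof.
move=> fl; have f0 := lin_0 fl; have fD := lin_add fl.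
rewrite /comb fD !(big_morph f fD f0); congr (_ + _);
by apply: eq_bigr => i _; rewrite (lin_scale fl).
Qed.

Lemma flash_ext (N : lmodType M) (f g : L -> N) :
  (forall (m : M) x y, f (m *: x + y) = m *: f x + f y) ->
  (forall (m : M) x y, g (m *: x + y) = m *: g x + g y) ->
  (forall i, f (xb i) = g (xb i)) -> (forall j, f (zb j) = g (zb j)) -> f =1 g.
Proof.
move=> fl gl Ex Ez w; rewrite (comb_basis w) (lin_comb _ _ _ fl) (lin_comb _ _ _ gl).
by congr (_ + _); apply: eq_bigr => i _; rewrite ?Ex ?Ez.
Qed.

Definition zlo (i : 'I_nu) : 'I_nu.+1 := widen_ord (leqnSn nu) i.
Definition zhi (i : 'I_nu) : 'I_nu.+1 := lift ord0 i.

Definition xcoef (N : lmodType M) (X : 'I_nu -> N) (Z : 'I_nu.+1 -> N) i (a : bool * bool) : N :=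
  match a with
  | (false, false) => X i | (true, false) => Z (zhi i) | (false, true) => Z (zlo i)
  | _ => 0 end.
Definition zcoef (N : lmodType M) (Z : 'I_nu.+1 -> N) j (a : bool * bool) : N :=
  if a == (false, false) then Z j else 0.

Definition flash_coact : L -> stens KE L :=
  comb (fun i => expand (xcoef xb zb i)) (fun j => expand (zcoef zb j)).

Definition xdeg (i : nat) : int * int := (2 * i%:Z * (p%:Z - 1) + 1, i%:Z * (p%:Z - 1)).
Definition zdeg (i : nat) : int * int := (2 * i%:Z * (p%:Z - 1), i%:Z * (p%:Z - 1)).

Definition flash_gr (d : int * int) (w : L) : Prop :=
  (forall i : 'I_nu, homog (mdeg b) (d - xdeg i.+1) (w.1 i : M)) /\
  (forall j : 'I_nu.+1, homog (mdeg b) (d - zdeg j) (w.2 j : M)).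

Definition flash : comod p b := @Comod p b L flash_gr flash_coact.

Lemma flash_coact_lin (m : M) x y :
  flash_coact (m *: x + y) = m *: flash_coact x + flash_coact y.
Proof. exact: comb_lin. Qed.
Lemma flash_coact_xb i : flash_coact (xb i) = expand (xcoef xb zb i).
Proof. exact: comb_xb. Qed.
Lemma flash_coact_zb j : flash_coact (zb j) = expand (zcoef zb j).
Proof. exact: comb_zb. Qed.

Let Mh := @mrel_homog p b.

Lemma homogB d (x y : M) : homog (mdeg b) d x -> homog (mdeg b) d y -> homog (mdeg b) d (x - y).
Proof. by move=> Hx Hy; apply: homogD => //; exact: homogN. Qed.

Lemma homog_delta (d : int * int) (J : eqType) (i j : J) (deg : J -> int * int) :
  deg j = d -> homog (mdeg b) (d - deg i) ((i == j)%:R : M).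
Proof.
move=> <-; case: eqP => [->|_]; last exact: homog0.
by rewrite subrr; exact: homog1.
Qed.

Lemma flash_gr_xb (i : 'I_nu) : flash_gr (xdeg i.+1) (xb i).
Proof.
split=> [i'|j] /=; rewrite ffunE; last exact: homog0.
exact: (@homog_delta _ _ i' i (fun i : 'I_nu => xdeg i.+1)).
Qed.
Lemma flash_gr_zb (j : 'I_nu.+1) : flash_gr (zdeg j) (zb j).
Proof.
split=> [i'|j'] /=; rewrite ffunE; first exact: homog0.
exact: (@homog_delta _ _ j' j (fun j : 'I_nu.+1 => zdeg j)).
Qed.

Lemma flash_gr_add d x y : flash_gr d x -> flash_gr d y -> flash_gr d (x + y).
Proof. by move=> [H1 H2] [H3 H4]; split=> i /=; rewrite ffunE; exact: homogD. Qed.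
Lemma flash_gr_0 d : flash_gr d 0.
Proof. by split=> i /=; rewrite ffunE; exact: homog0. Qed.

(** That [c] vanishes outside [D] allows decompositions over different index lists to be added. *)
Definition graded_sum (N : zmodType) (gr : int * int -> N -> Prop) (x : N) :=
  exists (D : seq (int * int)) (c : int * int -> N),
    [/\ uniq D, forall d, gr d (c d), forall d, d \notin D -> c d = 0 & x = \sum_(d <- D) c d].

Lemma graded_sumD (N : zmodType) (gr : int * int -> N -> Prop) x y :
  (forall d x y, gr d x -> gr d y -> gr d (x + y)) ->
  graded_sum gr x -> graded_sum gr y -> graded_sum gr (x + y).
Proof.
move=> grD [D [c [uD Hc c0 ->]]] [D' [c' [uD' Hc' c0' ->]]].
have ext (D1 D2 : seq (int * int)) (f : int * int -> N) : uniq D1 -> uniq D2 ->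
    {subset D1 <= D2} -> (forall d, d \notin D1 -> f d = 0) ->
    \sum_(d <- D1) f d = \sum_(d <- D2) f d.
  move=> u1 u2 s12 f0; rewrite [RHS](bigID (mem D1)) /= [X in _ + X]big1 // addr0.
  rewrite -[RHS]big_filter; apply: perm_big; apply: uniq_perm => //; first exact: filter_uniq.
  by move=> d; rewrite mem_filter /=; case d1: (d \in D1) => //=; rewrite s12.
exists (undup (D ++ D')), (fun d => c d + c' d); split.
- exact: undup_uniq.
- by move=> d; exact: grD.
- by move=> d; rewrite mem_undup mem_cat negb_or => /andP[/c0 -> /c0' ->]; rewrite addr0.
- rewrite big_split /=; congr (_ + _); apply: ext; rewrite ?undup_uniq // => d dD;
  by rewrite mem_undup mem_cat dD ?orbT.
Qed.

Lemma graded_sum1 (N : zmodType) (gr : int * int -> N -> Prop) d x :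
  (forall d, gr d 0) -> gr d x -> graded_sum gr x.
Proof.
move=> gr0 Hx; exists [:: d], (fun e => if e == d then x else 0); split=> //.
- by move=> e; case: eqP => [->|_].
- by move=> e; rewrite inE => /negbTE ->.
- by rewrite big_seq1 eqxx.
Qed.

Lemma graded_sum_big (N : zmodType) (gr : int * int -> N ->
  Prop) (J : Type) (r : seq J) (F : J -> N) :
  (forall d, gr d 0) -> (forall d x y, gr d x -> gr d y -> gr d (x + y)) ->
  (forall j, graded_sum gr (F j)) -> graded_sum gr (\sum_(j <- r) F j).
Proof.
move=> gr0 grD H; elim: r => [|j r IH]; last by rewrite big_cons; exact: graded_sumD.
rewrite big_nil; exact: (graded_sum1 (d := 0)).
Qed.

Lemma flash_gr_scale d e (m : M) (x : L) :
  homog (mdeg b) d m -> flash_gr e x -> flash_gr (d + e) (m *: x).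
Proof.
move=> Hm [H1 H2]; split=> i; rewrite ffunE -addrA; apply: homogM => //.
Qed.

Lemma flash_graded w : graded_sum flash_gr w.
Proof.
rewrite (comb_basis w) /comb.
have H (m : M) d x : flash_gr d x -> graded_sum flash_gr (m *: x).
  move=> Hx; elim/(pres_homog_ind (E := mrel p b) (deg := mdeg b)): m => [|e m m' Hm IH].
    by rewrite scale0r; apply: (graded_sum1 (d := 0)) => //; exact: flash_gr_0.
  rewrite (scalerDl (_ : L) (m : M)); apply: graded_sumD IH; first exact: flash_gr_add.
  apply: graded_sum1; first exact: flash_gr_0.
  exact: flash_gr_scale Hm Hx.
apply: graded_sumD; first exact: flash_gr_add.
  apply: graded_sum_big => [d|d x y|i]; [exact: flash_gr_0|exact: flash_gr_add|].
  exact: H (flash_gr_xb i).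
apply: graded_sum_big => [d|d x y|j]; [exact: flash_gr_0|exact: flash_gr_add|].
exact: H (flash_gr_zb j).
Qed.

Lemma homog_indep_shift (D : seq (int * int)) (c : int * int -> M) e :
  uniq D -> (forall d, homog (mdeg b) (d - e) (c d)) -> \sum_(d <- D) c d = 0 ->
  forall d, d \in D -> c d = 0.
Proof.
move=> uD Hc S d dD.
have /= := @homog_indep _ _ _ Mh [seq d - e | d <- D] (fun d => c (d + e)) _ _ _ (d - e).
rewrite subrK; apply.
- by rewrite map_inj_uniq //; exact: addIr.
- by move=> d' _; rewrite -{1}(addrK e d').
- by rewrite big_map -[RHS]S; apply: eq_bigr => d' _; rewrite subrK.
- exact: map_f.
Qed.

Lemma degE_tau0 : adeg p b (Tau 0) = (1, 0).
Proof. by apply: injective_projections; rewrite /= expn0. Qed.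
(** Together with [xdeg_lo] this is the consistency of the zigzag: [tau_1] exceeds [tau_0] in degree
    by exactly one step from [x_i] to [x_{i+1}]. *)
Lemma xdeg_hi i : xdeg i.+1 = adeg p b (Tau 0) + zdeg i.+1.
Proof. by rewrite degE_tau0; apply: injective_projections; rewrite /=; lia. Qed.
Lemma xdeg_lo i : xdeg i.+1 = adeg p b (Tau 1) + zdeg i.
Proof. by apply: injective_projections; rewrite /= expn1; lia. Qed.

Lemma spure_gr d e (N : comod p b) (x : E1) (n : N) : homog (adeg p b) d x -> cm_gr e n ->
  stens_gr (@cm_gr p b N) (d + e) (spure x n).
Proof. exact: stens_gr_pure. Qed.

Lemma stens_gr_scale (N : comod p b) d e m (t : stens KE N) :
  homog (mdeg b) d m -> stens_gr (@cm_gr p b N) e t ->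
  stens_gr (@cm_gr p b N) (d + e) (m *: t).
Proof.
move=> Hm; elim=> {t} [e'|e' t u _ IHt _ IHu|e1 e2 x n Hx Hn].
- by rewrite scaler0; exact: stens_gr0.
- by rewrite scalerDr; exact: stens_grD.
- rewrite [m *: _]stens_scale_pure addrA; apply: stens_gr_pure => //.
  by apply: homogM => //; exact: homog_etaL.
Qed.

Lemma stens_gr_sum (N : comod p b) d (J : Type) (r : seq J) (F : J -> stens KE N) :
  (forall j, stens_gr (@cm_gr p b N) d (F j)) ->
  stens_gr (@cm_gr p b N) d (\sum_(j <- r) F j).
Proof.
by move=> H; apply: big_ind => //; [exact: stens_gr0|exact: stens_grD].
Qed.

Lemma flash_coact_gr d (w : flash) : cm_gr d w ->
  stens_gr (@cm_gr p b flash) d (cm_coact w).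
Proof.
move=> [H1 H2]; rewrite /= /flash_coact /comb.
apply: stens_grD; apply: (@stens_gr_sum flash) => j.
  rewrite -[d](subrK (xdeg j.+1)); apply: (@stens_gr_scale flash) => //.
  rewrite /expand /=; apply: stens_grD; last by rewrite spure0r; exact: stens_gr0.
  apply: stens_grD; [apply: stens_grD|].
  - rewrite -[xdeg _]add0r; apply: (@spure_gr _ _ flash); [exact: homog1|exact: flash_gr_xb].
  - rewrite xdeg_hi; apply: (@spure_gr _ _ flash); first exact: homog_ag.
    exact: (flash_gr_zb (zhi j)).
  - rewrite xdeg_lo; apply: (@spure_gr _ _ flash); first exact: homog_ag.
    exact: (flash_gr_zb (zlo j)).
rewrite -[d](subrK (zdeg j)); apply: (@stens_gr_scale flash) => //.
rewrite /expand /= !spure0r !addr0 -[zdeg _]add0r.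
by apply: (@spure_gr _ _ flash); [exact: homog1|exact: flash_gr_zb].
Qed.

Lemma slant_counit_lin (N : lmodType M) (m : M) (t u : stens KE N) :
  slant (@counit p b) (m *: t + u) = m *: slant (@counit p b) t + slant (@counit p b) u.
Proof.
have Hc := counit_rlin p b.
rewrite (slantD Hc); congr (_ + _).
have S0 : slant (@counit p b) (0 : stens KE N) = 0 by exact: (tlift0 (slant_bal N Hc)).
elim/stens_ind: t => [|x n t IH]; first by rewrite scaler0 S0 scaler0.
rewrite scalerDr !(slantD Hc) scalerDr IH; congr (_ + _).
rewrite [m *: _]stens_scale_pure !(slant_pure Hc) scalerA; congr (_ *: _).
rewrite scaleE /counit (pmap_ringM (@counit_model p b)); congr (_ * _).
rewrite (pmap_etaL _ (@counit_model p b)) -[RHS](rclassK m) rclassE /pmap_ring.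
by elim: (repr m) => //= [a ->|a -> c ->|a -> c ->].
Qed.

Lemma psi_tens_lin (N : lmodType M) (m : M) (t u : stens KE N) :
  psi_tens (m *: t + u) = m *: psi_tens t + psi_tens u.
Proof.
rewrite psi_tensD //; congr (_ + _).
have P0 : psi_tens (0 : stens KE N) = 0 by apply: (addrI (psi_tens (0 : stens KE N)));
  rewrite -psi_tensD // !addr0.
elim/stens_ind: t => [|x n t IH]; first by rewrite scaler0 P0 scaler0.
rewrite scalerDr !psi_tensD // scalerDr IH; congr (_ + _).
rewrite [m *: spure _ _]stens_scale_pure !psi_tens_pure // psiZ; last by move=> g; exact: kill_E_ok.
by rewrite (lin_smapZ (spure_lin n)).
Qed.

Lemma flash_is_comodule : is_comodule flash.
Proof.
split=> /=.
- exact: flash_gr_0.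
- move=> d x y [H1 H2] [H3 H4]; split=> i /=; rewrite !ffunE; exact: homogB.
- exact: flash_gr_scale.
- move=> w; have [D [c [_ Hc _ E]]] := flash_graded w; by exists D, c.
- move=> D c uD Hc S d dD; apply: injective_projections; apply/ffunP => i; rewrite ffunE.
    have S1 : \sum_(d <- D) ((c d).1 i : M) = 0.
      have S' := congr1 (fun w : L => w.1 i) S; rewrite ffunE in S'; rewrite -[RHS]S' {S'}.
      by elim: (D) => [|e r IH]; rewrite ?big_nil ?ffunE // !big_cons /= ffunE IH.
    exact: (homog_indep_shift uD (fun d => (Hc d).1 i) S1 dD).
  have S1 : \sum_(d <- D) ((c d).2 i : M) = 0.
    have S' := congr1 (fun w : L => w.2 i) S; rewrite ffunE in S'; rewrite -[RHS]S' {S'}.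
    by elim: (D) => [|e r IH]; rewrite ?big_nil ?ffunE // !big_cons /= ffunE IH.
  exact: (homog_indep_shift uD (fun d => (Hc d).2 i) S1 dD).
- exact: flash_coact_lin.
- exact: flash_coact_gr.
- have sl : forall (m : M) (t u : stens KE L),
      smap flash_coact (m *: t + u) = m *: smap flash_coact t + smap flash_coact u.
    by move=> m t u; rewrite (lin_smapD flash_coact_lin) (lin_smapZ flash_coact_lin).
  apply: flash_ext => [m x y|m x y|i|j].
  + by rewrite flash_coact_lin psi_tens_lin.
  + by rewrite flash_coact_lin sl.
  + rewrite flash_coact_xb; apply: stens_eq => a; rewrite slant_psi_tens //.
    rewrite (smap_expand flash_coact_lin) slant_expand.
    case: a => -[] []; rewrite /= ?flash_coact_xb ?flash_coact_zb ?(lin_0 flash_coact_lin);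
      by rewrite ?/expand /= ?spure0l ?spure0r ?addr0 ?add0r.
  + rewrite flash_coact_zb; apply: stens_eq => a; rewrite slant_psi_tens //.
    rewrite (smap_expand flash_coact_lin) slant_expand.
    case: a => -[] []; rewrite /zcoef /= ?flash_coact_zb ?(lin_0 flash_coact_lin);
      by rewrite ?/expand /= ?spure0l ?spure0r ?addr0 ?add0r.
- apply: flash_ext => [m x y|m x y|i|j] //.
  + by rewrite flash_coact_lin [LHS]slant_counit_lin.
  + rewrite flash_coact_xb -[LHS]/(slant _ _) (slant_ext (@counit_rcoord p b)).
    by rewrite slant_expand.
  + rewrite flash_coact_zb -[LHS]/(slant _ _) (slant_ext (@counit_rcoord p b)).
    by rewrite slant_expand.
Qed.
End Flash.

(** * The universal property of the flash *)

Section Lightning.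
Context (p : nat) (b : coeff_data).
Hypothesis p_gt0 : (0 < p)%N.
Hypothesis wt1 : p = 2%N -> coeff_wt b = 1%N.
Notation M := (MM p b).
Notation KE := (kill_E 1).
Notation E1 := (steenrod p b KE).
Notation t0 := (tau p b KE 0).
Notation t1 := (tau p b KE 1).

Lemma ract_milnor (N : comod p b) (x : N) i : (i <= 1)%N ->
  ract x (@milnor p b i) = cocoef (if i == 0%N then (true, false) else (false, true)) x.
Proof. by move=> i1; rewrite -[LHS]/(slant _ _) (slant_ext (milnor_rcoord i1)). Qed.

Lemma ract_milnor0 (N : comod p b) (x : N) : ract x (@milnor p b 0) = cocoef (true, false) x.
Proof. exact: ract_milnor. Qed.
Lemma ract_milnor1 (N : comod p b) (x : N) : ract x (@milnor p b 1) = cocoef (false, true) x.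
Proof. exact: ract_milnor. Qed.

Section Hom.
Context (N N' : comod p b) (f : N -> N') (Hf : is_comod_hom f).
Lemma hom_lin (m : M) x y : f (m *: x + y) = m *: f x + f y.
Proof. by case: Hf. Qed.
Lemma hom_cocoef a x : f (cocoef a x) = cocoef a (f x).
Proof.
case: Hf => fl _ fc; rewrite /cocoef fc (slant_smap fl) //; exact: rcoord_rlin.
Qed.
End Hom.

Context (nu : nat).
Notation flash := (flash p b nu).
Notation xb := (@xb p b nu).
Notation zb := (@zb p b nu).

(** Generators are numbered from 1 and ordinals from 0; values outside [1..nu] are immaterial. *)
Definition xfam (i : nat) : flash :=
  if insub i.-1 is Some o then xb o else 0.

Lemma xfamE (i : 'I_nu) : xfam i.+1 = xb i.
Proof. by rewrite /xfam /= valK. Qed.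

Lemma ord_ex i : (0 < i <= nu)%N -> exists o : 'I_nu, i = o.+1.
Proof.
move=> /andP[i0 inu]; have lt : (i.-1 < nu)%N by lia.
by exists (Ordinal lt); rewrite /= prednK.
Qed.

Lemma cocoef_xb a o : cocoef a (xb o : flash) = xcoef xb zb o a.
Proof. by rewrite /cocoef /= flash_coact_xb slant_expand. Qed.
Lemma cocoef_zb a j : cocoef a (zb j : flash) = zcoef zb j a.
Proof. by rewrite /cocoef /= flash_coact_zb slant_expand. Qed.

Lemma xfam_flash : flash_family nu xfam.
Proof.
split=> i.
- by move=> /ord_ex[o ->]; rewrite xfamE; exact: flash_gr_xb.
- move=> Hi; rewrite ract_milnor0 ract_milnor1.
  have [o Eo] : exists o : 'I_nu, i.+1 = o.+1 by apply: ord_ex; lia.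
  have [o' Eo'] : exists o : 'I_nu, i = o.+1 by apply: ord_ex; lia.
  rewrite Eo xfamE Eo' xfamE !cocoef_xb; congr zb; apply: val_inj.
  by rewrite /= /bump leq0n add1n -Eo'; case: Eo.
- by move=> /ord_ex[o ->]; rewrite ract_milnor0 ract_milnor1 xfamE cocoef_xb cocoef_zb.
Qed.

Section Universal.
Context (N : comod p b) (y : nat -> N).
Hypotheses (co : is_comodule N) (Fy : flash_family nu y).

(** [z_0] is reached only from [x_1], by [Q_1]; every other [z_j] is the [Q_0]-image of [x_j]. Hence
    at least one generator is required below. *)
Definition zimg (j : 'I_nu.+1) : N :=
  if (j : nat) is j'.+1 then cocoef (true, false) (y j'.+1) else cocoef (false, true) (y 1%N).
Definition ximg (i : 'I_nu) : N := y i.+1.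
Definition univ : flash -> N := comb ximg zimg.

Lemma cocoef_counit x : cocoef (false, false) x = x :> N.
Proof. by rewrite -[RHS](cm_counit co) /cocoef -(slant_ext (@counit_rcoord p b)). Qed.

(** By coassociativity the coefficient at [tau_0 tau_1] is [Q_0] followed by [Q_1], which the
    relations of the flash kill. *)
Lemma y_top (i : 'I_nu) : cocoef (true, true) (y i.+1) = 0.
Proof.
have [_ _ F3] := Fy; have := F3 i.+1 (ltn_ord i); rewrite ract_milnor0 ract_milnor1.
rewrite -[cocoef (false, true) _]/(slant _ (cm_coact _)) (coact_comp p_gt0 co).
rewrite !spure0l addr0 add0r (slantD (rcoord_rlin p b _)) !(slant_pure (rcoord_rlin p b _)).
by rewrite /= -tE00 -tE01 !rcoordE scale0r scale1r add0r.
Qed.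

Lemma y_coact (i : 'I_nu) : cm_coact (y i.+1) = expand (xcoef ximg zimg i).
Proof.
rewrite coact_expand; apply: expand_ext => -[[] []] /=; rewrite ?y_top ?cocoef_counit //.
rewrite /zimg /=; case E : (i : nat) => [|j] //.
have [_ F2 _] := Fy; have := F2 j.+1; rewrite ract_milnor0 ract_milnor1; apply.
by rewrite /= -E ltn_ord.
Qed.

Lemma z_coact (j : 'I_nu.+1) : (0 < nu)%N -> cm_coact (zimg j) = expand (zcoef zimg j).
Proof.
move=> nu0; have H (i : 'I_nu) a : (a = (true, false) \/ a = (false, true)) ->
    cm_coact (cocoef a (y i.+1)) = spure 1 (cocoef a (y i.+1)).
  by case=> ->; rewrite (coact_comp p_gt0 co) /= y_top !spure0l !spure0r ?addr0 ?add0r.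
rewrite /expand /zcoef /= !spure0r !addr0 /zimg.
case: j => -[|j] Hj /=.
  by rewrite (H (Ordinal nu0)) //; right.
by rewrite (H (Ordinal (Hj : (j < nu)%N))) //; left.
Qed.

Lemma univ_hom : (0 < nu)%N -> is_comod_hom univ.
Proof.
move=> nu0; have ul := comb_lin ximg zimg; split=> //.
- move=> d w [H1 H2]; rewrite /univ /comb.
  have [F1 _ _] := Fy.
  have grs (J : finType) (F : J -> N) : (forall j, cm_gr d (F j)) -> cm_gr d (\sum_j F j).
    by move=> H; apply: big_ind => //; [exact: (cm_gr0 co)|move=> ? ?; exact: (cm_grD co)].
  have F1' (i : 'I_nu) : cm_gr (xdeg p i.+1) (y i.+1) by exact: (F1 i.+1 (ltn_ord i)).
  apply: cm_grD => //; apply: grs => j.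
    by rewrite -[d](subrK (xdeg p j.+1)); apply: (cm_grZ co).
  rewrite -[d](subrK (zdeg p j)); apply: (cm_grZ co) => //.
  have dE0 : degE p b (true, false) = adeg p b (Tau 0) by rewrite /degE /= mulr1n mulr0n addr0.
  have dE1 : degE p b (false, true) = adeg p b (Tau 1) by rewrite /degE /= mulr1n mulr0n add0r.
  rewrite /zimg; case: j => -[|j] Hj /=.
    have := cm_gr_comp wt1 co (false, true) (F1' (Ordinal nu0)).
    by rewrite (xdeg_lo p_gt0 wt1) dE1 addrAC subrr add0r.
  have := cm_gr_comp wt1 co (true, false) (F1' (Ordinal (Hj : (j < nu)%N))).
  by rewrite (xdeg_hi p_gt0 wt1) dE0 addrAC subrr add0r.
- apply: flash_ext => [m u v|m u v|i|j].
  + by rewrite [univ _]ul (cm_coactP co).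
  + by rewrite [cm_coact _]flash_coact_lin (lin_smapD ul) (lin_smapZ ul).
  + rewrite [univ _]comb_xb y_coact [cm_coact _]flash_coact_xb (smap_expand ul).
    by apply: expand_ext => -[[] []] /=; rewrite ?comb_xb ?comb_zb ?(lin_0 ul).
  + rewrite [univ _]comb_zb z_coact // [cm_coact _]flash_coact_zb (smap_expand ul).
    by apply: expand_ext => -[[] []] /=; rewrite /zcoef /= ?comb_zb ?(lin_0 ul).
Qed.

Lemma univ_unique (g : flash -> N) : is_comod_hom g ->
  (forall i, (0 < i <= nu)%N -> g (xfam i) = y i) -> (0 < nu)%N -> g =1 univ.
Proof.
move=> Hg Eg nu0.
have gx (i : 'I_nu) : g (xb i) = y i.+1 by rewrite -xfamE Eg //= ltn_ord.
apply: (flash_ext (hom_lin Hg) (comb_lin ximg zimg)) => [i|j].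
- by rewrite gx comb_xb.
- rewrite comb_zb /zimg; case: j => -[|j] Hj /=.
    rewrite -(gx (Ordinal nu0)) -(hom_cocoef Hg) cocoef_xb /=; congr (g (zb _)); exact: val_inj.
  rewrite -(gx (Ordinal (Hj : (j < nu)%N))) -(hom_cocoef Hg) cocoef_xb /=.
  by congr (g (zb _)); exact: val_inj.
Qed.
End Universal.

Lemma flash_zero_iso : nu = 0%N -> comod_iso flash (coeff_comod p b).
Proof.
move=> nu0.
have no_x (i : 'I_nu) : False by case: i; rewrite nu0.
have jz (j : 'I_nu.+1) : j = ord0 by apply: val_inj; case: j => j /=; rewrite nu0; case: j.
pose f (w : flash) : coeff_comod p b := (w.2 ord0 : M).
pose g (m : coeff_comod p b) : flash := (m : M) *: zb ord0.
have fl (m : M) x y : f (m *: x + y) = m *: f x + f y by rewrite /f /= !ffunE.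
have gl (m : M) x y : g (m *: x + y) = m *: g x + g y by rewrite /g scalerDl scalerA.
have z0 : zdeg p 0 = 0 by apply: injective_projections; rewrite /= ?mulr0 ?mul0r.
have dz d : d - zdeg p 0 = d by rewrite z0 subr0.
exists f, g; split.
- split=> // [d w [_ H2]|]; first by have := H2 ord0; rewrite dz.
  apply: flash_ext => [m u v|m u v|i|j].
  + rewrite fl /= etaLD spureDl; congr (_ + _).
    by rewrite [RHS]stens_scale_pure /= etaLM.
  + by rewrite /= flash_coact_lin (lin_smapD fl) (lin_smapZ fl).
  + by case: (no_x i).
  + rewrite (jz j) /= flash_coact_zb (smap_expand fl) /f /= ffunE eqxx etaL1.
    by rewrite /expand /zcoef /= !ffunE !spure0r !addr0.
- split=> // [d m Hm|m].
    rewrite -[d]addr0 /g; apply: flash_gr_scale => //.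
    by have := @flash_gr_zb p b nu ord0; rewrite z0.
  rewrite /= /flash_coact (lin_smap_pure gl) /g scale1r.
  rewrite -[m *: zb ord0]addr0 comb_lin comb_zb /expand /zcoef /= !spure0r !addr0.
  rewrite (lin_0 (comb_lin _ _)) addr0 [LHS]stens_scale_pure scaleE mulr1.
  by [].
- move=> w; rewrite /f /g; apply: injective_projections; apply/ffunP => i.
    by case: (no_x i).
  by rewrite (jz i) !ffunE eqxx [LHS]mulr1.
- by move=> m; rewrite /f /g /= !ffunE eqxx [LHS]mulr1.
Qed.

Lemma flash_lightning : lightning_flash nu flash.
Proof.
rewrite /lightning_flash; case: eqP => [nu0|/eqP nu0]; first exact: flash_zero_iso.
rewrite -lt0n in nu0; split; first exact: flash_is_comodule.
exists xfam; split; first exact: xfam_flash.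
move=> N y co Fy; exists (univ y); split.
- exact: univ_hom.
- by move=> i /ord_ex[o ->]; rewrite xfamE /univ comb_xb.
- by move=> g Hg Eg; exact: univ_unique.
Qed.
End Lightning.

(** * The coaction on monomials *)

Section Quads.
Context (p : nat) (b : coeff_data).
Hypothesis p_gt0 : (0 < p)%N.
Hypothesis wt1 : p = 2%N -> coeff_wt b = 1%N.
Notation M := (MM p b).
Notation KE := (kill_E 1).
Notation E1 := (steenrod p b KE).
Notation A := (steenrod p b kill_none).
Notation t0 := (tau p b KE 0).
Notation t1 := (tau p b KE 1).
Notation xi := (xi p b kill_none).
Notation tau := (tau p b kill_none).
Notation rho := (rho p b kill_none).

Let killA := @kill_A p b KE.

Definition four (y y0 y1 y01 : A) (a : bool * bool) : A :=
  match a with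
  | (false, false) => y | (true, false) => y0 | (false, true) => y1 | _ => y01 end.

Lemma psi_gen_xi_expand k (n : bool * bool -> A) :
  psi_gen (Xi k) (expand n) = expand (fun a => xi k * n a).
Proof.
have cx : gcentral false (xi k ^+ 1) by exact: gcentral_xi.
rewrite /= big_ord_recl big1 ?addr0 /=.
  by rewrite subn0 expn0 xi_0 /expand !mulopD // !mulop_pure //= !mul1r expr1.
by move=> i _; rewrite xiE // mulop_0l //; exact: gcentral_xi.
Qed.

Lemma rho_expand (n : bool * bool -> A) : p = 2%N ->
  mrho p b *: (expand n : stens KE A) = expand (fun a => rho * n a).
Proof.
move=> p2; have E (x : E1) (y : A) : mrho p b *: (spure x y : stens KE A) = spure x (rho * y).
  rewrite [LHS]stens_scale_pure scaleE etaL_mrho -etaR_mrho.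
  by rewrite (@gcentral_char2 p b KE false _ p2) spureM scaleE etaL_mrho.
by rewrite /expand !scalerDr !E.
Qed.

Lemma psi_xi k x : psi KE (xi k * x) = psi_gen (Xi k) (psi KE x).
Proof. exact: (psi_mul_gen killA (Xi k)). Qed.
Lemma psi_tauA k x : psi KE (tau k * x) = psi_gen (Tau k) (psi KE x).
Proof. exact: (psi_mul_gen killA (Tau k)). Qed.
Lemma psi_rho x : psi KE (rho * x) = mrho p b *: psi KE x.
Proof. by rewrite -etaL_mrho -scaleE psiZ. Qed.
Lemma psiNA (x : A) : psi KE (- x) = - psi KE x.
Proof. by apply: (addrI (psi KE x)); rewrite -psiD // !subrr psi0. Qed.
Lemma expandN (n : bool * bool -> A) : - (expand n : stens KE A) = expand (fun a => - n a).
Proof. by rewrite /expand !spureNr !opprD. Qed.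

(** A free rank one subcomodule with top class [y]: the coactions on [y] and on its images
    [y0], [y1], [y01] under [Q_0], [Q_1] and their product. *)
Record quad (y y0 y1 y01 : A) : Prop := Quad {
  quad_y : psi KE y = expand (four y y0 y1 y01);
  quad_y0 : psi KE y0 = expand (four y0 0 y01 0);
  quad_y1 : psi KE y1 = expand (four y1 (- y01) 0 0);
  quad_y01 : psi KE y01 = expand (four y01 0 0 0) }.

Lemma quad_one : quad 1 0 0 0.
Proof.
have z : psi KE (0 : A) = expand (four 0 0 0 0).
  by rewrite psi0 // /expand /= !spure0r !addr0.
split; rewrite ?oppr0 // psi1 // sone_expand; by apply: expand_ext => -[[] []].
Qed.

Lemma quad_xi k y y0 y1 y01 : quad y y0 y1 y01 ->
  quad (xi k * y) (xi k * y0) (xi k * y1) (xi k * y01).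
Proof.
case=> H H0 H1 H01; split; rewrite psi_xi ?(H, H0, H1, H01) psi_gen_xi_expand;
by apply: expand_ext => -[[] []] /=; rewrite ?mulr0 ?mulrN.
Qed.

Lemma quad_xiX k n y y0 y1 y01 : quad y y0 y1 y01 ->
  quad (xi k ^+ n * y) (xi k ^+ n * y0) (xi k ^+ n * y1) (xi k ^+ n * y01).
Proof.
move=> H; elim: n => [|n IH]; first by rewrite !mul1r.
by rewrite !exprS -!mulrA; exact: quad_xi.
Qed.

(** The trace of [tau_0^2 = rho tau_1], a relation present only for [p = 2]. *)
Definition rho2 (x : A) : A := if p == 2%N then rho * x else 0.

Lemma psi_xiX k n x (f : bool * bool -> A) : psi KE x = expand f ->
  psi KE (xi k ^+ n * x) = expand (fun a => xi k ^+ n * f a).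
Proof.
move=> H; elim: n => [|n IH].
  by rewrite mul1r H; apply: expand_ext => a; rewrite mul1r.
rewrite exprS -mulrA psi_xi IH psi_gen_xi_expand; apply: expand_ext => a.
by rewrite mulrA.
Qed.

Lemma psi_rho2 x (f : bool * bool -> A) : psi KE x = expand f ->
  psi KE (rho2 x) = expand (fun a => rho2 (f a)).
Proof.
rewrite /rho2 => H; case: eqP => [p2|_].
  by rewrite psi_rho H rho_expand.
by rewrite psi0 // /expand /= !spure0r !addr0.
Qed.

Lemma rho2D (x : A) : rho2 x + rho2 x = 0.
Proof.
rewrite /rho2; case: eqP => [p2|_]; last exact: addr0.
by rewrite -{2}[rho * x](@opp_char2 p b kill_none _ p2) subrr.
Qed.

(** The new entries are those of [tau_step]: the Leibniz rule plus one correction, which is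
    2-torsion by [rho2D] and therefore disappears from the coactions of the lower classes. *)
Lemma quad_tau k y y0 y1 y01 : quad y y0 y1 y01 ->
  quad (tau k.+1 * y) (xi k.+1 * y - tau k.+1 * y0)
    (xi k ^+ p * y - tau k.+1 * y1 + rho2 (xi k.+1 * y0))
    (tau k.+1 * y01 + xi k.+1 * y1 - xi k ^+ p * y0).
Proof.
case=> H H0 H1 H01; split.
- by rewrite psi_tauA H psi_gen_tau_expand //; apply: expand_ext => -[[] []].
- rewrite psiD // psiNA psi_xi psi_tauA H H0 psi_gen_tau_expand // psi_gen_xi_expand.
  rewrite expandN expandD; apply: expand_ext => -[[] []] /=; rewrite ?mulr0 ?if_same.
  + by rewrite add0r subr0 subrr.
  + by rewrite subr0 subrr.
  + by rewrite addr0 opprB addrA [xi _ * _ + _]addrC.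
  + by [].
- rewrite !psiD // psiNA psi_tauA H1 psi_gen_tau_expand // (psi_xiX _ _ H).
  rewrite (psi_rho2 (f := fun a => xi k.+1 * four y0 0 y01 0 a)); last first.
    by rewrite psi_xi H0 psi_gen_xi_expand.
  rewrite expandN !expandD; apply: expand_ext => -[[] []] /=; rewrite ?mulr0 /rho2 ?if_same.
  + by rewrite mulr0 if_same addr0 addr0 add0r !mulrN opprK subrr.
  + rewrite mulr0 if_same addr0 mulrN opprK.
    by rewrite [tau _ * _ + _]addrC opprB.
  + rewrite subr0 opprD addrA subrr add0r -!/(rho2 _).
    rewrite /rho2; case: eqP => [p2|]; last by rewrite oppr0 addr0.
    by rewrite !mulrN opprK; have := rho2D (xi k.+1 * y01); rewrite /rho2; case: eqP.
  + by [].
- rewrite !psiD // psiNA psi_tauA psi_xi (psi_xiX _ _ H0) H1 H01 psi_gen_tau_expand //.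
  rewrite psi_gen_xi_expand expandN !expandD; apply: expand_ext => -[[] []] /=;
    rewrite ?mulr0 ?if_same.
  + by rewrite !subr0 !addr0.
  + by rewrite !subr0 mulrN subrr.
  + by rewrite !subr0 !addr0 subrr.
  + by [].
Qed.

Record hquad d (y y0 y1 y01 : A) : Prop := HQuad {
  hq_y : homog (adeg p b) d y;
  hq_y0 : homog (adeg p b) (d - adeg p b (Tau 0)) y0;
  hq_y1 : homog (adeg p b) (d - adeg p b (Tau 1)) y1;
  hq_y01 : homog (adeg p b) (d - (adeg p b (Tau 0) + adeg p b (Tau 1))) y01 }.

Lemma hquad_one : hquad 0 1 0 0 0.
Proof. by split; rewrite ?sub0r; constructor. Qed.

Lemma homog_xiX k n (d : int * int) (y : A) : homog (adeg p b) d y ->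
  homog (adeg p b) (adeg p b (Xi k) *+ n + d) (xi k ^+ n * y).
Proof.
move=> H; elim: n => [|n IH]; first by rewrite mulr0n add0r mul1r.
by rewrite exprS -mulrA mulrS -addrA; apply: homogM => //; exact: (homog_ag p b kill_none (Xi k)).
Qed.

Lemma hquad_xiX k n d y y0 y1 y01 : hquad d y y0 y1 y01 ->
  hquad (adeg p b (Xi k) *+ n + d)
    (xi k ^+ n * y) (xi k ^+ n * y0) (xi k ^+ n * y1) (xi k ^+ n * y01).
Proof. by case=> H H0 H1 H01; split; rewrite -?addrA; exact: homog_xiX. Qed.

Lemma hquad_tau k d y y0 y1 y01 : hquad d y y0 y1 y01 ->
  hquad (adeg p b (Tau k.+1) + d) (tau k.+1 * y) (xi k.+1 * y - tau k.+1 * y0)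
    (xi k ^+ p * y - tau k.+1 * y1 + rho2 (xi k.+1 * y0))
    (tau k.+1 * y01 + xi k.+1 * y1 - xi k ^+ p * y0).
Proof.
case=> H H0 H1 H01.
have ht e (z : A) : homog (adeg p b) e z -> homog (adeg p b) (adeg p b (Tau k.+1) + e) (tau k.+1
  * z).
  by move=> Hz; apply: homogM => //; exact: (homog_ag p b kill_none (Tau k.+1)).
have hx e (z : A) : homog (adeg p b) e z -> homog (adeg p b) (adeg p b (Xi k.+1) + e) (xi k.+1 * z).
  by move=> Hz; apply: homogM => //; exact: (homog_ag p b kill_none (Xi k.+1)).
have dx : adeg p b (Xi k.+1) = adeg p b (Tau k.+1) - adeg p b (Tau 0).
  by apply: injective_projections; rewrite /= expn0; lia.
have dc : adeg p b (Xi k) *+ p = adeg p b (Tau k.+1) - adeg p b (Tau 1).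
  rewrite pairMnE; apply: injective_projections; rewrite /= expn1 expnS; lia.
split.
- exact: ht.
- apply: homogD; last by rewrite -addrA; apply: homogN; exact: ht.
  by rewrite addrAC -dx; exact: hx.
- apply: homogD; first apply: homogD.
  + by rewrite addrAC -dc; exact: homog_xiX.
  + by rewrite -addrA; apply: homogN; exact: ht.
  + rewrite /rho2; case: eqP => [p2|_]; last exact: homog0.
    have -> : adeg p b (Tau k.+1) + d - adeg p b (Tau 1)
        = adeg p b (Mg Gamma) + (adeg p b (Xi k.+1) + (d - adeg p b (Tau 0))).
      rewrite dx; apply: injective_projections; rewrite /= ?wt1 // ?expn0 ?expn1 p2; lia.
    by apply: homogM; [exact: homog_rho|exact: hx].
- apply: homogD; first apply: homogD.
  + by rewrite -addrA; exact: ht.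
  + by rewrite opprD addrACA -dx; exact: hx.
  + have -> : adeg p b (Tau k.+1) + d - (adeg p b (Tau 0) + adeg p b (Tau 1))
        = adeg p b (Xi k) *+ p + (d - adeg p b (Tau 0)).
      by rewrite dc opprD (AC (2*2) ((1*4)*(2*3)))%AC.
    by apply: homogN; exact: homog_xiX.
Qed.
End Quads.

(** * Words and their images under [Q_0] and [Q_1] *)

Section Words.
Context (p : nat) (b : coeff_data).
Hypothesis p_gt1 : (1 < p)%N.
Hypothesis wt1 : p = 2%N -> coeff_wt b = 1%N.
Notation M := (MM p b).
Notation KE := (kill_E 1).
Notation A := (steenrod p b kill_none).
Notation xi := (xi p b kill_none).
Notation tau := (tau p b kill_none).
Notation amon := (amon p b kill_none).
Notation rho2 := (@rho2 p b).
Implicit Types (a i m : nat) (t : seq (bool * nat)) (P : nat -> seq (bool * nat) -> Prop)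
  (f g : fam int).

Let p_gt0 : (0 < p)%N := ltnW p_gt1.

(** [xi_i] is the ghost variable of the rest of the word. Induction needs every [i]; in the end
    [i = 0], where the ghost is 1. *)
Definition bmon i a t : A := xi i ^+ a * amon i.+1 t.

Lemma bmon_cons i a e m t : bmon i a ((e, m) :: t) = xi i ^+ a * (tau i.+1 ^+ (e : nat) * bmon
  i.+1 m t).
Proof. by []. Qed.

Lemma bmon_xi i m t : bmon i m.+1 t = xi i * bmon i m t.
Proof. by rewrite /bmon exprS mulrA. Qed.

(** Main terms have integer coefficients, recorded by [f] so that they can be scaled by any element
    of [M] later. For error terms [mspan] records only where they lie. *)
Inductive rep i P : fam int -> A -> Prop :=
  | rep0 : rep i P 0 0
  | repD f g x y : rep i P f x -> rep i P g y -> rep i P (f + g) (x + y)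
  | repN f x : rep i P f x -> rep i P (- f) (- x)
  | rep_mon a t : P a t -> rep i P (dlt 1 a t) (bmon i a t).

Inductive mspan i P : A -> Prop :=
  | mspan0 : mspan i P 0
  | mspanD x y : mspan i P x -> mspan i P y -> mspan i P (x + y)
  | mspan_mon (m : M) a t : P a t -> mspan i P (m *: bmon i a t).

Lemma repB i P f g x y : rep i P f x -> rep i P g y -> rep i P (f - g) (x - y).
Proof. by move=> Hx Hy; apply: repD => //; exact: repN. Qed.

Lemma mspanZ i P (m : M) x : mspan i P x -> mspan i P (m *: x).
Proof.
elim=> {x} [|x y _ Hx _ Hy|m' a t Pt]; first by rewrite scaler0; exact: mspan0.
- by rewrite scalerDr; exact: mspanD.
- by rewrite scalerA; exact: mspan_mon.
Qed.
Lemma mspanN i P x : mspan i P x -> mspan i P (- x).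
Proof. by rewrite -scaleN1r; exact: mspanZ. Qed.
Lemma mspanB i P x y : mspan i P x -> mspan i P y -> mspan i P (x - y).
Proof. by move=> Hx Hy; apply: mspanD => //; exact: mspanN. Qed.
Lemma rep_mspan i P f x : rep i P f x -> mspan i P x.
Proof.
elim=> {f x} [|f g x y _ Hx _ Hy|f x _|a t Pt]; first exact: mspan0.
- exact: mspanD.
- exact: mspanN.
- by rewrite -[bmon i a t]scale1r; exact: mspan_mon.
Qed.

Lemma lftD (C : zmodType) a e (f g : fam C) : lft a e (f + g) = lft a e f + lft a e g.
Proof.
apply/funext => a'; apply/funext => -[|[e' m] t]; rewrite famD /= ?addr0 //.
by case: ifP; rewrite ?addr0.
Qed.
Lemma lftN (C : zmodType) a e (f : fam C) : lft a e (- f) = - lft a e f.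
Proof. by apply: (addrI (lft a e f)); rewrite -lftD !subrr lft0. Qed.
Lemma xishD (C : zmodType) (f g : fam C) : xish (f + g) = xish f + xish g.
Proof. by apply/funext => -[|m]; apply/funext => t; rewrite famD /= ?addr0. Qed.
Lemma xish0 (C : zmodType) : xish (0 : fam C) = 0.
Proof. by apply: (addrI (xish (0 : fam C))); rewrite -xishD !addr0. Qed.
Lemma xishN (C : zmodType) (f : fam C) : xish (- f) = - xish f.
Proof. by apply: (addrI (xish f)); rewrite -xishD !subrr xish0. Qed.

Lemma rep_lft i P P' a e f x : (forall m t, P m t -> P' a ((e, m) :: t)) ->
  rep i.+1 P f x -> rep i P' (lft a e f) (xi i ^+ a * (tau i.+1 ^+ (e : nat) * x)).
Proof.
move=> PP'; elim=> {f x} [|f g x y _ Hx _ Hy|f x _ Hx|m t Pt].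
- by rewrite lft0 !mulr0; exact: rep0.
- by rewrite lftD !mulrDr; exact: repD.
- by rewrite lftN !mulrN; exact: repN.
- by rewrite -dlt_lft -bmon_cons; apply: rep_mon; exact: PP'.
Qed.
Lemma rep_xish i P P' f x : (forall m t, P m t -> P' m.+1 t) ->
  rep i P f x -> rep i P' (xish f) (xi i * x).
Proof.
move=> PP'; elim=> {f x} [|f g x y _ Hx _ Hy|f x _ Hx|m t Pt].
- by rewrite xish0 !mulr0; exact: rep0.
- by rewrite xishD !mulrDr; exact: repD.
- by rewrite xishN !mulrN; exact: repN.
- by rewrite xish_dlt -bmon_xi; apply: rep_mon; exact: PP'.
Qed.

Lemma xi_scale i n (m : M) (x : A) : xi i ^+ n * (m *: x) = m *: (xi i ^+ n * x).
Proof. exact: (@gscale_comm p b false _ _ _ (gcentral_xi i n)). Qed.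

Lemma mspan_lft i P P' a e x : (forall m t, P m t -> P' a ((e, m) :: t)) ->
  mspan i.+1 P x -> mspan i P' (xi i ^+ a * (tau i.+1 ^+ (e : nat) * x)).
Proof.
move=> PP'; elim=> {x} [|x y _ Hx _ Hy|c m t Pt]; first by rewrite !mulr0; exact: mspan0.
- by rewrite !mulrDr; exact: mspanD.
- have -> : tau i.+1 ^+ (e : nat) * (c *: bmon i.+1 m t)
      = mpar_iter e c *: (tau i.+1 ^+ (e : nat) * bmon i.+1 m t).
    case: e PP' => _; last by rewrite !mul1r.
    exact: (@gscale_comm p b true _ _ _ (@gcentral_ag _ _ _ (Tau i.+1))).
  by rewrite xi_scale -bmon_cons; apply: mspan_mon; exact: PP'.
Qed.
Lemma mspan_xi i P P' x : (forall m t, P m t -> P' m.+1 t) ->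
  mspan i P x -> mspan i P' (xi i * x).
Proof.
move=> PP'; elim=> {x} [|x y _ Hx _ Hy|c m t Pt]; first by rewrite !mulr0; exact: mspan0.
- by rewrite !mulrDr; exact: mspanD.
- by rewrite (xi_scale i 1) -bmon_xi; apply: mspan_mon; exact: PP'.
Qed.
Lemma mspan_rho2 i P x : mspan i P x -> mspan i P (rho2 x).
Proof.
rewrite /rho2; case: (p == 2%N) => Hx; last exact: mspan0.
by rewrite -etaL_mrho -scaleE; exact: mspanZ.
Qed.
Lemma mspan_sub i P P' x : (forall a t, P a t -> P' a t) -> mspan i P x -> mspan i P' x.
Proof.
move=> PP'; elim=> {x} [|x y _ Hx _ Hy|c m t Pt]; first exact: mspan0.
- exact: mspanD.
- by apply: mspan_mon; exact: PP'.
Qed.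
Lemma rho2M i a x : xi i ^+ a * rho2 x = rho2 (xi i ^+ a * x).
Proof.
rewrite /rho2; case: eqP => p2; last by rewrite mulr0.
by rewrite -etaL_mrho -!scaleE xi_scale.
Qed.

Definition lw (n w c h : nat) a t := [/\ size t = n, rwt p a t = w & (cnt t + h <= c)%N].

(** The degree of [xi_j] is [p^j (2, 1) - (2, 1)] and that of [tau_j] is [p^j (2, 1) - (1, 1)], so
    weight and the two counts determine the degree. *)
Definition wdeg i a t : int * int :=
  (2 * (p ^ i * rwt p a t)%N%:Z - 2 * (xdg a t)%:Z - (cnt t)%:Z,
   (p ^ i * rwt p a t)%N%:Z - (xdg a t)%:Z - (cnt t)%:Z).

Lemma wdeg_cons i a e m t : wdeg i a ((e, m) :: t) =
  adeg p b (Xi i) *+ a + (adeg p b (Tau i.+1) *+ e + wdeg i.+1 m t).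
Proof.
rewrite !pairMnE; apply: injective_projections; rewrite /= !expnS;
case: e; rewrite /= ?mulr0n ?mulr1n; lia.
Qed.
Lemma wdeg_nil i a : wdeg i a [::] = adeg p b (Xi i) *+ a + 0.
Proof. by rewrite !pairMnE; apply: injective_projections; rewrite /=; lia. Qed.

(** For [p = 2] the relation for [tau_i^2] perturbs the derivation formula for [Q_1]; the
    errors [r1] and [r01] have one [tau] less than the main terms [u1] and [u01]. *)
Record qword i a t (y0 y1 y01 u1 r1 u01 r01 : A) : Prop := QWord {
  qw_quad : quad (bmon i a t) y0 y1 y01;
  qw_hquad : hquad (wdeg i a t) (bmon i a t) y0 y1 y01;
  qw_0 : rep i (lw (size t) (rwt p a t) (cnt t) 1) (Q0 (dlt 1 a t)) y0;
  qw_1E : y1 = u1 + r1;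
  qw_1 : rep i (lw (size t) (rwt p a t) (cnt t) 1) (Q1 p (dlt 1 a t)) u1;
  qw_r1 : mspan i (lw (size t) (rwt p a t) (cnt t) 2) r1;
  qw_01E : y01 = u01 + r01;
  qw_01 : rep i (lw (size t) (rwt p a t) (cnt t) 2) (Q1 p (Q0 (dlt 1 a t))) u01;
  qw_r01 : mspan i (lw (size t) (rwt p a t) (cnt t) 3) r01 }.

Lemma Q1_xish (C : zmodType) (f : fam C) : Q1 p (xish f) = xish (Q1 p f).
Proof.
apply/funext => a; apply/funext => t; have := Q1_shift p 1 f a t.
have -> : (fun a t => if (1 <= a)%N then f (a - 1)%N t else 0) = xish f.
  by apply/funext => -[|a'] //; apply/funext => t'; rewrite /= subn1.
by move=> ->; case: a => //= a; rewrite subn1.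
Qed.

(** Each prefix [xi_i^a tau_{i+1}^e] is handled by [quad_tau] and [quad_xiX]. The correction is made
    of the [Q_0]-image of the tail with [tau_{i+1}] gone, so it loses two [tau]'s where the main
    term of [Q_1] loses one. *)
Lemma quad_word i a t : exists y0 y1 y01 u1 r1 u01 r01,
  qword i a t y0 y1 y01 u1 r1 u01 r01.
Proof.
elim: t i a => [|[e m] t IH] i a.
  exists 0, 0, 0, 0, 0, 0, 0; split; rewrite ?addr0 //.
  - by have := quad_xiX i a (quad_one p b); rewrite !mulr0.
  - by have := hquad_xiX i a (hquad_one p b); rewrite !mulr0 -wdeg_nil.
  - by rewrite Q0_pure //; exact: rep0.
  - by rewrite Q1_pure //; exact: rep0.
  - exact: mspan0.
  - by rewrite Q0_pure // Q1_0; exact: rep0.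
  - exact: mspan0.
have [y0 [y1 [y01 [u1 [r1 [u01 [r01 [q h e0 E1 e1 s1 E01 e01 s01]]]]]]]] := IH i.+1 m.
have em : rep i.+1 (lw (size t) (rwt p m t) (cnt t) 0) (dlt 1 m t) (bmon i.+1 m t).
  by apply: rep_mon; split; rewrite // addn0.
set w := rwt p a ((e, m) :: t); set c := cnt ((e, m) :: t).
case: e @w @c => w c.
- have Lt hh f x : rep i.+1 (lw (size t) (rwt p m t) (cnt t) hh) f x ->
     rep i (lw (size t).+1 w c hh) (lft a true f) (xi i ^+ a * (tau i.+1 * x)).
    move=> H; rewrite -[tau _]expr1; apply: (rep_lft (e := true)) H => m' t' [sz wt ct].
    by split; rewrite /= ?sz // ?wt // -addnA leq_add2l.
  have Lf hh f x : rep i.+1 (lw (size t) (rwt p m t) (cnt t) hh) f x ->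
     rep i (lw (size t).+1 w c hh.+1) (lft a false (xish f)) (xi i ^+ a * (xi i.+1 * x)).
    move=> H; rewrite -[xi i.+1 * x]mul1r.
    apply: (rep_lft (e := false)) (rep_xish (P' := fun m' t' => lw (size t).+1 w c hh.+1 a
      ((false, m') :: t')) _ H) => m' t' // [sz wt ct].
    by split; rewrite /= ?sz // /w /c /=; [move: wt; case: (t') => [|[]] /=; nia|lia].
  have Lp hh f x : rep i.+1 (lw (size t) (rwt p m t) (cnt t) hh) f x ->
     rep i (lw (size t).+1 w c hh.+1) (lft (a + p) false f) (xi i ^+ a * (xi i ^+ p * x)).
    move=> H; rewrite mulrA -exprD -[x]mul1r; apply: (rep_lft (e := false)) H => m' t' [sz wt ct].
    by split; rewrite /= ?sz // /w /c /= ?wt; nia.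
  have Mt hh x : mspan i.+1 (lw (size t) (rwt p m t) (cnt t) hh) x ->
     mspan i (lw (size t).+1 w c hh) (xi i ^+ a * (tau i.+1 * x)).
    move=> H; rewrite -[tau _]expr1; apply: (mspan_lft (e := true)) H => m' t' [sz wt ct].
    by split; rewrite /= ?sz // ?wt // -addnA leq_add2l.
  have Mf hh x : mspan i.+1 (lw (size t) (rwt p m t) (cnt t) hh) x ->
     mspan i (lw (size t).+1 w c hh.+1) (xi i ^+ a * (xi i.+1 * x)).
    move=> H; rewrite -[xi i.+1 * x]mul1r.
    apply: (mspan_lft (e := false)) (mspan_xi (P' := fun m' t' => lw (size t).+1 w c hh.+1 a
      ((false, m') :: t')) _ H) => m' t' // [sz wt ct].
    by split; rewrite /= ?sz // /w /c /=; [move: wt; case: (t') => [|[]] /=; nia|lia].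
  exists (xi i ^+ a * (xi i.+1 * bmon i.+1 m t - tau i.+1 * y0)),
    (xi i ^+ a * (xi i ^+ p * bmon i.+1 m t - tau i.+1 * y1 + rho2 (xi i.+1 * y0))),
    (xi i ^+ a * (tau i.+1 * y01 + xi i.+1 * y1 - xi i ^+ p * y0)),
    (xi i ^+ a * (xi i ^+ p * bmon i.+1 m t) - xi i ^+ a * (tau i.+1 * u1)),
    (- (xi i ^+ a * (tau i.+1 * r1)) + rho2 (xi i ^+ a * (xi i.+1 * y0))),
    (xi i ^+ a * (tau i.+1 * u01) + xi i ^+ a * (xi i.+1 * u1) - xi i ^+ a * (xi i ^+ p * y0)),
    (xi i ^+ a * (tau i.+1 * r01) + xi i ^+ a * (xi i.+1 * r1)).
  have Q0E : Q0 (dlt (1 : int) a ((true, m) :: t))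
      = lft a false (xish (dlt 1 m t)) - lft a true (Q0 (dlt 1 m t)).
    by rewrite dlt_lft Q0_lft.
  split.
  + by rewrite bmon_cons expr1; apply: quad_xiX; exact: quad_tau.
  + rewrite bmon_cons wdeg_cons expr1 mulr1n; apply: hquad_xiX; exact: hquad_tau.
  + by rewrite Q0E mulrBr; apply: repB; [exact: Lf em|exact: Lt].
  + by rewrite E1 -rho2M [tau _ * (_ + _)]mulrDr opprD !mulrDr !mulrN !addrA.
  + by rewrite dlt_lft Q1_lft; apply: repB; [exact: Lp em|exact: Lt].
  + apply: mspanD; first by apply: mspanN; exact: Mt.
    by apply: mspan_rho2; apply: Mf; exact: rep_mspan e0.
  + rewrite E01 E1 !(mulrDr, mulrN). by rewrite [RHS](AC (3*2) (1*4*(2*5)*3))%AC.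
  + rewrite Q0E Q1_morph Q1_opp !Q1_lft add0r opprD opprK Q1_xish addrA.
    rewrite -[_ * _ + _ - _]addrA [X in rep _ _ X](_ : _ = lft a true (Q1 p (Q0 (dlt 1 m t)))
      + (lft a false (xish (Q1 p (dlt 1 m t))) - lft (a + p) false (Q0 (dlt 1 m t)))); last first.
      by rewrite [LHS](AC 3 (3*(1*2)))%AC.
    apply: repD; first exact: Lt.
    by apply: repB; [exact: Lf|exact: Lp].
  + by apply: mspanD; [exact: Mt|exact: Mf].
- have L hh f x : rep i.+1 (lw (size t) (rwt p m t) (cnt t) hh) f x ->
     rep i (lw (size t).+1 w c hh) (lft a false f) (xi i ^+ a * x).
    move=> H; rewrite -[x]mul1r; apply: (rep_lft (e := false)) H => m' t' [sz wt ct].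
    by split; rewrite /= ?sz // wt.
  have Ls hh x : mspan i.+1 (lw (size t) (rwt p m t) (cnt t) hh) x ->
     mspan i (lw (size t).+1 w c hh) (xi i ^+ a * x).
    move=> H; rewrite -[x]mul1r; apply: (mspan_lft (e := false)) H => m' t' [sz wt ct].
    by split; rewrite /= ?sz // wt.
  exists (xi i ^+ a * y0), (xi i ^+ a * y1), (xi i ^+ a * y01), (xi i ^+ a * u1), (xi i ^+ a * r1),
    (xi i ^+ a * u01), (xi i ^+ a * r01); split.
  + by rewrite bmon_cons mul1r; exact: quad_xiX.
  + rewrite bmon_cons wdeg_cons mul1r mulr0n add0r; exact: hquad_xiX.
  + by rewrite dlt_lft Q0_lft add0r; exact: L.
  + by rewrite E1 mulrDr.
  + by rewrite dlt_lft Q1_lft add0r; exact: L.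
  + exact: Ls.
  + by rewrite E01 mulrDr.
  + by rewrite dlt_lft Q0_lft add0r Q1_lft add0r; exact: L.
  + exact: Ls.
Qed.
End Words.

(** * Monomial bases *)

Section Span.
Context (p : nat) (b : coeff_data).
Hypothesis p_prime : prime p.
Notation M := (MM p b).
Notation A := (steenrod p b kill_none).
Notation xi := (xi p b kill_none).
Notation tau := (tau p b kill_none).
Notation amon := (amon p b kill_none).
Notation bmw := (@bmon p b).
Notation mspan := (@mspan p b).
Notation mon := (mon p).
Implicit Types (a i m : nat) (t : seq (bool * nat)).

Let p_gt1 : (1 < p)%N := prime_gt1 p_prime.
Let p_gt0 : (0 < p)%N := prime_gt0 p_prime.

Lemma xi_comm j (x : A) : xi j * x = x * xi j.
Proof. exact: (@gcentral_ag p b kill_none (Xi j) x). Qed.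
Lemma xiX_comm j n (x : A) : x * xi j ^+ n = xi j ^+ n * x.
Proof. by rewrite (gcentral_xi j n). Qed.
Lemma tau_anti i j : tau i * tau j = - (tau j * tau i).
Proof. by rewrite [LHS]ag_comm /= expr1 mulN1r. Qed.

Lemma mspan_lin i P P' (f : A -> A) (s : bool) :
  (forall x y, f (x + y) = f x + f y) -> (forall (m : M) x, f (m *: x) = mpar_iter s m *: f x) ->
  (forall a t, P a t -> mspan i P' (f (bmw i a t))) -> forall x, mspan i P x -> mspan i P' (f x).
Proof.
move=> fD fZ H x; elim=> {x} [|x y _ Hx _ Hy|m a t Pt].
- have -> : f 0 = 0 by apply: (addrI (f 0)); rewrite -fD !addr0.
  exact: mspan0.
- by rewrite fD; exact: mspanD.
- by rewrite fZ; apply: mspanZ; exact: H.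
Qed.

(** The bound on the weight ensures that the index [i + d] still falls into one of the [n] slots. *)
Lemma mspan_xiA n i d w x : (w + p ^ d < p ^ n.+1)%N ->
  mspan i (mon w n) x -> mspan i (mon (w + p ^ d) n) (xi (i + d) * x).
Proof.
elim: n i d w x => [|n IH] i d w x wd.
  have d0 : d = 0%N.
    by apply/eqP; rewrite -leqn0 -ltnS -(ltn_exp2l _ _ p_gt1) -[(p ^ 1)%N]/(p ^ 1)%N; lia.
  rewrite d0 addn0 expn0 addn1; apply: mspan_xi => m t [sz wt].
  by split=> //; move: wt; case: (t) => [|[e m'] t'] /=; lia.
case: d wd => [|d] wd.
  rewrite addn0 expn0 addn1; apply: mspan_xi => m t [sz wt].
  by split=> //; move: wt; case: (t) => [|[e m'] t'] /=; lia.
apply: (@mspan_lin _ _ _ ( *%R (xi (i + d.+1))) false) => [y z|m y|a [|[e m] t] [] // [sz] wt].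
- by rewrite mulrDr.
- exact: (@gscale_comm p b false _ _ _ (@gcentral_ag _ _ _ (Xi _))).
rewrite bmon_cons mulrA xiX_comm -mulrA [xi (i + _) * _]mulrA xi_comm -[_ * xi _ * _]mulrA addnS
  -addSn.
have wt' : w = (a + p * (e + rwt p m t))%N by [].
apply: (@mspan_lft _ _ _ (mon (rwt p m t + p ^ d) n)).
  move=> m' t' [sz' wt'']; split; rewrite /= ?sz' // wt'' wt' expnS; nia.
apply: IH; last by rewrite -[bmw _ _ _]scale1r; apply: mspan_mon.
move: wd; rewrite wt' (expnS p n.+1) (expnS p d); nia.
Qed.

Lemma theta_scale (x : A) : ag p b kill_none (Mg Theta) * x = mtheta p b *: x.
Proof. by rewrite scaleE /etaL (pmap_ring_gen (@etaL_model p b kill_none)). Qed.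

(** For [p = 2] the place of the new [tau] may be taken; its square then spills over to the next
    index without changing the weight, which is why the tail is again in the scope of the
    induction. *)
Lemma mspan_tauA n i d w x : (w + p ^ d.+1 < p ^ n.+1)%N ->
  mspan i (mon w n) x -> mspan i (mon (w + p ^ d.+1) n) (tau (i + d.+1) * x).
Proof.
elim: n i d w x => [|n IH] i d w x wd.
  by have := leq_pexp2l p_gt0 (ltn0Sn d); lia.
apply: (@mspan_lin _ _ _ ( *%R (tau (i + d.+1))) true) => [y z|m y|a [|[e m] t] [] // [sz] wt].
- by rewrite mulrDr.
- exact: (@gscale_comm p b true _ _ _ (@gcentral_ag _ _ _ (Tau _))).
rewrite bmon_cons mulrA xiX_comm -mulrA.
have wt' : w = (a + p * (e + rwt p m t))%N by [].
have word : mspan i.+1 (mon (rwt p m t) n) (bmw i.+1 m t).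
  by rewrite -[bmw _ _ _]scale1r; apply: mspan_mon.
case: d wd => [|d] wd.
  rewrite addn1 expn1; case: e wt' wt => wt' wt; last first.
    rewrite mul1r -[tau _ * _]/(tau i.+1 ^+ (true : nat) * _).
    apply: (@mspan_lft _ _ _ (mon (rwt p m t) n)) word => m' t' [sz' wt''].
    by split; rewrite /= ?sz' // wt'' wt' add0n; nia.
  rewrite expr1 [tau _ * (tau _ * _)]mulrA tau_sq; case: eqP => [p2|_];
    last by rewrite mul0r mulr0; exact: mspan0.
  rewrite -[X in xi i ^+ a * X]mul1r -[X in xi i ^+ a * (X * _)]/(tau i.+1 ^+ (false : nat)).
  apply: (@mspan_lft _ _ _ (mon (rwt p m t + p) n)) => [m' t' [sz' wt'']|].
    by split; rewrite /= ?sz' // wt'' wt' add0n add1n; rewrite p2; nia.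
  have wd' : (rwt p m t + p < p ^ n.+1)%N by move: wd; rewrite wt' (expnS p n.+1) expn1 p2; nia.
  rewrite mulrDl; apply: mspanD.
    rewrite -mulrA theta_scale; apply: mspanZ.
    have := @mspan_xiA n i.+1 1 (rwt p m t) (bmw i.+1 m t); rewrite expn1 addn1; exact.
  rewrite -mulrA -etaL_mrho -scaleE; apply: mspanZ.
  have := IH i.+1 0%N (rwt p m t) (bmw i.+1 m t); rewrite expn1 addn1; exact.
have -> : tau (i + d.+2) * (tau i.+1 ^+ e * bmw i.+1 m t)
   = (-1) ^+ (e : nat) * (tau i.+1 ^+ e * (tau (i + d.+2) * bmw i.+1 m t)).
  case: e {wt wt'} => /=; last by rewrite !mul1r.
  by rewrite !expr1 mulN1r mulrA tau_anti mulNr -mulrA.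
have -> (s : bool) (y z : A) : y * ((-1) ^+ s * z) = (-1) ^+ s * (y * z).
  by case: s; rewrite ?expr1 ?expr0 ?mul1r // !mulN1r mulrN.
have H : mspan i (mon (w + p ^ d.+2) n.+1) (xi i ^+ a * (tau i.+1 ^+ e * (tau (i + d.+2) * bmw
  i.+1 m t))).
  rewrite addnS -addSn.
  apply: (@mspan_lft _ _ _ (mon (rwt p m t + p ^ d.+1) n)).
    by move=> m' t' [sz' wt'']; split; rewrite /= ?sz' // wt'' wt' (expnS p d.+1); nia.
  apply: IH => //.
  by move: wd; rewrite wt' (expnS p n.+1) (expnS p d.+1); nia.
case: e {wt wt'} H => H; last by rewrite mul1r.
by rewrite expr1 mulN1r; exact: mspanN.
Qed.

Lemma bmon0 a t : bmw 0 a t = amon 1 t.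
Proof. by rewrite /bmon xi_0 expr1n mul1r. Qed.

(** Missing weight is filled up with powers of [xi_0 = 1]. This replaces weight at most [k] by
    weight exactly [k]. *)
Lemma mspan_le n v w x : (v <= w)%N -> mspan 0 (mon v n) x -> mspan 0 (mon w n) x.
Proof.
move=> vw; elim=> {x} [|x y _ Hx _ Hy|m a t [sz wt]]; first exact: mspan0.
- exact: mspanD.
- have -> : bmw 0 a t = bmw 0 (a + (w - v)) t by rewrite !bmon0.
  apply: mspan_mon; split=> //; move: wt; case: (t) => [|[e m'] t'] /=; lia.
Qed.

Lemma amon_zs n i : amon i (zs n) = 1.
Proof. by elim: n i => //= n IH i; rewrite !mul1r IH. Qed.

(** [k] slots are enough because [k < p^(k+1)]. *)
Lemma bg_mspan k x : bg_span k x -> mspan 0 (mon k k) x.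
Proof.
elim=> {x} [w x wk Hx||x y _ Hx _ Hy|m x _ Hx].
- apply: (mspan_le wk _); elim: Hx wk => {w x} [|w i x i0 _ IH|w i x i0 _ IH] wk.
  + rewrite -(amon_zs k 1) -(bmon0 0) -[bmw _ _ _]scale1r; apply: mspan_mon.
    by split; rewrite ?size_nseq // rwt_zs.
  + rewrite addnC; apply: (@mspan_xiA k 0 i); last by apply: IH; lia.
    by rewrite addnC; apply: (leq_ltn_trans wk _); apply: (leq_trans (ltnSn k));
      exact: ltnW (ltn_expl _ p_gt1).
  + rewrite addnC -(prednK i0); apply: (@mspan_tauA k 0 i.-1); last by apply: IH; lia.
    rewrite prednK // addnC; apply: (leq_ltn_trans wk _).
    by apply: (leq_trans (ltnSn k)); exact: ltnW (ltn_expl _ p_gt1).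
- exact: mspan0.
- exact: mspanD.
- exact: mspanZ.
Qed.

Lemma bg_span_exp k i n x : (0 < i)%N -> bg_span k x -> bg_span (p ^ i * n + k) (xi i ^+ n * x).
Proof.
move=> i0 Hx; elim: n => [|n IH]; first by rewrite muln0 mul1r.
by rewrite exprS -mulrA mulnS -addnA; exact: bg_span_xi.
Qed.

Lemma bmon_bg_pos i a t : (0 < i)%N -> bg_span (p ^ i * rwt p a t) (bmw i a t).
Proof.
elim: t i a => [|[e m] t IH] i a i0.
  rewrite /= addn0 -[(_ * _)%N]addn0; apply: bg_span_exp => //.
  by apply: (@bg_span_mon _ _ _ 0) => //; exact: bg_one.
rewrite bmon_cons /= mulnDr; apply: bg_span_exp => //.
rewrite mulnA -expnSr mulnDr; case: e; last by rewrite mul1r muln0; exact: IH.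
by rewrite muln1 expr1; apply: bg_span_tau => //; exact: IH.
Qed.

Lemma bmon_bg k a t : rwt p a t = k -> bg_span k (bmw 0 a t).
Proof.
rewrite bmon0; case: t => [|[e m] t] /= wt.
  by apply: (@bg_span_mon _ _ _ 0) => //; exact: bg_one.
apply: (@bg_span_mon_le _ _ (p * (e + rwt p m t))); first by lia.
rewrite mulnDr; have := @bmon_bg_pos 1 m t isT; rewrite expn1 /bmon => H.
case: e {wt}; last by rewrite mul1r muln0.
by rewrite muln1 expr1; have := @bg_span_tau p b _ 1 _ isT H; rewrite expn1.
Qed.
End Span.

(** * Elements of [B_0(k)] as families of coefficients *)

Section Alpha.
Context (p : nat) (b : coeff_data).
Hypothesis p_prime : prime p.
Context (k : nat).
Notation M := (MM p b).
Notation A := (steenrod p b kill_none).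
Notation amon := (amon p b kill_none).
Notation bmon := (@bmon p b 0).
Notation mspan := (@mspan p b 0).
Notation mon := (mon p k k).
Notation mons := (mons p k k).

Definition alpha (f : fam M) : A := \sum_(u <- mons) ev f u *: bmon u.1 u.2.

Lemma alphaD f g : alpha (f + g) = alpha f + alpha g.
Proof. by rewrite /alpha -big_split /=; apply: eq_bigr => u _; rewrite -scalerDl. Qed.
Lemma alpha0 : alpha 0 = 0.
Proof. by apply: (addrI (alpha 0)); rewrite -alphaD !addr0. Qed.
Lemma alphaN f : alpha (- f) = - alpha f.
Proof. by apply: (addrI (alpha f)); rewrite -alphaD !subrr alpha0. Qed.
Lemma alpha_sum I (r : seq I) (F : I -> fam M) :
  alpha (\sum_(i <- r) F i) = \sum_(i <- r) alpha (F i).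
Proof. exact: (big_morph _ alphaD alpha0). Qed.

Lemma alpha_dp (m : M) a t : mon a t -> alpha (dp m (a, t)) = m *: bmon a t.
Proof.
move=> /(mem_mons p_prime) Hu; rewrite /alpha (bigD1_seq (a, t)) ?uniq_mons //= big1 ?addr0.
  by rewrite dpE eqxx.
by move=> u ne; rewrite dpE (negbTE ne) scale0r.
Qed.

(** The bridge from the calculus over the integers to coefficients in [M]. *)
Lemma alpha_rep P (m : M) f x : (forall a t, P a t -> mon a t) ->
  @rep p b 0 P f x -> alpha (fcomp (fun z : int => m *~ z) f) = m *: x.
Proof.
move=> Pm; have mD : {morph (fun z : int => m *~ z) : x y / x + y} by move=> y z; exact: mulrzDr.
elim=> {f x} [|f g x y _ Hx _ Hy|f x _ Hx|a t Pt].
- by rewrite fcomp0 // alpha0 scaler0.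
- by rewrite fcompD // alphaD Hx Hy scalerDr.
- by rewrite fcompN // alphaN Hx scalerN.
- by rewrite -[dlt 1 a t]/(dp 1 (a, t)) fcomp_dp // mulr1z alpha_dp //; exact: Pm.
Qed.

Lemma mspan_alpha P x : (forall a t, P a t -> mon a t) -> mspan P x ->
  exists2 f, supp P f & x = alpha f.
Proof.
move=> Pm; elim=> {x} [|x y _ [f Hf ->] _ [g Hg ->]|m a t Pt].
- by exists 0; [exact: supp0|rewrite alpha0].
- by exists (f + g); [exact: suppD|rewrite alphaD].
- exists (dp m (a, t)); first exact: supp_dlt.
  by rewrite alpha_dp //; exact: Pm.
Qed.

Lemma alpha_bg f : bg_span k (alpha f).
Proof.
rewrite /alpha big_seq; elim/big_rec: _ => [|u x Hu Hx]; first exact: bg_span0.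
apply: bg_spanD => //; apply: bg_spanZ; case: u Hu => a t /(mem_mons p_prime)[_ wt].
exact: bmon_bg.
Qed.

Lemma bg_alpha x : bg_span k x -> exists2 f, supp mon f & x = alpha f.
Proof. by move=> /(bg_mspan p_prime); exact: mspan_alpha. Qed.

Lemma amon_gcentral i t : gcentral (odd (cnt t)) (amon i t).
Proof.
elim: t i => [|[e m] t IH] i /=; first exact: gcentral1.
rewrite oddD oddb; apply: (@gcentralM _ _ _ e).
  case: e; last exact: gcentral1.
  by rewrite expr1; exact: (@gcentral_ag p b kill_none (Tau i)).
apply: (@gcentralM _ _ _ false) => //; exact: gcentral_xi.
Qed.

Lemma mpar_iterK s (m : M) : mpar_iter s (mpar_iter s m) = m.
Proof. by case: s => //=; exact: MilnorModel.ms_K. Qed.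
Lemma mpar_iterD s (m m' : M) : mpar_iter s (m + m') = mpar_iter s m + mpar_iter s m'.
Proof. by case: s => //=; exact: MilnorModel.ms_D. Qed.

(** [coordA] is adapted to scalars on the right; passing a word to reach the left twists a scalar by
    the parity of its number of [tau]'s. *)
Definition ccoord t (x : A) : M := mpar_iter (odd (cnt t)) (coordA k t x).

Lemma ccoordD t x y : ccoord t (x + y) = ccoord t x + ccoord t y.
Proof. by rewrite /ccoord coordAD mpar_iterD. Qed.

Lemma ccoord_bmon t t' a (m : M) : size t = k -> size t' = k ->
  ccoord t' (m *: bmon a t) = if t == t' then m else 0.
Proof.
move=> st st'; rewrite bmon0 scaleE -[m in LHS](mpar_iterK (odd (cnt t))).
rewrite -par_iter_etaL -amon_gcentral /ccoord coordA_amon //; case: eqP => [->|_].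
  exact: mpar_iterK.
by case: (odd _) => //=; exact: MilnorModel.ms_0.
Qed.

(** Coordinates do not see the ghost exponent, but the weight [k] recovers it from [t]. *)
Lemma ccoord_alpha f a t : mon a t -> ccoord t (alpha f) = f a t.
Proof.
move=> mat; have c0 : ccoord t 0 = 0 by apply: (addrI (ccoord t 0)); rewrite -ccoordD !addr0.
rewrite /alpha (big_morph _ (ccoordD t) c0) big_seq.
have [st wt] := mat.
rewrite (eq_bigr (fun u => if u.2 == t then ev f u else 0)); last first.
  by move=> [a' t'] /(mem_mons p_prime)[st' _]; rewrite ccoord_bmon.
rewrite -big_seq (bigD1_seq (a, t)) ?uniq_mons //=; last exact/(mem_mons p_prime).
rewrite eqxx big_seq_cond big1 ?addr0 // => -[a' t'] /andP[/(mem_mons p_prime)[_ wt'] ne] /=.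
case: eqP => // E; case/negP: ne; apply/eqP; congr pair => //.
by move: wt' wt; rewrite E; case: (t) => [|[e' m'] t''] /=; lia.
Qed.

Lemma alpha_inj f : supp mon f -> alpha f = 0 -> f = 0.
Proof.
move=> sf f0; apply/funext => a; apply/funext => t; apply: contrapT => nz.
have ma := sf a t nz; have := ccoord_alpha f ma; rewrite f0.
have -> : ccoord t 0 = 0 by apply: (addrI (ccoord t 0)); rewrite -ccoordD !addr0.
by move=> E; apply: nz; rewrite -E.
Qed.
End Alpha.

(** * Left coordinates and maps out of [E(1)^vee] *)

Section LeftCoordinates.
Context (p : nat) (b : coeff_data).
Hypothesis p_gt0 : (0 < p)%N.
Hypothesis wt1 : p = 2%N -> coeff_wt b = 1%N.
Notation M := (MM p b).
Notation KE := (kill_E 1).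
Notation E1 := (steenrod p b KE).
Notation A := (steenrod p b kill_none).
Notation tE_ := (tE p b).

Lemma tE_gcentral a : gcentral (a.1 (+) a.2) (tE_ a).
Proof.
apply: gcentralM; [case: a.1|case: a.2]; try exact: gcentral1; rewrite expr1.
  exact: (@gcentral_ag p b KE (Tau 0)).
exact: (@gcentral_ag p b KE (Tau 1)).
Qed.

Definition lcoord (a : bool * bool) (x : E1) : M :=
  let u := if a.1 then (coordE x).2 else (coordE x).1 in
  mpar_iter (a.1 (+) a.2) (if a.2 then u.2 else u.1).

Lemma lcoordD a x y : lcoord a (x + y) = lcoord a x + lcoord a y.
Proof.
by rewrite /lcoord coordED; case: a => -[] [] //=; exact: MilnorModel.ms_D.
Qed.
Lemma lcoord0 a : lcoord a 0 = 0.
Proof. by apply: (addrI (lcoord a 0)); rewrite -lcoordD !addr0. Qed.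

Lemma lcoord_tE a c (m : M) : lcoord a (m *: tE_ c) = if a == c then m else 0.
Proof.
have mK s (m' : M) : mpar_iter s (mpar_iter s m') = m' by case: s => //=; exact: MilnorModel.ms_K.
rewrite scaleE -[m in LHS](mK (c.1 (+) c.2)) -par_iter_etaL -tE_gcentral.
move: (mpar_iter (c.1 (+) c.2) m) (mK (c.1 (+) c.2) m) => m' Em.
have Ec : coordE (tE_ c * etaL KE m') =
    ((if c == (false, false) then m' else 0, if c == (false, true) then m' else 0),
     (if c == (true, false) then m' else 0, if c == (true, true) then m' else 0)).
  case: c {Em} m' => -[] [] m'; rewrite /tE /= ?expr0 ?expr1 ?mul1r ?mulr1.
  - by rewrite -mulrA coordE_tau0 coordE_tau1.
  - by rewrite coordE_tau0 coordE_etaL.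
  - exact: coordE_tau1.
  - exact: coordE_etaL.
rewrite /lcoord Ec; case: a => -[] []; case: c {Ec} m' Em => -[] [] m' //=;
  rewrite ?MilnorModel.ms_0 //.
Qed.

Lemma lcoordZ a (m : M) x : lcoord a (m *: x) = m * lcoord a x.
Proof.
elim: (lspanP x) => [|y z _ IHy _ IHz|c r]; first by rewrite scaler0 lcoord0 mulr0.
- by rewrite scalerDr !lcoordD mulrDr IHy IHz.
- by rewrite scalerA !lcoord_tE; case: eqP; rewrite ?mulr0.
Qed.

Lemma lcoordE x : x = \sum_c lcoord c x *: tE_ c.
Proof.
elim: (lspanP x) => [|y z _ IHy _ IHz|c r].
- by rewrite big1 // => c _; rewrite lcoord0 scale0r.
- by rewrite {1}IHy {1}IHz -big_split /=; apply: eq_bigr => c _; rewrite lcoordD scalerDl.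
- rewrite (bigD1 c) //= lcoord_tE eqxx big1 ?addr0 // => c' ne.
  by rewrite lcoord_tE (negbTE ne) scale0r.
Qed.

Lemma homog_lcoord d a (x : E1) : homog (adeg p b) d x ->
  homog (mdeg b) (d - degE p b a) (lcoord a x).
Proof.
move=> Hx; have Eh := arel_homog wt1 (K := KE); have Mh := @mrel_homog p b.
pose pr e (m : M) := gproj (mdeg b) e m.
have prP e c m : gproj (adeg p b) e (m *: tE_ c : E1) = pr (e - degE p b c) m *: tE_ c.
  elim/(pres_homog_ind (E := mrel p b) (deg := mdeg b)): m => [|e' m m' Hm IH].
    by rewrite /pr (gproj0 Mh) !scale0r (gproj0 Eh).
  rewrite scalerDl (gprojD Eh) IH /pr (gprojD Mh) scalerDl; congr (_ + _).
  rewrite (gproj_homog Eh _ (homogM (homog_etaL KE Hm) (homog_tE p b c))).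
  rewrite (gproj_homog Mh _ Hm) subr_eq.
  by case: eqP => // _; rewrite scale0r.
have -> : lcoord a x = pr (d - degE p b a) (lcoord a x); last exact: homog_gproj.
have E2 : x = \sum_c pr (d - degE p b c) (lcoord c x) *: tE_ c.
  have <- : gproj (adeg p b) d x = x by rewrite (gproj_homog Eh _ Hx) eqxx.
  rewrite {1}(lcoordE x) (big_morph _ (gprojD Eh d) (gproj0 Eh d)); apply: eq_bigr => c _.
  by rewrite prP (gproj_homog Eh _ Hx) eqxx.
rewrite {1}E2 (big_morph _ (lcoordD a) (lcoord0 a)).
rewrite (bigD1 a) //= lcoord_tE eqxx big1 ?addr0 // => c' ne.
by rewrite lcoord_tE eq_sym (negbTE ne).
Qed.

(** For [quad y y0 y1 y01], the comodule map with [tau_0 tau_1 |-> y]. *)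
Definition gE (y y0 y1 y01 : A) (x : E1) : A :=
  lcoord (true, true) x *: y + lcoord (false, true) x *: y0
  - lcoord (true, false) x *: y1 + lcoord (false, false) x *: y01.

Section Quad.
Context (y y0 y1 y01 : A).
Notation g := (gE y y0 y1 y01).

Lemma gE_lin (m : M) u v : g (m *: u + v) = m *: g u + g v.
Proof.
rewrite /gE !lcoordD !lcoordZ !scalerDl -!scalerA !scalerDr scalerN opprD.
by rewrite [LHS](AC (2*2*2*2) ((1*3*5*7)*(2*4*6*8)))%AC.
Qed.

Lemma gE_tE c : g (tE_ c) = match c with
  | (true, true) => y | (false, true) => y0 | (true, false) => - y1 | _ => y01 end.
Proof.
rewrite /gE -[tE_ c]scale1r !lcoord_tE; case: c => -[] [] /=;
by rewrite ?scale0r ?scale1r ?oppr0 ?addr0 ?add0r.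
Qed.

(** The lower coefficients in the coaction of [tau_0 tau_1] are [tau_1], [- tau_0] and 1, and [quad]
    gives [y] the same pattern; linearity reduces the claim to the four basis elements. *)
Lemma psi_gE x : quad y y0 y1 y01 -> psi KE (g x) = smap g (psi KE x).
Proof.
case=> H H0 H1 H01; have gl := gE_lin.
have kE := fun g => @kill_E_ok p b 1 g p_gt0.
elim: (lspanP x) => [|u v _ IHu _ IHv|c m].
- by rewrite (lin_0 gl) !psi0 // (lin_smap0 gl).
- by rewrite (lin_add gl) [LHS]psiD // IHu IHv [psi KE (u + v)]psiD // (lin_smapD gl).
- rewrite (lin_scale gl) !psiZ // (lin_smapZ gl); congr (_ *: _).
  rewrite psi_tE // (smap_expand gl) gE_tE.
  have g1 : g 1 = y01 by rewrite -(tE00 p b) gE_tE.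
  have g0 : g 0 = 0 by exact: lin_0 gl.
  have gt0 : g (Defs.tau p b KE 0) = - y1 by rewrite -tE10 gE_tE.
  have gt1 : g (Defs.tau p b KE 1) = y0 by rewrite -tE01 gE_tE.
  have gN u : g (- u) = - g u by rewrite -scaleN1r (lin_scale gl) scaleN1r.
  case: c => -[] [].
  + rewrite H; apply: expand_ext => -[[] []] //=; rewrite ?gN ?gt0 ?gt1 ?g1 ?opprK //.
    by rewrite -tE11 gE_tE.
  + rewrite psiNA H1 expandN; apply: expand_ext => -[[] []] /=;
    rewrite ?gt0 ?g1 ?g0 ?oppr0 ?opprK //.
  + by rewrite H0; apply: expand_ext => -[[] []] /=; rewrite ?gt1 ?g1 ?g0.
  + by rewrite H01; apply: expand_ext => -[[] []] /=; rewrite ?g1 ?g0.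
Qed.

Lemma homog_gE d e x : hquad d y y0 y1 y01 ->
  homog (adeg p b) (e - (d - (adeg p b (Tau 0) + adeg p b (Tau 1)))) x ->
  homog (adeg p b) e (g x).
Proof.
case=> H H0 H1 H01; set s := d - _ => Hx.
have Z a (z : A) dz : homog (adeg p b) dz z -> dz = s + degE p b a ->
    homog (adeg p b) e (lcoord a x *: z).
  move=> Hz Ez; rewrite -[e](subrK dz); apply: homogM => //; apply: homog_etaL.
  by have := homog_lcoord a Hx; rewrite -addrA -opprD -Ez.
rewrite /gE; apply: homogD; first apply: homogD; first apply: homogD.
- by apply: (Z _ _ _ H); rewrite /degE !mulr1n subrK.
- by apply: (Z _ _ _ H0); rewrite /degE mulr1n mulr0n add0r /s opprD addrA subrK.
- apply: homogN; apply: (Z _ _ _ H1).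
  by rewrite /degE mulr1n mulr0n addr0 /s opprD addrA addrAC subrK.
- by apply: (Z _ _ _ H01); rewrite /degE !mulr0n !addr0.
Qed.
End Quad.
End LeftCoordinates.

(** * The comparison map *)

Section Comparison.
Context (p : nat) (b : coeff_data).
Hypothesis p_prime : prime p.
Hypothesis wt1 : p = 2%N -> coeff_wt b = 1%N.
Context (k : nat) (Y : seq mono).
Hypothesis Y_mon : forall a t, (a, t) \in Y -> mon p k k a t.
Notation M := (MM p b).
Notation KE := (kill_E 1).
Notation E1 := (steenrod p b KE).
Notation A := (steenrod p b kill_none).
Notation N := (nu p k k).
Notation z := (zch p k k).
Notation x := (xch p k k).
Notation word := (fun u : mono => @bmon p b 0 u.1 u.2).

Let p_gt1 : (1 < p)%N := prime_gt1 p_prime.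
Let p_gt0 : (0 < p)%N := prime_gt0 p_prime.

Lemma mspan_empty i P (y : A) : (forall a t, ~ P a t) -> @mspan p b i P y -> y = 0.
Proof.
move=> P0; elim=> // [y' y'' _ -> _ ->|m a t /P0//]; exact: addr0.
Qed.

Lemma rep_dlt P (f : fam int) (y : A) u : (forall a t, P a t -> mon p k k a t) ->
  @rep p b 0 P f y -> mon p k k u.1 u.2 -> f = dp 1 u -> y = word u.
Proof.
move=> Pm Hr; case: u => a t ma Ef; have := alpha_rep p_prime (1 : M) Pm Hr.
have mD : {morph (fun z : int => (1 : M) *~ z) : x y / x + y} by move=> i j; exact: mulrzDr.
by rewrite scale1r Ef fcomp_dp // mulr1z alpha_dp // scale1r => <-.
Qed.

Lemma rep_0 P (f : fam int) (y : A) : (forall a t, P a t -> mon p k k a t) ->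
  @rep p b 0 P f y -> f = 0 -> y = 0.
Proof.
move=> Pm Hr Ef; have := alpha_rep p_prime (1 : M) Pm Hr.
have mD : {morph (fun z : int => (1 : M) *~ z) : x y / x + y} by move=> i j; exact: mulrzDr.
by rewrite scale1r Ef fcomp0 // alpha0 => <-.
Qed.

Lemma lw_mon u c h : mon p k k u.1 u.2 ->
  forall a t, lw p (size u.2) (rwt p u.1 u.2) c h a t -> mon p k k a t.
Proof. by case: u => a t [/= -> ->] a' t' []. Qed.

(** Without a [tau] there is none to lose, so all images and error terms are empty sums. *)
Lemma z_quad j : (j <= N)%N ->
  psi KE (word (z j)) = expand (four (word (z j)) 0 0 0) /\
  homog (adeg p b) (zdeg p j) (word (z j)).
Proof.
move=> jN; have [sz wt ct xd] := zchP p_gt1 jN; case: (z j) sz wt ct xd => a t /= sz wt ct xd.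
have [y0 [y1 [y01 [u1 [r1 [u01 [r01 [[q _ _ _] [h _ _ _] e0 E1 e1 s1 E01 e01 s01]]]]]]]] :=
  quad_word p_gt1 wt1 0 a t.
have no h' a' t' : ~ lw p (size t) (rwt p a t) (cnt t) h'.+1 a' t' by case=> _ _; lia.
split; last first.
  move: h; rewrite (_ : wdeg p 0 a t = zdeg p j) //.
  by rewrite /wdeg /zdeg wt ct; congr pair; rewrite expn0; nia.
have y00 : y0 = 0 by apply: mspan_empty (rep_mspan e0) => a' t'; exact: no.
have u10 : u1 = 0 by apply: mspan_empty (rep_mspan e1) => a' t'; exact: no.
have r10 : r1 = 0 by apply: mspan_empty s1 => a' t'; exact: no.
have u010 : u01 = 0 by apply: mspan_empty (rep_mspan e01) => a' t'; exact: no.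
have r010 : r01 = 0 by apply: mspan_empty s01 => a' t'; exact: no.
by rewrite q E1 E01 y00 u10 r10 u010 r010 addr0.
Qed.

(** With a single [tau] the errors, which lose at least two, vanish. The zigzag is thus realized
    exactly, even for [p = 2]. *)
Lemma x_quad i : (0 < i <= N)%N ->
  psi KE (word (x i)) = expand (four (word (x i)) (word (z i)) (word (z i.-1)) 0) /\
  homog (adeg p b) (xdeg p i) (word (x i)).
Proof.
move=> iN; have [sz wt ct xd] := xchP p_gt1 iN.
have Q0x := Q0_xch p_gt1 (1 : int) iN; have Q1x := Q1_xch p_gt1 (1 : int) iN.
have [szz wtz _ _] : [/\ size (z i).2 = k, rwt p (z i).1 (z i).2 = k, cnt (z i).2 = 0%N
    & (xdg (z i).1 (z i).2 + i * p.-1 = k)%N] by apply: zchP => //; lia.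
have [szw wtw _ _] : [/\ size (z i.-1).2 = k, rwt p (z i.-1).1 (z i.-1).2 = k, cnt (z i.-1).2 = 0%N
    & (xdg (z i.-1).1 (z i.-1).2 + i.-1 * p.-1 = k)%N] by apply: zchP => //; lia.
have zp : tau_free (z i).2 by exact: zch_pure.
case: (x i) sz wt ct xd Q0x Q1x => a t /= sz wt ct xd Q0x Q1x.
have [y0 [y1 [y01 [u1 [r1 [u01 [r01 [[q _ _ _] [h _ _ _] e0 E1 e1 s1 E01 e01 s01]]]]]]]] :=
  quad_word p_gt1 wt1 0 a t.
have no h' a' t' : ~ lw p (size t) (rwt p a t) (cnt t) h'.+2 a' t' by case=> _ _; lia.
split; last first.
  move: h; rewrite (_ : wdeg p 0 a t = xdeg p i) //.
  by rewrite /wdeg /xdeg wt ct; congr pair; rewrite expn0; nia.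
have mt : mon p k k (a, t).1 (a, t).2 by [].
have lm := @lw_mon (a, t) _ _ mt.
have y0E : y0 = word (z i) by apply: (rep_dlt (lm _ _) e0).
have u1E : u1 = word (z i.-1) by apply: (rep_dlt (lm _ _) e1).
have u010 : u01 = 0 by apply: (rep_0 (lm _ _) e01); rewrite Q0x Q1_pure.
have r10 : r1 = 0 by apply: mspan_empty s1 => a' t'; exact: no.
have r010 : r01 = 0 by apply: mspan_empty s01 => a' t'; exact: no.
by rewrite q E1 E01 y0E u1E r10 u010 r010 !addr0.
Qed.

Lemma quad_word3 (u : mono) : exists q : A * A * A, exists u1 r1 u01 r01,
  @qword p b 0 u.1 u.2 q.1.1 q.1.2 q.2 u1 r1 u01 r01.
Proof.
have [y0 [y1 [y01 [u1 [r1 [u01 [r01 H]]]]]]] := quad_word p_gt1 wt1 0 u.1 u.2.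
by exists (y0, y1, y01), u1, r1, u01, r01.
Qed.
Definition quad_of u := projT1 (cid (quad_word3 u)).
Lemma quad_ofP u : exists u1 r1 u01 r01,
  @qword p b 0 u.1 u.2 (quad_of u).1.1 (quad_of u).1.2 (quad_of u).2 u1 r1 u01 r01.
Proof. exact: projT2 (cid (quad_word3 u)). Qed.

Definition yw (j : 'I_(size Y)) : mono := tnth (in_tuple Y) j.
(** The suspension that puts [tau_0 tau_1], the class sent to the word, in the degree of that
    word. *)
Definition ydeg (j : 'I_(size Y)) : int * int :=
  wdeg p 0 (yw j).1 (yw j).2 - (adeg p b (Tau 0) + adeg p b (Tau 1)).

Definition flash_free : comod p b := comod_sum (flash p b N) (susp_sum p b ydeg).

Definition gX (i : 'I_N) : A := word (x i.+1).
Definition gZ (j : 'I_N.+1) : A := word (z j).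
Definition gY (j : 'I_(size Y)) : E1 -> A :=
  gE (word (yw j)) (quad_of (yw j)).1.1 (quad_of (yw j)).1.2 (quad_of (yw j)).2.

Definition gsum (w : {ffun 'I_(size Y) -> E1}) : A := \sum_j gY j (w j).
Definition compare (w : flash_free) : A := comb gX gZ w.1 + gsum w.2.

Lemma gY_lin j (m : M) u v : gY j (m *: u + v) = m *: gY j u + gY j v.
Proof. exact: gE_lin. Qed.
Lemma gsum_lin (m : M) u v : gsum (m *: u + v) = m *: gsum u + gsum v.
Proof.
rewrite /gsum scaler_sumr -big_split /=; apply: eq_bigr => j _.
by rewrite !ffunE gY_lin.
Qed.
Lemma compare_lin (m : M) u v : compare (m *: u + v) = m *: compare u + compare v.
Proof.
rewrite /compare [comb _ _ _]comb_lin [gsum _]gsum_lin [m *: (_ + gsum _)]scalerDr.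
exact: addrACA.
Qed.

Lemma homog_compare d (w : flash_free) : cm_gr d w -> homog (adeg p b) d (compare w).
Proof.
move=> [[H1 H2] H3].
have S (J : finType) (F : J -> A) : (forall j, homog (adeg p b) d (F j)) ->
    homog (adeg p b) d (\sum_j F j).
  by move=> H; apply: big_ind => //; [exact: homog0|move=> ? ?; exact: homogD].
apply: homogD; first apply: homogD.
- apply: S => i; rewrite -[d](subrK (xdeg p i.+1)); apply: homogM; first exact: homog_etaL.
  by apply: (x_quad _).2; rewrite /= ltn_ord.
- apply: S => j; rewrite -[d](subrK (zdeg p j)); apply: homogM; first exact: homog_etaL.
  by apply: (z_quad _).2; rewrite -ltnS ltn_ord.
- apply: S => j; have [? [? [? [? [_ h _ _ _ _ _ _ _]]]]] := quad_ofP (yw j).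
  exact: homog_gE h (H3 j).
Qed.

Lemma psi_sum (J : finType) (F : J -> A) : psi KE (\sum_j F j) = \sum_j psi KE (F j).
Proof.
have D : {morph (@psi p b KE kill_none) : u v / u + v} by move=> u v; exact: psiD.
by apply: (big_morph _ D); exact: psi0.
Qed.

Lemma psi_compare (w : flash_free) : psi KE (compare w) = smap compare (cm_coact w).
Proof.
have Gl := compare_lin; have kE := kill_A (p := p) (b := b) (K := KE).
have inl_lin (m : M) (u v : flash p b N) :
    ((m *: u + v, 0) : flash_free) = m *: ((u, 0) : flash_free) + ((v, 0) : flash_free).
  by apply: injective_projections; rewrite /= ?scaler0 ?addr0.
have inr_lin (m : M) (u v : susp_sum p b ydeg) :
    ((0, m *: u + v) : flash_free) = m *: ((0, u) : flash_free) + ((0, v) : flash_free).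
  by apply: injective_projections; rewrite /= ?scaler0 ?addr0.
have dl_lin j (m : M) (u v : E1) :
    [ffun i => if i == j then m *: u + v else 0] = m *: [ffun i => if i == j then u else 0]
      + [ffun i => if i == j then v else 0] :> {ffun 'I_(size Y) -> E1}.
  by apply/ffunP => i; rewrite !ffunE; case: eqP; rewrite ?scaler0 ?addr0.
have cl := comb_lin gX gZ.
have gsum0 : gsum 0 = 0 by exact: lin_0 gsum_lin.
have comb0 : comb gX gZ 0 = 0 by exact: lin_0 cl.
rewrite /= (lin_smapD Gl) (smap_comp _ inl_lin Gl) (smap_comp _ inr_lin Gl).
rewrite (_ : (fun u => compare (u, 0)) = comb gX gZ); last first.
  by apply/funext => u; rewrite /compare /= gsum0 addr0.
rewrite (_ : (fun u => compare (0, u)) = gsum); last first.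
  by apply/funext => u; rewrite /compare /= comb0 add0r.
rewrite /compare psiD //; congr (_ + _).
  move: (w.1); apply: flash_ext => [m u v|m u v|i|j].
  - rewrite cl [LHS](psiD kE) (psiZ kE). reflexivity.
  - rewrite flash_coact_lin.
    rewrite [LHS](lin_smapD cl).
    rewrite (lin_smapZ cl).
    reflexivity.
  - rewrite comb_xb flash_coact_xb.
    rewrite [RHS](smap_expand cl).
    have iN : (0 < i.+1 <= N)%N by rewrite /= ltn_ord.
    apply: etrans (x_quad iN).1 _.
    by apply: expand_ext => -[[] []] /=; rewrite ?comb_xb ?comb_zb ?comb0.
  - rewrite comb_zb flash_coact_zb.
    rewrite [RHS](smap_expand cl).
    have jN : (j <= N)%N by rewrite -ltnS ltn_ord.
    apply: etrans (z_quad jN).1 _.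
    by apply: expand_ext => -[[] []]; rewrite /zcoef /= ?comb_zb ?comb0.
rewrite /gsum psi_sum (big_morph _ (lin_smapD gsum_lin) (lin_smap0 gsum_lin)).
apply: eq_bigr => j _; rewrite (smap_comp _ (dl_lin j) gsum_lin).
rewrite (_ : (fun u => _) = gY j); last first.
  apply/funext => u; rewrite /gsum (bigD1 j) //= ffunE eqxx big1 ?addr0 // => i ne.
  by rewrite ffunE (negbTE ne); exact: lin_0 (gY_lin i).
have [? [? [? [? [q _ _ _ _ _ _ _ _]]]]] := quad_ofP (yw j).
exact: psi_gE.
Qed.
End Comparison.

(** * The comparison map on decomposed elements *)

Section Bijection.
Context (p : nat) (b : coeff_data).
Hypothesis p_prime : prime p.
Hypothesis wt1 : p = 2%N -> coeff_wt b = 1%N.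
Context (k : nat) (Y : seq mono).
Hypothesis uniqY : uniq Y.
Hypothesis Y_mon : forall a t, (a, t) \in Y -> mon p k k a t.
Notation M := (MM p b).
Notation onY := (supp (fun a t => (a, t) \in Y)).
Hypothesis spanY : forall v : fam M, supp (mon p k k) v ->
  exists2 r, onY r & imQL p k k (v - r).
Hypothesis freeY : forall r : fam M, onY r -> imQL p k k r -> r = 0.
Notation KE := (kill_E 1).
Notation E1 := (steenrod p b KE).
Notation A := (steenrod p b kill_none).
Notation N := (nu p k k).
Notation z := (zch p k k).
Notation x := (xch p k k).
Notation word := (fun u : mono => @bmon p b 0 u.1 u.2).
Notation al := (@alpha p b k).
Notation yw := (@yw Y).
Notation FF := (flash_free p b k Y).
Notation cmp_ := (@compare p b p_prime wt1 k Y).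
Notation quad_of_ := (@quad_of p b p_prime wt1).
Implicit Types (l a c d e : fam M).

Let p_gt1 : (1 < p)%N := prime_gt1 p_prime.
Let p_gt0 : (0 < p)%N := prime_gt0 p_prime.

(** The coordinates imitate [decomp]. The sign at [d] is there because [gE] sends [tau_0] to [- y1],
    that at [e] because [gE] yields [Q1 Q0] where [decomp] has [Q0 Q1]. *)
Definition assemble l a c d e : FF :=
  (([ffun i : 'I_N => ev l (x i.+1)], [ffun j : 'I_N.+1 => ev l (z j)]),
   [ffun j : 'I_(size Y) => ev a (yw j) *: tE p b (true, true) + ev c (yw j) *: tE p b (false, true)
      - ev d (yw j) *: tE p b (true, false) - ev e (yw j) *: tE p b (false, false)]).

Lemma alpha_dpu (m : M) u : mon p k k u.1 u.2 -> al (dp m u) = m *: word u.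
Proof. by case: u => a t; exact: alpha_dp. Qed.

Lemma inL_sum l : supp (inL p k k) l ->
  comb (@gX p b k) (@gZ p b k) (assemble l 0 0 0 0).1 = al l.
Proof.
move=> Hl; rewrite {2}(inL_dec p_gt1 Hl) alphaD !alpha_sum addrC /comb /=; congr (_ + _).
  apply: eq_bigr => i _; rewrite ffunE alpha_dpu //.
  by apply: inL_mon => //; right; exists i.+1; [exact: (ltn_ord i)|rewrite -surjective_pairing].
apply: eq_bigr => j _; rewrite ffunE alpha_dpu //.
by apply: inL_mon => //; left; exists j; [exact: (ltn_ord j)|rewrite -surjective_pairing].
Qed.

Lemma Y_sum (f : fam M) (F : mono -> A) :
  \sum_(j < size Y) ev f (yw j) *: F (yw j) = \sum_(u <- Y) ev f u *: F u.
Proof. by rewrite [RHS]big_tnth. Qed.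

Lemma gY_assemble l a c d e j : gY p_prime wt1 j ((assemble l a c d e).2 j) =
  ev a (yw j) *: word (yw j) + ev c (yw j) *: (quad_of_ (yw j)).1.1
  + ev d (yw j) *: (quad_of_ (yw j)).1.2 - ev e (yw j) *: (quad_of_ (yw j)).2.
Proof.
have gl := @gY_lin p b p_prime wt1 Y j.
have gN u : gY p_prime wt1 j (- u) = - gY p_prime wt1 j u.
  by rewrite -scaleN1r (lin_scale gl) scaleN1r.
rewrite ffunE !(lin_add gl) !gN !(lin_scale gl) /gY !gE_tE.
by rewrite scalerN opprK.
Qed.

Lemma sum_lower (F : mono -> A) (Fa : mono -> fam M) P s :
  (forall u, u \in s -> exists2 r, mspan 0 P r & F u = al (Fa u) + r) ->
  exists2 r, mspan 0 P r & \sum_(u <- s) F u = al (\sum_(u <- s) Fa u) + r.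
Proof.
elim: s => [|u s IH] H; first by exists 0; rewrite ?big_nil ?alpha0 ?addr0 //; exact: mspan0.
have [r Hr Er] := IH (fun v vs => H v (mem_behead (s := u :: s) vs)).
have [r' Hr' Er'] := H u (mem_head u s).
exists (r' + r); first exact: mspanD.
by rewrite !big_cons Er Er' alphaD addrACA.
Qed.

Let mD (m : M) : {morph (fun i : int => m *~ i) : i j / i + j}.
Proof. by move=> i j; exact: mulrzDr. Qed.

Lemma lw_monY u (n h : nat) : u \in Y ->
  forall i t, lw p (size u.2) (rwt p u.1 u.2) n h i t -> mon p k k i t.
Proof. by case: u => a t /Y_mon ma; exact: (lw_mon (u := (a, t))). Qed.

Definition below h (i : nat) t := mon p k k i t /\ (cnt t < h)%N.

Lemma low_eq0 h (f : fam M) u : low h f -> ~~ (cnt u.2 < h)%N -> ev f u = 0.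
Proof. by case: u => a t Hf /= nlt; apply: contrapT => /Hf; exact/negP. Qed.

Lemma sum_Q0 c : onY c -> \sum_(u <- Y) ev c u *: (quad_of_ u).1.1 = al (Q0 c).
Proof.
move=> Hc; rewrite {2}(supp_sum_dp uniqY Hc) Q0_sum alpha_sum.
rewrite big_seq [RHS]big_seq; apply: eq_bigr => u uY.
have [u1 [r1 [u01 [r01 H]]]] := quad_ofP p_prime wt1 u.
rewrite -(alpha_rep p_prime _ (lw_monY uY) (qw_0 H)) -fcomp_Q0; last exact: mD.
by rewrite -[dlt 1 _ _]/(dp 1 u) fcomp_dp ?mulr1z //; exact: mD.
Qed.

(** A word with at most [h] [tau]'s has errors with at most [h - 2]. *)
Lemma sum_Q1 h d : onY d -> low h.+1 d ->
  exists2 r, mspan 0 (below h.-1) r &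
    \sum_(u <- Y) ev d u *: (quad_of_ u).1.2 = al (Q1 p d) + r.
Proof.
move=> Hd ld; rewrite {2}(supp_sum_dp uniqY Hd) Q1_sum; apply: sum_lower => u uY.
have [u1 [r1 [u01 [r01 H]]]] := quad_ofP p_prime wt1 u.
exists (ev d u *: r1); last first.
  rewrite (qw_1E H) scalerDr; congr (_ + _).
  rewrite -(alpha_rep p_prime _ (lw_monY uY) (qw_1 H)) -fcomp_Q1; last exact: mD.
  by rewrite -[dlt 1 _ _]/(dp 1 u) fcomp_dp ?mulr1z //; exact: mD.
have [lt|nlt] := boolP (cnt u.2 < h.+1)%N; last first.
  by rewrite (low_eq0 ld nlt) scale0r; exact: mspan0.
apply: mspanZ; apply: mspan_sub (qw_r1 H) => a t Ha; split; first exact: (lw_monY uY Ha).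
by case: Ha => _ _; lia.
Qed.

Lemma sum_Q01 h e : onY e -> low h.+2 e ->
  exists2 r, mspan 0 (below h.-1) r &
    \sum_(u <- Y) ev e u *: (quad_of_ u).2 = al (Q1 p (Q0 e)) + r.
Proof.
move=> He le; rewrite {2}(supp_sum_dp uniqY He) Q0_sum Q1_sum; apply: sum_lower => u uY.
have [u1 [r1 [u01 [r01 H]]]] := quad_ofP p_prime wt1 u.
exists (ev e u *: r01); last first.
  rewrite (qw_01E H) scalerDr; congr (_ + _).
  rewrite -(alpha_rep p_prime _ (lw_monY uY) (qw_01 H)) -fcomp_Q1 -?fcomp_Q0; try exact: mD.
  by rewrite -[dlt 1 _ _]/(dp 1 u) fcomp_dp ?mulr1z //; exact: mD.
have [lt|nlt] := boolP (cnt u.2 < h.+2)%N; last first.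
  by rewrite (low_eq0 le nlt) scale0r; exact: mspan0.
apply: mspanZ; apply: mspan_sub (qw_r01 H) => a t Ha; split; first exact: (lw_monY uY Ha).
by case: Ha => _ _; lia.
Qed.

Lemma sum_word a : onY a -> \sum_(u <- Y) ev a u *: word u = al a.
Proof.
move=> Ha; rewrite {2}(supp_sum_dp uniqY Ha) alpha_sum.
rewrite big_seq [RHS]big_seq; apply: eq_bigr => -[a' t] uY.
by rewrite alpha_dp //; exact: Y_mon.
Qed.

(** The comparison map is triangular for the number of [tau]'s, with [decomp] as its diagonal
    part. *)
Lemma compare_assemble h l a c d e : supp (inL p k k) l -> onY a -> onY c -> onY d -> onY e ->
  low_decomp h l a c d e -> exists2 r, supp (below h.-1) r &
    cmp_ (assemble l a c d e) = al (decomp p l a c d e + r).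
Proof.
move=> Hl Ha Hc Hd He [_ _ _ ld le].
have [r1 Hr1 E1] := sum_Q1 Hd ld; have [r2 Hr2 E2] := sum_Q01 He le.
have below_mon i t : below h.-1 i t -> mon p k k i t by case.
have [r Hr Er] := mspan_alpha p_prime below_mon (mspanB Hr1 Hr2).
exists r => //; rewrite /compare [comb _ _ _]inL_sum // /gsum (eq_bigr _ (fun j _ => gY_assemble
  l a c d e j)).
rewrite !big_split /= sumrN (Y_sum a word) (Y_sum c (fun u => (quad_of_ u).1.1)).
rewrite (Y_sum d (fun u => (quad_of_ u).1.2)) (Y_sum e (fun u => (quad_of_ u).2)).
rewrite sum_word // sum_Q0 // E1 E2.
rewrite alphaD -Er /decomp !alphaD Q01 alphaN opprD.
by rewrite [LHS](AC (1*(2*2*2)) ((((1*2)*3)*4)*6*(5*7)))%AC.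
Qed.
End Bijection.

Section DecompSub.
Context (p : nat) (C : zmodType).
Lemma decompB (l a c d e l' a' c' d' e' : fam C) :
  decomp p l a c d e - decomp p l' a' c' d' e'
  = decomp p (l - l') (a - a') (c - c') (d - d') (e - e').
Proof.
rewrite /decomp !(Q0_morph, Q1_morph, Q0_opp, Q1_opp) !opprD.
by rewrite [LHS](AC (5*5) ((1*6)*(2*7)*(3*8)*(4*9)*(5*10)))%AC.
Qed.
Lemma cnt_le_rwt a t : (0 < p)%N -> (cnt t <= rwt p a t)%N.
Proof.
move=> p0; elim: t a => [|[e m] t IH] a //=; have := IH m.
by case: e => /=; nia.
Qed.
End DecompSub.

(** * Bijectivity of the comparison map *)

Section Iso.
Context (p : nat) (b : coeff_data).
Hypothesis p_prime : prime p.
Hypothesis wt1 : p = 2%N -> coeff_wt b = 1%N.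
Context (k : nat) (Y : seq mono).
Hypothesis uniqY : uniq Y.
Hypothesis Y_mon : forall a t, (a, t) \in Y -> mon p k k a t.
Notation M := (MM p b).
Notation onY := (supp (fun a t => (a, t) \in Y)).
Hypothesis spanY : forall v : fam M, supp (mon p k k) v ->
  exists2 r, onY r & imQL p k k (v - r).
Hypothesis freeY : forall r : fam M, onY r -> imQL p k k r -> r = 0.
Notation KE := (kill_E 1).
Notation E1 := (steenrod p b KE).
Notation A := (steenrod p b kill_none).
Notation N := (nu p k k).
Notation z := (zch p k k).
Notation x := (xch p k k).
Notation al := (@alpha p b k).
Notation yw := (@yw Y).
Notation FF := (flash_free p b k Y).
Notation cmp_ := (@compare p b p_prime wt1 k Y).
Notation asm_ := (@assemble p b k Y).
Implicit Types (l a c d e f : fam M).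

Let p_gt1 : (1 < p)%N := prime_gt1 p_prime.
Let p_gt0 : (0 < p)%N := prime_gt0 p_prime.

Lemma onY_mon f : onY f -> supp (mon p k k) f.
Proof. by apply: supp_sub => i t; exact: Y_mon. Qed.

Lemma mon_low f h : (k < h)%N -> supp (mon p k k) f -> low h f.
Proof.
move=> kh Hf i t /Hf[_ wt]; apply: leq_ltn_trans kh.
by rewrite -wt; exact: cnt_le_rwt.
Qed.

Lemma supp_below0 f : supp (below p k 0) f -> f = 0.
Proof. by move=> Hf; apply/funext => i; apply/funext => t; apply: contrapT => /Hf[]. Qed.

Lemma decomp_mon l a c d e : supp (inL p k k) l -> onY a -> onY c -> onY d -> onY e ->
  supp (mon p k k) (decomp p l a c d e).
Proof.
move=> Hl /onY_mon Ha /onY_mon Hc /onY_mon Hd /onY_mon He; rewrite /decomp.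
apply: suppD; last exact: mon_Q0 (mon_Q1 He).
apply: suppD; last exact: mon_Q1.
apply: suppD; last exact: mon_Q0.
by apply: suppD Ha; apply: supp_sub Hl => i t; exact: inL_mon.
Qed.

(** If the image vanishes, [decomp] equals minus an error term and so satisfies a smaller bound.
    Cutting commutes with [decomp], so uniqueness identifies the coordinates with their cuts, and
    the bound drops; at bound 0 no error is left. *)
Lemma assemble_ker h l a c d e : supp (inL p k k) l -> onY a -> onY c -> onY d -> onY e ->
  low_decomp h l a c d e -> cmp_ (asm_ l a c d e) = 0 ->
  [/\ l = 0, a = 0, c = 0, d = 0 & e = 0].
Proof.
move=> Hl Ha Hc Hd He; elim: h => [|h IH] Hh G0.
all: have [r Hr E] := compare_assemble p_prime wt1 uniqY Y_mon Hl Ha Hc Hd He Hh.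
all: have {E} Dr : decomp p l a c d e = - r.
  1,3: apply/eqP; rewrite -addr_eq0; apply/eqP; apply: (alpha_inj p_prime) (etrans (esym E) G0).
  1,2: apply: suppD; [exact: decomp_mon|by apply: supp_sub Hr => i t []].
  by rewrite (supp_below0 Hr) oppr0 in Dr; exact: (decomp_free p_gt1 Y_mon freeY).
have Dl : low h (decomp p l a c d e).
  by rewrite Dr; apply: suppN; apply: supp_sub Hr => i t [].
have := decomp_cut p_gt1 h l a c d e; rewrite (low_cut Dl) => Ec.
have Z : decomp p (l - cut h l) (a - cut h a) (c - cut h.+1 c) (d - cut h.+1 d) (e - cut h.+2 e)
  = 0.
  by rewrite -decompB Ec subrr.
have [] := decomp_free p_gt1 Y_mon freeY _ _ _ _ _ Z; try by apply: suppB => //; exact: supp_restr.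
move=> /subr0_eq El /subr0_eq Ea /subr0_eq Ecc /subr0_eq Ed /subr0_eq Ee.
apply: IH G0; split; [rewrite El|rewrite Ea|rewrite Ecc|rewrite Ed|rewrite Ee]; exact: cut_low.
Qed.

Lemma ev_sum_dp (J : finType) (F : J -> M) (u : J -> mono) j : injective u ->
  ev (\sum_i dp (F i) (u i)) (u j) = F j.
Proof.
move=> uI; rewrite ev_sum (bigD1 j) //= dpE eqxx big1 ?addr0 // => i ne.
by rewrite dpE (inj_eq uI) eq_sym (negbTE ne).
Qed.

Lemma yw_inj : injective yw.
Proof. by move=> i j /(tuple_uniqP (in_tuple Y) uniqY). Qed.

Lemma assemble_surj (w : FF) : exists l a c d e,
  [/\ supp (inL p k k) l, onY a, onY c, onY d & onY e /\ w = asm_ l a c d e].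
Proof.
pose tri (F : E1 -> M) : fam M := \sum_j dp (F (w.2 j)) (yw j).
have tri_onY F : onY (tri F).
  apply: supp_sum => j; apply: supp_dlt; rewrite -surjective_pairing; exact: mem_tnth.
pose lx : fam M := \sum_i dp (w.1.1 i) (x (i : 'I_N).+1).
pose lz : fam M := \sum_j dp (w.1.2 j) (z (j : 'I_N.+1)).
exists (lx + lz), (tri (lcoord (true, true))), (tri (lcoord (false, true))),
  (tri (fun u => - lcoord (true, false) u)), (tri (fun u => - lcoord (false, false) u)).
split=> //; first apply: suppD.
- by apply: supp_sum => i; apply: inL_dpx => //; exact: (ltn_ord i).
- by apply: supp_sum => j; apply: inL_dpz => //; exact: (ltn_ord j).
split=> //.
have io (i : 'I_N) : (0 < i.+1 <= N)%N := ltn_ord i.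
have jo (j : 'I_N.+1) : (j <= N)%N := ltn_ord j.
have xI : injective (fun i : 'I_N => x i.+1).
  by move=> i j /(xch_inj p_gt1 (io i) (io j))[/val_inj].
have zI : injective (fun j : 'I_N.+1 => z j).
  by move=> i j /(zch_inj p_gt1 (jo i) (jo j))/val_inj.
apply: injective_projections; first apply: injective_projections; apply/ffunP => j; rewrite ffunE.
- rewrite evD (ev_sum_dp _ _ xI) ev_sum big1 ?addr0 // => i _; rewrite dpE.
  by case: eqP => // E; case: (xch_zch p_gt1 (io j) (jo i) E).
- rewrite evD (ev_sum_dp _ _ zI) ev_sum big1 ?add0r // => i _; rewrite dpE.
  by case: eqP => // E; case: (xch_zch p_gt1 (io i) (jo j) (esym E)).
- rewrite !(ev_sum_dp _ _ yw_inj) !scaleNr !opprK.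
  rewrite {1}(lcoordE (w.2 j)) (reindex (fun u : bool * bool => u)) /=; last by exists id.
  rewrite -(pair_big xpredT xpredT (fun i j' => lcoord (i, j') (w.2 j) *: tE p b (i, j'))) /=.
  rewrite !big_bool /=.
  by rewrite [LHS](AC (2*2) (1*3*2*4))%AC.
Qed.

Lemma compare_ker w : cmp_ w = 0 -> w = 0.
Proof.
have [l [a [c [d [e [Hl Ha Hc Hd [He ->]]]]]]] := assemble_surj w => G0.
have low_ f h : (k < h)%N -> onY f -> low h f by move=> kh /onY_mon; exact: mon_low.
(* A word of weight [k] has at most [k] factors [tau], which gives a bound to start from. *)
have Hlow : low_decomp k.+1 l a c d e.
  split; try by apply: low_ => //; lia.
  by apply: mon_low => //; apply: supp_sub Hl => i t; exact: inL_mon.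
have [-> -> -> -> ->] := assemble_ker Hl Ha Hc Hd He Hlow G0.
apply: injective_projections; first apply: injective_projections; apply/ffunP => j;
by rewrite !ffunE // !scale0r !subr0 addr0.
Qed.

Lemma compare_inj : injective cmp_.
Proof.
have gl := @compare_lin p b p_prime wt1 k Y.
move=> u v E; apply/eqP; rewrite -subr_eq0; apply/eqP; apply: compare_ker.
by rewrite -scaleN1r addrC gl E scaleN1r addNr.
Qed.

(** The decomposition of [f], cut to the bound of [f], hits [f] up to an error of smaller bound,
    which the induction hits in turn. *)
Lemma compare_alpha h f : supp (mon p k k) f -> low h f -> exists w, cmp_ w = al f.
Proof.
have gl := @compare_lin p b p_prime wt1 k Y.
elim: h f => [|h IH] f Hf lf.
  exists 0; rewrite (lin_0 gl) (_ : f = 0) ?alpha0 //.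
  by apply/funext => i; apply/funext => t; apply: contrapT => /lf.
have [l [a [c [d [e [Hl Ha Hc Hd [He Ef]]]]]]] := decomp_span p_gt1 spanY Hf.
have Efc : f = decomp p (cut h.+1 l) (cut h.+1 a) (cut h.+2 c) (cut h.+2 d) (cut h.+3 e).
  by rewrite decomp_cut // -Ef low_cut.
have [r Hr E] : exists2 r, supp (below p k h) r &
    cmp_ (asm_ (cut h.+1 l) (cut h.+1 a) (cut h.+2 c) (cut h.+2 d) (cut h.+3 e)) = al (f + r).
  rewrite Efc; apply: (compare_assemble (h := h.+1) p_prime wt1 uniqY Y_mon); try exact: supp_restr.
  by split; exact: cut_low.
have [w' Ew'] := IH r (supp_sub (fun i t => @proj1 _ _) Hr) (supp_sub (fun i t => @proj2 _ _) Hr).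
exists (asm_ (cut h.+1 l) (cut h.+1 a) (cut h.+2 c) (cut h.+2 d) (cut h.+3 e) - w').
by rewrite addrC -scaleN1r gl E Ew' alphaD scaleN1r addrC addrK.
Qed.

Lemma compare_bg w : cmp_ w \in bg_pred k.
Proof.
apply/asboolP; have [l [a [c [d [e [Hl Ha Hc Hd [He ->]]]]]]] := assemble_surj w.
have low_ f h : (k < h)%N -> onY f -> low h f by move=> kh /onY_mon; exact: mon_low.
have Hlow : low_decomp k.+1 l a c d e.
  split; try by apply: low_ => //; lia.
  by apply: mon_low => //; apply: supp_sub Hl => i t; exact: inL_mon.
have [r _ ->] := compare_assemble p_prime wt1 uniqY Y_mon Hl Ha Hc Hd He Hlow.
exact: alpha_bg.
Qed.

Lemma compare_onto (u : bg p b k) : exists w, cmp_ w = val u.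
Proof.
have /asboolP/(bg_alpha p_prime)[f Hf ->] := valP u.
exact: (compare_alpha Hf (mon_low (ltnSn k) Hf)).
Qed.
End Iso.

Lemma graded_sum_map (V V' : zmodType) (gr : int * int -> V -> Prop)
  (gr' : int * int -> V' -> Prop) (f : V -> V') v :
  {morph f : x y / x + y} -> (forall d x, gr d x -> gr' d (f x)) ->
  graded_sum gr v -> graded_sum gr' (f v).
Proof.
move=> fD fgr [D [c [uD Hc c0 ->]]].
have f0 : f 0 = 0 by apply: (addrI (f 0)); rewrite -fD !addr0.
exists D, (fun d => f (c d)); split=> // [d|d dD|].
- exact: fgr.
- by rewrite c0.
- exact: (big_morph f fD f0).
Qed.

(** * The isomorphism of comodules *)

Section Iso.
Context (p : nat) (b : coeff_data).
Hypothesis p_prime : prime p.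
Hypothesis wt1 : p = 2%N -> coeff_wt b = 1%N.
Context (k : nat) (Y : seq mono).
Hypothesis uniqY : uniq Y.
Hypothesis Y_mon : forall a t, (a, t) \in Y -> mon p k k a t.
Notation M := (MM p b).
Notation onY := (supp (fun a t => (a, t) \in Y)).
Hypothesis spanY : forall v : fam M, supp (mon p k k) v ->
  exists2 r, onY r & imQL p k k (v - r).
Hypothesis freeY : forall r : fam M, onY r -> imQL p k k r -> r = 0.
Notation KE := (kill_E 1).
Notation E1 := (steenrod p b KE).
Notation A := (steenrod p b kill_none).
Notation N := (nu p k k).
Notation FF := (flash_free p b k Y).
Notation BG := (brown_gitler p b k).
Notation cmp_ := (@compare p b p_prime wt1 k Y).

Lemma flash_free_graded (w : FF) : graded_sum (@cm_gr p b FF) w.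
Proof.
have Mh := @mrel_homog p b.
have gr0 d : cm_gr d (0 : FF).
  split; first exact: flash_gr_0.
  by move=> j; rewrite ffunE; exact: homog0.
have grD d (u v : FF) : cm_gr d u -> cm_gr d v -> cm_gr d (u + v).
  move=> [u1 u2] [v1 v2]; split; first exact: flash_gr_add.
  by move=> j; rewrite ffunE; exact: homogD.
pose dl j (u : E1) : FF := (0, [ffun i => if i == j then u else 0]).
have dlD j : {morph dl j : u v / u + v}.
  move=> u v; apply: injective_projections; rewrite /= ?addr0 //.
  by apply/ffunP => i; rewrite !ffunE; case: eqP; rewrite ?addr0.
have -> : w = (w.1, 0) + \sum_j dl j (w.2 j).
  have S (J : finType) (F : J -> FF) : \sum_j F j = (\sum_j (F j).1, \sum_j (F j).2).
    by elim/big_rec3: _ => // j f g h _ ->.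
  rewrite S; apply: injective_projections => /=; first by rewrite big1 ?addr0.
  apply/ffunP => j; rewrite ffunE sum_ffunE ffunE add0r (bigD1 j) //= ffunE eqxx big1 ?addr0 //.
  by move=> i ne; rewrite ffunE eq_sym (negbTE ne).
apply: graded_sumD => //.
  apply: (graded_sum_map (gr := @flash_gr p b N) (f := fun u : flash p b N => (u, 0) : FF)).
  - by move=> u v; apply: injective_projections; rewrite /= ?addr0.
  - by move=> d u Hu; split=> // j; rewrite ffunE; exact: homog0.
  - exact: flash_graded.
apply: graded_sum_big => // j.
apply: (graded_sum_map (gr := fun d => homog (adeg p b) (d - ydeg p b j)) (f := dl j)) => //.
  move=> d u Hu; split; first exact: flash_gr_0.
  by move=> i; rewrite ffunE; case: eqP => [->|_]; last exact: homog0.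
elim/(pres_homog_ind (E := arel p b KE) (deg := adeg p b)): (w.2 j) => [|e u v Hu IH].
  by apply: (graded_sum1 (d := 0)) => [d|]; exact: homog0.
apply: graded_sumD IH; first by move=> d u' v'; exact: homogD.
apply: (graded_sum1 (d := e + ydeg p b j)) => [d|]; first exact: homog0.
by rewrite addrK.
Qed.

(** The inverse must preserve degrees too. Components of [w] outside degree [d] have images outside
    degree [d], hence zero, and injectivity removes them. *)
Lemma gr_of_homog_compare d (w : FF) : homog (adeg p b) d (cmp_ w) -> cm_gr d w.
Proof.
move=> Hd; have gl := @compare_lin p b p_prime wt1 k Y; have Ah := arel_homog wt1 (K := kill_none).
have GI := @compare_inj p b p_prime wt1 k Y uniqY Y_mon freeY.
have [D [c [uD Hc c0 Ew]]] := flash_free_graded w.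
suff -> : w = c d by [].
apply: GI; have {1}<- : gproj (adeg p b) d (cmp_ w) = cmp_ w.
  by rewrite (gproj_homog Ah _ Hd) eqxx.
rewrite Ew (big_morph _ (lin_add gl) (lin_0 gl)) (big_morph _ (gprojD Ah d) (gproj0 Ah d)).
have E e : gproj (adeg p b) d (cmp_ (c e)) = if e == d then cmp_ (c e) else 0.
  rewrite (gproj_homog Ah _ (homog_compare p_prime wt1 (Hc e))); by rewrite eq_sym.
have [dD|dD] := boolP (d \in D).
  rewrite (bigD1_seq d) //= E eqxx big1 ?addr0 // => e ne.
  by rewrite E (negbTE ne).
rewrite c0 // (lin_0 gl) big_seq big1 // => e eD; rewrite E; case: eqP => // Ee.
by move: dD; rewrite -Ee eD.
Qed.

Definition bg_compare (w : FF) : BG := Sub (cmp_ w) (compare_bg p_prime wt1 uniqY Y_mon w).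

Lemma val_lin (m : M) (u v : bg p b k) : val (m *: u + v) = m *: (val u : A) + val v.
Proof. by []. Qed.

Lemma bg_compare_lin (m : M) u v : bg_compare (m *: u + v) = m *: bg_compare u + bg_compare v.
Proof. by apply: val_inj; rewrite val_lin /= (compare_lin p_prime wt1). Qed.

Lemma bg_compare_hom : is_comod_hom bg_compare.
Proof.
split; first exact: bg_compare_lin.
- move=> d w Hw; exact: homog_compare.
(* Coactions are compared inside the dual Steenrod algebra, as the inclusion stays injective after
   tensoring. *)
- move=> w; apply: (smap_inj val_lin val_inj).
  rewrite (smap_comp _ bg_compare_lin val_lin) [LHS]bg_coactP coactAE.
  exact: psi_compare.
Qed.

Lemma brown_gitler_iso : comod_iso BG FF.
Proof.
have GI := @compare_inj p b p_prime wt1 k Y uniqY Y_mon freeY.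
have onto := @compare_onto p b p_prime wt1 k Y uniqY Y_mon spanY.
have bgI : injective bg_compare by move=> u v /(congr1 val); exact: GI.
pose f (u : BG) : FF := projT1 (cid (onto u)).
have fK : cancel f bg_compare by move=> u; apply: val_inj; exact: projT2 (cid (onto u)).
have Kf : cancel bg_compare f by move=> w; apply: bgI; exact: fK.
have fl (m : M) u v : f (m *: u + v) = m *: f u + f v.
  by apply: bgI; rewrite bg_compare_lin !fK.
have [_ _ gc] := bg_compare_hom.
exists f, bg_compare; split=> //; last exact: bg_compare_hom.
split=> // [d u Hu|u].
  by apply: gr_of_homog_compare; rewrite -[cmp_ _]/(val (bg_compare (f u))) fK.
rewrite -[u in RHS]fK gc (smap_comp _ bg_compare_lin fl).
by rewrite (_ : (fun w => _) = id) ?smap_id //; apply/funext.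
Qed.
End Iso.

(** An odd [q] has order 1 modulo 2. For even [q], [x^q = x] at [x = -1] gives [1 = -1], so the
    characteristic would be 2. *)
Lemma coeffs_wt1 (p : nat) (F : base_field) : char_neq p F -> p = 2%N ->
  coeff_wt (coeffs p F) = 1%N.
Proof.
case: F => [||K] //=; first by move=> _ ->.
move=> Kp p2; move: Kp; rewrite p2 => K2.
have oddK : odd #|K|.
  apply: contraR K2 => evenK; have := expf_card (- 1 : K).
  rewrite -signr_odd (negbTE evenK) expr0 => /eqP.
  by rewrite -subr_eq0 opprK inE.
by rewrite /order_mod /= expn1 !modn2 oddK.
Qed.

Theorem proposition3p16 (p : nat) (p_prime : prime p)
    (F : base_field) (F_char : char_neq p F) (k : nat) :
  exists (L : comod p (coeffs p F)) (n : nat) (s : 'I_n -> int * int),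
    lightning_flash (logn p (k`!)) L /\
    comod_iso (brown_gitler p (coeffs p F) k)
              (comod_sum L (susp_sum p (coeffs p F) s)).
Proof.
have wt1 := coeffs_wt1 F_char; have p_gt1 := prime_gt1 p_prime; have p_gt0 := prime_gt0 p_prime.
(* With [k] slots all words of weight [k] are present, and the zigzag attains its full length, the
   valuation of the factorial of [k]. *)
have [Y [uY sY HY]] := complement p_prime k k.
have Y_mon a t : (a, t) \in Y -> mon p k k a t by move=> /sY /(mem_mons p_prime).
have Mp (m : MM p (coeffs p F)) : m *+ p = 0.
  by rewrite -mulr_natl MilnorModel.mchar mul0r.
have [spanY freeY] := HY _ Mp.
exists (flash p (coeffs p F) (nu p k k)), (size Y), (@ydeg p (coeffs p F) Y); split.
  rewrite -(nu_fact p_gt1 p_prime (leqnn k)); exact: flash_lightning.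
exact: brown_gitler_iso.
Qed.
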